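(* For all constants $C>0$ and $K>0$ there is a constant $\ell=\ell(C,K)>0$, depending only on $C$ and $K$, such that the following holds. Let $0<T<\ell$, let $(\Omega,\mathcal F,\mathbb F=(\mathcal F_t)_{t\in[0,T]},P)$, the $m$-dimensional Brownian motion $W$ and the spaces of processes be as in the context, let $x\in\mathbb R^n$, let $\mu,\sigma,f,\phi$ satisfy Assumption (A1) (stated in the context) with constant $C$, let $\mathcal L^1,\mathcal L^3$ satisfy Assumption (L1) (stated in the context) with constant $K$, where for each of them $\mathscr O^2$ may be either $\mathscr H^2$ or $\mathscr S^2$, and let $\mathcal L^2$ satisfy Assumption (L1) with constant $K$ and with $\mathscr O^2([0,T],\mathbb R^{p_2})=\mathscr S^2([0,T],\mathbb R^{p_2})$. Then the functional differential system $$\begin{cases} dX_t=\mu\big(t,X_t,\mathcal Y(X,V)_t,\mathcal L^1(\mathcal M(X,V))_t\big)\,dt+\sigma\big(t,X_t,\mathcal Y(X,V)_t,\mathcal L^2(\mathcal M(X,V))_t\big)\,dW_t,\\ dV_t=f\big(t,X_t,\mathcal Y(X,V)_t,\mathcal L^3(\mathcal M(X,V))_t\big)\,dt,\\ X_0=x,\quad V_0=0,\end{cases}$$ on $[0,T]$, where $\mathcal M(X,V)_t=E[\phi(X_T)+V_T\mid\mathcal F_t]$ and $\mathcal Y(X,V)_t=\mathcal M(X,V)_t-V_t$, admits a unique solution $(X,V)$ in $\mathscr S^2([0,T],\mathbb R^n)\times\mathscr S^2_0([0,T],\mathbb R^d)$ (i.e. a unique pair in this space satisfying the integral formulation of the 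system).
   Context: Setting. $(\Omega,\mathcal F,P)$ is a complete probability space with a filtration $\mathbb F=(\mathcal F_t)_{t\in[0,T]}$ satisfying the usual conditions (not necessarily Brownian), carrying an $m$-dimensional $\mathbb F$-Brownian motion $W$. Martingales are taken in their càdlàg versions. $\mathcal P$ is the predictable $\sigma$-field. $|\cdot|$ is the Euclidean norm on $\mathbb R^k$ and the Hilbert–Schmidt norm on $\mathbb R^{k\times l}$. Spaces. $\mathscr S^2([0,T],\mathbb R^k)$: continuous adapted $\mathbb R^k$-valued processes $U$ with $\|U\|_{\mathscr S^2[0,T]}:=E[\sup_{t\in[0,T]}|U_t|^2]^{1/2}<\infty$; $\mathscr S^2_0([0,T],\mathbb R^k)$: those with $U_0=0$. $\mathscr M^2([0,T],\mathbb R^d)$: square-integrable $\mathbb R^d$-valued $\mathbb F$-martingales on $[0,T]$, with the norm $\|\cdot\|_{\mathscr S^2[0,T]}$ given by the same formula. $\mathscr H^2([0,T],\mathbb R^k)$: $\mathcal P$-measurable $\mathbb R^k$-valued processes $H$ with $\|H\|_{\mathscr H^2[0,T]}^2:=E[\int_0^T|H_t|^2dt]<\infty$. Assumption (A1) with constant $C>0$, for $\mu:\Omega\times[0,T]\times\mathbb R^n\times\mathbb R^d\times\mathbb R^{p_1}\to\mathbb R^n$, $\sigma:\Omega\times[0,T]\times\mathbb R^n\times\mathbb R^d\times\mathbb R^{p_2}\to\mathbb R^{n\times m}$, $f:\Omega\times[0,T]\times\mathbb R^n\times\mathbb R^d\times\mathbb R^{p_3}\to\mathbb R^d$, $\phi:\Omega\times\mathbb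 R^n\to\mathbb R^d$ (the almost sure conditions hold outside one null set simultaneously for all arguments $x,x',y,y',z_i,z_i'$): (A1.1) For all fixed $(x,y,z_1,z_2,z_3)$ the processes $\mu(\cdot,x,y,z_1)$, $\sigma(\cdot,x,y,z_2)$, $f(\cdot,x,y,z_3)$ are $\mathcal P$-measurable and $\phi(x)$ is $\mathcal F_T$-measurable. (A1.2) $dP\otimes dt$-a.s.: $(x-x')^{\mathrm T}(\mu(\cdot,x,y,z_1)-\mu(\cdot,x',y,z_1))\le C|x-x'|^2$; $|\mu(\cdot,x,y,z_1)-\mu(\cdot,x,y',z_1')|\le C(|y-y'|+|z_1-z_1'|)$; $|\mu(\cdot,x,0,0)|\le C(1+|x|)$; and $x\mapsto\mu(\cdot,x,y,z_1)$ is continuous. (A1.3) $f(\cdot,0,0,0)\in\mathscr H^2([0,T],\mathbb R^d)$, $\sigma(\cdot,0,0,0)\in\mathscr H^2([0,T],\mathbb R^{n\times m})$, $\phi(0)\in L^2(\Omega,\mathbb R^d)$. (A1.4) $dP\otimes dt$-a.s. (respectively $P$-a.s. for $\phi$): $|\sigma(\cdot,x,y,z_2)-\sigma(\cdot,x',y',z_2')|^2\le C(|x-x'|^2+|y-y'|^2+|z_2-z_2'|^2)$; $|f(\cdot,x,y,z_3)-f(\cdot,x',y',z_3')|\le C(|x-x'|+|y-y'|+|z_3-z_3'|)$; $|\phi(x)-\phi(x')|\le C|x-x'|$. Assumption (L1) with constant $K>0$ ($K$ not depending on $T$), for an operator $\mathcal L$: $\mathcal L$ maps $\mathscr M^2([0,T],\mathbb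 R^d)$ into $\mathscr O^2([0,T],\mathbb R^p)$, where $\mathscr O^2$ is either $\mathscr H^2$ or $\mathscr S^2$, and for all $M,M'\in\mathscr M^2([0,T],\mathbb R^d)$: $\|\mathcal L(M)\|_{\mathscr O^2[0,T]}\le K\|M\|_{\mathscr S^2[0,T]}$ and $\|\mathcal L(M)-\mathcal L(M')\|_{\mathscr O^2[0,T]}\le K\|M-M'\|_{\mathscr S^2[0,T]}$. For $\mathcal L^i$ one has $p=p_i$, $i=1,2,3$. *)

(* Defs.v *)
From HB Require Import structures.
From mathcomp Require Import all_boot all_order all_algebra.
From mathcomp Require Import all_classical all_reals all_analysis.
Import Order.TTheory GRing.Theory Num.Theory.
Import numFieldNormedType.Exports.

Set Implicit Arguments.
Unset Strict Implicit.
Unset Printing Implicit Defensive.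

Local Open Scope classical_set_scope.
Local Open Scope ring_scope.

(* Euclidean norm of a vector, Hilbert-Schmidt norm of a matrix (the library
   norm `| A | on matrices is the maximum norm). *)
Definition hsnorm {R : realType} {k l : nat} (A : 'M[R]_(k, l)) : R :=
  Num.sqrt (\sum_i \sum_j A i j ^+ 2).

Definition dotp {R : realType} {k : nat} (x y : 'cV[R]_k) : R :=
  (x^T *m y) ord0 ord0.

(* A process is a total function on Omega * R; only its values at times in
   [0, T] are ever constrained or used. *)
Definition process (R : realType) (Omega : Type) (k l : nat) :=
  Omega -> R -> 'M[R]_(k, l).

Section StochasticBasis.
Context {R : realType} {dsp : measure_display} {Omega : measurableType dsp}.
Context (P : probability Omega R) (T : R) (F : R -> set (set Omega)).

Local Notation leb := (@lebesgue_measure R).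

Definition usual_filtration : Prop :=
  [/\ forall t, t \in `[0, T] -> sigma_algebra setT (F t),
      forall t, t \in `[0, T] -> F t `<=` measurable,
      forall s t, 0 <= s -> s <= t -> t <= T -> F s `<=` F t,
      forall t, t \in `[0, T[ -> \bigcap_(s in `]t, T]) F s `<=` F t
    & forall N : set Omega, P.-negligible N -> F 0 N].

Definition rv_measurable (G : set (set Omega)) {k l : nat}
    (X : Omega -> 'M[R]_(k, l)) : Prop :=
  forall i j (B : set R), measurable B -> G ((fun w => X w i j) @^-1` B).

Definition adapted {k l : nat} (U : process R Omega k l) : Prop :=
  forall t, t \in `[0, T] -> rv_measurable (F t) (fun w => U w t).

Definition square_integrable {k l : nat} (X : Omega -> 'M[R]_(k, l)) : Prop :=
  (\int[P]_w (hsnorm (X w) ^+ 2)%:E < +oo)%E.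

Definition predictable_sets : set (set (Omega * R)) :=
  <<s setT `*` `[0, T]%classic,
      [set A `*` [set 0] | A in F 0] `|`
      [set E | exists s t A, [/\ 0 <= s, s < t, t <= T, F s A
                               & E = A `*` `]s, t]%classic]] >>.

Definition predictable {k l : nat} (H : process R Omega k l) : Prop :=
  forall i j (B : set R), measurable B ->
    predictable_sets ((setT `*` `[0, T]%classic) `&`
                      (fun wt => H wt.1 wt.2 i j) @^-1` B).

Definition ae_dPdt (Q : Omega -> R -> Prop) : Prop :=
  {ae (P \x leb)%E, forall wt, wt.2 \in `[0, T] -> Q wt.1 wt.2}.

Definition indistinguishable {k l : nat} (U U' : process R Omega k l) : Prop :=
  {ae P, forall w, forall t, t \in `[0, T] -> U w t = U' w t}.

Definition normS2 {k l : nat} (U : process R Omega k l) : \bar R :=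
  sqrte (\int[P]_w ereal_sup
           [set (hsnorm (U w t) ^+ 2)%:E | t in `[0%R, T]%classic])%E.

Definition normH2 {k l : nat} (H : process R Omega k l) : \bar R :=
  sqrte (\int[P]_w \int[leb]_(t in `[0%R, T]) (hsnorm (H w t) ^+ 2)%:E)%E.

Definition S2 {k l : nat} (U : process R Omega k l) : Prop :=
  [/\ adapted U,
      forall w, {within `[0, T], continuous (U w)}
    & (normS2 U < +oo)%E].

Definition S20 {k l : nat} (U : process R Omega k l) : Prop :=
  S2 U /\ forall w, U w 0 = 0.

Definition H2 {k l : nat} (H : process R Omega k l) : Prop :=
  predictable H /\ (normH2 H < +oo)%E.

Definition cadlag {k l : nat} (U : process R Omega k l) : Prop :=
  forall w,
    (forall t, t \in `[0, T[ -> U w s @[s --> t^'+] --> U w t) /\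
    (forall t, t \in `]0, T] ->
       exists a : 'M[R]_(k, l), U w s @[s --> t^'-] --> a).

Definition is_condexp (G : set (set Omega)) {k l : nat}
    (X Z : Omega -> 'M[R]_(k, l)) : Prop :=
  rv_measurable G Z /\
  forall i j,
    [/\ P.-integrable setT (EFin \o (fun w => X w i j)),
        P.-integrable setT (EFin \o (fun w => Z w i j))
      & forall A, G A ->
          (\int[P]_(w in A) (X w i j)%:E = \int[P]_(w in A) (Z w i j)%:E)%E].

Definition M2 {k l : nat} (M : process R Omega k l) : Prop :=
  [/\ adapted M,
      cadlag M,
      forall t, t \in `[0, T] -> square_integrable (fun w => M w t)
    & forall s t, 0 <= s -> s <= t -> t <= T ->
        is_condexp (F s) (fun w => M w t) (fun w => M w s)].

(* M is the cadlag version of the martingale E[X | F_t], 0 <= t <= T *)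
Definition condexp_process {k l : nat} (X : Omega -> 'M[R]_(k, l))
    (M : process R Omega k l) : Prop :=
  M2 M /\
  forall t, t \in `[0, T] -> is_condexp (F t) X (fun w => M w t).

(* The last clause says both that W_t - W_s is independent of F_s and that its
   law is N(0, (t - s) I_m). *)
Definition brownian_motion {m : nat} (W : process R Omega m 1) : Prop :=
  [/\ adapted W,
      {ae P, forall w, W w 0 = 0},
      {ae P, forall w, {within `[0, T], continuous (W w)}}
    & forall (s t : R) (A : set Omega) (B : 'I_m -> set R),
        0 <= s -> s < t -> t <= T -> F s A -> (forall j, measurable (B j)) ->
        P (A `&` [set w | forall j, B j (W w t j ord0 - W w s j ord0)]) =
        (P A * \prod_(j < m) normal_prob 0 (Num.sqrt (t - s)) (B j))%E].

(* the data of sum_(i < N) xi_i 1_(t_i, t_(i+1)] *)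
Record simple_process (k l : nat) := SimpleProcess {
  sp_size : nat;
  sp_time : nat -> R;
  sp_coef : nat -> Omega -> 'M[R]_(k, l) }.

Definition simple_integrand {k l : nat} (h : simple_process k l) : Prop :=
  [/\ forall i, (i <= sp_size h)%N -> sp_time h i \in `[0, T],
      forall i, (i < sp_size h)%N -> sp_time h i <= sp_time h i.+1,
      forall i, (i < sp_size h)%N ->
        rv_measurable (F (sp_time h i)) (sp_coef h i)
    & forall i, (i < sp_size h)%N ->
        exists c : R, forall w, hsnorm (sp_coef h i w) <= c].

Definition simple_value {k l : nat} (h : simple_process k l) :
    process R Omega k l :=
  fun w t => \sum_(i < sp_size h)
    (if sp_time h i < t <= sp_time h i.+1 then sp_coef h i w else 0).

Definition simple_integral {k l : nat} (W : process R Omega l 1)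
    (h : simple_process k l) : process R Omega k 1 :=
  fun w t => \sum_(i < sp_size h)
    sp_coef h i w *m (W w (Num.min (sp_time h i.+1) t) -
                      W w (Num.min (sp_time h i) t)).

(* I is the Ito integral of H in H^2 against W: the S^2-limit of the integrals
   of simple integrands that converge to H in H^2. *)
Definition ito_integral {k l : nat} (W : process R Omega l 1)
    (H : process R Omega k l) (I : process R Omega k 1) : Prop :=
  [/\ H2 H, S2 I
    & exists h : nat -> simple_process k l,
      [/\ forall q, simple_integrand (h q),
          normH2 (fun w t => simple_value (h q) w t - H w t)
            @[q --> \oo] --> 0%E
        & normS2 (fun w t => simple_integral W (h q) w t - I w t)
            @[q --> \oo] --> 0%E]].

Definition time_integral {k : nat} (H I : process R Omega k 1) : Prop :=
  {ae P, forall w,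
    (forall i, leb.-integrable `[0, T] (fun s => (H w s i ord0)%:E)) /\
    forall t, t \in `[0, T] -> forall i,
      I w t i ord0 = \int[leb]_(s in `[0, t]) H w s i ord0}.

(* G is a predictable representative of the dP (x) dt-class of H *)
Definition predictable_version {k l : nat} (H G : process R Omega k l) : Prop :=
  predictable G /\ ae_dPdt (fun w t => G w t = H w t).

Record coefficients_condition (n d m p1 p2 p3 : nat) (C : R)
    (mu : Omega -> R -> 'cV[R]_n -> 'cV[R]_d -> 'cV[R]_p1 -> 'cV[R]_n)
    (sigma : Omega -> R -> 'cV[R]_n -> 'cV[R]_d -> 'cV[R]_p2 -> 'M[R]_(n, m))
    (f : Omega -> R -> 'cV[R]_n -> 'cV[R]_d -> 'cV[R]_p3 -> 'cV[R]_d)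
    (phi : Omega -> 'cV[R]_n -> 'cV[R]_d) : Prop := CoefficientsCondition {
  mu_predictable : forall x y z,
    predictable (fun w t => mu w t x y z);
  sigma_predictable : forall x y z,
    predictable (fun w t => sigma w t x y z);
  f_predictable : forall x y z,
    predictable (fun w t => f w t x y z);
  phi_measurable : forall x, rv_measurable (F T) (fun w => phi w x);
  mu_monotone : ae_dPdt (fun w t => forall x x' y z,
    dotp (x - x') (mu w t x y z - mu w t x' y z) <= C * hsnorm (x - x') ^+ 2);
  mu_lipschitz : ae_dPdt (fun w t => forall x y y' z z',
    hsnorm (mu w t x y z - mu w t x y' z')
      <= C * (hsnorm (y - y') + hsnorm (z - z')));
  mu_growth : ae_dPdt (fun w t => forall x,
    hsnorm (mu w t x 0 0) <= C * (1 + hsnorm x));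
  mu_continuous : ae_dPdt (fun w t => forall y z,
    continuous (fun x => mu w t x y z));
  f_H2 : H2 (fun w t => f w t 0 0 0);
  sigma_H2 : H2 (fun w t => sigma w t 0 0 0);
  phi_L2 : square_integrable (fun w => phi w 0);
  sigma_lipschitz : ae_dPdt (fun w t => forall x x' y y' z z',
    hsnorm (sigma w t x y z - sigma w t x' y' z') ^+ 2
      <= C * (hsnorm (x - x') ^+ 2 + hsnorm (y - y') ^+ 2
              + hsnorm (z - z') ^+ 2));
  f_lipschitz : ae_dPdt (fun w t => forall x x' y y' z z',
    hsnorm (f w t x y z - f w t x' y' z')
      <= C * (hsnorm (x - x') + hsnorm (y - y') + hsnorm (z - z')));
  phi_lipschitz : {ae P, forall w, forall x x',
    hsnorm (phi w x - phi w x') <= C * hsnorm (x - x')} }.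

Inductive O2_kind := O2_is_H2 | O2_is_S2.

Definition O2 (o : O2_kind) {k l : nat} (U : process R Omega k l) : Prop :=
  match o with O2_is_H2 => H2 U | O2_is_S2 => S2 U end.

Definition normO2 (o : O2_kind) {k l : nat} (U : process R Omega k l) :
    \bar R :=
  match o with O2_is_H2 => normH2 U | O2_is_S2 => normS2 U end.

(* An operator on M^2 is a total function on processes, constrained on M^2
   only; the Lipschitz bound makes it well defined up to indistinguishability
   (resp. dP (x) dt-equality when O^2 is H^2). *)
Definition operator_condition (d p : nat) (K : R) (o : O2_kind)
    (L : process R Omega d 1 -> process R Omega p 1) : Prop :=
  [/\ forall M, M2 M -> O2 o (L M),
      forall M, M2 M -> (normO2 o (L M) <= K%:E * normS2 M)%E
    & forall M M', M2 M -> M2 M' ->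
        (normO2 o (fun w t => L M w t - L M' w t)%R
           <= K%:E * normS2 (fun w t => M w t - M' w t)%R)%E].

(* The processes mu(., X, Y, L1 M), sigma(., X, Y, L2 M), f(., X, Y, L3 M) are
   predictable only up to a dP (x) dt-null set, because Y = M - V is merely
   cadlag and the regularity in (x, y, z) holds off such a set; b, s, g are
   predictable representatives, on which the integrals do not depend. *)
Definition fds_solution (n d m p1 p2 p3 : nat)
    (W : process R Omega m 1) (x0 : 'cV[R]_n)
    (mu : Omega -> R -> 'cV[R]_n -> 'cV[R]_d -> 'cV[R]_p1 -> 'cV[R]_n)
    (sigma : Omega -> R -> 'cV[R]_n -> 'cV[R]_d -> 'cV[R]_p2 -> 'M[R]_(n, m))
    (f : Omega -> R -> 'cV[R]_n -> 'cV[R]_d -> 'cV[R]_p3 -> 'cV[R]_d)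
    (phi : Omega -> 'cV[R]_n -> 'cV[R]_d)
    (L1 : process R Omega d 1 -> process R Omega p1 1)
    (L2 : process R Omega d 1 -> process R Omega p2 1)
    (L3 : process R Omega d 1 -> process R Omega p3 1)
    (X : process R Omega n 1) (V : process R Omega d 1) : Prop :=
  [/\ S2 X, S20 V
    & exists M : process R Omega d 1,
      condexp_process (fun w => phi w (X w T) + V w T) M /\
      let Y := fun w t => M w t - V w t in
      exists b s g A I J,
        [/\ predictable_version (fun w t => mu w t (X w t) (Y w t) (L1 M w t)) b,
            predictable_version
              (fun w t => sigma w t (X w t) (Y w t) (L2 M w t)) s
          & predictable_version (fun w t => f w t (X w t) (Y w t) (L3 M w t)) g]
        /\
        [/\ time_integral b A, ito_integral W s I, time_integral g J,
            indistinguishable X (fun w t => x0 + A w t + I w t)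
          & indistinguishable V J]].

End StochasticBasis.

(* Main.v *)
(* The solution is the fixed point of a map acting on a terminal value xi in
   L^2(F_T) and on two predictable processes x, v in H^2. Given these, M is the
   cadlag martingale E[xi | F_t], y = M - v, and the new state is made of the
   solution X of an equation with additive noise int sigma(x, y, L2 M) dW and
   drift mu(X, y, L1 M), of V = int f(x, y, L3 M) dt, and of phi(X_T) + V_T.
   Doob's inequality controls M by xi; Ito's isometry controls the noise; and the
   energy identity E|D_t|^2 = 2 E int_0^t D . dB + E|N_t|^2, for D = B + N with B
   of finite variation and N a martingale, together with the one-sided Lipschitz
   condition and Young's inequality, controls X. When T is small all squared
   distances shrink by a factor 16.

   The equation with additive noise is solved by an Euler scheme, which is Cauchy
   in mean square by the same energy identity; continuity and growth of the drift
   give the limit. *)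

Require Import Defs.
From HB Require Import structures.
From mathcomp Require Import all_boot all_order all_algebra.
From mathcomp Require Import all_classical all_reals all_analysis measurable_realfun.
From mathcomp Require Import ring lra.
Import Order.TTheory GRing.Theory Num.Theory.
Import numFieldNormedType.Exports.
Set Implicit Arguments.
Unset Strict Implicit.
Unset Printing Implicit Defensive.
Local Open Scope classical_set_scope.
Local Open Scope ring_scope.

(** * Mean-square convergence *)

(** [mu] is only one-sided Lipschitz in its first variable, so two drifts can be compared only when
    tested against the difference of the very solutions they drive; hence the drift is implicit in a
    step and the other coefficients are explicit. The three operators then decide the constants. The
    isometry gives the noise no power of T, so its smallness must come from [L2]: an S^2 bound
    integrated over [0, T] becomes T K^2 in mean square over dP dt. The integral of [f] gains T by
    Cauchy-Schwarz. The drift gains nothing when [L1] is H^2-valued; it is made small by the weight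
    tau of Young's inequality, whose inverse reappears in front of |X - X'|^2 and is absorbed for
    small T, so tau is fixed before T.

    Completeness is used in one form throughout: squared increments of size at most 16^-q have a
    common dominating variable and force convergence almost everywhere at rate 2^-q. The iteration
    converges only in L^2 and H^2; one further step returns continuous processes. The filtration
    being general, cadlag versions of martingales are built by counting oscillations along dyadic
    grids. *)

Section fast_sequences.
Context {R : realType}.

(** [u n - 2 A 2^-n] increases and [u n + 2 A 2^-n] decreases, because the correction shrinks by
    [A 2^-n] at each step; the limit is caught between them, which gives the rate as well. *)
Lemma fast_cvg (u : nat -> R) (A : R) : 0 <= A ->
  (forall n, `|u n.+1 - u n| <= A * 2^-1 ^+ n) ->
  exists l, u n @[n --> \oo] --> l /\ forall n, `|l - u n| <= 2 * A * 2^-1 ^+ n.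
Proof.
move=> A0 hu.
pose v n := u n - 2 * A * 2^-1 ^+ n.
pose w n := u n + 2 * A * 2^-1 ^+ n.
have p0 n : 0 <= A * 2^-1 ^+ n by rewrite mulr_ge0 ?exprn_ge0.
have nv : nondecreasing_seq v.
  apply/nondecreasing_seqP => n; rewrite /v exprS.
  by have := hu n; rewrite ler_norml => /andP[h1 h2]; lra.
have nw : nonincreasing_seq w.
  apply/nonincreasing_seqP => n; rewrite /w exprS.
  by have := hu n; rewrite ler_norml => /andP[h1 h2]; lra.
have vw m n : v m <= w n.
  apply: (@le_trans _ _ (v (maxn m n))); first exact/nv/leq_maxl.
  apply: (@le_trans _ _ (w (maxn m n))); last exact/nw/leq_maxr.
  by rewrite /v /w; have := p0 (maxn m n); lra.
have cv : cvgn v.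
  by apply: nondecreasing_is_cvgn => //; exists (w 0%N) => _ [n _ <-].
exists (limn v); split; last first.
  move=> n; have h1 : v n <= limn v by apply: nondecreasing_cvgn_le.
  have h2 : limn v <= w n by apply: limr_le => //; near=> k.
  by rewrite ler_norml; rewrite /v /w in h1 h2; lra.
have -> : u = v \+ (fun n => 2 * A * 2^-1 ^+ n).
  by apply/funext => n /=; rewrite /v subrK.
rewrite -[X in _ --> X]addr0; apply: cvgD => //.
rewrite -[X in _ --> X](mulr0 (2 * A)); apply: cvgMr.
by apply: cvg_expr; rewrite ger0_norm//; lra.
Unshelve. all: by end_near. Qed.

End fast_sequences.

Section L2.
Context {R : realType} {d : measure_display} {T : measurableType d}.
Variable mu : {measure set T -> \bar R}.
Implicit Types f g : T -> R.

Definition int1 f := mu.-integrable setT (EFin \o f).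

(** The squared L^2 norm, kept in the extended reals so that estimates can be stated before
    finiteness is known. *)
Definition nn2 f : \bar R := (\int[mu]_x (f x ^+ 2)%:E)%E.

Definition L2 f := measurable_fun setT f /\ (nn2 f < +oo)%E.

Lemma nn2_ge0 f : (0 <= nn2 f)%E.
Proof. by apply: integral_ge0 => x _; rewrite lee_fin sqr_ge0. Qed.

Lemma measurable_sqE f : measurable_fun setT f ->
  measurable_fun setT (fun x => (f x ^+ 2)%:E).
Proof. by move=> mf; apply/measurable_EFinP; exact: measurable_funX. Qed.

Lemma int1_sq f : L2 f -> int1 (fun x => f x ^+ 2).
Proof.
move=> [mf hf]; apply/integrableP; split; first exact: measurable_sqE.
rewrite (eq_integral (fun x => (f x ^+ 2)%:E))// => x _ /=.
by rewrite ger0_norm// sqr_ge0.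
Qed.

Lemma int1D f g : int1 f -> int1 g -> int1 (fun x => f x + g x).
Proof. by move=> hf hg; exact: (integrableD measurableT hf hg). Qed.

Lemma int1B f g : int1 f -> int1 g -> int1 (fun x => f x - g x).
Proof. by move=> hf hg; exact: (integrableB measurableT hf hg). Qed.

Lemma int1Z (c : R) f : int1 f -> int1 (fun x => c * f x).
Proof. by move=> hf; have := integrableZl measurableT c hf. Qed.

Lemma int1_measurable f : int1 f -> measurable_fun setT f.
Proof. by move=> /integrableP[/measurable_EFinP]. Qed.

Lemma int1_le f g : measurable_fun setT f -> int1 g ->
  (forall x, `|f x| <= g x) -> int1 f.
Proof.
move=> mf hg fg; apply: (@le_integrable _ _ _ _ _ _ _ (EFin \o g)) => //.
  exact/measurable_EFinP.
by move=> x _ /=; rewrite lee_fin (le_trans (fg x))// ler_norm.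
Qed.

Lemma int1_sum (I : Type) (s : seq I) (F : I -> T -> R) :
  (forall i, int1 (F i)) -> int1 (fun x => \sum_(i <- s) F i x).
Proof.
move=> h; rewrite /int1 (_ : _ \o _ = fun x => (\sum_(i <- s) (F i x)%:E)%E).
  by apply: integrable_sum => // i _; exact: h.
by apply/funext => x /=; rewrite sumEFin.
Qed.

Lemma Rintegral_sum (I : Type) (s : seq I) (F : I -> T -> R) :
  (forall i, int1 (F i)) ->
  \int[mu]_x (\sum_(i <- s) F i x) = \sum_(i <- s) \int[mu]_x F i x.
Proof.
move=> h; elim: s => [|a s IH].
  rewrite big_nil -[RHS](_ : \int[mu]_x (0:R) = 0).
    by apply: eq_Rintegral => x _; rewrite big_nil.
  by rewrite /Rintegral integral0.
rewrite big_cons -IH -RintegralD//; first last.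
- exact: int1_sum.
- exact: h.
- by apply: eq_Rintegral => x _; rewrite big_cons.
Qed.

Lemma L2M f g : L2 f -> L2 g -> int1 (fun x => f x * g x).
Proof.
move=> Lf Lg; apply: (@int1_le _ (fun x => f x ^+ 2 + g x ^+ 2)).
- by apply: measurable_funM; [case: Lf|case: Lg].
- by apply: int1D; exact: int1_sq.
- move=> x; rewrite normrM -(real_normK (num_real (f x))).
  rewrite -(real_normK (num_real (g x))).
  have := sqr_ge0 (`|f x| - `|g x|); have := sqr_ge0 (`|f x| + `|g x|); nra.
Qed.

Lemma nn2D f g : measurable_fun setT f -> measurable_fun setT g ->
  (nn2 (fun x => f x + g x)%R <= 2%:E * nn2 f + 2%:E * nn2 g)%E.
Proof.
move=> mf mg; rewrite /nn2 -!ge0_integralZl_EFin//;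
  try (by move=> x _; rewrite lee_fin sqr_ge0); try exact: measurable_sqE.
have ms (h : T -> R) : measurable_fun setT h ->
    measurable_fun setT (fun x => 2%:E * (h x ^+ 2)%:E)%E.
  move=> mh; apply/measurable_EFinP; apply: measurable_funM => //.
  exact: measurable_funX.
have s0 (h : T -> R) x : setT x -> (0 <= 2%:E * (h x ^+ 2)%:E)%E.
  by move=> _; rewrite -EFinM lee_fin mulr_ge0// sqr_ge0.
rewrite -ge0_integralD//; try exact: s0; try exact: ms.
apply: ge0_le_integral => //.
- by move=> x _; rewrite lee_fin sqr_ge0.
- by apply: measurable_sqE; exact: measurable_funD.
- by apply: emeasurable_funD; exact: ms.
- by move=> x _; rewrite -!EFinM -EFinD lee_fin; have := sqr_ge0 (f x - g x); nra.
Qed.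

Lemma nn2Z (c : R) f : measurable_fun setT f ->
  nn2 (fun x => c * f x) = ((c ^+ 2)%:E * nn2 f)%E.
Proof.
move=> mf; rewrite /nn2 -ge0_integralZl_EFin ?sqr_ge0//.
- by apply: eq_integral => x _; rewrite exprMn EFinM.
- by move=> x _; rewrite lee_fin sqr_ge0.
- exact: measurable_sqE.
Qed.

Lemma nn2_le f g : measurable_fun setT f -> measurable_fun setT g ->
  (forall x, f x ^+ 2 <= g x ^+ 2) -> (nn2 f <= nn2 g)%E.
Proof.
move=> mf mg fg; apply: ge0_le_integral => //.
- by move=> x _; rewrite lee_fin sqr_ge0.
- exact: measurable_sqE.
- exact: measurable_sqE.
- by move=> x _; rewrite lee_fin.
Qed.

Lemma L2_le f g : measurable_fun setT f -> L2 g ->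
  (forall x, f x ^+ 2 <= g x ^+ 2) -> L2 f.
Proof.
by move=> mf [mg hg] fg; split => //; apply: le_lt_trans hg; exact: nn2_le.
Qed.

Lemma L2D f g : L2 f -> L2 g -> L2 (fun x => f x + g x).
Proof.
move=> [mf hf] [mg hg]; split; first exact: measurable_funD.
by rewrite (le_lt_trans (nn2D mf mg))// lte_add_pinfty// lte_mul_pinfty// ?lee_fin// nn2_ge0.
Qed.

Lemma L2Z (c : R) f : L2 f -> L2 (fun x => c * f x).
Proof.
move=> [mf hf]; split; first exact: measurable_funM.
by rewrite nn2Z// lte_mul_pinfty// lee_fin sqr_ge0.
Qed.

Lemma L2N f : L2 f -> L2 (fun x => - f x).
Proof. by move/(L2Z (-1)); congr L2; apply/funext => x; rewrite mulN1r. Qed.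

Lemma L2B f g : L2 f -> L2 g -> L2 (fun x => f x - g x).
Proof. by move=> hf hg; apply: L2D => //; exact: L2N. Qed.

Lemma nn2N f : nn2 (fun x => - f x) = nn2 f.
Proof. by rewrite /nn2; apply: eq_integral => x _; rewrite sqrrN. Qed.

Lemma nn2B f g : measurable_fun setT f -> measurable_fun setT g ->
  (nn2 (fun x => f x - g x)%R <= 2%:E * nn2 f + 2%:E * nn2 g)%E.
Proof. by move=> mf mg; rewrite -(nn2N g); apply: nn2D => //; exact: measurableT_comp. Qed.

Lemma nn2E f : L2 f -> nn2 f = (\int[mu]_x (f x ^+ 2))%:E.
Proof.
by move=> [mf hf]; rewrite /Rintegral fineK// ge0_fin_numE// nn2_ge0.
Qed.

Lemma L2_sum (I : Type) (s : seq I) (F : I -> T -> R) :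
  (forall i, L2 (F i)) -> L2 (fun x => \sum_(i <- s) F i x).
Proof.
move=> h; elim: s => [|a s IH].
  split; first by under eq_fun do rewrite big_nil; exact: measurable_cst.
  by rewrite /nn2 (eq_integral (cst 0%E)) ?integral0// => x _; rewrite big_nil expr0n.
by under eq_fun do rewrite big_cons; exact: L2D.
Qed.

Lemma nn2_eq0 f : measurable_fun setT f -> nn2 f = 0%E -> {ae mu, forall x, f x = 0}.
Proof.
move=> mf h.
have /ae_eq_integral_abs : measurable_fun setT (fun x => (f x ^+ 2)%:E) by exact: measurable_sqE.
move=> /(_ mu measurableT)[+ _].
rewrite (_ : (\int[mu]_(x in setT) `|_|)%E = nn2 f); last first.
  by apply: eq_integral => x _; rewrite gee0_abs// lee_fin sqr_ge0.
move=> /(_ h); apply: filterS => x /(_ I) [] /eqP.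
by rewrite sqrf_eq0 => /eqP.
Qed.

Lemma ae_eq_Rintegral f g : measurable_fun setT f -> measurable_fun setT g ->
  {ae mu, forall x, f x = g x} -> \int[mu]_x f x = \int[mu]_x g x.
Proof.
move=> mf mg fg; rewrite /Rintegral; congr fine; apply: ae_eq_integral => //.
- exact/measurable_EFinP.
- exact/measurable_EFinP.
- by apply: filterS fg => x -> _.
Qed.

Lemma ae_eq_nn2 f g : measurable_fun setT f -> measurable_fun setT g ->
  {ae mu, forall x, f x = g x} -> nn2 f = nn2 g.
Proof.
move=> mf mg fg; apply: ae_eq_integral => //; try exact: measurable_sqE.
by apply: filterS fg => x -> _.
Qed.

(** [Q] is the sum of [4 ^ n * D n]: its integral is at most the sum of [4^-n], so it is finite
    almost everywhere, and each nonnegative term lies below the sum. Of the decay [16^-n], one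
    factor [4^-n] pays for summability and the other remains as a pointwise rate. *)
Lemma fast_summable (D : nat -> T -> \bar R) :
  (forall n, measurable_fun setT (D n)) -> (forall n x, (0 <= D n x)%E) ->
  (forall n, (\int[mu]_x D n x <= (16^-1 ^+ n)%:E)%E) ->
  exists Q : T -> R, [/\ int1 Q, forall x, 0 <= Q x
    & {ae mu, forall x, forall n, (D n x <= (Q x * 4^-1 ^+ n)%:E)%E}].
Proof.
move=> mD D0 hD.
pose F n x := ((4 ^+ n)%:E * D n x)%E.
have F0 n x : (0 <= F n x)%E by rewrite mule_ge0// lee_fin exprn_ge0.
have mF n : measurable_fun setT (F n) by exact: measurable_funeM.
pose S x := (\sum_(0 <= n <oo) F n x)%E.
have mS : measurable_fun setT S by apply: ge0_emeasurable_sum => // *; exact: mF.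
have S0 x : (0 <= S x)%E by apply: nneseries_ge0 => *; exact: F0.
have hS : (\int[mu]_x S x < +oo)%E.
  rewrite /S integral_nneseries//.
  apply: (@le_lt_trans _ _ (\sum_(0 <= n <oo) (geometric 1 4^-1 n)%:E)%E).
    apply: lee_nneseries => n _ ; first by move=> _; exact: integral_ge0.
    rewrite /F ge0_integralZl_EFin// ?exprn_ge0//.
    apply: (@le_trans _ _ ((4 ^+ n)%:E * (16^-1 ^+ n)%:E)%E).
      by rewrite lee_wpmul2l// lee_fin exprn_ge0.
    rewrite -EFinM lee_fin /geometric /= mul1r -exprMn.
    by rewrite (_ : 4 * 16^-1 = 4^-1 :> R)//; lra.
  have := @cvg_geometric_series R 1 4^-1.
  rewrite ger0_norm// => /(_ ltac:(lra)) h.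
  rewrite (_ : (\sum_(0 <= n <oo) _)%E = (1 / (1 - 4^-1))%:E) ?ltry//.
  apply/cvg_lim => //.
  have -> : (fun n => \sum_(0 <= k < n | xpredT k) (geometric 1 4^-1 k)%:E)%E =
    EFin \o series (geometric 1 (4^-1 : R)).
    by apply/funext => n; rewrite /= /series /= sumEFin.
  by apply/fine_cvgP; split => //; exact: nearW.
have iS : mu.-integrable setT S.
  apply/integrableP; split => //.
  by under eq_integral do rewrite gee0_abs//.
exists (fine \o S); split.
- have := integrable_ae measurableT iS => h.
  apply/integrableP; split.
    by apply/measurable_EFinP; exact: measurableT_comp.
  apply: le_lt_trans hS; apply: ge0_le_integral => //.
  + by apply: measurableT_comp => //; apply/measurable_EFinP; exact: measurableT_comp.
  + move=> x _ /=; rewrite ger0_norm ?fine_ge0//.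
    by have := S0 x; case: (S x) => //= r; rewrite ?leey.
- by move=> x /=; rewrite fine_ge0.
- have := integrable_ae measurableT iS; apply: filterS => x /(_ I) Sx n /=.
  rewrite EFinM fineK// -(@lee_pmul2l _ (4 ^+ n)%:E)// ?lte_fin ?exprn_gt0//.
  rewrite muleCA -EFinM -exprMn divff// expr1n mule1.
  apply: (le_trans _ (@nneseries_lim_ge _ (F ^~ x) xpredT 0 n.+1 _)) => //.
  by rewrite big_mkcond/= big_nat_recr//= leeDr// sume_ge0.
Qed.

End L2.

(** The domain is retyped with the sigma-algebra generated by [G], so that the closure properties of
    measurable functions apply to a sub-sigma-algebra; [gmeasP] returns to preimages when [G] is
    itself a sigma-algebra. *)
Definition gmeas {R : realType} {T : pointedType} (G : set (set T)) (f : T -> R) :=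
  measurable_fun [set: g_sigma_algebraType G] (f : g_sigma_algebraType G -> R).

Section gmeas.
Context {R : realType} {d : measure_display} {T : measurableType d}.
Variable G : set (set T).

Lemma gmeasP (f : T -> R) : sigma_algebra setT G ->
  gmeas G f <-> forall B, measurable B -> G (f @^-1` B).
Proof.
move=> sG; have e : <<s G >> = G := sigma_algebra_id sG.
split=> [h B mB|h _ B mB].
  have hB : <<s G >> (f @^-1` B) by have := h measurableT B mB; rewrite setTI.
  by rewrite -e.
by rewrite setTI; suff : <<s G >> (f @^-1` B) by []; rewrite e; exact: h.
Qed.

Hypothesis subG : G `<=` measurable.

Lemma gmeas_sub (f : T -> R) : gmeas G f -> measurable_fun setT f.
Proof.
move=> h _ B mB; have := h measurableT B mB; rewrite setTI => hB.
apply: (smallest_sub (sigma_algebra_measurable T) subG) => //.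
Qed.

Lemma gmeas_ext (f g : T -> R) : f =1 g -> gmeas G f -> gmeas G g.
Proof. by move=> /funext ->. Qed.

Lemma gmeas_indic (A : set T) : G A -> gmeas G (\1_A : T -> R).
Proof.
move=> GA; have mA : measurable (A : set (g_sigma_algebraType G)).
  exact: sub_sigma_algebra.
exact: (measurable_indic mA).
Qed.

(** An everywhere defined candidate for an almost everywhere limit that stays measurable for [G];
    [fine] supplies a value where the upper limit is infinite. *)
Lemma gmeas_limsup (f : nat -> T -> R) : (forall n, gmeas G (f n)) ->
  gmeas G (fun x => fine (limn_esup (fun n => (f n x)%:E))).
Proof.
move=> h; apply: (@measurableT_comp _ _ _ _ _ _ fine) => //.
apply: measurable_fun_limn_esup => n; apply/measurable_EFinP; exact: h.
Qed.

End gmeas.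

Section fast_L2.
Context {R : realType} {d : measure_display} {T : measurableType d}.
Variables (mu : {measure set T -> \bar R}) (G : set (set T)).
Hypothesis subG : G `<=` measurable.

(** [fast_summable] bounds the squared increments by [Q 4^-n], so the increments by [sqrt Q 2^-n],
    and [fast_cvg] applies point by point. This is completeness of L^2 together with almost
    everywhere convergence and a limit that is measurable for [G]. *)
Lemma fast_L2 (f : nat -> T -> R) :
  (forall n, gmeas G (f n)) ->
  (forall n, (nn2 mu (fun x => f n.+1 x - f n x)%R <= (16^-1 ^+ n)%:E)%E) ->
  exists g Q : T -> R, [/\ gmeas G g, int1 mu Q, forall x, 0 <= Q x &
   {ae mu, forall x, f n x @[n --> \oo] --> g x /\
      forall n, `|g x - f n x| <= 2 * Num.sqrt (Q x) * 2^-1 ^+ n}].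
Proof.
move=> Gf hf.
have mf n : measurable_fun setT (f n) := gmeas_sub subG (Gf n).
have [|n x|n|Q [iQ Q0 aQ]] := @fast_summable _ _ _ mu
    (fun n x => ((f n.+1 x - f n x) ^+ 2)%:E).
- by move=> n; apply: measurable_sqE; exact: measurable_funB.
- by rewrite lee_fin sqr_ge0.
- exact: hf.
exists (fun x => fine (limn_esup (fun n => (f n x)%:E))), Q.
split => //; first exact: gmeas_limsup.
apply: filterS aQ => x hx.
have [|l [hl hl2]] := @fast_cvg R (fun n => f n x) (Num.sqrt (Q x)) (sqrtr_ge0 _).
  move=> n; have := hx n; rewrite lee_fin => h.
  rewrite -[leRHS]ger0_norm ?mulr_ge0 ?exprn_ge0 ?sqrtr_ge0//.
  rewrite -ler_sqr ?nnegrE// !real_normK ?num_real// exprMn sqr_sqrtr//.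
  by rewrite exprAC (_ : 2^-1 ^+ 2 = 4^-1)//; lra.
have -> : limn_esup (fun n => (f n x)%:E) = l%:E.
  have hE : (f n x)%:E @[n --> \oo] --> l%:E.
    by apply/fine_cvgP; split => //; exact: nearW.
  by rewrite (cvg_limn_einf_sup hE).2.
by split.
Qed.

Lemma fast_L2_cvg (f : nat -> T -> R) (g Q : T -> R) :
  (forall n, gmeas G (f n)) -> gmeas G g -> int1 mu Q -> (forall x, 0 <= Q x) ->
  {ae mu, forall x, forall n, `|g x - f n x| <= 2 * Num.sqrt (Q x) * 2^-1 ^+ n} ->
  forall n, (nn2 mu (fun x => g x - f n x)%R <= (4 * 4^-1 ^+ n * \int[mu]_x Q x)%:E)%E.
Proof.
move=> Gf Gg iQ Q0 hfg n.
have mf : measurable_fun setT (f n) := gmeas_sub subG (Gf n).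
have mg : measurable_fun setT g := gmeas_sub subG Gg.
have fQ : (\int[mu]_x (Q x)%:E)%E \is a fin_num by exact: integrable_fin_num.
rewrite EFinM /Rintegral fineK// -ge0_integralZl_EFin//; last 2 first.
- by move=> x _; rewrite lee_fin.
- by apply/measurable_EFinP; exact: int1_measurable iQ.
apply: ae_ge0_le_integral => //.
- by move=> x _; rewrite lee_fin sqr_ge0.
- by apply: measurable_sqE; exact: measurable_funB.
- by move=> x _; rewrite -EFinM lee_fin !mulr_ge0// exprn_ge0.
- apply/measurable_EFinP; apply: measurable_funM => //.
  exact: int1_measurable iQ.
apply: filterS hfg => x /(_ n) h _; rewrite -EFinM lee_fin.
rewrite -(@real_normK _ (g x - f n x)) ?num_real//.
apply: (@le_trans _ _ ((2 * Num.sqrt (Q x) * 2^-1 ^+ n) ^+ 2)).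
  by rewrite ler_sqr ?nnegrE// ?mulr_ge0 ?sqrtr_ge0 ?exprn_ge0.
rewrite !exprMn sqr_sqrtr// exprAC (_ : 2^-1 ^+ 2 = 4^-1); last by lra.
by rewrite (_ : 2 ^+ 2 = 4); [rewrite mulrAC|lra].
Qed.

End fast_L2.

(** * Orthogonality and conditional expectation *)

Import HBNNSimple.

Section orth.
Context {R : realType} {d : measure_display} {T : measurableType d}.
Variables (mu : {measure set T -> \bar R}) (G : set (set T)).
Hypothesis sG : sigma_algebra setT G.
Hypothesis subG : G `<=` measurable.

Lemma Rintegral_indic (f : T -> R) (A : set T) : measurable A ->
  \int[mu]_(x in A) f x = \int[mu]_x (\1_A x * f x).
Proof.
move=> mA; rewrite Rintegral_mkcond; apply: eq_Rintegral => x _.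
by rewrite patchE indicE; case: ifP; rewrite ?mul1r ?mul0r.
Qed.

Lemma int1_indic (f : T -> R) (A : set T) : measurable A -> int1 mu f ->
  int1 mu (fun x => \1_A x * f x).
Proof.
move=> mA If; apply: (@int1_le _ _ _ _ _ (fun x => `|f x|)).
- apply: measurable_funM; [exact: measurable_indic|exact: int1_measurable If].
- exact: (integrable_norm If).
- by move=> x; rewrite normrM indicE; case: (_ \in _);
    rewrite ?normr1 ?normr0 ?mul1r ?mul0r.
Qed.

(** From indicators to simple functions by linearity, then to [h] by its increasing simple
    approximations; these are built for the sigma-algebra [G], so their level sets belong to [G],
    and [|h z|] dominates. *)
Lemma int_mul_eq0_ge0 (z h : T -> R) : int1 mu z ->
  (forall A, G A -> \int[mu]_x (\1_A x * z x) = 0) ->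
  gmeas G h -> (forall x, 0 <= h x) -> int1 mu (fun x => h x * z x) ->
  \int[mu]_x (h x * z x) = 0.
Proof.
move=> Iz Az Gh h0 Ihz.
have mh : measurable_fun [set: g_sigma_algebraType G] (EFin \o h).
  exact/measurable_EFinP.
pose s n : {nnsfun (g_sigma_algebraType G) >-> R} := nnsfun_approx measurableT mh n.
pose g n : T -> R := fun x => s n x.
have gh n x : g n x <= h x.
  rewrite /g /s nnsfun_approxE -lee_fin; apply: le_approx => //= t _.
  by rewrite lee_fin.
have mg n : measurable_fun [set: T] (g n).
  by apply: (gmeas_sub subG); exact: measurable_funP.
have z0 n : \int[mu]_x (g n x * z x) = 0.
  have hg x : g n x * z x = \sum_(y <- finmap.enum_fset (fset_set (range (s n))))
      y * (\1_(g n @^-1` [set y]) x * z x).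
    by rewrite /g fimfunE fsbig_finite//= mulr_suml; apply: eq_bigr => y _; rewrite mulrA.
  have Gy y : G (g n @^-1` [set y]).
    apply: (gmeasP _ sG).1; first exact: measurable_funP.
    exact: measurable_set1.
  under eq_Rintegral do rewrite hg.
  have II y : int1 mu (fun x => \1_(g n @^-1` [set y]) x * z x).
    by apply: int1_indic => //; exact/subG/Gy.
  rewrite Rintegral_sum => [|y]; last exact/int1Z/II.
  rewrite big1// => y _; rewrite RintegralZl//; last exact: II.
  by rewrite Az ?mulr0.
have [|||||_ _] := @dominated_convergence _ _ _ mu setT measurableT
  (fun n x => (g n x * z x)%:E) (fun x => (h x * z x)%:E)
  (fun x => `|h x * z x|%:E) .
- move=> n; apply/measurable_EFinP; apply: measurable_funM => //.
  exact: int1_measurable Iz.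
- by apply/measurable_EFinP; exact: int1_measurable Ihz.
- apply: nearW => x _.
  have := cvg_nnsfun_approx measurableT mh (fun t _ => h0 t) (I : setT x).
  move=> /fine_cvgP[_ hc]; apply/fine_cvgP; split; first exact: nearW.
  by apply: cvgMl; exact: hc.
- exact: (integrable_norm Ihz).
- apply: nearW => x n _ /=; rewrite lee_fin !normrM ler_wpM2r//.
  by rewrite !ger0_norm.
- rewrite (_ : [sequence _]_n = cst 0%E); last first.
    apply/funext => n /=; rewrite -[LHS]fineK.
      by have := z0 n; rewrite /Rintegral => ->.
    apply: integrable_fin_num => //.
    apply: (@int1_le _ _ _ _ _ (fun x => `|h x * z x|)).
    - by apply: measurable_funM => //; exact: int1_measurable Iz.
    - exact: (integrable_norm Ihz).
    - by move=> x; rewrite !normrM ler_wpM2r// !ger0_norm.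
  by move=> hc; rewrite /Rintegral -(cvg_lim _ hc)// lim_cst.
Qed.

Lemma int_mul_eq0 (z h : T -> R) : int1 mu z ->
  (forall A, G A -> \int[mu]_x (\1_A x * z x) = 0) ->
  gmeas G h -> int1 mu (fun x => h x * z x) ->
  \int[mu]_x (h x * z x) = 0.
Proof.
move=> Iz Az Gh Ihz.
have mhz := int1_measurable Ihz.
have mz := int1_measurable Iz.
have Ghp : gmeas G (h^\+) by exact: measurable_funrpos.
have Ghn : gmeas G (h^\-) by exact: measurable_funrneg.
have Ip : int1 mu (fun x => h^\+ x * z x).
  apply: (int1_le _ (integrable_norm Ihz)) => [|x].
    by apply: measurable_funM => //; exact: (gmeas_sub subG).
  rewrite /= !normrM ler_wpM2r// ger0_norm ?funrpos_ge0// /funrpos.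
  by rewrite ge_max normr_ge0 ler_norm.
have In : int1 mu (fun x => h^\- x * z x).
  apply: (int1_le _ (integrable_norm Ihz)) => [|x].
    by apply: measurable_funM => //; exact: (gmeas_sub subG).
  rewrite /= !normrM ler_wpM2r// ger0_norm ?funrneg_ge0// /funrneg.
  by rewrite ge_max normr_ge0 -normrN ler_norm.
have -> : \int[mu]_x (h x * z x) = \int[mu]_x (h^\+ x * z x - h^\- x * z x).
  apply: eq_Rintegral => x _; rewrite -mulrBl; congr (_ * _).
  by rewrite -[in LHS](funrposBneg h).
by rewrite RintegralB// !int_mul_eq0_ge0 ?subrr// => x; rewrite ?funrpos_ge0 ?funrneg_ge0.
Qed.

End orth.

Lemma eq0_of_geom {R : realType} (a c : R) :
  (forall n, `|a| <= c * 2^-1 ^+ n) -> a = 0.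
Proof.
move=> h; apply/eqP; rewrite -normr_le0.
have hc : c * 2^-1 ^+ n @[n --> \oo] --> (0 : R).
  rewrite -[X in _ --> X](mulr0 c); apply: cvgMr.
  by apply: cvg_expr; rewrite ger0_norm//; lra.
by rewrite -(cvg_lim _ hc)//; apply: limr_ge; [exact: cvgP hc|exact: nearW].
Qed.

Section condexp.
Context {R : realType} {d : measure_display} {T : measurableType d}.
Variables (P : probability T R) (G : set (set T)).
Hypothesis sG : sigma_algebra setT G.
Hypothesis subG : G `<=` measurable.

Lemma L2_cst (c : R) : L2 P (fun=> c).
Proof.
split; first exact: measurable_cst.
by rewrite /nn2 integral_cst//= probability_setT mule1 ltry.
Qed.

Lemma L2_indic (A : set T) : measurable A -> L2 P (\1_A : T -> R).
Proof.
move=> mA; apply: (L2_le _ (L2_cst 1)); first exact: measurable_indic.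
by move=> x; rewrite indicE; case: (_ \in _); rewrite ?expr1n ?expr0n.
Qed.

Lemma L2_int1 (f : T -> R) : L2 P f -> int1 P f.
Proof.
move=> Lf; rewrite (_ : f = fun x => f x * 1); first exact: (L2M Lf (L2_cst 1)).
by apply/funext => x; rewrite mulr1.
Qed.

Lemma int1_cst (c : R) : int1 P (fun=> c).
Proof. exact/L2_int1/L2_cst. Qed.

Lemma Rint_cst (c : R) : \int[P]_x c = c.
Proof. by rewrite Rintegral_cst//= probability_setT mulr1. Qed.

Let sqdist (f g : T -> R) : R := \int[P]_x ((f x - g x) ^+ 2).

(** The conditional expectation is the [G]-measurable point of L^2 nearest to [f]. A minimizing
    sequence is Cauchy by the parallelogram identity, and orthogonality to an indicator is the
    first-order condition at the minimum, obtained along the sequence with a vanishing error. *)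
Lemma projection_exists (f : T -> R) : L2 P f ->
  exists2 z, gmeas G z /\ L2 P z & forall A, G A -> \int[P]_x (\1_A x * (f x - z x)) = 0.
Proof.
move=> Lf.
pose E := [set sqdist f z | z in [set z | gmeas G z /\ L2 P z]].
have E0 : has_inf E.
  split.
    exists (sqdist f (fun=> 0)), (fun=> 0) => //; split; last exact: L2_cst.
    exact: measurable_cst.
  by exists 0 => _ [z _ <-]; apply: Rintegral_ge0 => x _; exact: sqr_ge0.
have Em z : gmeas G z -> L2 P z -> inf E <= sqdist f z.
  by move=> Gz Lz; apply: ge_inf; [exact: E0.2|exists z].
pose e n : R := 16^-1 ^+ n / 4.
have e0 n : 0 < e n by rewrite divr_gt0// exprn_gt0.
have /choice[zn hzn] : forall n, exists z, [/\ gmeas G z, L2 P z & sqdist f z < inf E + e n].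
  by move=> n; have [_ [z [Gz Lz] <-] h] := inf_adherent (e0 n) E0; exists z.
have Gn n : gmeas G (zn n) by case: (hzn n).
have Ln n : L2 P (zn n) by case: (hzn n).
have Dn n : sqdist f (zn n) < inf E + e n by case: (hzn n).
have isq (g : T -> R) : L2 P g -> int1 P (fun x => (f x - g x) ^+ 2).
  by move=> Lg; apply: int1_sq; exact: L2B.
have hn n : (nn2 P (fun x => zn n.+1 x - zn n x)%R <= (16^-1 ^+ n)%:E)%E.
  rewrite nn2E; last exact: L2B.
  rewrite lee_fin.
  pose y x := 2^-1 * (zn n.+1 x + zn n x).
  have Ly : L2 P y by apply/L2Z/L2D.
  have hy : inf E <= sqdist f y.
    apply: Em => //; apply: measurable_funM; first exact: measurable_cst.
    exact: (measurable_funD (Gn _) (Gn _)).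
  have -> : \int[P]_x ((zn n.+1 x - zn n x) ^+ 2) =
     2 * sqdist f (zn n.+1) + 2 * sqdist f (zn n) - 4 * sqdist f y.
    rewrite /sqdist -!RintegralZl//; try exact: isq.
    rewrite -RintegralD//; try (apply/int1Z; exact: isq).
    rewrite -RintegralB//; first last.
    - by apply/int1Z; exact: isq.
    - by apply/int1D; apply/int1Z; exact: isq.
    by apply: eq_Rintegral => x _; rewrite /y; field.
  have := Dn n; have := Dn n.+1; rewrite /e exprS => h1 h2.
  have h3 : 0 <= 16^-1 ^+ n :> R by rewrite exprn_ge0.
  lra.
have [z [Q [Gz IQ Q0 hz]]] := fast_L2 subG Gn hn.
have hz2 : {ae P, forall x, forall n, `|z x - zn n x| <= 2 * Num.sqrt (Q x) * 2^-1 ^+ n}.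
  by apply: filterS hz => x [].
have hzd := fast_L2_cvg subG Gn Gz IQ Q0 hz2.
have mz := gmeas_sub subG Gz.
have Lz : L2 P z.
  have -> : z = fun x => (z x - zn 0%N x) + zn 0%N x.
    by apply/funext => x; rewrite subrK.
  apply: L2D => //; split; last by rewrite (le_lt_trans (hzd 0%N))// ltry.
  by apply: measurable_funB => //; exact: (gmeas_sub subG (Gn _)).
exists z => // A GA.
have mA : measurable A by exact: subG.
have IA : L2 P (\1_A : T -> R) by exact: L2_indic.
apply: (@eq0_of_geom _ _ (2 + \int[P]_x Q x)) => n.
have L1 : L2 P (fun x => f x - zn n x) by exact: L2B.
have L2' : L2 P (fun x => z x - zn n x) by exact: L2B.
have -> : \int[P]_x (\1_A x * (f x - z x)) =
   \int[P]_x (\1_A x * (f x - zn n x)) - \int[P]_x (\1_A x * (z x - zn n x)).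
  rewrite -RintegralB//; try exact: L2M.
  by apply: eq_Rintegral => x _; rewrite -mulrBr; congr (_ * _); lra.
set I1 := \int[P]_x _; set I2 := \int[P]_x _.
(* Minimality is tested on [zn n + t 1_A]. The choices [t = 2^-n] and [t = - 2^-n] then give
   [|I1| <= 2^-n], because [e n <= t^2]. *)
have h1 (t : R) : 2 * t * I1 <= t ^+ 2 + e n.
  have Lt : L2 P (fun x => zn n x + t * \1_A x) by apply/L2D => //; exact: L2Z.
  have Gt : gmeas G (fun x => zn n x + t * \1_A x).
    apply: measurable_funD; first exact: Gn.
    by apply: measurable_funM; [exact: measurable_cst|exact: gmeas_indic].
  have := Em _ Gt Lt.
  have -> : sqdist f (fun x => zn n x + t * \1_A x) =
     sqdist f (zn n) - 2 * t * I1 + t ^+ 2 * \int[P]_x (\1_A x ^+ 2).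
    rewrite /sqdist /I1 -!RintegralZl//; [|exact: int1_sq|exact: L2M].
    rewrite -RintegralB//; [|exact: isq|apply/int1Z; exact: L2M].
    rewrite -RintegralD//; first last.
    - by apply/int1Z; exact: int1_sq.
    - by apply/int1B; [exact: isq|apply/int1Z; exact: L2M].
    by apply: eq_Rintegral => x _; ring.
  have : \int[P]_x (\1_A x ^+ 2) <= 1.
    apply: (@le_trans _ _ (\int[P]_x (1 : R))).
      apply: le_Rintegral => //; [exact: int1_sq|exact: int1_cst].
    by rewrite Rint_cst.
  move=> h; have := Dn n; have := sqr_ge0 t; nra.
have h2 : `|I2| <= 2^-1 ^+ n * (1 + \int[P]_x Q x).
  have : 0 <= 2^-1 ^+ n :> R by rewrite exprn_ge0.
  have : forall x, (forall n, `|z x - zn n x| <= 2 * Num.sqrt (Q x) * 2^-1 ^+ n) ->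
    `|z x - zn n x| <= 2 * Num.sqrt (Q x) * 2^-1 ^+ n by move=> x; exact.
  move: (2^-1 ^+ n) => q hq q0.
  rewrite (le_trans (le_normr_Rintegral _ _))//; first exact: L2M.
  have IQ1 : int1 P (fun x => 1 + Q x) by apply: int1D => //; exact: int1_cst.
  rewrite -[1 in leRHS](_ : \int[P]_x (1 : R) = 1); last first.
    by rewrite Rint_cst.
  rewrite -RintegralD//; last exact: int1_cst.
  rewrite -RintegralZl//.
  have IN := integrable_norm (L2M IA L2').
  have IZ := int1Z q IQ1.
  rewrite /Rintegral fine_le//.
  - exact: (integrable_fin_num measurableT IN).
  - exact: (integrable_fin_num measurableT IZ).
  apply: ae_ge0_le_integral => //.
  - by case/integrableP: IN.
  - by move=> x _; rewrite lee_fin mulr_ge0// addr_ge0.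
  - by case/integrableP: IZ.
  apply: filterS hz2 => x /hq h _; rewrite lee_fin normrM.
  apply: (@le_trans _ _ (2 * Num.sqrt (Q x) * q)).
    rewrite -[leRHS]mul1r ler_pM// indicE; case: (_ \in _); rewrite ?normr1 ?normr0//.
  rewrite mulrC ler_wpM2l//.
  by have := sqr_sqrtr (Q0 x); have := sqr_ge0 (Num.sqrt (Q x) - 1); nra.
have h3 : `|I1| <= 2^-1 ^+ n.
  have p0 : 0 < 2^-1 ^+ n :> R by rewrite exprn_gt0.
  have en : e n <= (2^-1 ^+ n) ^+ 2.
    rewrite /e exprAC (_ : 2^-1 ^+ 2 = 4^-1 :> R); last by lra.
    have : 16^-1 ^+ n <= 4^-1 ^+ n :> R by rewrite lerXn2r// ?nnegrE//; lra.
    have : 0 <= 16^-1 ^+ n :> R by rewrite exprn_ge0.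
    by lra.
  have := h1 (2^-1 ^+ n); have := h1 (- 2^-1 ^+ n); rewrite ler_norml.
  by move: (2^-1 ^+ n) p0 en => t t0 en; rewrite sqrrN => k1 k2; apply/andP; split; nra.
rewrite (le_trans (ler_normB _ _))//.
have h4 : 0 <= 2^-1 ^+ n :> R by rewrite exprn_ge0.
nra.
Qed.

End condexp.

(** * Maximal and oscillation inequalities for discrete martingales *)

Section paths.
Context {R : realType}.
Implicit Types (x : nat -> R) (e : R).

Fixpoint runmax x n : R :=
  if n is m.+1 then Num.max (runmax x m) `|x m.+1| else `|x 0%N|.

Lemma runmax_ge0 x n : 0 <= runmax x n.
Proof. by elim: n => //= n IH; rewrite le_max IH. Qed.

Lemma runmax_ge x n k : (k <= n)%N -> `|x k| <= runmax x n.
Proof.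
elim: n => [|n IH]; first by rewrite leqn0 => /eqP ->.
by rewrite leq_eqVlt => /predU1P[->|/IH h] /=; rewrite le_max ?lexx ?orbT// h.
Qed.

(* Trajectorial form of Doob's L^2 maximal inequality. *)
Lemma runmax_sqr x n :
  runmax x n ^+ 2 + 4 * \sum_(i < n) runmax x i * (`|x i.+1| - `|x i|)
    <= 4 * x n ^+ 2.
Proof.
suff h : \sum_(i < n) runmax x i * (`|x i.+1| - `|x i|) <=
    runmax x n * `|x n| - runmax x n ^+ 2 / 2.
  rewrite -(real_normK (num_real (x n))).
  by have := sqr_ge0 (runmax x n - 2 * `|x n|); nra.
elim: n => [|n IH]; first by rewrite big_ord0 /=; have := sqr_ge0 (`|x 0%N|); nra.
rewrite big_ord_recr /=; move: IH; set A := \sum_(i < n) _ => IH.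
have := runmax_ge0 x n; set r := runmax x n in IH * => r0.
case: (leP r `|x n.+1|) => h; last by nra.
by have := sqr_ge0 (r - `|x n.+1|); nra.
Qed.

(* [anchor e x n] is the last value of [x] at which the path was seen to have
   moved by more than [e]; [osc e x n] counts those moves. *)
Fixpoint anchor e x n : R :=
  if n is m.+1 then
    if e < `|x m.+1 - anchor e x m| then x m.+1 else anchor e x m
  else x 0%N.

Fixpoint osc e x n : R :=
  if n is m.+1 then
    osc e x m + (if e < `|x m.+1 - anchor e x m| then 1 else 0)
  else 0.

Lemma osc_le e x n : 0 <= osc e x n <= n%:R.
Proof.
elim: n => [|n /= /andP[IH1 IH2]]; first by rewrite /= lexx.
by rewrite -natr1; case: ifP => _; apply/andP; split; lra.
Qed.

Lemma osc_ge0 e x n : 0 <= osc e x n.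
Proof. by case/andP: (osc_le e x n). Qed.

Lemma anchor_close e x n : 0 <= e -> `|x n - anchor e x n| <= e.
Proof.
move=> e0; case: n => [|n] /=; first by rewrite subrr normr0.
by case: ltP => // _; rewrite subrr normr0.
Qed.

Lemma anchor_runmax e x n : `|anchor e x n| <= runmax x n.
Proof.
elim: n => [//|n IH] /=; case: ifP => _; first by rewrite le_max lexx orbT.
by rewrite le_max IH.
Qed.

(** For a fixed anchor [a], the increment of [x^2] minus [2 a] times the increment of [x] is the
    increment of [(x - a)^2]. When the anchor is reset, a square of at least [e^2] is given up and
    traded for one count. The sum is a discrete stochastic integral, so for a martingale the counts
    are controlled by the final second moment. *)
Lemma osc_ineq e x n : 0 <= e ->
  e ^+ 2 * osc e x n <=
  x n ^+ 2 - 2 * \sum_(i < n) anchor e x i * (x i.+1 - x i).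
Proof.
move=> e0.
suff h : (x n - anchor e x n) ^+ 2 + e ^+ 2 * osc e x n <=
    x n ^+ 2 - x 0%N ^+ 2 - 2 * \sum_(i < n) anchor e x i * (x i.+1 - x i).
  by have := sqr_ge0 (x n - anchor e x n); have := sqr_ge0 (x 0%N); lra.
elim: n => [|n IH] /=; first by rewrite big_ord0; lra.
rewrite big_ord_recr /=; move: IH; set A := \sum_(i < n) _.
have := @anchor_close e x n e0; set a := anchor e x n; set c := osc e x n => ha IH.
case: ltP => h; last by nra.
have : e ^+ 2 <= (x n.+1 - a) ^+ 2.
  by rewrite -(real_normK (num_real (x n.+1 - a))) ler_sqr ?nnegrE// ltW.
by nra.
Qed.

(** Without a count the anchor is the same at both times, and both values lie within [e] of it. *)
Lemma osc_step e x m n : 0 <= e -> (m < n)%N -> 2 * e < `|x n - x m| ->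
  osc e x m + 1 <= osc e x n.
Proof.
move=> e0 mn h.
suff [//|H] : osc e x m + 1 <= osc e x n \/
    (osc e x m <= osc e x n /\ anchor e x n = anchor e x m).
  have h1 := @anchor_close e x n e0; have h2 := @anchor_close e x m e0.
  have := ler_normB (x n - anchor e x n) (x m - anchor e x m).
  rewrite H.2 (_ : _ - _ - _ = x n - x m); last by lra.
  by rewrite H.2 in h1; lra.
elim: n mn {h} => // n IH; rewrite ltnS leq_eqVlt => /predU1P[<-|/IH{}IH] /=.
  by case: ltP => _; [left|right; split; lra].
case: IH => [h|[h1 h2]]; first by left; case: ltP => _; lra.
by case: ltP => _; [left; lra|right; split; [lra|]].
Qed.

Lemma osc_mono e x m n : (m <= n)%N -> osc e x m <= osc e x n.
Proof.
elim: n => [|n IH]; first by rewrite leqn0 => /eqP ->.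
rewrite leq_eqVlt => /predU1P[->//|/IH /= h].
by case: ifP => _; lra.
Qed.

End paths.

Section discrete_martingale.
Context {R : realType} {d : measure_display} {Omega : measurableType d}.
Variables (P : probability Omega R) (Fn : nat -> set (set Omega)).
Variable M : nat -> Omega -> R.
Hypothesis subF : forall n, Fn n `<=` measurable.
Hypothesis GM : forall k n, (k <= n)%N -> gmeas (Fn n) (M k).
Hypothesis LM : forall n, L2 P (M n).
Hypothesis orth : forall n h, gmeas (Fn n) h -> L2 P h ->
  \int[P]_w (h w * (M n.+1 w - M n w)) = 0.

Lemma gmeas_runmax k n : (k <= n)%N -> gmeas (Fn n) (fun w => runmax (M ^~ w) k).
Proof.
move=> kn; elim: k kn => [|k IH] kn /=.
  by apply: measurableT_comp => //; exact: GM.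
apply: measurable_maxr; first exact: (IH (ltnW kn)).
by apply: measurableT_comp => //; exact: GM.
Qed.

Lemma L2_norm (f : Omega -> R) : L2 P f -> L2 P (fun w => `|f w|).
Proof.
move=> Lf; apply: (L2_le _ Lf) => [|x].
  by apply: measurableT_comp => //; case: Lf.
by rewrite real_normK ?num_real.
Qed.

Lemma L2_runmax n : L2 P (fun w => runmax (M ^~ w) n).
Proof.
elim: n => [|n IH] /=; first exact: L2_norm.
apply: (L2_le _ (L2D IH (L2_norm (LM n.+1)))).
  by apply: measurable_maxr; [case: IH|case: (L2_norm (LM n.+1))].
move=> w; rewrite ler_sqr ?nnegrE ?addr_ge0 ?runmax_ge0//.
  by rewrite ge_max lerDl lerDr runmax_ge0 normr_ge0.
by rewrite le_max runmax_ge0.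
Qed.

(** The sum in the pathwise inequality [runmax_sqr] has nonnegative mean: [|M (i+1)| - |M i|] is at
    least the sign of [M i] times the increment of [M], and the running maximum times this sign is
    known at time [i], hence orthogonal to the increment. *)
Lemma doob_discrete n :
  \int[P]_w (runmax (M ^~ w) n ^+ 2) <= 4 * \int[P]_w (M n w ^+ 2).
Proof.
have Lr k := L2_runmax k.
have Ld k : L2 P (fun w => `|M k.+1 w| - `|M k w|) by apply: L2B; exact: L2_norm.
have Is : int1 P (fun w => \sum_(i < n) runmax (M ^~ w) i * (`|M i.+1 w| - `|M i w|)).
  by apply: int1_sum => i; exact: L2M.
have h0 : 0 <= \int[P]_w (\sum_(i < n) runmax (M ^~ w) i * (`|M i.+1 w| - `|M i w|)).
  rewrite Rintegral_sum; last by move=> i; exact: L2M.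
  apply: sumr_ge0 => i _.
  pose h w := runmax (M ^~ w) i * Num.sg (M i w).
  have mh : gmeas (Fn i) h.
    apply: measurable_funM; first exact: gmeas_runmax.
    apply: measurableT_comp; last exact: GM.
    rewrite (_ : (@Num.sg R : R -> R) = (fun x => \1_`]0, +oo[ x - \1_`]-oo, 0[ x)); last first.
      apply/funext => x; rewrite !indicE !mem_setE !in_itv/= andbT.
      by case: sgrP => _ /=; rewrite ?subrr ?subr0 ?sub0r.
    by apply: measurable_funB; exact: measurable_indic.
  have Lh : L2 P h.
    apply: (L2_le _ (Lr i)); first exact: (gmeas_sub (subF (n:=i)) mh).
    move=> w; rewrite /h exprMn ler_piMr ?sqr_ge0//.
    by case: sgrP => _; rewrite ?sqrrN ?expr1n ?expr0n.
  rewrite -(orth mh Lh); apply: le_Rintegral => //.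
  - by apply: (L2M Lh); exact: L2B.
  - exact: L2M.
  move=> w _; rewrite /h -mulrA ler_wpM2l ?runmax_ge0// mulrBr -normrEsg lerD2r.
  by case: sgrP => _; rewrite ?mul0r ?mul1r ?mulN1r ?ler_norm// -normrN ler_norm.
have : \int[P]_w (runmax (M ^~ w) n ^+ 2 +
   4 * \sum_(i < n) runmax (M ^~ w) i * (`|M i.+1 w| - `|M i w|)) <=
   \int[P]_w (4 * M n w ^+ 2).
  apply: le_Rintegral => //.
  - by apply: int1D; [exact: int1_sq|exact: int1Z].
  - by apply: int1Z; exact: int1_sq.
  - by move=> w _; exact: runmax_sqr.
rewrite RintegralD//; [|exact: int1_sq|exact: int1Z].
rewrite !RintegralZl//; [|exact: int1_sq].
by lra.
Qed.

Lemma gmeas_anchor e k n : (k <= n)%N -> gmeas (Fn n) (fun w => anchor e (M ^~ w) k).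
Proof.
move=> kn; elim: k kn => [|k IH] kn /=; first exact: GM.
have hk := IH (ltnW kn).
apply: measurable_fun_ifT => //; last exact: GM.
apply: measurable_fun_ltr; first exact: measurable_cst.
by apply: measurableT_comp => //; apply: measurable_funB => //; exact: GM.
Qed.

Lemma gmeas_osc e k n : (k <= n)%N -> gmeas (Fn n) (fun w => osc e (M ^~ w) k).
Proof.
move=> kn; elim: k kn => [|k IH] kn /=; first exact: measurable_cst.
apply: measurable_funD; first exact: (IH (ltnW kn)).
apply: measurable_fun_ifT; try exact: measurable_cst.
apply: measurable_fun_ltr; first exact: measurable_cst.
apply: measurableT_comp => //; apply: measurable_funB; first exact: GM.
exact: (gmeas_anchor e (ltnW kn)).
Qed.

(** Plays the part of the upcrossing inequality: in [osc_ineq] the anchor at [i] is known at time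
    [i], so the sum has mean zero. For given [e] the bound involves only the final second moment,
    not the number of times, as refining grids require. *)
Lemma osc_bound e n : 0 <= e ->
  e ^+ 2 * \int[P]_w osc e (M ^~ w) n <= \int[P]_w (M n w ^+ 2).
Proof.
move=> e0.
have La k : L2 P (fun w => anchor e (M ^~ w) k).
  apply: (L2_le _ (L2_runmax k)); first exact: (gmeas_sub (subF (n:=k)) (gmeas_anchor e (leqnn k))).
  move=> w; rewrite -(real_normK (num_real (anchor _ _ _))).
  by rewrite ler_sqr ?nnegrE ?runmax_ge0// anchor_runmax.
have Io : int1 P (fun w => osc e (M ^~ w) n).
  apply: (int1_le _ (int1_cst P n%:R)) => [|w].
    exact: (gmeas_sub (subF (n:=n)) (gmeas_osc e (leqnn n))).
  by case/andP: (osc_le e (M ^~ w) n) => h1 h2; rewrite ger0_norm.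
have It k : int1 P (fun w => anchor e (M ^~ w) k * (M k.+1 w - M k w)).
  by apply: L2M => //; exact: L2B.
have h0 : \int[P]_w (\sum_(i < n) anchor e (M ^~ w) i * (M i.+1 w - M i w)) = 0.
  rewrite Rintegral_sum//; apply: big1 => i _; apply: orth => //.
  exact: gmeas_anchor.
rewrite -RintegralZl//.
have -> : \int[P]_w (M n w ^+ 2) = \int[P]_w (M n w ^+ 2 -
    2 * \sum_(i < n) anchor e (M ^~ w) i * (M i.+1 w - M i w)).
  rewrite RintegralB//; [|exact: int1_sq|by apply: int1Z; exact: int1_sum].
  by rewrite RintegralZl// ?h0 ?mulr0 ?subr0//; exact: int1_sum.
apply: le_Rintegral => //; first exact: int1Z.
- by apply: int1B; [exact: int1_sq|apply: int1Z; exact: int1_sum].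
- by move=> w _; exact: osc_ineq.
Qed.

End discrete_martingale.

(** * One-sided limits, dyadic grids and regularization of paths *)

Section within.
Context {R : realType}.

(** A limit along [A] with explicit radii. [A] will be the times after [t], the times before [t], or
    [0, T], so that right limits, left limits and continuity on the interval share one calculus. *)
Definition tends (A : set R) (u : R -> R) (t l : R) :=
  forall e, 0 < e -> exists2 r, 0 < r &
    forall s, A s -> `|s - t| < r -> `|u s - l| <= e.

Lemma within_nearP (A : set R) (t : R) (Q : R -> Prop) :
  (\forall s \near within A (nbhs t), Q s) <->
  exists2 r, 0 < r & forall s, A s -> `|s - t| < r -> Q s.
Proof.
split=> [|[r r0 h]].
  rewrite near_withinE => /nbhs_ballP[r /= r0 h]; exists r => // s As st.
  by apply: h => //; rewrite /ball /= distrC.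
rewrite near_withinE; apply/nbhs_ballP; exists r => //= s /= st As; apply: h => //.
by move: st; rewrite /ball /= distrC.
Qed.

Lemma tendsP (A : set R) (u : R -> R) (t l : R) :
  u s @[s --> within A (nbhs t)] --> l <-> tends A u t l.
Proof.
rewrite cvgrPdist_le; split=> h e e0.
  by have /within_nearP[r r0 hr] := h e e0; exists r => // s As st; rewrite distrC hr.
have [r r0 hr] := h e e0.
by apply/within_nearP; exists r => // s As st; rewrite distrC hr.
Qed.

Lemma mx_tendsP (A : set R) k l (U : R -> 'M[R]_(k, l)) (t : R) (L : 'M[R]_(k, l)) :
  U s @[s --> within A (nbhs t)] --> L <->
  forall i j, tends A (fun s => U s i j) t (L i j).
Proof.
split=> [h i j|h].
  apply/tendsP; apply: (@cvg_comp _ _ _ U (fun M : 'M[R]_(k, l) => M i j) _ _ _ h).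
  exact: coord_continuous.
apply/cvg_ballP => e e0.
have {}h i : exists r : 'I_l -> R, forall j, 0 < r j /\ forall s, A s -> `|s - t| < r j ->
    `|U s i j - L i j| <= e / 2.
  suff /choice[r hr] : forall j, exists r : R, 0 < r /\ forall s, A s -> `|s - t| < r ->
    `|U s i j - L i j| <= e / 2 by exists r.
  by move=> j; have [r r0 hr] := h i j _ (divr_gt0 e0 (ltr0Sn _ 1)); exists r.
have [r hr] := @choice _ _ (fun i (r : 'I_l -> R) =>
   forall j, 0 < r j /\ forall s, A s -> `|s - t| < r j ->
    `|U s i j - L i j| <= e / 2) h.
apply/within_nearP; exists (\big[Num.min/1]_i \big[Num.min/1]_j r i j).
  apply: lt_bigmin => // i _; apply: lt_bigmin => // j _.
  by case: (hr i j).
move=> s As st; split => // i j; rewrite /ball /= distrC.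
have stj : `|s - t| < r i j.
  rewrite (lt_le_trans st)// (le_trans (bigmin_le_cond _ _ (isT : xpredT i)))//.
  exact: bigmin_le_cond.
apply: le_lt_trans ((hr i j).2 s As stj) _.
by rewrite ltr_pdivrMr// ltr_pMr// ltr1n.
Qed.

Lemma cadlagP {dsp} (Omega : measurableType dsp) (T : R) k l (U : process R Omega k l) :
  cadlag T U <-> forall w i j,
   (forall t, t \in `[0, T[ -> tends (fun s => t < s) (fun s => U w s i j) t (U w t i j)) /\
   (forall t, t \in `]0, T] ->
      exists a, tends (fun s => s < t) (fun s => U w s i j) t a).
Proof.
split=> [h w i j|h w].
  have [h1 h2] := h w; split=> t ht; first by have /mx_tendsP := h1 t ht; exact.
  by have [a /mx_tendsP ha] := h2 t ht; exists (a i j).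
split=> t ht; first by apply/mx_tendsP => i j; exact: (h w i j).1.
have /choice[a ha] : forall i, exists f, forall j, tends (fun s => s < t) (fun s => U w s i j) t (f j).
  move=> i; suff /choice[f hf] : forall j, exists a, tends (fun s => s < t) (fun s => U w s i j) t a by exists f.
  by move=> j; exact: (h w i j).2.
by exists (\matrix_(i, j) a i j); apply/mx_tendsP => i j; rewrite mxE.
Qed.

Lemma within_continuousP (T : R) k l (U : R -> 'M[R]_(k, l)) :
  {within `[0, T], continuous U} <-> forall i j t, t \in `[0, T] ->
    tends `[0, T]%classic (fun s => U s i j) t (U t i j).
Proof.
split=> [/subspace_continuousP h i j t ht|h].
  by have /mx_tendsP := h t ht; exact.
by apply/subspace_continuousP => t ht; apply/mx_tendsP => i j; exact: h.
Qed.

Lemma tends_seq (A : set R) u t l (v : nat -> R) : tends A u t l ->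
  (forall n, A (v n)) -> v n @[n --> \oo] --> t -> u (v n) @[n --> \oo] --> l.
Proof.
move=> h Av vt; apply/cvgrPdist_le => e /h[r r0 hr].
move/cvgrPdist_lt : vt => /(_ r r0); apply: filterS => n hn.
by rewrite distrC; apply: hr => //; rewrite distrC.
Qed.

Lemma tends_cauchy (A : set R) u t : (exists v : nat -> R, (forall n, A (v n)) /\ v n @[n --> \oo] --> t) ->
  (forall e, 0 < e -> exists2 r, 0 < r &
    forall s s', A s -> A s' -> `|s - t| < r -> `|s' - t| < r -> `|u s - u s'| <= e) ->
  exists l, tends A u t l.
Proof.
move=> [v [Av vt]] h.
have cv : cvgn (u \o v).
  apply/cauchy_cvgP/cauchy_exP => e e0 /=.
  have e2 : 0 < e / 2 by rewrite divr_gt0.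
  have [r r0 hr] := h _ e2.
  move/cvgrPdist_lt : vt => /(_ r r0)[N _ hN].
  exists (u (v N)) => /=; exists N => // n /= Nn; rewrite /ball /=.
  rewrite (@le_lt_trans _ _ (e / 2))//; last by rewrite ltr_pdivrMr// ltr_pMr// ltr1n.
  by apply: hr => //; rewrite distrC; apply: hN => //=.
exists (limn (u \o v)) => e /h[r r0 hr]; exists r => // s As st.
have h1 : `|u s - u (v n)| @[n --> \oo] --> `|u s - limn (u \o v)|.
  by apply: cvg_norm; apply: cvgB => //; exact: cvg_cst.
rewrite -(cvg_lim _ h1)//; apply: limr_le; first exact: cvgP h1.
move/cvgrPdist_lt : vt => /(_ r r0); apply: filterS => n hn.
by apply: hr => //; rewrite distrC.
Qed.

End within.

Section grid.
Context {R : realType}.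
Variable T : R.
Hypothesis T0 : 0 < T.

(* [k] is capped, so that [grid j] is defined, nondecreasing and [T]-valued
   from [2 ^ j] on. *)
Definition grid (j k : nat) : R := T * (minn k (2 ^ j))%:R / 2 ^+ j.

Let p2 j : 0 < 2 ^+ j :> R. Proof. by rewrite exprn_gt0. Qed.

Lemma grid0 j : grid j 0 = 0.
Proof. by rewrite /grid min0n mulr0 mul0r. Qed.

Lemma gridT j k : (2 ^ j <= k)%N -> grid j k = T.
Proof.
by move=> h; rewrite /grid (minn_idPr h) natrX mulfK// gt_eqF.
Qed.

Lemma grid_mono j k l : (k <= l)%N -> grid j k <= grid j l.
Proof.
move=> kl; rewrite /grid ler_pM2r ?invr_gt0// ler_pM2l// ler_nat.
by rewrite leq_min geq_minr andbT (leq_trans (geq_minl _ _)).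
Qed.

Lemma grid_itv j k : grid j k \in `[0, T].
Proof.
rewrite in_itv/= -[X in X <= _](grid0 j) grid_mono//=.
by rewrite -(gridT (leq_maxl (2 ^ j) k)) grid_mono// leq_maxr.
Qed.

Lemma grid_ge0 j k : 0 <= grid j k.
Proof. by have := grid_itv j k; rewrite in_itv => /andP[]. Qed.

Lemma grid_leT j k : grid j k <= T.
Proof. by have := grid_itv j k; rewrite in_itv => /andP[]. Qed.

Lemma grid_refine j i k : grid j k = grid (j + i) (k * 2 ^ i).
Proof.
rewrite /grid expnD -minnMl natrM exprD natrX -!mulrA; congr (T * (_ * _)).
by rewrite invfM mulrCA divff ?mulr1// gt_eqF.
Qed.

(** For [0 <= t < T] the first grid point strictly after [t]. Strictness is what makes a limit along
    these points a right limit at [t]. *)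
Definition up j (t : R) := grid j (Num.truncn (t / T * 2 ^+ j)).+1.

Lemma up_bounds j t : 0 <= t -> t < T -> t < up j t <= t + T / 2 ^+ j.
Proof.
move=> t0 tT; have x0 : 0 <= t / T * 2 ^+ j.
  by rewrite mulr_ge0// ?divr_ge0// ltW.
have /andP[h1 h2] := truncn_itv x0; rewrite /up /grid.
have -> : (minn (Num.truncn (t / T * 2 ^+ j)).+1 (2 ^ j) =
          (Num.truncn (t / T * 2 ^+ j)).+1)%N.
  apply/minn_idPl; rewrite -(ltr_nat R) natrX (le_lt_trans h1)//.
  by rewrite gtr_pMl// ltr_pdivrMr// mul1r.
move: (Num.truncn _) h1 h2 => m h1; rewrite -[m.+1%:R]natr1 => h2.
move: m%:R h1 h2 => {}m h1 h2; apply/andP; split.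
  rewrite ltr_pdivlMr// -ltr_pdivrMl// (le_lt_trans _ h2)//.
  by rewrite [X in X <= _]mulrC mulrAC.
rewrite mulrDr mulr1 mulrDl lerD2r ler_pdivrMr// -ler_pdivlMl//.
by rewrite (le_trans h1)// mulrAC mulrC.
Qed.

Lemma up_cvg t : 0 <= t -> t < T -> up j t @[j --> \oo] --> t.
Proof.
move=> t0 tT; apply: (@squeeze_cvgr _ _ _ _ (fun=> t) (fun j => t + T / 2 ^+ j)).
- apply: nearW => j; have /andP[h1 h2] := up_bounds j t0 tT.
  by rewrite (ltW h1).
- exact: cvg_cst.
- rewrite -[X in _ --> X]addr0; apply: cvgD; first exact: cvg_cst.
  rewrite -[X in _ --> X](mulr0 T); apply: cvgMr.
  under eq_fun do rewrite -exprVn.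
  by apply: cvg_expr; rewrite ger0_norm//; lra.
Qed.

Lemma up_itv j t : up j t \in `[0, T]. Proof. exact: grid_itv. Qed.

Definition gsup j (z : R -> R) := runmax (fun k => z (grid j k)) (2 ^ j).

Lemma runmax_le (x : nat -> R) n y :
  (forall k, (k <= n)%N -> `|x k| <= y) -> runmax x n <= y.
Proof.
elim: n => [|n IH] h /=; first exact: h.
by rewrite ge_max h// andbT IH// => k kn; rewrite h// ltnW.
Qed.

Lemma gsup_ge0 j z : 0 <= gsup j z. Proof. exact: runmax_ge0. Qed.

Lemma gsup_ge j z k : `|z (grid j k)| <= gsup j z.
Proof.
case: (leqP k (2 ^ j)) => h; first exact: runmax_ge.
by rewrite (gridT (ltnW h)) -(gridT (leqnn (2 ^ j))); exact: runmax_ge.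
Qed.

Lemma gsup_mono z : nondecreasing_seq (gsup ^~ z).
Proof.
apply/nondecreasing_seqP => j; apply: runmax_le => k _.
by rewrite (grid_refine j 1 k) addn1; exact: gsup_ge.
Qed.

Lemma gsup_le_esup j z : (forall t, 0 <= z t) ->
  ((gsup j z)%:E <= ereal_sup [set (z t)%:E | t in `[0%R, T]%classic])%E.
Proof.
move=> z0; rewrite /gsup; elim: (2 ^ j)%N => [|n IH] /=.
  by rewrite ger0_norm//; apply: ereal_sup_ubound; exists (grid j 0) => //; exact: grid_itv.
rewrite EFin_max ge_max IH/= ger0_norm//.
by apply: ereal_sup_ubound; exists (grid j n.+1) => //; exact: grid_itv.
Qed.

(** By right continuity the value at [t] is the limit of the values at [up T j t], and [T] lies on
    every grid. An uncountable supremum thus becomes a monotone limit of finite maxima, which is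
    measurable in the parameter of the path. *)
Lemma esup_gsup z : (forall t, 0 <= z t) ->
  (forall t, t \in `[0, T[ -> tends (fun s => t < s) z t (z t)) ->
  ereal_sup [set (z t)%:E | t in `[0%R, T]%classic] = limn (fun j => (gsup j z)%:E).
Proof.
move=> z0 hz.
have nd : nondecreasing_seq (fun j => (gsup j z)%:E).
  by move=> i j ij; rewrite lee_fin; exact: gsup_mono.
rewrite (cvg_lim _ (ereal_nondecreasing_cvgn nd))//.
have ub j : ((gsup j z)%:E <= ereal_sup (range (fun j => (gsup j z)%:E)))%E.
  by apply: ereal_sup_ubound; exists j.
apply/eqP; rewrite eq_le; apply/andP; split; last first.
  by apply: ge_ereal_sup => _ [j _ <-]; exact: gsup_le_esup.
apply: ge_ereal_sup => _ [t /= tT <-].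
have [->|tT'] := eqVneq t T.
  apply: le_trans (ub 0%N).
  by rewrite lee_fin -[X in z X <= _](gridT (leqnn (2 ^ 0))) (le_trans (ler_norm _))// gsup_ge.
move: tT; rewrite in_itv/= => /andP[t0 tT].
have tT2 : t < T by rewrite lt_neqAle tT'.
have h : z (up j t) @[j --> \oo] --> z t.
  apply: (tends_seq (hz t _)); first by rewrite in_itv/= t0.
    by move=> j; case/andP: (up_bounds j t0 tT2).
  exact: up_cvg.
have hE : (z (up j t))%:E @[j --> \oo] --> (z t)%:E.
  by apply/fine_cvgP; split => //; exact: nearW.
rewrite -(cvg_lim _ hE)//; apply: lime_le; first exact: cvgP hE.
apply: nearW => j; apply: le_trans (ub j).
by rewrite lee_fin (le_trans (ler_norm _))// gsup_ge.
Qed.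

End grid.

Section regularization.
Context {R : realType}.
Variables (T : R) (z : R -> R).
Hypothesis T0 : 0 < T.

Definition dyadic (q : R) := exists j k, (k <= 2 ^ j)%N /\ grid T j k = q.

(** Between [a] and [b] the count of moves grows by at least [n], on one grid that contains both
    points and on all its refinements. Asking it of every refinement allows two intervals found at
    different levels to be joined at a common level. *)
Definition incr (e : R) (n : nat) (a b : R) := exists j k l,
  [/\ (k <= l <= 2 ^ j)%N, grid T j k = a, grid T j l = b
    & forall i, osc e (fun m => z (grid T (j + i) m)) (k * 2 ^ i) + n%:R <=
                osc e (fun m => z (grid T (j + i) m)) (l * 2 ^ i)].

Lemma grid_inj_le j k l : (k <= 2 ^ j)%N -> grid T j k <= grid T j l -> (k <= l)%N.
Proof.
move=> kj; rewrite /grid ler_pM2r ?invr_gt0 ?exprn_gt0// ler_pM2l// ler_nat.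
by rewrite (minn_idPl kj) leq_min => /andP[].
Qed.

Lemma scale_le j i k : (k <= 2 ^ j)%N -> (k * 2 ^ i <= 2 ^ (j + i))%N.
Proof. by move=> h; rewrite expnD leq_mul2r h orbT. Qed.

Lemma incr_cat e n m a b b' c : incr e n a b -> incr e m b' c -> b <= b' ->
  incr e (n + m) a c.
Proof.
move=> [j [k [l [/andP[kl lj] <- <- h]]]] [j' [k' [l' [/andP[kl' lj'] <- <- h']]]] bb.
have ll : (l * 2 ^ j' <= k' * 2 ^ j)%N.
  apply: (@grid_inj_le (j + j')); first exact: scale_le.
  by rewrite -grid_refine [X in _ <= grid T X _]addnC -grid_refine.
exists (j + j')%N, (k * 2 ^ j')%N, (l' * 2 ^ j)%N; split.
- rewrite [X in (_ <= 2 ^ X)%N]addnC scale_le// andbT.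
  rewrite (leq_trans _ (leq_trans ll _))// leq_mul2r ?kl ?kl' orbT//.
- by rewrite -grid_refine.
- by rewrite addnC -grid_refine.
move=> i; rewrite -!mulnA -!expnD -addnA.
have h1 := h (j' + i)%N; have := h' (j + i)%N.
rewrite (_ : (j' + (j + i) = j + (j' + i))%N); last by rewrite addnCA.
have h2 : (l * 2 ^ (j' + i) <= k' * 2 ^ (j + i))%N.
  by rewrite !expnD !mulnA leq_mul2r ll orbT.
have := osc_mono e (fun m => z (grid T (j + (j' + i)) m)) h2.
rewrite natrD; lra.
Qed.

Lemma incr1 e a b : 0 <= e -> dyadic a -> dyadic b -> a < b ->
  2 * e < `|z b - z a| -> incr e 1 a b.
Proof.
move=> e0 [j [k [kj ka]]] [j' [l [lj lb]]] ab h.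
exists (j + j')%N, (k * 2 ^ j')%N, (l * 2 ^ j)%N.
have ga : grid T (j + j') (k * 2 ^ j') = a by rewrite -grid_refine.
have gb : grid T (j + j') (l * 2 ^ j) = b by rewrite addnC -grid_refine.
have kl : (k * 2 ^ j' < l * 2 ^ j)%N.
  rewrite ltnNge; apply/negP => /(grid_mono T0 (j + j')).
  by rewrite ga gb leNgt ab.
split=> //.
  by rewrite (ltnW kl)/= addnC scale_le.
move=> i; apply: osc_step => //.
  by rewrite ltn_mul2r expn_gt0/=.
by rewrite -(grid_refine T (j + j') i (l * 2 ^ j)) -(grid_refine T (j + j') i (k * 2 ^ j')) ga gb.
Qed.

Lemma incr_osc e n a b : 0 <= e -> incr e n a b ->
  exists j0, forall j, (j0 <= j)%N -> n%:R <= osc e (fun m => z (grid T j m)) (2 ^ j).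
Proof.
move=> e0 [j [k [l [/andP[kl lj] _ _ h]]]]; exists j => j' jj'.
have := h (j' - j)%N; rewrite subnKC//.
have := osc_ge0 e (fun m => z (grid T j' m)) (k * 2 ^ (j' - j)).
have : (l * 2 ^ (j' - j) <= 2 ^ j')%N by rewrite -[X in (_ <= 2 ^ X)%N](subnKC jj') scale_le.
move=> /(osc_mono e (fun m => z (grid T j' m))); lra.
Qed.

(** A lower limit over the levels, because Fatou's lemma will bound its mean; the thresholds are
    countably many, so that one null set serves them all. *)
Definition tame := forall p : nat,
  (limn_einf (fun j => (osc (p.+1%:R^-1) (fun m => z (grid T j m)) (2 ^ j))%:E) < +oo)%E.

(** If for every [n] some interval carried [n] counts, every fine enough grid would count at least
    [n] and the lower limit would be infinite. The threshold is taken with [2 / (p + 1) < e] because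
    [osc_step] detects moves of twice the threshold. *)
Lemma tame_incr (e : R) : tame -> 0 < e -> exists p : nat, 2 * p.+1%:R^-1 < e /\
  exists n, forall a b : R, ~ incr (p.+1%:R^-1) n a b.
Proof.
move=> tz e0.
have [p hp] : exists p : nat, 2 * p.+1%:R^-1 < e.
  exists (Num.truncn (2 / e)); rewrite ltr_pdivrMr ?ltr0n// -ltr_pdivrMl// mulrC.

  have x0 : 0 <= 2 / e by rewrite divr_ge0// ltW.
  by have /andP[] := truncn_itv x0.
exists p; split => //; apply: contrapT => /forallNP H.
have := tz p; rewrite ltNge => /negP; apply.
rewrite leye_eq; apply/eqP; apply: eq_infty => t.
have [a [b ab]] : exists a b, incr (p.+1%:R^-1) (Num.truncn `|t|).+1 a b.
  have := H (Num.truncn `|t|).+1 => /existsNP[a] /existsNP[b] /contrapT ab.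
  by exists a, b.
have [|j0 hj] := incr_osc _ ab; first by rewrite invr_ge0.
have nt : t <= (Num.truncn `|t|).+1%:R.
  rewrite (le_trans (ler_norm _))// ltW//.
  by have /andP[] := truncn_itv (normr_ge0 t).
rewrite limn_einf_lim; apply: lime_ge; first exact: is_cvg_einfs.
exists j0 => //= j /= jj; apply: le_ereal_inf_tmp => _ [i /= ji <-].
by rewrite lee_fin (le_trans nt)// hj// (leq_trans jj).
Qed.

Definition osc_small (a b e : R) := forall q q', dyadic q -> dyadic q' ->
  a < q < b -> a < q' < b -> `|z q - z q'| <= e.

Lemma not_osc_small (a b e : R) : 0 < e -> ~ osc_small a b e -> exists q q',
  [/\ dyadic q, dyadic q', a < q < q', q' < b & e < `|z q' - z q|].
Proof.
move=> e0 /existsNP[q] /existsNP[q'] /not_implyP[dq] /not_implyP[dq'].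
move=> /not_implyP[/andP[aq qb]] /not_implyP[/andP[aq' qb']] /negP; rewrite -ltNge => h.
case: (ltgtP q q') => qq; [|by exists q', q; rewrite aq' qq|].
  by exists q, q'; rewrite aq qq distrC.
by move: h; rewrite qq subrr normr0 ltNge ltW.
Qed.

(** Otherwise pairs of dyadic times with a displacement above [e] occur in every right neighbourhood
    of [t]. Each new pair is chosen between [t] and the earlier ones, so the intervals do not
    overlap and their counts add up beyond any bound. *)
Lemma tame_right t e : tame -> 0 < e -> exists2 r, 0 < r & osc_small t (t + r) e.
Proof.
move=> tz e0; have [p [pe [n hn]]] := tame_incr tz e0.
apply: contrapT => /forall2NP H.
have {}H r : 0 < r -> exists q q', [/\ dyadic q, dyadic q', t < q < q', q' < t + r & e < `|z q' - z q|].
  by move=> r0; apply: not_osc_small => //; case: (H r).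
suff C : forall m r, 0 < r -> exists a b, [/\ t < a, b < t + r & incr (p.+1%:R^-1) m.+1 a b].
  have [a [b [_ _ ab]]] := C n 1 ltr01; apply: (hn a b).
  case: ab => j [k [l [h1 h2 h3 h4]]]; exists j, k, l; split=> // i.
  by apply: le_trans (h4 i); rewrite lerD2l ler_nat.
have i1 q q' : dyadic q -> dyadic q' -> q < q' -> e < `|z q' - z q| -> incr (p.+1%:R^-1) 1 q q'.
  by move=> *; apply: incr1 => //; exact: (lt_trans pe).
elim=> [|m IH] r r0.
  by have [q [q' [dq dq' /andP[aq qq] qb h]]] := H r r0; exists q, q'; split=> //; exact: i1.
have [a [b [ta br ab]]] := IH r r0.
have ar : 0 < a - t by rewrite subr_gt0.
have [q [q' [dq dq' /andP[tq qq] q'a h]]] := H _ ar.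
exists q, b; split=> //; rewrite -addn1 addnC; apply: (incr_cat (i1 _ _ dq dq' qq h) ab).
by rewrite ltW// (lt_le_trans q'a)// subrKC.
Qed.

Lemma tame_left t e : tame -> 0 < e -> exists2 r, 0 < r & osc_small (t - r) t e.
Proof.
move=> tz e0; have [p [pe [n hn]]] := tame_incr tz e0.
apply: contrapT => /forall2NP H.
have {}H r : 0 < r -> exists q q', [/\ dyadic q, dyadic q', t - r < q < q', q' < t & e < `|z q' - z q|].
  by move=> r0; apply: not_osc_small => //; case: (H r).
suff C : forall m r, 0 < r -> exists a b, [/\ t - r < a, b < t & incr (p.+1%:R^-1) m.+1 a b].
  have [a [b [_ _ ab]]] := C n 1 ltr01; apply: (hn a b).
  case: ab => j [k [l [h1 h2 h3 h4]]]; exists j, k, l; split=> // i.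
  by apply: le_trans (h4 i); rewrite lerD2l ler_nat.
have i1 q q' : dyadic q -> dyadic q' -> q < q' -> e < `|z q' - z q| -> incr (p.+1%:R^-1) 1 q q'.
  by move=> *; apply: incr1 => //; exact: (lt_trans pe).
elim=> [|m IH] r r0.
  by have [q [q' [dq dq' /andP[aq qq] qb h]]] := H r r0; exists q, q'; split=> //; exact: i1.
have [a [b [ta br ab]]] := IH r r0.
have ar : 0 < t - b by rewrite subr_gt0.
have [q [q' [dq dq' /andP[tq qq] q'a h]]] := H _ ar.
exists a, q'; split=> //; rewrite -[m.+2]addn1; apply: (incr_cat ab (i1 _ _ dq dq' qq h)).
by rewrite ltW// (le_lt_trans _ tq)// opprB subrKC.
Qed.

(** The right limit along dyadic times; at [T], where nothing lies to the right, the original value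
    is kept. *)
Definition regular (t : R) : R := if t < T then limn (fun j => z (up T j t)) else z T.

Hypothesis tz : tame.

Lemma dyadic_up j t : 0 <= t -> dyadic (up T j t).
Proof.
move=> t0; rewrite /up; set k := (_.+1); case: (leqP k (2 ^ j)) => h.
  by exists j, k.
by exists j, (2 ^ j)%N; split => //; rewrite !gridT// ltnW.
Qed.

Lemma regular_cvg t : 0 <= t -> t < T -> z (up T j t) @[j --> \oo] --> regular t.
Proof.
move=> t0 tT; rewrite /regular tT.
suff : cvgn (fun j => z (up T j t)) by [].
apply/cauchy_cvgP/cauchy_exP => e e0 /=.
have e2 : 0 < e / 2 by rewrite divr_gt0.
have [r r0 hr] := tame_right t tz e2.
have := up_cvg T0 t0 tT => /cvgrPdist_lt/(_ r r0)[N _ hN].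
have w n : (N <= n)%N -> t < up T n t < t + r.
  move=> Nn; have := hN n Nn; rewrite ltr_norml => /andP[h1 h2].
  by have /andP[-> _] := up_bounds T0 n t0 tT; rewrite /=; lra.
exists (z (up T N t)), N => // n /= Nn; rewrite /ball /=.
apply: (@le_lt_trans _ _ (e / 2)); last by rewrite ltr_pdivrMr// ltr_pMr// ltr1n.
by apply: hr; [exact: dyadic_up|exact: dyadic_up|exact: w|exact: w].
Qed.

(** The oscillation bound passes to the limit along [up T j t]. The point [t] may coincide with [a],
    because the dyadic times used there lie strictly after it. *)
Lemma regular_close t a b e q : 0 <= t -> t < T -> a <= t -> t < b ->
  osc_small a b e -> dyadic q -> a < q < b -> `|regular t - z q| <= e.
Proof.
move=> t0 tT at_ tb h dq hq.
have hc : `|z (up T j t) - z q| @[j --> \oo] --> `|regular t - z q|.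
  by apply: cvg_norm; apply: cvgB; [exact: regular_cvg|exact: cvg_cst].
rewrite -(cvg_lim _ hc)//; apply: limr_le; first exact: cvgP hc.
have bt : 0 < b - t by rewrite subr_gt0.
have := up_cvg T0 t0 tT => /cvgrPdist_lt/(_ _ bt); apply: filterS => n.
rewrite ltr_norml => /andP[h1 h2]; apply: h => //; first exact: dyadic_up.
have /andP[h3 _] := up_bounds T0 n t0 tT.
by rewrite (le_lt_trans at_ h3)/=; lra.
Qed.

Lemma dyadic_between a b : 0 <= a -> a < b -> b <= T -> exists2 q, dyadic q & a < q < b.
Proof.
move=> a0 ab bT; have aT := lt_le_trans ab bT.
have ba : 0 < b - a by rewrite subr_gt0.
have := up_cvg T0 a0 aT => /cvgrPdist_lt/(_ _ ba)[N _ /(_ N (leqnn N))].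
rewrite ltr_norml => /andP[h1 h2]; exists (up T N a); first exact: dyadic_up.
by have /andP[-> _] := up_bounds T0 N a0 aT; rewrite /=; lra.
Qed.

Lemma regular_right t : t \in `[0, T[ -> tends (fun s => t < s) regular t (regular t).
Proof.
rewrite in_itv/= => /andP[t0 tT] e e0.
have e2 : 0 < e / 2 by rewrite divr_gt0.
have [r r0 hr] := tame_right t tz e2.
exists (Num.min r (T - t)); first by rewrite lt_min r0 subr_gt0.
move=> s ts; rewrite lt_min gtr0_norm ?subr_gt0// => /andP[sr sT].
have sr' : t + r - s > 0 by lra.
have [|||q dq /andP[sq qT]] := @dyadic_between t (Num.min (t + r) T) => //.
- by rewrite lt_min tT ltrDl r0.
- by rewrite ge_min lexx orbT.
move: qT; rewrite lt_min => /andP[qr qT].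
have h1 := @regular_close t t (t + r) _ q t0 tT (lexx _) _ hr dq _.
have h2 := @regular_close s t (t + r) _ q _ _ (ltW ts) _ hr dq _.
have := ler_distD (z q) (regular s) (regular t).
have := h1 ltac:(lra) ltac:(apply/andP; split; lra).
have := h2 ltac:(lra) ltac:(lra) ltac:(lra) ltac:(apply/andP; split; lra).
rewrite [`|regular t - _|]distrC; lra.
Qed.

Lemma regular_left t : t \in `]0, T] -> exists a, tends (fun s => s < t) regular t a.
Proof.
rewrite in_itv/= => /andP[t0 tT]; apply: tends_cauchy.
  exists (fun n => t - n.+1%:R^-1); split.
    by move=> n; rewrite ltrBlDr ltrDl invr_gt0.
  rewrite -[X in _ --> X]subr0; apply: cvgB; first exact: cvg_cst.
  exact: cvg_harmonic.
move=> e e0; have e2 : 0 < e / 2 by rewrite divr_gt0.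
have [r r0 hr] := tame_left t tz e2.
exists (Num.min r t); first by rewrite lt_min r0.
have [|||q dq /andP[sq qT]] := @dyadic_between (Num.max (t - r) 0) t => //.
- by rewrite le_max lexx orbT.
- by rewrite gt_max t0 ltrBlDr ltrDl r0.
move: sq; rewrite gt_max => /andP[sq q0].
have H s : s < t -> `|s - t| < Num.min r t -> `|regular s - z q| <= e / 2.
  move=> st; rewrite lt_min ltr0_norm ?subr_lt0// opprB => /andP[h1 h2].
  apply: (@regular_close s (t - r) t _ q) => //; [lra|lra|lra|].
  by rewrite sq qT.
move=> s s' st st' h h'; have := ler_distD (z q) (regular s) (regular s').
have := H s st h; have := H s' st' h'.
rewrite [`|regular s' - _|]distrC; lra.
Qed.

End regularization.

(** * Cadlag versions of martingales *)

Section filtration.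
Context {R : realType} {dsp} {Omega : measurableType dsp}
  (P : probability Omega R) (T : R) (F : R -> set (set Omega)).
Hypothesis T0 : 0 < T.
Hypothesis hP : measure_is_complete P.
Hypothesis hF : usual_filtration P T F.

Lemma itv0T : 0 \in `[0, T].
Proof. by rewrite in_itv/= lexx ltW. Qed.

Lemma itvTT : T \in `[0, T].
Proof. by rewrite in_itv/= lexx ltW. Qed.

Lemma filt_sigma t : t \in `[0, T] -> sigma_algebra setT (F t).
Proof. by case: hF => h _ _ _ _; exact: h. Qed.

Lemma filt_sub t : t \in `[0, T] -> F t `<=` measurable.
Proof. by case: hF => _ h _ _ _; exact: h. Qed.

Lemma filt_mono s t : 0 <= s -> s <= t -> t <= T -> F s `<=` F t.
Proof. by case: hF => _ _ h _ _; exact: h. Qed.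

Lemma filt_negl t N : t \in `[0, T] -> P.-negligible N -> F t N.
Proof.
rewrite in_itv => /andP[t0 tT] hN; apply: (filt_mono (lexx 0) t0 tT).
by case: hF => _ _ _ _ h; exact: h.
Qed.

Lemma gmeas_mono s t (f : Omega -> R) : 0 <= s -> s <= t -> t <= T ->
  gmeas (F s) f -> gmeas (F t) f.
Proof.
move=> s0 st tT /gmeasP h; apply/gmeasP.
  by apply: filt_sigma; rewrite in_itv/= tT (le_trans s0).
by move=> B mB; apply: (filt_mono s0 st tT); apply: h => //; apply: filt_sigma;
   rewrite in_itv/= s0 (le_trans st).
Qed.

Lemma gmeas_right t (f : Omega -> R) : 0 <= t -> t < T ->
  (forall s, t < s -> s <= T -> gmeas (F s) f) -> gmeas (F t) f.
Proof.
move=> t0 tT h; apply/gmeasP; first by apply: filt_sigma; rewrite in_itv/= t0 ltW.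
move=> B mB; case: hF => _ _ _ hr _; apply: (hr t); first by rewrite in_itv/= t0.
move=> s /=; rewrite in_itv/= => /andP[ts sT].
apply: (gmeasP _ _).1; [|exact: h|exact: mB].
by apply: filt_sigma; rewrite in_itv/= sT (le_trans t0)// ltW.
Qed.

(** The two preimages differ only inside the exceptional set, all of whose subsets are negligible
    and hence in [F t]. Paths can therefore be modified on null sets without losing adaptedness. *)
Lemma gmeas_ae t (f g : Omega -> R) : t \in `[0, T] -> gmeas (F t) f ->
  {ae P, forall w, f w = g w} -> gmeas (F t) g.
Proof.
move=> tT /gmeasP h fg; have sF := filt_sigma tT; apply/gmeasP => // B mB.
pose N := ~` [set w | f w = g w].
have -> : g @^-1` B = (f @^-1` B `\` N) `|` (g @^-1` B `&` N).
  apply/seteqP; split=> w /=.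
    move=> gB; have [e|e] := pselect (f w = g w); [left|right]; split => //.
    by rewrite e.
  by case=> [[fB /contrapT <-//]|[]].
have nN : P.-negligible N by exact: fg.
have mm (A : set Omega) : F t A = measurable (A : set (g_sigma_algebraType (F t))).
  by rewrite -[RHS]/(<<s F t >> A) (sigma_algebra_id sF).
rewrite mm; apply: measurableU.
  by apply: measurableD; rewrite -mm; [exact: h|exact: filt_negl].
by rewrite -mm; apply: filt_negl => //; apply: negligibleS nN; exact: subIsetr.
Qed.

Lemma rv_measurableP t k l (X : Omega -> 'M[R]_(k, l)) : t \in `[0, T] ->
  rv_measurable (F t) X <-> forall i j, gmeas (F t) (fun w => X w i j).
Proof.
move=> tT; split=> h i j; first by apply/gmeasP; [exact: filt_sigma|exact: h].
by apply: (gmeasP _ _).1; [exact: filt_sigma|exact: h].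
Qed.

Definition cexp (xi : Omega -> R) (Z : R -> Omega -> R) :=
  forall t, t \in `[0, T] -> [/\ gmeas (F t) (Z t), L2 P (Z t)
    & forall A, F t A -> \int[P]_w (\1_A w * (xi w - Z t w)) = 0].

(** The martingale property is stated against square integrable factors known at time [s] instead of
    events, because isometries and energy estimates multiply increments by such factors. *)
Definition mart (Z : R -> Omega -> R) := [/\
  forall t, t \in `[0, T] -> gmeas (F t) (Z t),
  forall t, t \in `[0, T] -> L2 P (Z t)
  & forall s t h, 0 <= s -> s <= t -> t <= T -> gmeas (F s) h -> L2 P h ->
     \int[P]_w (h w * (Z t w - Z s w)) = 0].

Lemma cexp_exists xi : L2 P xi -> exists Z, cexp xi Z.
Proof.
move=> Lxi; have /choice[Z hZ] : forall t, exists z, t \in `[0, T] -> [/\ gmeas (F t) z, L2 P z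
    & forall A, F t A -> \int[P]_w (\1_A w * (xi w - z w)) = 0].
  move=> t; have [tT|tT] := pselect (t \in `[0, T]); last by exists (fun=> 0).
  by have [z [Gz Lz] h] := projection_exists (filt_sub tT) Lxi; exists z.
by exists Z.
Qed.

Lemma cexp_orth xi Z t h : L2 P xi -> cexp xi Z -> t \in `[0, T] ->
  gmeas (F t) h -> L2 P h -> \int[P]_w (h w * (xi w - Z t w)) = 0.
Proof.
move=> Lxi hZ tT Gh Lh; have [GZ LZ hA] := hZ t tT.
apply: (int_mul_eq0 (filt_sigma tT) (filt_sub tT)) => //.
- by apply: L2_int1; exact: L2B.
- by apply: L2M => //; exact: L2B.
Qed.

Lemma cexp_mart xi Z : L2 P xi -> cexp xi Z -> mart Z.
Proof.
move=> Lxi hZ; split.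
- by move=> t /hZ[].
- by move=> t /hZ[].
move=> s t h s0 st tT Gh Lh.
have sI : s \in `[0, T] by rewrite in_itv/= s0 (le_trans st).
have tI : t \in `[0, T] by rewrite in_itv/= tT (le_trans s0).
have [_ Ls _] := hZ s sI; have [_ Lt _] := hZ t tI.
have := cexp_orth Lxi hZ sI Gh Lh.
have := cexp_orth Lxi hZ tI (gmeas_mono s0 st tT Gh) Lh.
have -> : \int[P]_w (h w * (Z t w - Z s w)) =
   \int[P]_w (h w * (xi w - Z s w)) - \int[P]_w (h w * (xi w - Z t w)).
  rewrite -RintegralB//; [|by apply: L2M => //; exact: L2B..].
  by apply: eq_Rintegral => w _; lra.
by move=> -> ->; rewrite subrr.
Qed.

Lemma mart_grid Z j : mart Z ->
  [/\ forall k n, (k <= n)%N -> gmeas (F (grid T j n)) (Z (grid T j k)),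
      forall n, L2 P (Z (grid T j n))
   & forall n h, gmeas (F (grid T j n)) h -> L2 P h ->
      \int[P]_w (h w * (Z (grid T j n.+1) w - Z (grid T j n) w)) = 0].
Proof.
move=> [GZ LZ oZ]; split.
- move=> k n kn; apply: (gmeas_mono (grid_ge0 T0 j k) (grid_mono T0 j kn) (grid_leT T0 j n)).
  by apply: GZ; exact: grid_itv.
- by move=> n; apply: LZ; exact: grid_itv.
- move=> n h Gh Lh; apply: oZ => //; [exact: grid_ge0|exact: grid_mono|exact: grid_leT].
Qed.

Lemma mart_runmax_measurable Z j : mart Z ->
  measurable_fun setT (fun w => gsup T j (fun t => Z t w)).
Proof.
move=> /(mart_grid j)[GM LM _].
have := gmeas_runmax GM (leqnn (2 ^ j)) => /(gmeas_sub (filt_sub (grid_itv T0 _ _))).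
exact.
Qed.

Lemma doob_grid Z : mart Z ->
  (\int[P]_w limn (fun j => ((gsup T j (fun t => Z t w)) ^+ 2)%:E) <=
    (4 * \int[P]_w (Z T w ^+ 2))%:E)%E.
Proof.
move=> mZ; have mg j := mart_runmax_measurable j mZ.
rewrite monotone_convergence//; first last.
- move=> w _ i j ij; rewrite lee_fin ler_sqr ?nnegrE ?gsup_ge0//.
  exact: gsup_mono.
- by move=> j w _; rewrite lee_fin sqr_ge0.
- by move=> j; exact: measurable_sqE.
apply: lime_le.
  apply: ereal_nondecreasing_is_cvgn => i j ij; apply: ge0_le_integral => //.
  - by move=> w _; rewrite lee_fin sqr_ge0.
  - exact: measurable_sqE.
  - exact: measurable_sqE.
  - move=> w _; rewrite lee_fin ler_sqr ?nnegrE ?gsup_ge0//; exact: gsup_mono.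
apply: nearW => j; have [GM LM oM] := mart_grid j mZ.
have sF n : F (grid T j n) `<=` measurable by apply: filt_sub; exact: grid_itv.
have L := L2_runmax LM (2 ^ j).
rewrite [leLHS](nn2E L) lee_fin.
by have := doob_discrete sF GM LM oM (2 ^ j); rewrite gridT.
Qed.

(** [osc_bound] bounds the mean count by [E Z_T^2 / e^2] uniformly in the level of the grid; by
    Fatou's lemma the lower limit is integrable, hence finite almost surely. *)
Lemma mart_tame Z : mart Z -> {ae P, forall w, tame T (fun t => Z t w)}.
Proof.
move=> mZ; apply: ae_foralln => p.
set e := p.+1%:R^-1; have e0 : 0 < e :> R by rewrite invr_gt0.
pose u j w : \bar R := (osc e (fun m => Z (grid T j m) w) (2 ^ j))%:E.
have mu j : measurable_fun setT (u j).
  have [GM LM oM] := mart_grid j mZ; apply/measurable_EFinP.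
  have := gmeas_osc GM e (leqnn (2 ^ j)) => /(gmeas_sub (filt_sub (grid_itv T0 _ _))).
  exact.
have u0 j w : (0 <= u j w)%E by rewrite lee_fin osc_ge0.
have ml : measurable_fun setT (fun w => limn_einf (u ^~ w)).
  rewrite /limn_einf; apply: measurableT_comp => //.
  by apply: measurable_fun_limn_esup => j; exact: measurableT_comp.
have l0 w : (0 <= limn_einf (u ^~ w))%E.
  rewrite limn_einf_lim; apply: lime_ge; first exact: is_cvg_einfs.
  by apply: nearW => j; apply: le_ereal_inf_tmp => _ [i _ <-].
suff il : P.-integrable setT (fun w => limn_einf (u ^~ w)).
  have := integrable_ae measurableT il; apply: filterS => w /(_ I) h.
  by move: h; rewrite (ge0_fin_numE (l0 w)).
apply/integrableP; split => //.
under eq_integral do rewrite gee0_abs//.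
apply: le_lt_trans (fatou P measurableT mu _) _ => //.
pose B : R := (e ^+ 2)^-1 * \int[P]_w (Z T w ^+ 2).
apply: (@le_lt_trans _ _ B%:E); last exact: ltry.
rewrite limn_einf_lim; apply: lime_le; first exact: is_cvg_einfs.
apply: nearW => j; apply: (@le_trans _ _ (\int[P]_w u j w)%E).
  by apply: ereal_inf_lbound; exists j => /=.
have [GM LM oM] := mart_grid j mZ.
have sF n : F (grid T j n) `<=` measurable by apply: filt_sub; exact: grid_itv.
have := osc_bound sF GM LM oM (2 ^ j) (ltW e0); rewrite gridT// => h.
have Io : int1 P (fun w => osc e (fun m => Z (grid T j m) w) (2 ^ j)).
  apply: (int1_le _ (int1_cst P (2 ^ j)%:R)) => [|w]; first exact/measurable_EFinP/mu.
  by case/andP: (osc_le e (fun m => Z (grid T j m) w) (2 ^ j)) => h1 h2; rewrite ger0_norm.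
rewrite -[leLHS]fineK ?lee_fin; last exact: (integrable_fin_num measurableT Io).
by rewrite /B ler_pdivlMl ?exprn_gt0.
Qed.

(** The variables [Z t] are chosen time by time, with no link between them along a path; tameness of
    the dyadic skeleton allows them to be replaced by right limits. Exceptional paths are set to 0,
    so that every path is cadlag, and right continuity of the filtration keeps the value at [t]
    measurable at [t]. *)
Lemma cadlag_version xi : L2 P xi -> exists M : Omega -> R -> R,
  cexp xi (fun t w => M w t) /\
  forall w, (forall t, t \in `[0, T[ -> tends (fun s => t < s) (M w) t (M w t)) /\
    (forall t, t \in `]0, T] -> exists a, tends (fun s => s < t) (M w) t a).
Proof.
move=> Lxi; have [Z hZ] := cexp_exists Lxi; have mZ := cexp_mart Lxi hZ.
have hT := mart_tame mZ.
pose good w := tame T (fun t => Z t w).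
pose M w t := if `[< good w >] then regular T (fun t => Z t w) t else 0.
have [GZ LZ oZ] := mZ.
exists M; split; last first.
  move=> w; rewrite /M; case: asboolP => gw; split=> t ht.
  - exact: regular_right.
  - exact: regular_left.
  - by move=> e e0; exists 1 => // s _ _; rewrite subrr normr0 ltW.
  - by exists 0 => e e0; exists 1 => // s _ _; rewrite subrr normr0 ltW.
move=> t; rewrite in_itv/= => /andP[t0].
rewrite le_eqVlt => /predU1P[->|tT].
  have e : {ae P, forall w, Z T w = M w T}.
    apply: filterS hT => w gw; rewrite /M; case: asboolP => // _.
    by rewrite /regular ltxx.
  have [G1 L1 h1] := hZ T itvTT.
  have G2 := gmeas_ae itvTT G1 e.
  have m2 := gmeas_sub (filt_sub itvTT) G2.
  split => //.
    by split => //; rewrite -(ae_eq_nn2 (L1.1) m2 e); exact: L1.2.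
  move=> A FA; rewrite -(h1 A FA); have mA := filt_sub itvTT FA.
  apply: ae_eq_Rintegral; last by apply: filterS e => w ->.
  - apply: measurable_funM; first exact: measurable_indic.
    by apply: measurable_funB => //; exact: Lxi.1.
  - apply: measurable_funM; first exact: measurable_indic.
    by apply: measurable_funB; [exact: Lxi.1|exact: L1.1].
have tI : t \in `[0, T] by rewrite in_itv/= t0 ltW.
have cv : {ae P, forall w, Z (up T j t) w @[j --> \oo] --> M w t}.
  apply: filterS hT => w gw; rewrite /M; case: asboolP => // _.
  exact: (regular_cvg T0 gw).
have GL : gmeas (F t) (M ^~ t).
  apply: gmeas_right => // s ts sT.
  have st : 0 < s - t by rewrite subr_gt0.
  have sI : s \in `[0, T] by rewrite in_itv/= sT (le_trans t0)// ltW.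
  have [N _ hN] : \forall n \near \oo, up T n t < s.
    have := up_cvg T0 t0 tT => /cvgrPdist_lt/(_ _ st); apply: filterS => n.
    by rewrite ltr_norml => /andP[h1 h2]; lra.
  (* The first [N] levels are dropped: from there on the grid point precedes [s], so the variable
     taken at it is [F s]-measurable. *)
  apply: (@gmeas_ae s (fun w => fine (limn_esup (fun j => (Z (up T (j + N) t) w)%:E)))) => //.
    apply: gmeas_limsup => j.
    apply: (@gmeas_mono (up T (j + N) t)) => //; first exact: grid_ge0.
      by apply/ltW/hN => /=; exact: leq_addl.
    by apply: GZ; exact: grid_itv.
  apply: filterS cv => w cw.
  have hE : (Z (up T (j + N) t) w)%:E @[j --> \oo] --> (M w t)%:E.
    apply/fine_cvgP; split; first exact: nearW.
    by move: cw; rewrite -(cvg_shiftn N).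
  by rewrite (cvg_limn_einf_sup hE).2.
have mM := gmeas_sub (filt_sub tI) GL.
(* The supremum of [Z^2] over the dyadic times, integrable by Doob's inequality. It dominates both
   the second moment at [t] and the integrals over events in the passage to the limit. *)
pose Q w : \bar R := limn (fun j => ((gsup T j (fun t => Z t w)) ^+ 2)%:E).
have ndQ w : nondecreasing_seq (fun j => ((gsup T j (fun t => Z t w)) ^+ 2)%:E).
  by move=> i j ij; rewrite lee_fin ler_sqr ?nnegrE ?gsup_ge0//; exact: gsup_mono.
have ubQ w j : (((gsup T j (fun t => Z t w)) ^+ 2)%:E <= Q w)%E.
  rewrite /Q (cvg_lim _ (ereal_nondecreasing_cvgn (ndQ w)))//.
  by apply: ereal_sup_ubound; exists j.
have mQ : measurable_fun setT Q.
  apply: (emeasurable_fun_cvg (fun j w => ((gsup T j (fun t => Z t w)) ^+ 2)%:E)).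
    by move=> j; apply: measurable_sqE; exact: mart_runmax_measurable.
  by move=> w _; apply: ereal_nondecreasing_is_cvgn.
have Q0 w : (0 <= Q w)%E by apply: le_trans (ubQ w 0%N); rewrite lee_fin sqr_ge0.
have iQ : (\int[P]_w Q w < +oo)%E by apply: le_lt_trans (doob_grid mZ) _; rewrite ltry.
have zQ w j : ((Z (up T j t) w ^+ 2)%:E <= Q w)%E.
  apply: le_trans (ubQ w j); rewrite lee_fin -(real_normK (num_real (Z _ w))).
  by rewrite ler_sqr ?nnegrE ?gsup_ge0//; exact: gsup_ge.
have IQ : P.-integrable setT Q.
  by apply/integrableP; split => //; under eq_integral do rewrite gee0_abs//.
have LM : L2 P (M ^~ t).
  split => //; apply: le_lt_trans iQ; apply: ae_ge0_le_integral => //.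
  - by move=> w _; rewrite lee_fin sqr_ge0.
  - exact: measurable_sqE.
  apply: filterS cv => w cw _.
  have hE : (Z (up T j t) w ^+ 2)%:E @[j --> \oo] --> (M w t ^+ 2)%:E.
    apply/fine_cvgP; split; first exact: nearW.
    by rewrite expr2; apply: cvgM.
  by rewrite -(cvg_lim _ hE)//; apply: lime_le; [exact: cvgP hE|exact: nearW].
split=> // A FA; have mA := filt_sub tI FA.
have z0 j : \int[P]_w (\1_A w * (xi w - Z (up T j t) w)) = 0.
  have [_ _] := hZ _ (up_itv T0 j t); apply.
  apply: filt_mono FA => //; last exact: grid_leT.
  by apply/ltW; case/andP: (up_bounds T0 j t0 tT).
have mxi := Lxi.1.
have mZ' j : measurable_fun setT (Z (up T j t)) by case: (LZ _ (up_itv T0 j t)).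
have mI : measurable_fun setT (\1_A : Omega -> R) by exact: measurable_indic.
have [|||||_ _] := @dominated_convergence _ _ _ P setT measurableT
  (fun j w => (\1_A w * (xi w - Z (up T j t) w))%:E) (fun w => (\1_A w * (xi w - M w t))%:E)
  (fun w => `|xi w|%:E + (1%:E + Q w))%E.
- by move=> j; apply/measurable_EFinP; apply: measurable_funM => //; exact: measurable_funB.
- by apply/measurable_EFinP; apply: measurable_funM => //; exact: measurable_funB.
- apply: filterS cv => w cw _; apply/fine_cvgP; split; first exact: nearW.
  by apply: cvgMr; apply: cvgB => //; exact: cvg_cst.
- apply: integrableD => //; first exact: (integrable_norm (L2_int1 Lxi)).
  by apply: integrableD => //; exact: int1_cst.
- apply: nearW => w j _ /=.
  apply: (@le_trans _ _ (`|xi w| + `|Z (up T j t) w|)%:E).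
    rewrite lee_fin normrM; apply: (@le_trans _ _ (1 * `|xi w - Z (up T j t) w|)).
      by rewrite ler_wpM2r// indicE; case: (_ \in _); rewrite ?normr1 ?normr0.
    by rewrite mul1r ler_normB.
  rewrite EFinD leeD2l//; apply: (@le_trans _ _ (1%:E + (Z (up T j t) w ^+ 2)%:E)%E).
    rewrite lee_fin -(real_normK (num_real (Z _ w))).
    by have := sqr_ge0 (`|Z (up T j t) w| - 1); have := normr_ge0 (Z (up T j t) w); nra.
  by rewrite leeD2l.
rewrite (_ : [sequence _]_n = cst 0%E); last first.
  apply/funext => j /=; rewrite -[LHS]fineK; first by have := z0 j; rewrite /Rintegral => ->.
  apply: integrable_fin_num => //; apply: (@L2M _ _ _ P (\1_A)); first exact: L2_indic.
  by apply: L2B => //; apply: LZ; exact: grid_itv.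
by move=> hc; rewrite /Rintegral -(cvg_lim _ hc)// lim_cst.
Qed.

End filtration.

(** * Norms on matrices and processes *)

Section hsnorm.
Context {R : realType} {k l : nat}.
Implicit Types A B : 'M[R]_(k, l).

Definition mdot A B : R := \sum_i \sum_j A i j * B i j.

Lemma mdotDl A B C : mdot (A + B) C = mdot A C + mdot B C.
Proof.
rewrite /mdot -big_split/=; apply: eq_bigr => i _; rewrite -big_split/=.
by apply: eq_bigr => j _; rewrite !mxE mulrDl.
Qed.

Lemma mdotC A B : mdot A B = mdot B A.
Proof. by apply: eq_bigr => i _; apply: eq_bigr => j _; rewrite mulrC. Qed.

Lemma hsnorm_ge0 A : 0 <= hsnorm A.
Proof. exact: sqrtr_ge0. Qed.

Lemma hsnorm_mdot A : hsnorm A ^+ 2 = mdot A A.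
Proof.
rewrite /hsnorm sqr_sqrtr; first by do 2 (apply: eq_bigr => ? _); rewrite expr2.
by do 2 (apply: sumr_ge0 => ? _); exact: sqr_ge0.
Qed.

Lemma hsnorm_sqr A : hsnorm A ^+ 2 = \sum_i \sum_j A i j ^+ 2.
Proof. by rewrite hsnorm_mdot; do 2 (apply: eq_bigr => ? _); rewrite expr2. Qed.

Lemma mdot_young (e : R) A B : 0 < e ->
  2 * mdot A B <= e * hsnorm A ^+ 2 + e^-1 * hsnorm B ^+ 2.
Proof.
move=> e0; rewrite !hsnorm_mdot /mdot !mulr_sumr -big_split/=.
apply: ler_sum => i _; rewrite !mulr_sumr -big_split/=; apply: ler_sum => j _.
have h : e * e^-1 = 1 by rewrite divff// gt_eqF.
have := sqr_ge0 (e * A i j - B i j); have : 0 < e^-1 by rewrite invr_gt0.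
move: (A i j) (B i j) (e^-1) h => a b f h f0 h2.
have : 0 <= f * (e * a - b) ^+ 2 by rewrite mulr_ge0// ltW.
have -> : f * (e * a - b) ^+ 2 = e * (a * a) * (e * f) - 2 * (a * b) * (e * f) + f * (b * b).
  by ring.
by rewrite h; lra.
Qed.

Lemma hsnorm_eq0 A : hsnorm A = 0 -> A = 0.
Proof.
move=> h; apply/matrixP => i j; rewrite mxE; apply/eqP; rewrite -sqrf_eq0.
have : hsnorm A ^+ 2 = 0 by rewrite h expr0n.
rewrite hsnorm_sqr => /eqP; rewrite psumr_eq0; last first.
  by move=> *; apply: sumr_ge0 => *; exact: sqr_ge0.
move=> /allP/(_ i (mem_index_enum i))/implyP/(_ isT); rewrite psumr_eq0; last first.
  by move=> *; exact: sqr_ge0.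
by move=> /allP/(_ j (mem_index_enum j))/implyP/(_ isT).
Qed.

Lemma mdot0l B : mdot 0 B = 0.
Proof. by rewrite /mdot big1// => i _; rewrite big1// => j _; rewrite mxE mul0r. Qed.

(** Young's inequality with the optimal weight [|B| / |A|]; a vanishing factor is treated apart. *)
Lemma mdot_le A B : mdot A B <= hsnorm A * hsnorm B.
Proof.
have [/hsnorm_eq0 ->|A0] := eqVneq (hsnorm A) 0.
  by rewrite mdot0l mulr_ge0// hsnorm_ge0.
have [/hsnorm_eq0 ->|B0] := eqVneq (hsnorm B) 0.
  by rewrite mdotC mdot0l mulr_ge0// hsnorm_ge0.
have a0 : 0 < hsnorm A by rewrite lt_neqAle eq_sym A0 hsnorm_ge0.
have b0 : 0 < hsnorm B by rewrite lt_neqAle eq_sym B0 hsnorm_ge0.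
have := mdot_young A B (divr_gt0 b0 a0).
rewrite (_ : hsnorm B / hsnorm A * hsnorm A ^+ 2 = hsnorm A * hsnorm B); last by field.
rewrite (_ : (hsnorm B / hsnorm A)^-1 * _ = hsnorm A * hsnorm B); first by lra.
by field; rewrite A0.
Qed.

Lemma hsnormD A B : hsnorm (A + B) <= hsnorm A + hsnorm B.
Proof.
rewrite -ler_sqr ?nnegrE ?addr_ge0 ?hsnorm_ge0// sqrrD !hsnorm_mdot.
rewrite mdotDl [mdot A (A + B)]mdotC [mdot B (A + B)]mdotC !mdotDl [mdot B A]mdotC.
by have := mdot_le A B; lra.
Qed.

Lemma hsnormN A : hsnorm (- A) = hsnorm A.
Proof.
by rewrite /hsnorm; congr Num.sqrt; do 2 (apply: eq_bigr => ? _); rewrite mxE sqrrN.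
Qed.

Lemma hsnormB A B : hsnorm (A - B) <= hsnorm A + hsnorm B.
Proof. by rewrite -(hsnormN B); exact: hsnormD. Qed.

Lemma hsnorm0 : hsnorm (0 : 'M[R]_(k, l)) = 0.
Proof. by apply/eqP; rewrite -sqrf_eq0 hsnorm_mdot mdot0l. Qed.

Lemma hsnorm_sqrD A B : hsnorm (A + B) ^+ 2 <= 2 * hsnorm A ^+ 2 + 2 * hsnorm B ^+ 2.
Proof.
have := hsnormD A B; have := hsnorm_ge0 (A + B); have := hsnorm_ge0 A; have := hsnorm_ge0 B.
by have := sqr_ge0 (hsnorm A - hsnorm B); nra.
Qed.

Lemma entry_le A i j : `|A i j| <= hsnorm A.
Proof.
rewrite -ler_sqr ?nnegrE ?hsnorm_ge0// real_normK ?num_real// hsnorm_sqr.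
rewrite (bigD1 i)//= (bigD1 j)//= -addrA lerDl addr_ge0//.
  by apply: sumr_ge0 => *; exact: sqr_ge0.
by do 2 (apply: sumr_ge0 => ? _); exact: sqr_ge0.
Qed.

Lemma entry_sqr_le A i j : A i j ^+ 2 <= hsnorm A ^+ 2.
Proof.
rewrite -(real_normK (num_real (A i j))) ler_sqr ?nnegrE ?hsnorm_ge0//.
exact: entry_le.
Qed.

End hsnorm.

Lemma dotp_mdot {R : realType} k (x y : 'cV[R]_k) : dotp x y = mdot x y.
Proof.
rewrite /dotp mxE /mdot; apply: eq_bigr => i _.
by rewrite big_ord1 mxE.
Qed.

Section vector_L2.
Context {R : realType} {d : measure_display} {S : measurableType d} {k l : nat}.
Variable mu : {measure set S -> \bar R}.
Implicit Types X Y : S -> 'M[R]_(k, l).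

Definition mmeas X := forall i j, measurable_fun setT (fun s => X s i j).

Definition vnn2 X : \bar R := (\int[mu]_s (hsnorm (X s) ^+ 2)%:E)%E.

Definition vL2 X := mmeas X /\ (vnn2 X < +oo)%E.

Lemma mmeasD X Y : mmeas X -> mmeas Y -> mmeas (fun s => X s + Y s).
Proof.
by move=> hX hY i j; under eq_fun do rewrite mxE; exact: measurable_funD.
Qed.

Lemma mmeasN X : mmeas X -> mmeas (fun s => - X s).
Proof.
by move=> hX i j; under eq_fun do rewrite mxE; exact: measurableT_comp.
Qed.

Lemma mmeasB X Y : mmeas X -> mmeas Y -> mmeas (fun s => X s - Y s).
Proof. by move=> hX hY; apply: mmeasD => //; exact: mmeasN. Qed.

Lemma mmeas_sqr X : mmeas X -> measurable_fun setT (fun s => hsnorm (X s) ^+ 2).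
Proof.
move=> h; under eq_fun do rewrite hsnorm_sqr.
by apply: measurable_sum => i; apply: measurable_sum => j; exact: measurable_funX.
Qed.

Lemma mmeas_hsnorm X : mmeas X -> measurable_fun setT (fun s => hsnorm (X s)).
Proof.
move=> h; rewrite (_ : (fun s => hsnorm (X s)) = (fun s => Num.sqrt (hsnorm (X s) ^+ 2))).
  apply: (@measurableT_comp _ _ _ _ _ _ (@Num.sqrt R)); last exact: mmeas_sqr.
  by apply: continuous_measurable_fun; exact: sqrt_continuous.
by apply/funext => s; rewrite sqrtr_sqr ger0_norm// hsnorm_ge0.
Qed.

Lemma mmeas_sqrE X : mmeas X -> measurable_fun setT (fun s => (hsnorm (X s) ^+ 2)%:E).
Proof. by move=> h; apply/measurable_EFinP; exact: mmeas_sqr. Qed.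

Lemma vnn2_ge0 X : (0 <= vnn2 X)%E.
Proof. by apply: integral_ge0 => s _; rewrite lee_fin sqr_ge0. Qed.

Lemma vnn2E X : mmeas X -> vnn2 X = (\sum_i \sum_j nn2 mu (fun s => X s i j))%E.
Proof.
move=> h; rewrite /vnn2.
under eq_integral do rewrite hsnorm_sqr -sumEFin.
rewrite ge0_integral_sum//; first last.
- by move=> i s _; rewrite lee_fin; apply: sumr_ge0 => *; exact: sqr_ge0.
- by move=> i; apply/measurable_EFinP; apply: measurable_sum => j; exact: measurable_funX.
apply: eq_bigr => i _; under eq_integral do rewrite -sumEFin.
rewrite ge0_integral_sum//.
- by move=> j; exact: measurable_sqE.
- by move=> j s _; rewrite lee_fin sqr_ge0.
Qed.

Lemma vnn2D X Y : mmeas X -> mmeas Y ->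
  (vnn2 (fun s => X s + Y s)%R <= 2%:E * vnn2 X + 2%:E * vnn2 Y)%E.
Proof.
move=> mX mY; rewrite /vnn2 -!ge0_integralZl_EFin//;
  try (by move=> s _; rewrite lee_fin sqr_ge0); try exact: mmeas_sqrE.
have m2 (Z : S -> 'M[R]_(k, l)) : mmeas Z -> measurable_fun setT (fun s => 2%:E * (hsnorm (Z s) ^+ 2)%:E)%E.
  by move=> mZ; apply: measurable_funeM; exact: mmeas_sqrE.
have s0 (Z : S -> 'M[R]_(k, l)) s : setT s -> (0 <= 2%:E * (hsnorm (Z s) ^+ 2)%:E)%E.
  by move=> _; rewrite -EFinM lee_fin mulr_ge0// sqr_ge0.
rewrite -ge0_integralD//; try exact: s0; try exact: m2.
apply: ge0_le_integral => //.
- by move=> s _; rewrite lee_fin sqr_ge0.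
- by apply: mmeas_sqrE; exact: mmeasD.
- by apply: emeasurable_funD; exact: m2.
- by move=> s _; rewrite -!EFinM -EFinD lee_fin hsnorm_sqrD.
Qed.

Lemma vnn2N X : vnn2 (fun s => - X s)%R = vnn2 X.
Proof. by apply: eq_integral => s _; rewrite hsnormN. Qed.

Lemma vnn2B X Y : mmeas X -> mmeas Y ->
  (vnn2 (fun s => X s - Y s)%R <= 2%:E * vnn2 X + 2%:E * vnn2 Y)%E.
Proof. by move=> mX mY; rewrite -(vnn2N Y); apply: vnn2D => //; exact: mmeasN. Qed.

Lemma vL2D X Y : vL2 X -> vL2 Y -> vL2 (fun s => X s + Y s).
Proof.
move=> [mX hX] [mY hY]; split; first exact: mmeasD.
by rewrite (le_lt_trans (vnn2D mX mY))// lte_add_pinfty// lte_mul_pinfty// ?lee_fin// vnn2_ge0.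
Qed.

Lemma vL2N X : vL2 X -> vL2 (fun s => - X s).
Proof. by move=> [mX hX]; split; [exact: mmeasN|rewrite vnn2N]. Qed.

Lemma vL2B X Y : vL2 X -> vL2 Y -> vL2 (fun s => X s - Y s).
Proof. by move=> hX hY; apply: vL2D => //; exact: vL2N. Qed.

Lemma vL2P X : vL2 X <-> forall i j, L2 mu (fun s => X s i j).
Proof.
split=> [[mX hX] i j|h].
  split; first exact: mX.
  apply: le_lt_trans hX; apply: ge0_le_integral => //.
  - by move=> s _; rewrite lee_fin sqr_ge0.
  - by apply: measurable_sqE; exact: mX.
  - exact: mmeas_sqrE.
  - by move=> s _; rewrite lee_fin entry_sqr_le.
have mX : mmeas X by move=> i j; case: (h i j).
split => //; rewrite vnn2E//; apply: lte_sum_pinfty => i _; apply: lte_sum_pinfty => j _.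
by case: (h i j).
Qed.

Lemma vL2_int1 X : vL2 X -> int1 mu (fun s => hsnorm (X s) ^+ 2).
Proof.
move=> [mX hX]; apply/integrableP; split; first exact: mmeas_sqrE.
rewrite (eq_integral (fun s => (hsnorm (X s) ^+ 2)%:E))// => s _ /=.
by rewrite ger0_norm// sqr_ge0.
Qed.

Lemma vnn2_fine X : vL2 X -> vnn2 X = (\int[mu]_s (hsnorm (X s) ^+ 2))%:E.
Proof.
by move=> [mX hX]; rewrite /Rintegral fineK// ge0_fin_numE// vnn2_ge0.
Qed.

Lemma vnn2_eq0 X : mmeas X -> vnn2 X = 0%E -> {ae mu, forall s, X s = 0}.
Proof.
move=> mX h; have := @nn2_eq0 _ _ _ mu (fun s => hsnorm (X s)) (mmeas_hsnorm mX) h.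
by apply: filterS => s; exact: hsnorm_eq0.
Qed.

Lemma ae_eq_vnn2 X Y : mmeas X -> mmeas Y -> {ae mu, forall s, X s = Y s} -> vnn2 X = vnn2 Y.
Proof.
move=> mX mY h; apply: ae_eq_integral => //; try exact: mmeas_sqrE.
by apply: filterS h => s -> _.
Qed.

End vector_L2.

Lemma adapted_gmeas {R : realType} {dsp} {Omega : measurableType dsp}
    (P : probability Omega R) (T : R) (F : R -> set (set Omega)) k l
    (U : process R Omega k l) : usual_filtration P T F ->
  adapted T F U <-> forall t, t \in `[0, T] -> forall i j, gmeas (F t) (fun w => U w t i j).
Proof.
move=> hF; split=> h t tT.
  by have /(rv_measurableP hF _ tT) := h t tT; exact.
by apply/(rv_measurableP hF _ tT); exact: h.
Qed.

Section S2norm.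
Context {R : realType} {dsp} {Omega : measurableType dsp}
  (P : probability Omega R) (T : R).
Hypothesis T0 : 0 < T.
Context {k l : nat}.
Implicit Types U V : process R Omega k l.

(* Right-continuous processes with measurable marginals: the class on which the
   supremum over [0, T] is the supremum over the dyadic grids. *)
Definition rcproc U := (forall t, t \in `[0, T] -> mmeas (U ^~ t)) /\
  forall w i j t, t \in `[0, T[ -> tends (fun s => t < s) (fun s => U w s i j) t (U w t i j).

Definition esup U w : \bar R :=
  ereal_sup [set (hsnorm (U w t) ^+ 2)%:E | t in `[0%R, T]%classic].

(** The square of [normS2], which is the quantity that Doob's inequality and Cauchy-Schwarz bound
    directly. *)
Definition nS U : \bar R := (\int[P]_w esup U w)%E.

Lemma normS2E U : normS2 P T U = sqrte (nS U). Proof. by []. Qed.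

Lemma esup_ge0 U w : (0 <= esup U w)%E.
Proof.
apply: (@le_trans _ _ (hsnorm (U w 0) ^+ 2)%:E); first by rewrite lee_fin sqr_ge0.
by apply: ereal_sup_ubound; exists 0 => //=; rewrite in_itv/= lexx ltW.
Qed.

Lemma esup_ub U w t : t \in `[0, T] -> ((hsnorm (U w t) ^+ 2)%:E <= esup U w)%E.
Proof. by move=> tT; apply: ereal_sup_ubound; exists t. Qed.

Lemma esup_le U w c : (forall t, t \in `[0, T] -> ((hsnorm (U w t) ^+ 2)%:E <= c)%E) ->
  (esup U w <= c)%E.
Proof. by move=> h; apply: ge_ereal_sup => _ [t tT <-]; exact: h. Qed.

Lemma nS_ge0 U : (0 <= nS U)%E.
Proof. by apply: integral_ge0 => w _; exact: esup_ge0. Qed.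

Lemma tendsD A (u v : R -> R) t a b : tends A u t a -> tends A v t b ->
  tends A (fun s => u s + v s) t (a + b).
Proof. by move=> /tendsP h1 /tendsP h2; apply/tendsP; apply: cvgD. Qed.

Lemma tendsM A (u v : R -> R) t a b : tends A u t a -> tends A v t b ->
  tends A (fun s => u s * v s) t (a * b).
Proof. by move=> /tendsP h1 /tendsP h2; apply/tendsP; apply: cvgM. Qed.

Lemma tendsN A (u : R -> R) t a : tends A u t a -> tends A (fun s => - u s) t (- a).
Proof. by move=> /tendsP h1; apply/tendsP; apply: cvgN. Qed.

Lemma tends_cst A (c t : R) : tends A (fun=> c) t c.
Proof. by move=> e e0; exists 1 => // s _ _; rewrite subrr normr0 ltW. Qed.

Lemma tends_sum (I : Type) (r : seq I) A (u : I -> R -> R) t (a : I -> R) :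
  (forall i, tends A (u i) t (a i)) -> tends A (fun s => \sum_(i <- r) u i s) t (\sum_(i <- r) a i).
Proof.
move=> h; elim: r => [|i r IH].
  by rewrite big_nil; under [X in tends _ X]funext do rewrite big_nil; exact: tends_cst.
rewrite big_cons; under [X in tends _ X]funext do rewrite big_cons.
exact: tendsD.
Qed.

Lemma tends_hsnorm A (u : R -> 'M[R]_(k, l)) t (L : 'M[R]_(k, l)) : (forall i j, tends A (fun s => u s i j) t (L i j)) ->
  tends A (fun s => hsnorm (u s) ^+ 2) t (hsnorm L ^+ 2).
Proof.
move=> h; rewrite hsnorm_sqr; under [X in tends _ X]funext do rewrite hsnorm_sqr.
apply: tends_sum => i; apply: tends_sum => j; under [X in tends _ X]funext do rewrite expr2.
by rewrite expr2; exact: tendsM.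
Qed.

Lemma rcprocD U V : rcproc U -> rcproc V -> rcproc (fun w t => U w t + V w t).
Proof.
move=> [mU cU] [mV cV]; split; first by move=> t tT; apply: mmeasD; [exact: mU|exact: mV].
move=> w i j t tT; rewrite mxE; under [X in tends _ X]funext do rewrite mxE.
by apply: tendsD; [exact: cU|exact: cV].
Qed.

Lemma rcprocN U : rcproc U -> rcproc (fun w t => - U w t).
Proof.
move=> [mU cU]; split; first by move=> t tT; apply: mmeasN; exact: mU.
move=> w i j t tT; rewrite mxE; under [X in tends _ X]funext do rewrite mxE.
by apply: tendsN; exact: cU.
Qed.

Lemma rcprocB U V : rcproc U -> rcproc V -> rcproc (fun w t => U w t - V w t).
Proof. by move=> hU hV; apply: rcprocD => //; exact: rcprocN. Qed.

Lemma esup_limn U w : rcproc U ->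
  esup U w = limn (fun j => (gsup T j (fun t => hsnorm (U w t) ^+ 2))%:E).
Proof.
move=> [_ cU]; apply: esup_gsup => //; first by move=> t; exact: sqr_ge0.
by move=> t tT; apply: tends_hsnorm => i j; exact: cU.
Qed.

Lemma measurable_runmax (x : nat -> Omega -> R) n : (forall k, measurable_fun setT (x k)) ->
  measurable_fun setT (fun w => runmax (x ^~ w) n).
Proof.
move=> h; elim: n => [|n IH] /=; first exact: measurableT_comp.
by apply: measurable_maxr => //; exact: measurableT_comp.
Qed.

Lemma measurable_esup U : rcproc U -> measurable_fun setT (esup U).
Proof.
move=> hU; rewrite (_ : esup U = fun w => limn (fun j => (gsup T j (fun t => hsnorm (U w t) ^+ 2))%:E)); last first.
  by apply/funext => w; exact: esup_limn.
apply: (emeasurable_fun_cvg (fun j w => (gsup T j (fun t => hsnorm (U w t) ^+ 2))%:E)).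
  move=> j; apply/measurable_EFinP; apply: (measurable_runmax (x := fun m w => hsnorm (U w (grid T j m)) ^+ 2)) => m.
  by apply: mmeas_sqr; apply: hU.1; exact: grid_itv.
move=> w _; apply: ereal_nondecreasing_is_cvgn => i j ij; rewrite lee_fin.
exact: gsup_mono.
Qed.

Lemma nSD U V : rcproc U -> rcproc V ->
  (nS (fun w t => U w t + V w t)%R <= 2%:E * nS U + 2%:E * nS V)%E.
Proof.
move=> hU hV; have mU := measurable_esup hU; have mV := measurable_esup hV.
rewrite /nS -!ge0_integralZl_EFin//; try (by move=> w _; exact: esup_ge0).
have s0 W w : setT w -> (0 <= 2%:E * esup W w)%E by move=> _; rewrite mule_ge0// esup_ge0.
rewrite -ge0_integralD//; try exact: s0; try exact: measurable_funeM.
apply: ge0_le_integral => //.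
- by move=> w _; exact: esup_ge0.
- by apply: measurable_esup; exact: rcprocD.
- by apply: emeasurable_funD; exact: measurable_funeM.
move=> w _; apply: esup_le => t tT.
apply: (@le_trans _ _ (2%:E * (hsnorm (U w t) ^+ 2)%:E + 2%:E * (hsnorm (V w t) ^+ 2)%:E)%E).
  by rewrite -!EFinM -EFinD lee_fin hsnorm_sqrD.
by apply: leeD; rewrite lee_wpmul2l// esup_ub.
Qed.

Lemma nSN U : nS (fun w t => - U w t)%R = nS U.
Proof.
apply: eq_integral => w _; rewrite /esup; congr ereal_sup; apply/seteqP.
by split=> _ [t tT <-]; exists t => //; rewrite hsnormN.
Qed.

Lemma nSB U V : rcproc U -> rcproc V ->
  (nS (fun w t => U w t - V w t)%R <= 2%:E * nS U + 2%:E * nS V)%E.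
Proof. by move=> hU hV; rewrite -(nSN V); apply: nSD => //; exact: rcprocN. Qed.

Lemma vnn2_nS U t : rcproc U -> t \in `[0, T] -> (vnn2 P (U ^~ t) <= nS U)%E.
Proof.
move=> hU tT; apply: ge0_le_integral => //.
- by move=> w _; rewrite lee_fin sqr_ge0.
- by apply: mmeas_sqrE; exact: hU.1.
- exact: measurable_esup.
- by move=> w _; exact: esup_ub.
Qed.

Lemma nS_eq0 U : rcproc U -> nS U = 0%E -> {ae P, forall w, forall t, t \in `[0, T] -> U w t = 0}.
Proof.
move=> hU h; have mU := measurable_esup hU.
have /ae_eq_integral_abs := mU => /(_ P measurableT)[+ _].
rewrite (_ : (\int[P]_(x in setT) `|_|)%E = nS U); last first.
  by apply: eq_integral => x _; rewrite gee0_abs// esup_ge0.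
move=> /(_ h); apply: filterS => w /(_ I) e t tT.
have := esup_ub U w tT; rewrite e lee_fin => h2; apply: hsnorm_eq0.
by apply/eqP; rewrite -sqrf_eq0 eq_le h2 sqr_ge0.
Qed.

Lemma normS2_le U (c : R) : 0 <= c -> (normS2 P T U <= c%:E)%E -> (nS U <= (c ^+ 2)%:E)%E.
Proof.
move=> c0; rewrite normS2E => h; rewrite -(sqr_sqrte (nS_ge0 U)).
by rewrite expe2 EFin_expe expe2 lee_pmul// sqrte_ge0.
Qed.

Lemma nS_lty U : (normS2 P T U < +oo)%E = (nS U < +oo)%E.
Proof.
rewrite normS2E -ge0_fin_numE ?sqrte_ge0// sqrte_fin_num ?nS_ge0//.
by rewrite ge0_fin_numE// nS_ge0.
Qed.

Lemma rcproc_mart (F : R -> set (set Omega)) U : usual_filtration P T F -> adapted T F U ->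
  cadlag T U -> rcproc U.
Proof.
move=> hF aU cU; split.
  move=> t tT i j; apply: (gmeas_sub (filt_sub hF tT)).
  exact: ((adapted_gmeas U hF).1 aU t tT).
by move=> w i j; have /cadlagP/(_ w i j)[h1 _] := cU; exact: h1.
Qed.

Lemma rcproc_cont (F : R -> set (set Omega)) U : usual_filtration P T F -> adapted T F U ->
  (forall w, {within `[0, T], continuous (U w)}) -> rcproc U.
Proof.
move=> hF aU cU; split.
  move=> t tT i j; apply: (gmeas_sub (filt_sub hF tT)).
  exact: ((adapted_gmeas U hF).1 aU t tT).
move=> w i j t; rewrite in_itv/= => /andP[t0 tT].
have tI : t \in `[0, T] by rewrite in_itv/= t0 ltW.
have := (within_continuousP T (U w)).1 (cU w) i j t tI => h e e0.
have [r r0 hr] := h e e0; exists (Num.min r (T - t)); first by rewrite lt_min r0 subr_gt0.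
move=> s ts; rewrite lt_min gtr0_norm ?subr_gt0// => /andP[sr sT]; apply: hr.
  by rewrite /= in_itv/=; apply/andP; split; lra.
by rewrite gtr0_norm ?subr_gt0.
Qed.

End S2norm.

Section conditional_expectation_process.
Context {R : realType} {dsp} {Omega : measurableType dsp}
  (P : probability Omega R) (T : R) (F : R -> set (set Omega)).
Hypothesis T0 : 0 < T.
Hypothesis hP : measure_is_complete P.
Hypothesis hF : usual_filtration P T F.
Context {k l : nat}.
Implicit Types (xi : Omega -> 'M[R]_(k, l)) (M : process R Omega k l).

Lemma cexp_condexp (f g : Omega -> R) t : t \in `[0, T] -> L2 P f -> L2 P g ->
  (forall A, F t A -> \int[P]_w (\1_A w * (f w - g w)) = 0) ->
  forall A, F t A -> (\int[P]_(w in A) (f w)%:E = \int[P]_(w in A) (g w)%:E)%E.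
Proof.
move=> tT Lf Lg h A FA; have mA := filt_sub hF tT FA.
have IA (u : Omega -> R) : L2 P u -> (\int[P]_(w in A) (u w)%:E)%E \is a fin_num.
  move=> Lu; apply: integrable_fin_num => //.
  by apply: integrableS (L2_int1 Lu).
rewrite -[LHS]fineK ?IA// -[RHS]fineK ?IA//; congr EFin.
have := h A FA; rewrite (_ : \int[P]_w (\1_A w * (f w - g w)) =
   \int[P]_w (\1_A w * f w) - \int[P]_w (\1_A w * g w)).
  by rewrite -!Rintegral_indic// => /eqP; rewrite subr_eq0 => /eqP.
rewrite -RintegralB//; try by apply: int1_indic => //; exact: L2_int1.
by apply: eq_Rintegral => w _; rewrite mulrBr.
Qed.

Lemma condexp_cexp (f g : Omega -> R) t : t \in `[0, T] -> L2 P f -> L2 P g ->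
  (forall A, F t A -> (\int[P]_(w in A) (f w)%:E = \int[P]_(w in A) (g w)%:E)%E) ->
  (forall A, F t A -> \int[P]_w (\1_A w * (f w - g w)) = 0).
Proof.
move=> tT Lf Lg h A FA; have mA := filt_sub hF tT FA.
have e : \int[P]_(w in A) f w = \int[P]_(w in A) g w by rewrite /Rintegral h.
have eI (u : Omega -> R) : \int[P]_(w in A) u w = \int[P]_w (\1_A w * u w) by exact: Rintegral_indic.
rewrite [LHS]eI [RHS]eI in e.
rewrite (_ : \int[P]_w (\1_A w * (f w - g w)) =
   \int[P]_w (\1_A w * f w) - \int[P]_w (\1_A w * g w)); first by rewrite e subrr.
rewrite -RintegralB//; try by apply: int1_indic => //; exact: L2_int1.
by apply: eq_Rintegral => w _; rewrite mulrBr.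
Qed.

Lemma condexp_process_exists xi : vL2 P xi -> exists M, condexp_process P T F xi M.
Proof.
move=> /vL2P Lxi.
have /choice[m hm] : forall ij : 'I_k * 'I_l, exists M : Omega -> R -> R,
  cexp P T F (fun w => xi w ij.1 ij.2) (fun t w => M w t) /\
  forall w, (forall t, t \in `[0, T[ -> tends (fun s => t < s) (M w) t (M w t)) /\
    (forall t, t \in `]0, T] -> exists a, tends (fun s => s < t) (M w) t a).
  by move=> ij; apply: cadlag_version.
pose M : process R Omega k l := fun w t => \matrix_(i, j) m (i, j) w t.
have ME i j t : (fun w => M w t i j) = (fun w => m (i, j) w t).
  by apply/funext => w; rewrite mxE.
have aM : adapted T F M.
  apply/(adapted_gmeas _ hF) => t tT i j; rewrite ME.
  by have [/(_ t tT)[]] := hm (i, j).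
have LM i j t : t \in `[0, T] -> L2 P (fun w => M w t i j).
  by move=> tT; rewrite ME; have [/(_ t tT)[]] := hm (i, j).
have hxM i j t A : t \in `[0, T] -> F t A -> (\int[P]_(w in A) (xi w i j)%:E = \int[P]_(w in A) (M w t i j)%:E)%E.
  move=> tT FA; apply: (cexp_condexp tT) => //; first exact: LM.
  move=> B FB; have [/(_ t tT)[_ _ /(_ B FB) e] _] := hm (i, j).
  by rewrite -[RHS]e; apply: eq_Rintegral => w _; rewrite mxE.
exists M; split; first split => //.
- apply/cadlagP => w i j; have [_ /(_ w)[h1 h2]] := hm (i, j); split=> t ht.
    have := h1 t ht; rewrite mxE; congr tends; by apply/funext => s; rewrite mxE.
  have [a ha] := h2 t ht; exists a; move: ha; congr tends; by apply/funext => s; rewrite mxE.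
- move=> t tT; apply: (_ : vL2 P (M ^~ t)).2; by apply/vL2P => i j; exact: LM.
- move=> s t s0 st tT.
  have sI : s \in `[0, T] by rewrite in_itv/= s0 (le_trans st).
  have tI : t \in `[0, T] by rewrite in_itv/= tT (le_trans s0).
  split; first exact: aM.
  move=> i j; split; [exact/L2_int1/LM|exact/L2_int1/LM|].
  move=> A FA; rewrite -(hxM i j t A tI (filt_mono hF s0 st tT FA)); exact: hxM.
move=> t tT; split; first exact: aM.
by move=> i j; split; [exact/L2_int1|exact/L2_int1/LM|move=> A FA; exact: hxM].
Qed.

Lemma M2_vL2 M t : M2 P T F M -> t \in `[0, T] -> vL2 P (M ^~ t).
Proof.
move=> [aM _ sM _] tT; split; last exact: sM.
move=> i j; apply: (gmeas_sub (filt_sub hF tT)).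
exact: ((adapted_gmeas M hF).1 aM t tT).
Qed.

Lemma M2_mart M i j : M2 P T F M -> mart P T F (fun t w => M w t i j).
Proof.
move=> hM; have [aM cM sM oM] := hM.
have LM t : t \in `[0, T] -> L2 P (fun w => M w t i j).
  by move=> tT; have /vL2P := M2_vL2 hM tT; exact.
split.
- by move=> t tT; exact: ((adapted_gmeas M hF).1 aM t tT).
- exact: LM.
move=> s t h s0 st tT Gh Lh.
have sI : s \in `[0, T] by rewrite in_itv/= s0 (le_trans st).
have tI : t \in `[0, T] by rewrite in_itv/= tT (le_trans s0).
apply: (int_mul_eq0 (filt_sigma hF sI) (filt_sub hF sI)) => //.
- by apply: L2_int1; apply: L2B; exact: LM.
- apply: condexp_cexp => //; [exact: LM|exact: LM|].
  by have [_ /(_ i j)[_ _]] := oM s t s0 st tT.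
- by apply: L2M => //; apply: L2B; exact: LM.
Qed.

Lemma M2_rcproc M : M2 P T F M -> rcproc T M.
Proof. by move=> [aM cM _ _]; exact: (rcproc_mart hF aM cM). Qed.

Lemma condexp_process_cexp xi M i j : vL2 P xi -> condexp_process P T F xi M ->
  cexp P T F (fun w => xi w i j) (fun t w => M w t i j).
Proof.
move=> /vL2P Lxi [hM hc] t tT; have [G L _] := M2_mart i j hM.
split; [exact: G|exact: L|].
apply: (condexp_cexp tT) => //; first exact: L.
by have [_ /(_ i j)[]] := hc t tT.
Qed.

Lemma mart_nS_scalar (Z : R -> Omega -> R) : mart P T F Z ->
  (forall w t, t \in `[0, T[ -> tends (fun s => t < s) (Z ^~ w) t (Z t w)) ->
  (\int[P]_w (ereal_sup [set (Z t w ^+ 2)%:E | t in `[0%R, T]%classic])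
    <= (4 * \int[P]_w (Z T w ^+ 2))%:E)%E.
Proof.
move=> mZ cZ; apply: le_trans (doob_grid T0 hF mZ).
have nd w : nondecreasing_seq (fun j => ((gsup T j (fun t => Z t w)) ^+ 2)%:E).
  by move=> i j ij; rewrite lee_fin ler_sqr ?nnegrE ?gsup_ge0//; exact: gsup_mono.
have e w : ereal_sup [set (Z t w ^+ 2)%:E | t in `[0%R, T]%classic] =
   limn (fun j => (gsup T j (fun t => Z t w ^+ 2))%:E).
  rewrite esup_gsup//; first by move=> t; exact: sqr_ge0.
  by move=> t tT; rewrite expr2; apply: tendsM; exact: cZ.
apply: ge0_le_integral => //.
- move=> w _; apply: (@le_trans _ _ (Z 0 w ^+ 2)%:E); first by rewrite lee_fin sqr_ge0.
  by apply: ereal_sup_ubound; exists 0 => //=; rewrite in_itv/= lexx ltW.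
- under eq_fun do rewrite e.
  apply: (emeasurable_fun_cvg (fun j w => (gsup T j (fun t => Z t w ^+ 2))%:E)).
    move=> j; apply/measurable_EFinP; apply: (measurable_runmax (x := fun m w => Z (grid T j m) w ^+ 2)) => m.
    by apply: measurable_funX; case: mZ => _ /(_ _ (grid_itv T0 j m))[].
  move=> w _; apply: ereal_nondecreasing_is_cvgn => i j ij; rewrite lee_fin; exact: gsup_mono.
- apply: (emeasurable_fun_cvg (fun j w => ((gsup T j (fun t => Z t w)) ^+ 2)%:E)).
    by move=> j; apply: measurable_sqE; exact: (mart_runmax_measurable T0 hF).
  by move=> w _; apply: ereal_nondecreasing_is_cvgn.
move=> w _; rewrite e; apply: lee_lim.
- apply: ereal_nondecreasing_is_cvgn => i j ij; rewrite lee_fin; exact: gsup_mono.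
- exact: ereal_nondecreasing_is_cvgn.
apply: nearW => j; rewrite lee_fin; apply: runmax_le => m _.
rewrite normrX ler_sqr ?nnegrE ?gsup_ge0//; exact: gsup_ge.
Qed.

(** Doob's inequality entry by entry: the supremum of a sum of squares is at most the sum of the
    suprema, and the right-hand side is a sum over entries. The constant 4 is thus free of the
    dimensions, which matters because the horizon may depend only on [C] and [K]. *)
Lemma mart_nS M : (forall i j, mart P T F (fun t w => M w t i j)) -> rcproc T M ->
  (nS P T M <= 4%:E * vnn2 P (M ^~ T))%E.
Proof.
move=> mM [rM cM].
have hij i j : rcproc T (fun w t => \matrix_(i0 < 1, j0 < 1) M w t i j).
  split; first by move=> t tT i0 j0; under eq_fun do rewrite mxE; exact: rM.
  move=> w i0 j0 t tT; rewrite mxE; under [X in tends _ X]funext do rewrite mxE.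
  exact: cM.
pose s i j w := ereal_sup [set (M w t i j ^+ 2)%:E | t in `[0%R, T]%classic].
have se i j : s i j = esup T (fun w t => \matrix_(i0 < 1, j0 < 1) M w t i j).
  apply/funext => w; rewrite /s /esup; congr ereal_sup; apply/seteqP.
  by split=> _ [t tT <-]; exists t => //; rewrite hsnorm_sqr !big_ord1 mxE.
have ms i j : measurable_fun setT (s i j) by rewrite se; exact: measurable_esup.
have s0 i j w : (0 <= s i j w)%E by rewrite se; exact: esup_ge0.
apply: (@le_trans _ _ (\int[P]_w (\sum_i \sum_j s i j w))%E).
  apply: ge0_le_integral => //.
  - by move=> w _; exact: esup_ge0.
  - by apply: measurable_esup.
  - by apply: emeasurable_sum => i; apply: emeasurable_sum.
  move=> w _; apply: esup_le => t tT; rewrite hsnorm_sqr -sumEFin; apply: lee_sum => i _.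
  rewrite -sumEFin; apply: lee_sum => j _.
  by apply: ereal_sup_ubound; exists t.
rewrite ge0_integral_sum//; first last.
- by move=> i w _; apply: sume_ge0 => *; exact: s0.
- by move=> i; apply: emeasurable_sum.
rewrite vnn2E; last by apply: rM; exact: (itvTT T0).
rewrite ge0_sume_distrr; last by move=> i _; apply: sume_ge0 => *; exact: nn2_ge0.
apply: lee_sum => i _; rewrite ge0_integral_sum//.
rewrite ge0_sume_distrr; last by move=> *; exact: nn2_ge0.
apply: lee_sum => j _; rewrite nn2E; last by case: (mM i j) => _ /(_ T (itvTT T0)).
by apply: mart_nS_scalar => // w t tT; exact: cM.
Qed.

Lemma martB (Z Z' : R -> Omega -> R) : mart P T F Z -> mart P T F Z' ->
  mart P T F (fun t w => Z t w - Z' t w).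
Proof.
move=> [G L o] [G' L' o']; split.
- by move=> t tT; apply: measurable_funB; [exact: G|exact: G'].
- by move=> t tT; apply: L2B; [exact: L|exact: L'].
move=> s t h s0 st tT Gh Lh.
have sI : s \in `[0, T] by rewrite in_itv/= s0 (le_trans st).
have tI : t \in `[0, T] by rewrite in_itv/= tT (le_trans s0).
rewrite -[RHS](subrr 0) -[X in _ = X - _](o s t h)// -[X in _ = _ - X](o' s t h)//.
rewrite -RintegralB//; [|by apply: L2M => //; apply: L2B; [exact: L|exact: L]|
  by apply: L2M => //; apply: L2B; [exact: L'|exact: L']].
by apply: eq_Rintegral => w _; ring.
Qed.

Lemma M2_nS M : M2 P T F M -> (nS P T M < +oo)%E.
Proof.
move=> hM; apply: le_lt_trans (mart_nS _ (M2_rcproc hM)) _; first by move=> i j; exact: M2_mart.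
by rewrite lte_mul_pinfty// ?(M2_vL2 hM (itvTT T0)).2// vnn2_ge0.
Qed.

Lemma cexp_contract (f : Omega -> R) Z t : L2 P f -> cexp P T F f Z -> t \in `[0, T] ->
  (nn2 P (Z t) <= nn2 P f)%E.
Proof.
move=> Lf hZ tT; have [GZ LZ _] := hZ t tT.
have h0 := cexp_orth hF Lf hZ tT GZ LZ.
rewrite !nn2E// lee_fin.
have Ld : L2 P (fun w => f w - Z t w) by exact: L2B.
have : 0 <= \int[P]_w ((f w - Z t w) ^+ 2) by apply: Rintegral_ge0 => w _; exact: sqr_ge0.
have -> : \int[P]_w ((f w - Z t w) ^+ 2) = \int[P]_w (f w ^+ 2) - \int[P]_w (Z t w ^+ 2) -
   2 * \int[P]_w (Z t w * (f w - Z t w)).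
  rewrite -RintegralZl//; last exact: L2M.
  rewrite -RintegralB//; [|exact: int1_sq|exact: int1_sq].
  rewrite -RintegralB//; [|by apply: int1B; exact: int1_sq|by apply: int1Z; exact: L2M].
  by apply: eq_Rintegral => w _; ring.
by rewrite h0; lra.
Qed.

(** Doob's inequality followed by the L^2 contraction of conditional expectation at time [T].
    Through this bound the terminal variable controls the whole martingale. *)
Lemma condexp_process_dist xi xi' M M' : vL2 P xi -> vL2 P xi' ->
  condexp_process P T F xi M -> condexp_process P T F xi' M' ->
  (nS P T (fun w t => M w t - M' w t)%R <= 4%:E * vnn2 P (fun w => xi w - xi' w)%R)%E.
Proof.
move=> Lxi Lxi' hM hM'.
apply: le_trans (mart_nS _ _) _.
- move=> i j; have := martB (M2_mart i j hM.1) (M2_mart i j hM'.1).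
  by congr mart; apply/funext => t; apply/funext => w; rewrite !mxE.
- by apply: rcprocB; apply: M2_rcproc; [exact: hM.1|exact: hM'.1].
rewrite lee_wpmul2l// !vnn2E; first last.
- by apply: mmeasB; [exact: (M2_vL2 hM.1 (itvTT T0)).1|exact: (M2_vL2 hM'.1 (itvTT T0)).1].
- by apply: mmeasB; [exact: Lxi.1|exact: Lxi'.1].
apply: lee_sum => i _; apply: lee_sum => j _.
have c := condexp_process_cexp i j Lxi hM; have c' := condexp_process_cexp i j Lxi' hM'.
have L : L2 P (fun w => xi w i j) by have /vL2P := Lxi; exact.
have L' : L2 P (fun w => xi' w i j) by have /vL2P := Lxi'; exact.
rewrite (_ : (fun w => (M w T - M' w T) i j) = fun w => M w T i j - M' w T i j); last first.
  by apply/funext => w; rewrite !mxE.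
rewrite (_ : (fun w => (xi w - xi' w) i j) = fun w => xi w i j - xi' w i j); last first.
  by apply/funext => w; rewrite !mxE.
have := @cexp_contract (fun w => xi w i j - xi' w i j) (fun t w => M w t i j - M' w t i j) T.
apply; [exact: L2B| |exact: (itvTT T0)].
move=> t tT; have [G1 L1 h1] := c t tT; have [G2 L2' h2] := c' t tT.
split; [exact: measurable_funB|exact: L2B|].
move=> A FA; have mA := filt_sub hF tT FA.
rewrite -[RHS](subrr 0) -[X in _ = X - _](h1 A FA) -[X in _ = _ - X](h2 A FA).
rewrite -RintegralB//; try by apply: int1_indic => //; apply: L2_int1; exact: L2B.
by apply: eq_Rintegral => w _; ring.
Qed.

End conditional_expectation_process.

Lemma measurable_prop {d} {S : measurableType d} (Q : Prop) : measurable [set _ : S | Q].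
Proof.
have [q|q] := pselect Q.
  by rewrite (_ : [set _ | _] = setT); [exact: measurableT|apply/seteqP; split].
by rewrite (_ : [set _ | _] = set0); [exact: measurable0|apply/seteqP; split].
Qed.

(** * Predictable processes *)

Section predictable.
Context {R : realType} {dsp} {Omega : measurableType dsp}
  (P : probability Omega R) (T : R) (F : R -> set (set Omega)).
Hypothesis T0 : 0 < T.
Hypothesis hF : usual_filtration P T F.
Local Notation D := (@setT Omega `*` `[0, T]%classic).

(** Processes are arbitrary outside [0, T]. The cut-off by zero turns them into functions on Omega x
    R that can be integrated over the whole product, and it commutes with differences. *)
Definition ext {k l} (U : process R Omega k l) (z : Omega * R) : 'M[R]_(k, l) :=
  if z.2 \in `[0, T] then U z.1 z.2 else 0.

(* [predictable_sets] is a sigma-algebra on Omega x [0, T]; this is the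
   corresponding sigma-algebra on Omega x R, unconstrained outside [0, T]. *)
Definition Gpred : set (set (Omega * R)) :=
  [set A | measurable A /\ predictable_sets T F (D `&` A)].

Lemma sigma_predictable : sigma_algebra D (predictable_sets T F).
Proof. exact: smallest_sigma_algebra. Qed.

Lemma predictable_sets_measurable (A : set (Omega * R)) : predictable_sets T F A -> measurable A /\ A `<=` D.
Proof.
have mD : measurable D by apply: measurableX => //; exact: measurable_itv.
apply: (@smallest_sub _ (sigma_algebra D) _ [set A | measurable A /\ A `<=` D]).
  split=> /=.
  - by split => //; exact: measurable0.
  - by move=> B [mB BD]; split; [exact: measurableD|exact: subDsetl].
  - move=> B hB; split; first by apply: bigcup_measurable => n _; case: (hB n).
    by move=> z [n _ Bz]; case: (hB n) => _; exact.
move=> B [[E FE <-]|[s [t [E [s0 st tT FE ->]]]]] /=.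
  split; first by apply: measurableX => //; exact: (filt_sub hF (itv0T T0)).
  by move=> [w u] /= [_ ->]; split => //; rewrite in_itv/= lexx ltW.
split.
  apply: measurableX; last exact: measurable_itv.
  apply: (filt_sub hF) FE; rewrite in_itv/= s0 (le_trans (ltW st))//.
move=> [w u] /= [_]; rewrite !in_itv/= => /andP[su ut]; split => //.
by rewrite (le_trans s0 (ltW su)) (le_trans ut).
Qed.

Lemma Gpred_sub : Gpred `<=` measurable.
Proof. by move=> A []. Qed.

Lemma Gpred_sigma : sigma_algebra setT Gpred.
Proof.
have [s0 sC sU] := sigma_predictable; split.
- by split; [exact: measurable0|rewrite setI0].
- move=> A [mA pA]; split; first by rewrite setTD; exact: measurableC.
  rewrite (_ : D `&` (setT `\` A) = D `\` (D `&` A)); first exact: sC.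
  by rewrite setDIr setDv set0U setTD setDE.
- move=> A hA; split; first by apply: bigcup_measurable => n _; case: (hA n).
  by rewrite setI_bigcupr; apply: sU => n; case: (hA n).
Qed.

(** Outside [0, T] the extension is constantly 0, so a preimage contains there everything or
    nothing; the rest is the definition of [Gpred]. *)
Lemma predictableP k l (H : process R Omega k l) : predictable T F H <->
  forall i j, gmeas Gpred (fun z => ext H z i j).
Proof.
have mD : measurable D by apply: measurableX => //; exact: measurable_itv.
have eD B i j : D `&` (fun z => ext H z i j) @^-1` B = D `&` (fun wt => H wt.1 wt.2 i j) @^-1` B.
  by apply/seteqP; split; move=> [w t] /= [[_ tT]]; rewrite /ext/= tT.
split=> h i j; last first.
  move=> B mB; rewrite -eD; have := (gmeasP _ Gpred_sigma).1 (h i j) B mB.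
  by case.
apply/(gmeasP _ Gpred_sigma) => B mB; split; last by rewrite eD; exact: h.
have [mH _] := predictable_sets_measurable (h i j B mB); rewrite -eD in mH.
have -> : (fun z => ext H z i j) @^-1` B = (D `&` (fun z => ext H z i j) @^-1` B) `|`
    (~` D `&` [set z | B 0]).
  apply/seteqP; split; move=> [w t] /=.
    have [tT|tT] := boolP (t \in `[0, T]); first by left.
    by rewrite /ext/= (negbTE tT) mxE => B0; right; split => // -[].
  case=> [[]//|[nD B0]]; rewrite /ext/=; case: ifPn => // tT; last by rewrite mxE.
  by exfalso; apply: nD.
apply: measurableU => //; apply: measurableI; first exact: measurableC.
exact: measurable_prop.
Qed.

Lemma gmeas_pred (f : Omega * R -> R) : gmeas Gpred f -> measurable_fun setT f.
Proof. by move=> h; exact: (gmeas_sub Gpred_sub h). Qed.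

Lemma gmeas_rect s t (z : Omega -> R) : 0 <= s -> s < t -> t <= T -> gmeas (F s) z ->
  gmeas Gpred (fun wt : Omega * R => (if s < wt.2 <= t then z wt.1 else 0)).
Proof.
move=> s0 st tT Gz; have sI : s \in `[0, T] by rewrite in_itv/= s0 (le_trans (ltW st)).
have rect E : F s E -> Gpred (E `*` `]s, t]%classic).
  move=> FE; suff pE : predictable_sets T F (E `*` `]s, t]%classic).
    have [mE ED] := predictable_sets_measurable pE; split => //.
    by rewrite (_ : D `&` _ = (E `*` `]s, t]%classic))//; apply/setIidPr.
  by apply: sub_sigma_algebra; right; exists s, t, E.
have Gm (A : set (Omega * R)) : Gpred A = measurable (A : set (g_sigma_algebraType Gpred)).
  by rewrite -[RHS]/(<<s Gpred >> A) (sigma_algebra_id Gpred_sigma).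
apply/(gmeasP _ Gpred_sigma) => B mB.
have -> : (fun wt : Omega * R => (if s < wt.2 <= t then z wt.1 else 0)) @^-1` B =
   ((z @^-1` B) `*` `]s, t]%classic) `|` (~` (setT `*` `]s, t]%classic) `&` [set _ | B 0]).
  apply/seteqP; split; move=> [w u] /=; rewrite in_itv/=; case: ifPn => h.
  - by left.
  - by move=> B0; right; split => // -[].
  - by case=> [[]//|[[]]].
  - by case=> [[]//|[]].
rewrite Gm; apply: measurableU; first by rewrite -Gm; apply: rect; apply: (gmeasP _ (filt_sigma hF sI)).1.
apply: measurableI.
  apply: measurableC; rewrite -Gm; apply: rect.
  by have [h0 hC _] := filt_sigma hF sI; rewrite -(setD0 setT); exact: hC.
exact: measurable_prop.
Qed.

Lemma gmeas_at0 (z : Omega -> R) : gmeas (F 0) z ->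
  gmeas Gpred (fun wt : Omega * R => (if wt.2 == 0 :> R then z wt.1 else 0)).
Proof.
move=> Gz; have sI := itv0T T0.
have rect E : F 0 E -> Gpred (E `*` [set 0]).
  move=> FE; suff pE : predictable_sets T F (E `*` [set 0]).
    have [mE ED] := predictable_sets_measurable pE; split => //.
    by rewrite (_ : D `&` _ = (E `*` [set 0]))//; apply/setIidPr.
  by apply: sub_sigma_algebra; left; exists E.
have Gm (A : set (Omega * R)) : Gpred A = measurable (A : set (g_sigma_algebraType Gpred)).
  by rewrite -[RHS]/(<<s Gpred >> A) (sigma_algebra_id Gpred_sigma).
apply/(gmeasP _ Gpred_sigma) => B mB.
have -> : (fun wt : Omega * R => (if wt.2 == 0 :> R then z wt.1 else 0)) @^-1` B =
   ((z @^-1` B) `*` [set 0]) `|` (~` (setT `*` [set 0]) `&` [set _ | B 0]).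
  apply/seteqP; split; move=> [w u] /=; case: eqP => h.
  - by left.
  - by move=> B0; right; split => // -[].
  - by case=> [[]//|[[]]].
  - by case=> [[]//|[]].
rewrite Gm; apply: measurableU; first by rewrite -Gm; apply: rect; apply: (gmeasP _ (filt_sigma hF sI)).1.
apply: measurableI.
  apply: measurableC; rewrite -Gm; apply: rect.
  by have [h0 hC _] := filt_sigma hF sI; rewrite -(setD0 setT); exact: hC.
exact: measurable_prop.
Qed.

(** Values at left end points on left-open cells, with a separate term at time 0: exactly the shape
    of the rectangles that generate the predictable sets. Applied to an adapted process it is
    therefore predictable. *)
Definition lstep j (u : R -> R) (t : R) : R :=
  (if t == 0 then u 0 else 0) +
  \sum_(k < 2 ^ j) (if grid T j k < t <= grid T j k.+1 then u (grid T j k) else 0).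

(** The family [v] is arbitrary, so that one evaluation serves the values at grid points, the
    increments of second moments and the lagged averages. *)
Lemma lstep_eval j t : 0 < t -> t <= T -> exists k : 'I_(2 ^ j),
  (grid T j k < t <= grid T j k.+1) /\ (forall v : nat -> R,
   \sum_(k < 2 ^ j) (if grid T j k < t <= grid T j k.+1 then v k else 0) = v k).
Proof.
move=> t0 tT.
have ex : exists m, t <= grid T j m by exists (2 ^ j)%N; rewrite gridT.
case: (ex_minnP ex) => m tm mmin.
have m0 : (0 < m)%N.
  by rewrite lt0n; apply/eqP => m0; move: tm; rewrite m0 grid0 leNgt t0.
have mj : (m <= 2 ^ j)%N by apply: mmin; rewrite gridT.
have kj : (m.-1 < 2 ^ j)%N by rewrite prednK.
have hk : grid T j m.-1 < t <= grid T j m.-1.+1.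
  rewrite prednK// tm andbT ltNge; apply/negP => /mmin.
  by rewrite leqNgt ltn_predL m0.
exists (Ordinal kj); split => //= v.
rewrite (bigD1 (Ordinal kj))//= hk big1 ?addr0// => i /eqP ik.
case: ifPn => // /andP[h1 h2]; exfalso; apply: ik; apply: val_inj => /=.
move/andP: hk => [h3 h4].
apply/eqP; rewrite eqn_leq; apply/andP; split; rewrite leqNgt; apply/negP => h.
  by have := grid_mono T0 j h; rewrite leNgt (lt_le_trans h1)//.
by have := grid_mono T0 j h; rewrite leNgt (lt_le_trans h3)//.
Qed.

Lemma grid_step j k : grid T j k.+1 - grid T j k <= T / 2 ^+ j.
Proof.
rewrite /grid -mulrBl ler_pM2r ?invr_gt0 ?exprn_gt0//.
rewrite -mulrBr ger_pMr// lerBlDr -[1]/(1%:R) -natrD ler_nat.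
by rewrite add1n -minnSS leq_min geq_minl/= (leq_trans (geq_minr _ _)).
Qed.

Lemma lstep0 j (u : R -> R) : lstep j u 0 = u 0.
Proof.
rewrite /lstep eqxx big1 ?addr0// => k _; case: ifPn => // /andP[h _].
by move: h; rewrite ltNge grid_ge0.
Qed.

Lemma lstep_out j (u : R -> R) t : t \notin `[0, T] -> lstep j u t = 0.
Proof.
move=> tT; rewrite /lstep; case: eqP => [t0|_].
  by move: tT; rewrite t0 itv0T.
rewrite add0r big1// => k _; case: ifPn => // /andP[h1 h2]; exfalso.
move: tT; rewrite in_itv/= (ltW (le_lt_trans (grid_ge0 T0 _ _) h1)).
by rewrite (le_trans h2)// grid_leT.
Qed.

Lemma pow2_small (r : R) : 0 < r -> exists N, forall j, (N <= j)%N -> T / 2 ^+ j < r.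
Proof.
move=> r0; have : T / 2 ^+ j @[j --> \oo] --> (0 : R).
  rewrite -[X in _ --> X](mulr0 T); apply: cvgMr.
  under eq_fun do rewrite -exprVn.
  by apply: cvg_expr; rewrite ger0_norm//; lra.
move=> /cvgrPdist_lt/(_ r r0)[N _ hN]; exists N => j Nj.
have := hN j Nj; rewrite sub0r normrN ger0_norm//.
by rewrite divr_ge0 ?exprn_ge0// ltW.
Qed.

Lemma lstep_cvg (u : R -> R) t : t \in `[0, T] ->
  tends `[0, T]%classic u t (u t) -> lstep j u t @[j --> \oo] --> u t.
Proof.
rewrite in_itv/= => /andP[]; rewrite le_eqVlt => /predU1P[<-|t0] tT hu.
  by under eq_fun do rewrite lstep0; exact: cvg_cst.
apply/cvgrPdist_le => e /hu[r r0 hr].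
have [N hN] := pow2_small r0; exists N => // j /= Nj.
rewrite /lstep gt_eqF// add0r.
have [k [/andP[h1 h2] hv]] := lstep_eval j t0 tT; rewrite (hv (fun m => u (grid T j m))).
rewrite distrC; apply: hr; first exact: grid_itv.
rewrite distrC ger0_norm ?subr_ge0 ?(ltW h1)//.
by apply: le_lt_trans (hN j Nj); have := grid_step j k; lra.
Qed.

Lemma gmeas_lstep j (u : Omega -> R -> R) : (forall t, t \in `[0, T] -> gmeas (F t) (u ^~ t)) ->
  gmeas Gpred (fun z => lstep j (u z.1) z.2).
Proof.
move=> hu; apply: measurable_funD; first by apply: (gmeas_at0 (z := u ^~ 0)); apply: hu; exact: itv0T.
apply: measurable_sum => k; have := grid_mono T0 j (leqnSn k).
rewrite le_eqVlt => /predU1P[e|h].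
  rewrite (_ : (fun _ => _) = fun=> 0); first exact: measurable_cst.
  apply/funext => z; case: ifPn => // /andP[h1 h2].
  by move: h1; rewrite e ltNge h2.
by apply: (gmeas_rect (z := u ^~ (grid T j k))) => //; [exact: grid_ge0|exact: grid_leT|apply: hu; exact: grid_itv].
Qed.

Lemma gmeas_cvg (G : set (set (Omega * R))) (f : nat -> Omega * R -> R) g :
  (forall n, gmeas G (f n)) -> (forall z, f n z @[n --> \oo] --> g z) -> gmeas G g.
Proof. by move=> hf hc; apply: (measurable_fun_cvg hf) => z _; exact: (hc z). Qed.

Lemma continuous_predictable k l (U : process R Omega k l) : adapted T F U ->
  (forall w, {within `[0, T], continuous (U w)}) -> predictable T F U.
Proof.
move=> /(adapted_gmeas _ hF) aU cU; apply/predictableP => i j.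
apply: (@gmeas_cvg _ (fun n z => lstep n (fun t => U z.1 t i j) z.2)).
  by move=> n; apply: (@gmeas_lstep n (fun w t => U w t i j)) => t tT; exact: aU.
move=> [w t]; rewrite /ext/=; case: ifPn => tT; last first.
  by under eq_fun do rewrite lstep_out//; rewrite mxE; exact: cvg_cst.
by apply: (@lstep_cvg (fun t => U w t i j)) => //; exact: ((within_continuousP T (U w)).1 (cU w)).
Qed.

Lemma predictableD k l (U V : process R Omega k l) : predictable T F U -> predictable T F V ->
  predictable T F (fun w t => U w t + V w t).
Proof.
move=> /predictableP hU /predictableP hV; apply/predictableP => i j.
rewrite (_ : (fun z => _) = (fun z => ext U z i j + ext V z i j)).
  exact: (measurable_funD (hU i j) (hV i j)).
by apply/funext => z; rewrite /ext; case: ifP => _; rewrite !mxE ?addr0.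
Qed.

Lemma predictableN k l (U : process R Omega k l) : predictable T F U ->
  predictable T F (fun w t => - U w t).
Proof.
move=> /predictableP hU; apply/predictableP => i j.
rewrite (_ : (fun z => _) = (fun z => - ext U z i j)).
  exact: (measurable_funN (hU i j)).
by apply/funext => z; rewrite /ext; case: ifP => _; rewrite !mxE ?oppr0.
Qed.

Lemma predictableB k l (U V : process R Omega k l) : predictable T F U -> predictable T F V ->
  predictable T F (fun w t => U w t - V w t).
Proof. by move=> hU hV; apply: predictableD => //; exact: predictableN. Qed.

Lemma predictable_mmeas k l (U : process R Omega k l) : predictable T F U -> mmeas (ext U).
Proof. by move=> /predictableP h i j; exact: gmeas_pred. Qed.

Lemma extB k l (U V : process R Omega k l) :
  ext (fun w t => U w t - V w t) = fun z => ext U z - ext V z.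
Proof. by apply/funext => z; rewrite /ext; case: ifP; rewrite ?subr0. Qed.

(** Approximation by the values at right end points on right-open cells, which converges by right
    continuity. Such steps look ahead, so they give joint measurability and not predictability. *)
Lemma rcproc_mmeas k l (U : process R Omega k l) : rcproc T U -> mmeas (ext U).
Proof.
move=> [mU cU] i j.
pose f n (z : Omega * R) : R := \sum_(k < 2 ^ n) (if grid T n k <= z.2 < grid T n k.+1
   then U z.1 (grid T n k.+1) i j else 0) + (if z.2 == T then U z.1 T i j else 0).
have mif (q : R -> bool) (v : Omega -> R) : measurable_fun setT q -> measurable_fun setT v ->
    measurable_fun setT (fun z : Omega * R => if q z.2 then v z.1 else 0).
  move=> mq mv; apply: measurable_fun_ifT => //.
  - exact: (measurableT_comp mq measurable_snd).
  - exact: (measurableT_comp mv measurable_fst).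
apply: (@measurable_fun_cvg _ _ _ _ f).
  move=> n; apply: measurable_funD; last first.
    apply: (mif (fun t : R => t == T) (fun w => U w T i j)); last by apply: mU; exact: itvTT.
    by apply: measurable_fun_eqr => //; exact: measurable_cst.
  apply: measurable_sum => k0; apply: (mif (fun t => grid T n k0 <= t < grid T n k0.+1) (fun w => U w (grid T n k0.+1) i j)).
    apply: measurable_and; first by apply: measurable_fun_ler => //; exact: measurable_cst.
    by apply: measurable_fun_ltr => //; exact: measurable_cst.
  by apply: mU; exact: grid_itv.
move=> [w t] _; rewrite /f/ext/=; case: (boolP (t \in `[0, T])) => [|tT]; last first.
  rewrite mxE; apply: cvg_near_cst; apply: nearW => n.
  rewrite big1 ?add0r; last first.
    move=> m _; case: ifPn => // /andP[h1 h2]; exfalso; move: tT; rewrite in_itv/=.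
    by rewrite (le_trans (grid_ge0 T0 _ _) h1) (le_trans (ltW h2))// grid_leT.
  by case: eqP => // e; move: tT; rewrite e itvTT.
rewrite in_itv/= => /andP[t0]; rewrite le_eqVlt => /predU1P[->|tT].
  apply: cvg_near_cst; apply: nearW => n; rewrite eqxx big1 ?add0r// => m _.
  by case: ifPn => // /andP[_]; rewrite ltNge grid_leT.
have ht : t \in `[0, T[ by rewrite in_itv/= t0.
apply/cvgrPdist_le => e /(cU w i j t ht)[r r0 hr].
have [N hN] := pow2_small r0; exists N => // n /= Nn.
have [m hm] : exists m : 'I_(2 ^ n), grid T n m <= t < grid T n m.+1.
  have ex : exists m, t < grid T n m by exists (2 ^ n)%N; rewrite gridT.
  case: (ex_minnP ex) => m tm mmin.
  have m0 : (0 < m)%N.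
    by rewrite lt0n; apply/eqP => m0; move: tm; rewrite m0 grid0 ltNge t0.
  have mj : (m <= 2 ^ n)%N by apply: mmin; rewrite gridT.
  have kj : (m.-1 < 2 ^ n)%N by rewrite prednK.
  exists (Ordinal kj) => /=; rewrite prednK// tm andbT leNgt; apply/negP => /mmin.
  by rewrite leqNgt ltn_predL m0.
rewrite (bigD1 m)//= hm big1 ?addr0; last first.
  move=> q /eqP qm; case: ifPn => // /andP[h1 h2]; exfalso; apply: qm; apply: val_inj => /=.
  move/andP: hm => [h3 h4].
  apply/eqP; rewrite eqn_leq; apply/andP; split; rewrite leqNgt; apply/negP => h.
    by have := grid_mono T0 n h; rewrite leNgt (le_lt_trans h1)//.
  by have := grid_mono T0 n h; rewrite leNgt (le_lt_trans h3)//.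
rewrite lt_eqF// addr0 distrC; move/andP: hm => [h3 h4]; apply: hr => //.
rewrite gtr0_norm ?subr_gt0//; apply: le_lt_trans (hN n Nn).
by have := grid_step n m; lra.
Qed.

End predictable.

(** * The product measure and predictable versions *)

Section Rintegral_section.
Context {R : realType} {d : measure_display} {S : measurableType d}.
Local Notation leb := (@lebesgue_measure R).

(** Tonelli's theorem for the positive and the negative part. The base space is arbitrary; taken
    with the sigma-algebra [F t], the lemma shows that time integrals up to [t] are adapted. *)
Lemma measurable_Rintegral_section (g : S * R -> R) : measurable_fun setT g ->
  measurable_fun setT (fun x => \int[leb]_y g (x, y)).
Proof.
move=> mg; apply: (@measurableT_comp _ _ _ _ _ _ fine) => //.
rewrite (_ : (fun x => \int[leb]_y (g (x, y))%:E)%E = (fun x =>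
   \int[leb]_y (g^\+ (x, y))%:E - \int[leb]_y (g^\- (x, y))%:E)%E); last first.
  apply/funext => x; rewrite integralE; congr (_ - _)%E; apply: eq_integral => y _.
    by rewrite -[RHS]/((EFin \o (fun y => g (x, y))^\+) y) -funerpos.
  by rewrite -[RHS]/((EFin \o (fun y => g (x, y))^\-) y) -funerneg.
apply: emeasurable_funB.
  apply: (measurable_fun_fubini_tonelli_F (m2 := leb) (fun z => (g^\+ z)%:E)).
    by apply/measurable_EFinP; exact: measurable_funrpos.
  by move=> z; rewrite lee_fin funrpos_ge0.
apply: (measurable_fun_fubini_tonelli_F (m2 := leb) (fun z => (g^\- z)%:E)).
  by apply/measurable_EFinP; exact: measurable_funrneg.
by move=> z; rewrite lee_fin funrneg_ge0.
Qed.

End Rintegral_section.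

(* [P \x leb] lives over [measurableTypeR R]; this copy lives over the default
   measurable structure of [R], so that both can be compared with [Omega * R]. *)
Definition dPdt {R : realType} {dsp} {Omega : measurableType dsp}
  (P : probability Omega R) (A : set (Omega * R)) : \bar R := (P \x @lebesgue_measure R)%E A.

Section dPdt_measure.
Context {R : realType} {dsp} {Omega : measurableType dsp}.
Variable P : probability Omega R.

Let PL : {measure set (Omega * measurableTypeR R)%type -> \bar R} :=
  [the {measure set _ -> \bar R} of (P \x @lebesgue_measure R)%E].

Let dPdt0 : dPdt P set0 = 0%E. Proof. exact: (measure0 PL). Qed.

Let dPdt_ge0 A : (0 <= dPdt P A)%E. Proof. exact: (measure_ge0 PL). Qed.

Let dPdt_sigma_additive : semi_sigma_additive (dPdt P).
Proof. exact: (@measure_semi_sigma_additive _ _ _ PL). Qed.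

HB.instance Definition _ := isMeasure.Build _ (Omega * R)%type R (dPdt P)
  dPdt0 dPdt_ge0 dPdt_sigma_additive.

Lemma integral_dPdt (f : Omega * R -> \bar R) : measurable_fun setT f -> (forall z, 0 <= f z)%E ->
  (\int[dPdt P]_z f z = \int[P \x @lebesgue_measure R]_z f z)%E.
Proof.
move=> mf f0; pose idm (z : Omega * measurableTypeR R) : Omega * R := z.
have midm : measurable_fun [set: Omega * measurableTypeR R] (idm : _ -> (Omega * R)%type).
  by move=> _ Y mY; rewrite setTI.
have := @ge0_integral_pushforward _ _ _ _ _ _ midm PL setT f measurableT mf (fun y _ => f0 y).
by [].
Qed.

End dPdt_measure.

Section H2norm.
Context {R : realType} {dsp} {Omega : measurableType dsp}
  (P : probability Omega R) (T : R) (F : R -> set (set Omega)).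
Hypothesis T0 : 0 < T.
Hypothesis hP : measure_is_complete P.
Hypothesis hF : usual_filtration P T F.
Local Notation leb := (@lebesgue_measure R).
Local Notation PL := (dPdt P).

Lemma ae_dPdtE (Q : Omega -> R -> Prop) : ae_dPdt P T Q =
  {ae PL, forall z, z.2 \in `[0, T] -> Q z.1 z.2}.
Proof. by []. Qed.

Lemma tonelli_P (f : Omega * R -> R) : measurable_fun setT f -> (forall z, 0 <= f z) ->
  (\int[PL]_z (f z)%:E = \int[P]_w \int[leb]_t (f (w, t))%:E)%E.
Proof.
move=> mf f0; have me : measurable_fun setT (EFin \o f) by exact/measurable_EFinP.
have f0' z : (0 <= (EFin \o f) z)%E by rewrite lee_fin.
rewrite integral_dPdt//; exact: (fubini_tonelli1 (m1 := P) (m2 := leb) (EFin \o f) me f0').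
Qed.

Lemma tonelli_leb (f : Omega * R -> R) : measurable_fun setT f -> (forall z, 0 <= f z) ->
  (\int[PL]_z (f z)%:E = \int[leb]_t \int[P]_w (f (w, t))%:E)%E.
Proof.
move=> mf f0; have me : measurable_fun setT (EFin \o f) by exact/measurable_EFinP.
have f0' z : (0 <= (EFin \o f) z)%E by rewrite lee_fin.
rewrite integral_dPdt//; have := fubini_tonelli1 (m1 := P) (m2 := leb) (EFin \o f) me f0'.
have := fubini_tonelli (m1 := P) (m2 := leb) (EFin \o f) me f0'.
by move=> <- <-.
Qed.

Lemma vnn2_normH2 k l (U : process R Omega k l) : mmeas (ext T U) ->
  vnn2 PL (ext T U) = (\int[P]_w \int[leb]_(t in `[0%R, T]) (hsnorm (U w t) ^+ 2)%:E)%E.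
Proof.
move=> mU; rewrite /vnn2 (tonelli_P (f := fun z => hsnorm (ext T U z) ^+ 2)); first last.
- by move=> z; exact: sqr_ge0.
- exact: mmeas_sqr.
apply: eq_integral => w _; rewrite [RHS]integral_mkcond; apply: eq_integral => t _.
rewrite patchE /ext/= mem_setE; case: ifP => // _.
by rewrite hsnorm0 expr0n.
Qed.

Lemma vnn2_time k l (U : process R Omega k l) : mmeas (ext T U) ->
  vnn2 PL (ext T U) = (\int[leb]_(t in `[0%R, T]) vnn2 P (U ^~ t))%E.
Proof.
move=> mU; rewrite /vnn2 (tonelli_leb (f := fun z => hsnorm (ext T U z) ^+ 2)); first last.
- by move=> z; exact: sqr_ge0.
- exact: mmeas_sqr.
rewrite [RHS]integral_mkcond; apply: eq_integral => t _.
rewrite patchE /ext/= mem_setE; case: ifP => // _.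
by under eq_integral do rewrite hsnorm0 expr0n; rewrite integral0.
Qed.

Lemma normH2E k l (U : process R Omega k l) : mmeas (ext T U) ->
  normH2 P T U = sqrte (vnn2 PL (ext T U)).
Proof. by move=> mU; rewrite vnn2_normH2. Qed.

Lemma H2P k l (U : process R Omega k l) : H2 P T F U <-> predictable T F U /\ vL2 PL (ext T U).
Proof.
have e : predictable T F U -> (normH2 P T U < +oo)%E = (vnn2 PL (ext T U) < +oo)%E.
  move=> /(predictable_mmeas T0 hF) mU; rewrite normH2E//.
  rewrite -ge0_fin_numE ?sqrte_ge0// sqrte_fin_num ?vnn2_ge0//.
  by rewrite ge0_fin_numE// vnn2_ge0.
split=> [[pU hU]|[pU [mU hU]]]; split => //; last by rewrite e.
by split; [exact: (predictable_mmeas T0 hF)|rewrite -e].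
Qed.

Lemma measurable_vnn2_time k l (U : process R Omega k l) : mmeas (ext T U) ->
  measurable_fun `[0%R, T]%classic (fun t => vnn2 P (U ^~ t)).
Proof.
move=> mU; apply: (@eq_measurable_fun _ _ _ _ _ (fun t => \int[P]_w (hsnorm (ext T U (w, t)) ^+ 2)%:E)%E).
  by move=> t /[!inE]/= tT; apply: eq_integral => w _; rewrite /ext/= tT.
apply: (measurable_funS measurableT) => //.
apply: (measurable_fun_fubini_tonelli_G (m1 := P) (fun z => (hsnorm (ext T U z) ^+ 2)%:E)).
  exact: mmeas_sqrE.
by move=> z; rewrite lee_fin sqr_ge0.
Qed.

Lemma vnn2_time_le k l (U : process R Omega k l) (c : R) : 0 <= c -> mmeas (ext T U) ->
  (forall t, t \in `[0, T] -> (vnn2 P (U ^~ t) <= c%:E)%E) -> (vnn2 PL (ext T U) <= (T * c)%:E)%E.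
Proof.
move=> c0 mU h; rewrite vnn2_time//.
apply: (@le_trans _ _ (\int[leb]_(t in `[0%R, T]) (cst c%:E t))%E).
  apply: ge0_le_integral => //.
  - by move=> t _; exact: vnn2_ge0.
  - exact: measurable_vnn2_time.
by rewrite integral_cst//= lebesgue_measure_itv/= lte_fin T0 oppr0 adde0 -EFinM mulrC.
Qed.

Lemma vnn2_le_nS k l (U : process R Omega k l) : rcproc T U -> (nS P T U < +oo)%E ->
  (vnn2 PL (ext T U) <= T%:E * nS P T U)%E.
Proof.
move=> rU hU; have n0 := nS_ge0 P T0 U.
have f : nS P T U \is a fin_num by rewrite ge0_fin_numE.
rewrite -(fineK f) -EFinM; apply: vnn2_time_le; first exact: fine_ge0.
  exact: rcproc_mmeas.
by move=> t tT; rewrite fineK//; exact: vnn2_nS.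
Qed.

Lemma ae_section (Q : Omega -> R -> Prop) : ae_dPdt P T Q ->
  {ae P, forall w, {ae leb, forall t, t \in `[0, T] -> Q w t}}.
Proof.
rewrite ae_dPdtE => -[A [mA A0 hA]].
have mX : measurable_fun setT (fun w => leb (xsection A w)).
  exact: measurable_fun_xsection.
have : (\int[P]_w leb (xsection A w) = 0)%E by rewrite -A0.
have /ae_eq_integral_abs := mX => /(_ P measurableT)[h _] e.
have {}h := h _; move: h => /(_ _); rewrite (_ : (\int[P]_(x in setT) `|leb (xsection A x)|)%E = 0%E); last first.
  by rewrite -[RHS]e; apply: eq_integral => w _; rewrite gee0_abs.
move=> /(_ erefl); apply: filterS => w /(_ I) hw.
exists (xsection A w); split => //; first exact: measurable_xsection.
move=> t /= ht; rewrite /xsection/= inE; apply: hA => /= hq; apply: ht => tT.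
exact: hq.
Qed.

Lemma predictable_of_gmeas k l (g : 'I_k -> 'I_l -> Omega * R -> R) :
  (forall i j, gmeas (Gpred T F) (g i j)) ->
  predictable T F (fun w t => \matrix_(i, j) g i j (w, t)).
Proof.
move=> h i j B mB.
have /(gmeasP _ (Gpred_sigma T F))/(_ B mB)[_] := h i j.
congr (predictable_sets _ _ (_ `&` _)); apply/seteqP.
by split; move=> [w t] /=; rewrite mxE.
Qed.

Lemma ext_ae k l (U V : process R Omega k l) :
  ae_dPdt P T (fun w t => U w t = V w t) <-> {ae PL, forall z, ext T U z = ext T V z}.
Proof.
rewrite ae_dPdtE; split=> h0; apply: filterS h0 => -[w t]/=.
  by move=> h; rewrite /ext/=; case: ifP => // tT; exact: h.
by rewrite /ext/= => + tT; rewrite tT.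
Qed.

Lemma mart_sqdist (Z : R -> Omega -> R) s t : mart P T F Z -> 0 <= s -> s <= t -> t <= T ->
  \int[P]_w ((Z t w - Z s w) ^+ 2) = \int[P]_w (Z t w ^+ 2) - \int[P]_w (Z s w ^+ 2).
Proof.
move=> [G L o] s0 st tT.
have sI : s \in `[0, T] by rewrite in_itv/= s0 (le_trans st).
have tI : t \in `[0, T] by rewrite in_itv/= tT (le_trans s0).
have Ls := L s sI; have Lt := L t tI; have Ld : L2 P (fun w => Z t w - Z s w) by exact: L2B.
have := o s t (Z s) s0 st tT (G s sI) Ls => h.
have -> : \int[P]_w ((Z t w - Z s w) ^+ 2) = \int[P]_w (Z t w ^+ 2) - \int[P]_w (Z s w ^+ 2) -
    2 * \int[P]_w (Z s w * (Z t w - Z s w)).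
  rewrite -RintegralZl//; last exact: L2M.
  rewrite -RintegralB//; [|exact: int1_sq|exact: int1_sq].
  rewrite -RintegralB//; [|by apply: int1B; exact: int1_sq|by apply: int1Z; exact: L2M].
  by apply: eq_Rintegral => w _; ring.
by rewrite h; lra.
Qed.

(** On the cell after [t_k] the mean squared error is at most the increase of [E Z^2] over the cell,
    by orthogonality of increments. These increases telescope, and the cell length [T / 2^j] remains
    as the rate. *)
Lemma lstep_mart_dist (Z : R -> Omega -> R) j : mart P T F Z ->
  measurable_fun setT (fun z : Omega * R => if z.2 \in `[0, T] then Z z.2 z.1 else 0) ->
  (nn2 PL (fun z => (if z.2 \in `[0, T] then Z z.2 z.1 else 0) - lstep T j (Z ^~ z.1) z.2)%R
    <= (T / 2 ^+ j * \int[P]_w (Z T w ^+ 2))%:E)%E.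
Proof.
move=> mZ mE; have [GZ LZ _] := mZ.
have Gs : gmeas (Gpred T F) (fun z => lstep T j (Z ^~ z.1) z.2).
  by apply: (@gmeas_lstep _ _ _ P T F T0 hF _ (fun w t => Z t w)).
have ms := gmeas_pred Gs.
rewrite /nn2 (tonelli_leb (f := fun z => _ ^+ 2)); first last.
- by move=> z; exact: sqr_ge0.
- by apply: measurable_funX; exact: measurable_funB.
pose m t := \int[P]_w (Z t w ^+ 2).
pose a k := m (grid T j k.+1) - m (grid T j k).
have gm k : 0 <= a k.
  rewrite /a /m -mart_sqdist//; [|exact: grid_ge0|exact: grid_mono|exact: grid_leT].
  by apply: Rintegral_ge0 => w _; exact: sqr_ge0.
pose b t : R := \sum_(k < 2 ^ j) (if grid T j k < t <= grid T j k.+1 then a k else 0).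
have mb : measurable_fun setT b.
  apply: measurable_sum => k; apply: measurable_fun_ifT; try exact: measurable_cst.
  apply: measurable_and; first by apply: measurable_fun_ltr => //; exact: measurable_cst.
  by apply: measurable_fun_ler => //; exact: measurable_cst.
apply: (@le_trans _ _ (\int[leb]_t (b t)%:E)%E).
  apply: ge0_le_integral => //.
  - by move=> t _; apply: integral_ge0 => w _; rewrite lee_fin sqr_ge0.
  - apply: (measurable_fun_fubini_tonelli_G (m1 := P)
      (fun z => (((if z.2 \in `[0, T] then Z z.2 z.1 else 0) - lstep T j (Z ^~ z.1) z.2)^+2)%:E)).
      by apply: measurable_sqE; exact: measurable_funB.
    by move=> z; rewrite lee_fin sqr_ge0.
  - exact/measurable_EFinP.
  move=> t _ /=.
  have b0 : 0 <= b t by apply: sumr_ge0 => k _; case: ifP.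
  case: (boolP (t \in `[0, T])) => tT; last first.
    under eq_integral do rewrite lstep_out// subrr expr0n.
    by rewrite integral0 lee_fin.
  move: tT; rewrite in_itv/= => /andP[]; rewrite le_eqVlt => /predU1P[<-|t0] tT.
    under eq_integral do rewrite lstep0// subrr expr0n/=.
    by rewrite integral0 lee_fin; apply: sumr_ge0 => k _; case: ifP.
  have [k [/andP[h1 h2] hv]] := lstep_eval T0 j t0 tT.
  have tI : t \in `[0, T] by rewrite in_itv/= tT ltW.
  rewrite (eq_integral (fun w => ((Z t w - Z (grid T j k) w) ^+ 2)%:E)); last first.
    by move=> w _; rewrite /lstep (gt_eqF t0) add0r (hv (fun m => Z (grid T j m) w)).
  rewrite [leLHS]nn2E; last by apply: L2B; apply: LZ => //; exact: grid_itv.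
  rewrite lee_fin /b hv mart_sqdist//; [|exact: grid_ge0|exact: ltW].
  have := @mart_sqdist Z t (grid T j k.+1) mZ (ltW t0) h2 (grid_leT T0 j _).
  have : 0 <= \int[P]_w ((Z (grid T j k.+1) w - Z t w) ^+ 2).
    by apply: Rintegral_ge0 => w _; exact: sqr_ge0.
  by rewrite /a /m => + e; rewrite e; lra.
under eq_integral do rewrite -sumEFin.
rewrite ge0_integral_sum//; first last.
- by move=> k t _; rewrite lee_fin; case: ifP.
- move=> k; apply/measurable_EFinP; apply: measurable_fun_ifT; try exact: measurable_cst.
  apply: measurable_and; first by apply: measurable_fun_ltr => //; exact: measurable_cst.
  by apply: measurable_fun_ler => //; exact: measurable_cst.
apply: (@le_trans _ _ (\sum_(k < 2 ^ j) (T / 2 ^+ j * a k)%:E)%E).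
  apply: lee_sum => k _.
  have -> : (\int[leb]_t (if grid T j k < t <= grid T j k.+1 then a k else 0)%:E =
      \int[leb]_t ((a k)%:E * (\1_(`]grid T j k, grid T j k.+1]%classic) t)%:E))%E.
    apply: eq_integral => t _; rewrite -EFinM indicE mem_setE in_itv/=.
    by case: ifP => _; rewrite ?mulr1 ?mulr0.
  rewrite ge0_integralZl_EFin//; last by apply/measurable_EFinP; exact: measurable_indic.
  have -> : (\int[leb]_x (\1_(`]grid T j k, grid T j k.+1]%classic) x)%:E =
      leb (`]grid T j k, grid T j k.+1]%classic))%E by rewrite integral_indic// setIT.
  rewrite lebesgue_measure_itv/= lte_fin.
  case: ifP => h; last by rewrite mule0 lee_fin mulr_ge0// divr_ge0 ?exprn_ge0// ltW.
  by rewrite -EFinB -EFinM lee_fin mulrC ler_wpM2r//; exact: grid_step.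
rewrite sumEFin lee_fin -mulr_sumr; apply: ler_wpM2l.
  by rewrite divr_ge0 ?exprn_ge0// ltW.
rewrite -(big_mkord xpredT (fun k => m (grid T j k.+1) - m (grid T j k))) telescope_sumr//.
rewrite gridT// grid0 /m lerBlDr lerDl.
by apply: Rintegral_ge0 => w _; exact: sqr_ge0.
Qed.

(** Left-point steps are predictable and converge to the martingale in mean square over dP dt; along
    a fast sequence of levels they have a predictable limit, equal to the martingale almost
    everywhere. *)
Lemma mart_predictable_entry (Z : R -> Omega -> R) : mart P T F Z ->
  measurable_fun setT (fun z : Omega * R => if z.2 \in `[0, T] then Z z.2 z.1 else 0) ->
  exists2 g, gmeas (Gpred T F) g &
    {ae PL, forall z, g z = if z.2 \in `[0, T] then Z z.2 z.1 else 0}.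
Proof.
move=> mZ mE; set e := (fun z : Omega * R => _) in mE.
pose B := \int[P]_w (Z T w ^+ 2).
have B0 : 0 <= B by apply: Rintegral_ge0 => w _; exact: sqr_ge0.
(* [c] absorbs the factor [T * B], so that the grid of level [4 n + c] has squared error at most
   [16^-n / 4]. *)
have [c hc] : exists c : nat, T * B * 4 <= 2 ^+ c.
  exists (Num.truncn (T * B * 4)).+1.
  have x0 : 0 <= T * B * 4 by rewrite !mulr_ge0// ltW.
  have /andP[_ h] := truncn_itv x0; rewrite (le_trans (ltW h))//.
  by rewrite -natrX ler_nat ltnW// ltn_expl.
pose f n (z : Omega * R) := lstep T (4 * n + c) (Z ^~ z.1) z.2.
have Gf n : gmeas (Gpred T F) (f n).
  by apply: (@gmeas_lstep _ _ _ P T F T0 hF _ (fun w t => Z t w)); case: mZ.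
have mf n := gmeas_pred (Gf n).
have hd n : (nn2 PL (fun z => e z - f n z)%R <= (16^-1 ^+ n / 4)%:E)%E.
  apply: le_trans (lstep_mart_dist (4 * n + c) mZ mE) _; rewrite lee_fin -/B.
  have p : 0 < 2 ^+ c :> R by rewrite exprn_gt0.
  have q : 16^-1 ^+ n = (2 ^+ (4 * n))^-1 :> R by rewrite exprVn exprM; congr ((_ ^+ _)^-1); lra.
  rewrite q exprD -/B; have p2 : 0 < 2 ^+ (4 * n) :> R by rewrite exprn_gt0.
  move: (2 ^+ c) (2 ^+ (4 * n)) hc p p2 => x y h1 h2 h3.
  rewrite (_ : T / (y * x) * B = y^-1 * (T * B / x)); last by rewrite invfM; ring.
  rewrite ler_wpM2l ?invr_ge0 ?(ltW h3)// ler_pdivrMr//; lra.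
have mEf n : measurable_fun setT (fun z => e z - f n z) by exact: measurable_funB.
have hn n : (nn2 PL (fun z => f n.+1 z - f n z)%R <= (16^-1 ^+ n)%:E)%E.
  rewrite (_ : (fun z => f n.+1 z - f n z) = fun z => (e z - f n z) - (e z - f n.+1 z)); last first.
    by apply/funext => z; ring.
  apply: le_trans (nn2B PL (mEf n) (mEf n.+1)) _.
  apply: (@le_trans _ _ (2%:E * (16^-1 ^+ n / 4)%:E + 2%:E * (16^-1 ^+ n.+1 / 4)%:E)%E).
    by apply: leeD; rewrite lee_wpmul2l.
  rewrite -!EFinM -EFinD lee_fin exprS.
  have : 0 <= 16^-1 ^+ n :> R by rewrite exprn_ge0.
  by lra.
have [g [Q [Gg IQ Q0 hz]]] := fast_L2 (Gpred_sub (T := T) (F := F)) Gf hn.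
exists g => //.
have hz2 : {ae PL, forall x, forall n, `|g x - f n x| <= 2 * Num.sqrt (Q x) * 2^-1 ^+ n}.
  by apply: filterS hz => x [].
have hzd := fast_L2_cvg (Gpred_sub (T := T) (F := F)) Gf Gg IQ Q0 hz2.
have mg := gmeas_pred Gg.
have mge : measurable_fun setT (fun z => g z - e z) by exact: measurable_funB.
suff : nn2 PL (fun z => g z - e z) = 0%E.
  move=> /(nn2_eq0 mge); apply: filterS => z /eqP.
  by rewrite subr_eq0 => /eqP.
apply/eqP; rewrite eq_le nn2_ge0 andbT; apply/lee_addgt0Pr => r r0; rewrite add0e.
pose I := \int[PL]_x Q x.
have I0 : 0 <= I by exact: Rintegral_ge0.
have [n hn2] : exists n, (8 * I + 1) * 4^-1 ^+ n <= r.
  have : (8 * I + 1) * 4^-1 ^+ n @[n --> \oo] --> (0 : R).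
    rewrite -[X in _ --> X](mulr0 (8 * I + 1)); apply: cvgMr.
    by apply: cvg_expr; rewrite ger0_norm//; lra.
  move=> /cvgrPdist_le/(_ r r0)[N _ /(_ N (leqnn N))]; rewrite sub0r normrN => h.
  by exists N; rewrite (le_trans (ler_norm _)).
rewrite (_ : (fun z => g z - e z) = fun z => (g z - f n z) - (e z - f n z)); last first.
  by apply/funext => z; ring.
apply: le_trans (nn2B PL (measurable_funB mg (mf n)) (mEf n)) _.
apply: (@le_trans _ _ (2%:E * (4 * 4^-1 ^+ n * I)%:E + 2%:E * (16^-1 ^+ n / 4)%:E)%E).
  apply: leeD; rewrite lee_wpmul2l//; exact: hzd.
rewrite -!EFinM -EFinD lee_fin; apply: le_trans hn2.
have h16 : 16^-1 ^+ n <= 4^-1 ^+ n :> R by rewrite lerXn2r// ?nnegrE//; lra.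
have : 0 <= 16^-1 ^+ n :> R by rewrite exprn_ge0.
by move: h16; move: (16^-1 ^+ n) (4^-1 ^+ n) => x y; lra.
Qed.

Lemma M2_predictable_version k l (M : process R Omega k l) : M2 P T F M ->
  exists G, predictable_version P T F M G.
Proof.
move=> hM; have mm := rcproc_mmeas T0 (M2_rcproc hF hM).
have /choice[g hg] : forall ij : 'I_k * 'I_l, exists g, gmeas (Gpred T F) g /\
    {ae PL, forall z, g z = ext T M z ij.1 ij.2}.
  move=> [i j]; have [|g Gg hg] := @mart_predictable_entry (fun t w => M w t i j) (M2_mart hF i j hM).
    rewrite (_ : (fun z => _) = fun z => ext T M z i j); first exact: mm.
    by apply/funext => z; rewrite /ext; case: ifP; rewrite ?mxE.
  exists g; split => //; apply: filterS hg => z -> /=.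
  by rewrite /ext; case: ifP; rewrite ?mxE.
exists (fun w t => \matrix_(i, j) g (i, j) (w, t)); split.
  by apply: (predictable_of_gmeas (g := fun i j => g (i, j))) => i j; case: (hg (i, j)).
rewrite ae_dPdtE; have : {ae PL, forall z, forall ij, g ij z = ext T M z ij.1 ij.2}.
  have hall : forall ij : 'I_k * 'I_l, {ae PL, forall z, g ij z = ext T M z ij.1 ij.2}.
    by move=> ij; case: (hg ij).
  exact: filter_forall.
apply: filterS => -[w t] h /= tT; apply/matrixP => i j; rewrite mxE h /ext/= tT//.
Qed.

(** The sets whose part before [t] is measurable for [F t] times Borel form a sigma-algebra that
    contains the generators: a rectangle over []s, u]] with [s < t] has its base in [F s], and one
    with [t <= s] does not meet [0, t]. *)
Lemma predictable_progressive t (A : set (Omega * R)) : t \in `[0, T] -> predictable_sets T F A ->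
  measurable ((A `&` (setT `*` `[0, t]%classic)) : set (g_sigma_algebraType (F t) * R)).
Proof.
move=> tT; have := tT; rewrite in_itv/= => /andP[t0 tT'].
have mD u : measurable ((setT `*` `[0, u]%classic) : set (g_sigma_algebraType (F t) * R)).
  by apply: measurableX => //; exact: measurable_itv.
pose C := [set A : set (Omega * R) |
   measurable ((A `&` (setT `*` `[0, t]%classic)) : set (g_sigma_algebraType (F t) * R))].
apply: (@smallest_sub _ (sigma_algebra (setT `*` `[0, T]%classic)) _ C).
  split.
  - by rewrite /C/= set0I; exact: measurable0.
  - move=> B; rewrite /C/= => mB.
    rewrite (_ : _ `&` _ = (setT `*` `[0, t]%classic) `\` (B `&` (setT `*` `[0, t]%classic))).
      by apply: measurableD.
    apply/seteqP; split; move=> [w u] /=.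
      by move=> [[_ nB] tu]; split => // -[].
    move=> [[_ ut] nB]; split => //; split; last by move=> Bwu; apply: nB.
    split => //; move: ut; rewrite !in_itv/= => /andP[-> ut].
    exact: le_trans tT'.
  - move=> B hB; rewrite /C/= setI_bigcupl; apply: bigcup_measurable => n _; exact: hB.
have Fm E : F t E -> measurable (E : set (g_sigma_algebraType (F t))) by exact: sub_sigma_algebra.
move=> B [[E FE <-]|[s [u [E [s0 su uT FE ->]]]]]; rewrite /C/=.
  rewrite (_ : _ `&` _ = E `*` [set 0]).
    by apply: measurableX => //; apply: Fm; exact: (filt_mono hF (lexx 0) t0 tT').
  apply/seteqP; split; move=> [w v] /=; first by case=> [[? ->] _].
  by move=> [Ew ->]; rewrite in_itv/= lexx t0.
have [st|ts] := ltP s t; last first.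
  rewrite (_ : _ `&` _ = set0); first exact: measurable0.
  apply/seteqP; split => // -[w v] /= [[_]]; rewrite !in_itv/= => /andP[sv _] [_ /andP[_ vt]].
  by move: (lt_le_trans sv vt); rewrite ltNge ts.
rewrite (_ : _ `&` _ = E `*` (`]s, u]%classic `&` `[0, t]%classic)).
  apply: measurableX; first by apply: Fm; exact: (filt_mono hF s0 (ltW st) tT').
  by apply: measurableI; exact: measurable_itv.
by apply/seteqP; split; move=> [w v] /=; tauto.
Qed.

Lemma predictable_truncated t k l (H : process R Omega k l) i j : t \in `[0, T] -> predictable T F H ->
  measurable_fun [set: g_sigma_algebraType (F t) * R]
    (fun z => if z.2 \in `[0, t] then H z.1 z.2 i j else 0).
Proof.
move=> tT pH; have := tT; rewrite in_itv/= => /andP[t0 tT'].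
have mD : measurable ((setT `*` `[0, t]%classic) : set (g_sigma_algebraType (F t) * R)).
  by apply: measurableX => //; exact: measurable_itv.
move=> _ B mB; rewrite setTI.
rewrite (_ : _ @^-1` B = ((setT `*` `[0, T]%classic) `&` ((fun wt => H wt.1 wt.2 i j) @^-1` B)
    `&` (setT `*` `[0, t]%classic)) `|` (~` (setT `*` `[0, t]%classic) `&` [set _ | B 0])).
  apply: measurableU; first by apply: predictable_progressive => //; exact: pH.
  by apply: measurableI; [exact: measurableC|exact: measurable_prop].
apply/seteqP; split; move=> [w u] /=.
  case: (boolP (u \in `[0, t])) => ut.
    move=> hB; left; split => //; split => //; split => //.
    by move: ut; rewrite !in_itv/= => /andP[-> ut]; exact: le_trans tT'.
  by move=> B0; right; split => // -[].
case: (boolP (u \in `[0, t])) => ut; first by case=> [[[]]|[[]]].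
by case=> [[_ []]|[]].
Qed.

Lemma gmeas_time_integral t k l (H : process R Omega k l) i j : t \in `[0, T] -> predictable T F H ->
  gmeas (F t) (fun w => \int[leb]_(s in `[0, t]) H w s i j).
Proof.
move=> tT pH; have := measurable_Rintegral_section (predictable_truncated i j tT pH).
congr measurable_fun; apply/funext => w; rewrite [RHS]Rintegral_mkcond.
by apply: eq_Rintegral => s _; rewrite patchE mem_setE.
Qed.

Lemma predictable_adapted k l (H : process R Omega k l) : predictable T F H -> adapted T F H.
Proof.
move=> pH; apply/(adapted_gmeas _ hF) => t tT i j.
have := measurableT_comp (predictable_truncated i j tT pH)
  (measurable_fun_pair (@measurable_id _ (g_sigma_algebraType (F t)) setT) (@measurable_cst _ _ (g_sigma_algebraType (F t)) R setT t)).
congr measurable_fun; apply/funext => w /=.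
by case: ifPn => //; rewrite in_itv/= lexx andbT; move: tT; rewrite in_itv/= => /andP[->].
Qed.

End H2norm.

Lemma ae_and {R : realType} {d} {S : measurableType d} (mu : {measure set S -> \bar R})
    (A B : S -> Prop) : {ae mu, forall x, A x} -> {ae mu, forall x, B x} ->
  {ae mu, forall x, A x /\ B x}.
Proof. by move=> hA hB; apply: filterS2 hA hB => x. Qed.

(** * Operators on martingales and integrals in time *)

Section operators.
Context {R : realType} {dsp} {Omega : measurableType dsp}
  (P : probability Omega R) (T : R) (F : R -> set (set Omega)).
Hypothesis T0 : 0 < T.
Hypothesis hF : usual_filtration P T F.
Local Notation PL := (dPdt P).

Lemma sqrte_le_sqr (a b : \bar R) (K : R) : (0 <= a)%E -> (0 <= b)%E -> 0 <= K ->
  (sqrte a <= K%:E * sqrte b)%E -> (a <= (K ^+ 2)%:E * b)%E.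
Proof.
move=> a0 b0 K0 h; rewrite -(sqr_sqrte a0) -(sqr_sqrte b0) !expe2.
rewrite EFin_expe expe2 muleACA.
by apply: lee_pmul => //; exact: sqrte_ge0.
Qed.

Lemma S2_rcproc k l (U : process R Omega k l) : S2 P T F U -> rcproc T U.
Proof. by move=> [aU cU _]; exact: (rcproc_cont hF aU cU). Qed.

Lemma S2_nS k l (U : process R Omega k l) : S2 P T F U -> (nS P T U < +oo)%E.
Proof. by move=> [_ _ h]; rewrite -nS_lty. Qed.

Lemma S2_H2 k l (U : process R Omega k l) : S2 P T F U ->
  predictable T F U /\ vL2 PL (ext T U).
Proof.
move=> hU; have [aU cU _] := hU; have rU := S2_rcproc hU.
split; first exact: (continuous_predictable T0 hF aU cU).
split; first exact: rcproc_mmeas.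
apply: le_lt_trans (vnn2_le_nS T0 rU (S2_nS hU)) _.
have n0 := nS_ge0 P T0 U; have := S2_nS hU.
by case: (nS P T U) n0 => //= r _ _; rewrite -EFinM ltry.
Qed.

Context {d p : nat} (K : R).
Hypothesis K0 : 0 <= K.
Variables (o : O2_kind) (L : process R Omega d 1 -> process R Omega p 1).
Hypothesis hL : operator_condition P T F K o L.

Lemma operator_H2 M : M2 P T F M -> predictable T F (L M) /\ vL2 PL (ext T (L M)).
Proof.
move=> hM; have [h _ _] := hL; have := h M hM.
by case: (o) => /= hLM; [exact/(H2P T0 hF)|exact: S2_H2].
Qed.

(** The H^2 kind gives the factor [K^2], the S^2 kind gives [T K^2] after integration over [0, T];
    [K^2 (1 + T)] covers both. *)
Lemma operator_dist M M' : M2 P T F M -> M2 P T F M' ->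
  (vnn2 PL (ext T (fun w t => L M w t - L M' w t)%R) <=
   (K ^+ 2 * (1 + T))%:E * nS P T (fun w t => M w t - M' w t)%R)%E.
Proof.
move=> hM hM'; have n0 := nS_ge0 P T0 (fun w t => M w t - M' w t).
have [pM _] := operator_H2 hM; have [pM' _] := operator_H2 hM'.
have mD : mmeas (ext T (fun w t => L M w t - L M' w t)).
  by apply: (predictable_mmeas T0 hF); exact: (predictableB T0 hF).
have [h _ /(_ M M' hM hM')] := hL; have := h _ hM; have := h _ hM'.
case: (o) => /= h1 h2.
  rewrite normH2E// normS2E => /sqrte_le_sqr -/(_ (vnn2_ge0 _ _) n0 K0) h3.
  apply: le_trans h3 _; apply: lee_wpmul2r => //.
  by rewrite lee_fin ler_peMr ?sqr_ge0// lerDl ltW.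
rewrite !normS2E => /sqrte_le_sqr -/(_ (nS_ge0 _ T0 _) n0 K0) h3.
have rD : rcproc T (fun w t => L M w t - L M' w t) by apply: rcprocB; exact: S2_rcproc.
have fin : (nS P T (fun w t => L M w t - L M' w t)%R < +oo)%E.
  apply: le_lt_trans (nSB P T0 (S2_rcproc h2) (S2_rcproc h1)) _.
  by apply: lte_add_pinfty; apply: lte_mul_pinfty => //; [exact: S2_nS h2|exact: S2_nS h1].
apply: le_trans (vnn2_le_nS T0 rD fin) _.
apply: (@le_trans _ _ (T%:E * ((K ^+ 2)%:E * nS P T (fun w t => M w t - M' w t)%R))%E).
  by apply: lee_wpmul2l => //; rewrite lee_fin ltW.
rewrite muleA -EFinM; apply: lee_wpmul2r => //.
by rewrite lee_fin mulrC ler_wpM2l ?sqr_ge0// lerDr.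
Qed.

End operators.

Section operator_S2.
Context {R : realType} {dsp} {Omega : measurableType dsp}
  (P : probability Omega R) (T : R) (F : R -> set (set Omega)).
Hypothesis T0 : 0 < T.
Hypothesis hF : usual_filtration P T F.
Context {d p : nat} (K : R).
Hypothesis K0 : 0 <= K.

(** The factor [T] kept here makes the noise term contract, since the isometry itself supplies no
    small factor. *)
Lemma operator_S2_dist (L : process R Omega d 1 -> process R Omega p 1) M M' :
  operator_condition P T F K O2_is_S2 L -> M2 P T F M -> M2 P T F M' ->
  (vnn2 (dPdt P) (ext T (fun w t => L M w t - L M' w t)%R) <=
   (T * K ^+ 2)%:E * nS P T (fun w t => M w t - M' w t)%R)%E.
Proof.
move=> hL hM hM'; have n0 := nS_ge0 P T0 (fun w t => M w t - M' w t).
have [h _ /(_ M M' hM hM')] := hL; have h2 := h _ hM; have h1 := h _ hM'.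
rewrite /= !normS2E => /sqrte_le_sqr -/(_ (nS_ge0 _ T0 _) n0 K0) h3.
have rM := S2_rcproc hF h2; have rM' := S2_rcproc hF h1.
have rD : rcproc T (fun w t => L M w t - L M' w t) by exact: rcprocB.
have fin : (nS P T (fun w t => L M w t - L M' w t)%R < +oo)%E.
  apply: le_lt_trans (nSB P T0 rM rM') _.
  by apply: lte_add_pinfty; apply: lte_mul_pinfty => //; [exact: S2_nS h2|exact: S2_nS h1].
apply: le_trans (vnn2_le_nS T0 rD fin) _.
by rewrite EFinM -muleA; apply: lee_wpmul2l => //; rewrite lee_fin ltW.
Qed.

End operator_S2.

Section time_integral.
Context {R : realType} {dsp} {Omega : measurableType dsp}
  (P : probability Omega R) (T : R) (F : R -> set (set Omega)).
Hypothesis T0 : 0 < T.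
Hypothesis hP : measure_is_complete P.
Hypothesis hF : usual_filtration P T F.
Local Notation PL := (dPdt P).
Local Notation leb := (@lebesgue_measure R).

Lemma ae_L2_section (f : Omega * R -> R) : L2 PL f ->
  {ae P, forall w, L2 leb (fun s => f (w, s))}.
Proof.
move=> [mf hf]; have ms w : measurable_fun setT (fun s => f (w, s)).
  exact: (measurableT_comp mf (measurable_pair1 w)).
have mf2 : measurable_fun setT (fun z => f z ^+ 2) by exact: measurable_funX.
have e : nn2 PL f = (\int[P]_w nn2 leb (fun s => f (w, s)))%E.
  by rewrite /nn2 (@tonelli_P _ _ _ P (fun z => f z ^+ 2))// => z; exact: sqr_ge0.
have I : P.-integrable setT (fun w => nn2 leb (fun s => f (w, s))).
  apply/integrableP; split.
    apply: (measurable_fun_fubini_tonelli_F (m2 := leb) (fun z => (f z ^+ 2)%:E)).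
      exact/measurable_EFinP.
    by move=> z; rewrite lee_fin sqr_ge0.
  by under eq_integral do rewrite gee0_abs ?nn2_ge0//; rewrite -e.
have := integrable_ae measurableT I; apply: filterS => w /(_ Logic.I) h.
by split; [exact: ms|rewrite -ge0_fin_numE// nn2_ge0].
Qed.

Lemma L2_itv t : L2 leb (\1_(`[0, t]%classic) : R -> R).
Proof.
split; first exact: measurable_indic.
rewrite /nn2 (_ : (fun x => _) = (fun x => (\1_(`[0, t]%classic) x)%:E)).
  have -> : (\int[leb]_x (\1_(`[0, t]%classic) x)%:E = leb (`[0%R, t]%classic))%E.
    by rewrite integral_indic// setIT.
  by rewrite lebesgue_measure_itv/= lte_fin; case: ifP => _; rewrite ?ltry.
by apply/funext => x; rewrite indicE; case: (_ \in _); rewrite ?expr1n ?expr0n.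
Qed.

(* Cauchy-Schwarz on [0, T], from [0 <= int (u - m/T)^2] with [m = int u]. *)
Lemma sqr_Rintegral_le (u : R -> R) t : L2 leb u -> t \in `[0, T] ->
  (\int[leb]_(s in `[0, t]) u s) ^+ 2 <= T * \int[leb]_s (u s ^+ 2).
Proof.
move=> Lu; rewrite in_itv/= => /andP[t0 tT].
have L1 := L2_itv t.
have e1 : \int[leb]_s ((\1_(`[0, t]%classic) s : R) ^+ 2) = t.
  rewrite (_ : (fun s => _) = (\1_(`[0, t]%classic) : R -> R)).
    rewrite /Rintegral; have -> : (\int[leb]_x (\1_(`[0, t]%classic) x)%:E = leb (`[0%R, t]%classic))%E.
      by rewrite integral_indic// setIT.
    rewrite lebesgue_measure_itv/= lte_fin; case: ltP => h; first by rewrite oppr0 addr0.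
    by apply/le_anti; rewrite h t0.
  by apply/funext => x; rewrite indicE; case: (_ \in _); rewrite ?expr1n ?expr0n.
rewrite Rintegral_indic//; set m := \int[leb]_s (\1__ s * u s).
pose l := m / T; have := L2B (L2Z l L1) Lu => L.
have : 0 <= \int[leb]_s ((l * \1_(`[0, t]%classic) s - u s) ^+ 2).
  by apply: Rintegral_ge0 => s _; exact: sqr_ge0.
have -> : \int[leb]_s ((l * \1_(`[0, t]%classic) s - u s) ^+ 2) =
    l ^+ 2 * t - 2 * l * m + \int[leb]_s (u s ^+ 2).
  rewrite -[X in l ^+ 2 * X]e1 /m -!RintegralZl//; [|exact: L2M|exact: int1_sq].
  rewrite -RintegralB//; [|by apply: int1Z; exact: int1_sq|by apply: int1Z; exact: L2M].
  rewrite -RintegralD//; first by apply: eq_Rintegral => s _; ring.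
  - by apply: int1B; apply: int1Z; [exact: int1_sq|exact: L2M].
  - exact: int1_sq.
set I := \int[leb]_s (u s ^+ 2) => h.
have hl : l * T = m by rewrite /l divfK// gt_eqF.
have : l ^+ 2 * t <= l ^+ 2 * T by rewrite ler_wpM2l ?sqr_ge0.
rewrite -hl in h *; move: h => h h2.
rewrite (_ : (l * T) ^+ 2 = T * (l ^+ 2 * T)); last by ring.
by rewrite ler_wpM2l ?(ltW T0)//; lra.
Qed.

Lemma Rintegral_ext k (g : process R Omega k 1) w t i : t \in `[0, T] ->
  \int[leb]_(s in `[0, t]) g w s i ord0 = \int[leb]_(s in `[0, t]) ext T g (w, s) i ord0.
Proof.
rewrite in_itv/= => /andP[_ tT]; apply: eq_Rintegral => s; rewrite inE/= in_itv/= => /andP[s0 st].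
by rewrite /ext/= in_itv/= s0 (le_trans st).
Qed.

Lemma integrable_ext k (g : process R Omega k 1) w i : L2 leb (fun s => ext T g (w, s) i ord0) ->
  leb.-integrable `[0, T] (fun s => (g w s i ord0)%:E).
Proof.
move=> L; have : int1 leb (fun s => \1_(`[0, T]%classic) s * ext T g (w, s) i ord0).
  exact: (L2M (L2_itv T) L).
move=> /(@integrableS _ _ _ leb setT `[0, T]%classic _ measurableT (measurable_itv _) (@subsetT _ _)).
apply: eq_integrable => // s; rewrite inE/= => sT.
by rewrite indicE mem_setE sT mul1r /ext/= sT.
Qed.


Lemma ae_time_integrable k (g : process R Omega k 1) : vL2 PL (ext T g) ->
  {ae P, forall w, forall i, L2 leb (fun s => ext T g (w, s) i ord0)}.
Proof.
move=> /vL2P h; apply: filter_forall => i; exact: (ae_L2_section (h i ord0)).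
Qed.

Lemma time_integral_nS k (g g' J J' : process R Omega k 1) :
  vL2 PL (ext T g) -> vL2 PL (ext T g') -> rcproc T J -> rcproc T J' ->
  time_integral P T g J -> time_integral P T g' J' ->
  (nS P T (fun w t => J w t - J' w t)%R <= T%:E * vnn2 PL (ext T (fun w t => g w t - g' w t)%R))%E.
Proof.
move=> Lg Lg' rJ rJ' tJ tJ'.
have Ld : vL2 PL (ext T (fun w t => g w t - g' w t)) by rewrite extB; exact: vL2B.
have [mD _] := Ld.
have mdw w i : measurable_fun setT (fun s => ext T (fun w t => g w t - g' w t) (w, s) i ord0).
  exact: (measurableT_comp (mD i ord0) (measurable_pair1 w)).
rewrite vnn2_normH2//.
have e : (\int[P]_w \int[leb]_(t in `[0%R, T]) (hsnorm (g w t - g' w t)%R ^+ 2)%:E =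
    \int[P]_w vnn2 leb (fun s => ext T (fun w t => g w t - g' w t)%R (w, s)))%E.
  apply: eq_integral => w _; rewrite integral_mkcond /vnn2; apply: eq_integral => t _.
  by rewrite patchE /ext/= mem_setE; case: ifP => // _; rewrite hsnorm0 expr0n.
rewrite {}e.
have mv : measurable_fun setT (fun w => vnn2 leb (fun s => ext T (fun w t => g w t - g' w t)%R (w, s))).
  apply: (measurable_fun_fubini_tonelli_F (m2 := leb)
    (fun z => (hsnorm (ext T (fun w t => g w t - g' w t) z) ^+ 2)%:E)); first exact: mmeas_sqrE.
  by move=> z; rewrite lee_fin sqr_ge0.
rewrite -ge0_integralZl_EFin ?(ltW T0)//; last by move=> w _; exact: vnn2_ge0.
apply: ae_ge0_le_integral => //.
- by move=> w _; exact: esup_ge0.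
- by apply: measurable_esup => //; exact: rcprocB.
- by move=> w _; rewrite mule_ge0// ?lee_fin ?(ltW T0)// vnn2_ge0.
- exact: measurable_funeM.
have hd := ae_time_integrable Ld.
have hg := ae_time_integrable Lg; have hg' := ae_time_integrable Lg'.
have := ae_and (ae_and hd hg) (ae_and hg' (ae_and tJ tJ')).
apply: filterS => w [[dw gw] [g'w [[_ Jw] [_ J'w]]]] _.
have mw : mmeas (fun s => ext T (fun w t => g w t - g' w t) (w, s)).
  by move=> i j; rewrite (ord1 j); case: (dw i).
apply: esup_le => t tT; rewrite vnn2E// hsnorm_sqr -sumEFin ge0_sume_distrr//; last first.
  by move=> i _; apply: sume_ge0 => j _; exact: nn2_ge0.
apply: lee_sum => i _; rewrite !big_ord1 !mxE (nn2E (dw i)) -EFinM lee_fin.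
rewrite Jw// J'w// !(Rintegral_ext _ _ _ tT).
apply: le_trans (sqr_Rintegral_le (dw i) tT).
have a (u : R -> R) : \int[leb]_(s in `[0, t]) u s = \int[leb]_s (\1_(`[0, t]%classic) s * u s).
  exact: Rintegral_indic.
rewrite !a -RintegralB//; first last.
- exact: (L2M (L2_itv t) (g'w i)).
- exact: (L2M (L2_itv t) (gw i)).
rewrite le_eqVlt; apply/orP; left; apply/eqP; congr (_ ^+ 2); apply: eq_Rintegral => s _.
by rewrite extB !mxE mulrBr.
Qed.

Lemma vL2_0 k : vL2 PL (ext T (fun (_ : Omega) (_ : R) => 0 : 'cV[R]_k)).
Proof.
have e : ext T (fun (_ : Omega) (_ : R) => 0 : 'cV[R]_k) = cst 0.
  by apply/funext => z; rewrite /ext; case: ifP.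
rewrite e; split; first by move=> i j; under eq_fun do rewrite mxE; exact: measurable_cst.
by rewrite /vnn2; under eq_integral do rewrite hsnorm0 expr0n; rewrite integral0.
Qed.

Lemma time_integral_le k (g J : process R Omega k 1) :
  vL2 PL (ext T g) -> rcproc T J -> time_integral P T g J ->
  (nS P T J <= T%:E * vnn2 PL (ext T g))%E.
Proof.
move=> Lg rJ tJ; pose z (_ : Omega) (_ : R) := 0 : 'cV[R]_k.
have rz : rcproc T z.
  by split=> [t tT i j|w i j t tT]; [exact: measurable_cst|exact: tends_cst].
have tz : time_integral P T z z.
  apply: aeW => w; split=> [i|t tT i].
    have -> : (fun s => (z w s i ord0)%:E) = cst 0%E by apply/funext => s; rewrite /z mxE.
    exact: integrable0.
  have -> : (fun s => z w s i ord0) = cst 0 by apply/funext => s; rewrite /z mxE.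
  by rewrite /Rintegral integral0 /z mxE.
have := time_integral_nS Lg (vL2_0 k) rJ rz tJ tz.
by rewrite /z; under [in nS _ _ _]eq_fun do under eq_fun do rewrite subr0;
  under [in ext _ _]eq_fun do under eq_fun do rewrite subr0.
Qed.

(** The paths on which the integrand is not square integrable in time form a null set. The integral
    is set to 0 there, since [S2] asks for continuity of every path. *)
Lemma time_integral_exists k (g : process R Omega k 1) : predictable T F g -> vL2 PL (ext T g) ->
  exists J, [/\ S2 P T F J, forall w, J w 0 = 0 & time_integral P T g J].
Proof.
move=> pg Lg; pose good w := forall i, L2 leb (fun s => ext T g (w, s) i ord0).
pose J w t : 'cV[R]_k := if `[< good w >] then \col_i \int[leb]_(s in `[0, t]) g w s i ord0 else 0.
have hgood := ae_time_integrable Lg.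
have aJ : adapted T F J.
  apply/(adapted_gmeas _ hF) => t tT i j; rewrite (ord1 j).
  apply: (gmeas_ae hF tT (gmeas_time_integral hF i ord0 tT pg)).
  by apply: filterS hgood => w gw; rewrite /J; case: asboolP => // _; rewrite mxE.
have cJ w : {within `[0, T], continuous (J w)}.
  apply/within_continuousP => i j t tT; rewrite /J; case: asboolP => gw; last first.
    by under [X in tends _ X]funext do rewrite mxE; rewrite mxE; exact: tends_cst.
  have /subspace_continuousP := parameterized_integral_continuous (ltW T0) (integrable_ext (gw i)).
  move=> /(_ t tT)/tendsP; rewrite /= mxE.
  by under [X in _ -> tends _ X _ _]funext do rewrite mxE.
have tJ : time_integral P T g J.
  apply: filterS hgood => w gw; split=> [i|t tT i]; first exact: integrable_ext.
  by rewrite /J; case: asboolP => // _; rewrite mxE.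
exists J; split => //.
  split => //; rewrite (nS_lty P T0); have rJ : rcproc T J by exact: (rcproc_cont hF aJ cJ).
  apply: le_lt_trans (time_integral_le Lg rJ tJ) _.
  by case: Lg => _ Lg; apply: lte_mul_pinfty => //; rewrite lee_fin ltW.

move=> w; rewrite /J; case: asboolP => // _; apply/matrixP => i j; rewrite !mxE.
by rewrite set_itv1 Rintegral_set1.
Qed.

End time_integral.

(** * Substitution of processes into random fields *)

Section nemytskii.
Context {R : realType}.

Definition dyadic_round (j : nat) N (u : 'cV[R]_N) : 'cV[int]_N :=
  \col_i Num.floor (2 ^+ j * u i ord0).

Definition dyadic_point (j : nat) N (v : 'cV[int]_N) : 'cV[R]_N :=
  \col_i ((v i ord0)%:~R / 2 ^+ j).

Lemma dyadic_round_le j N (u : 'cV[R]_N) :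
  hsnorm (dyadic_point j (dyadic_round j u) - u) <= N%:R * 2^-1 ^+ j.
Proof.
have p : 0 < 2 ^+ j :> R by rewrite exprn_gt0.
have n0 : 0 <= N%:R * 2^-1 ^+ j :> R by rewrite mulr_ge0 ?exprn_ge0.
rewrite -(@ler_pXn2r _ 2)// ?nnegrE ?hsnorm_ge0// hsnorm_sqr.
apply: (@le_trans _ _ (\sum_(i < N) (2^-1 ^+ j) ^+ 2)).
  apply: ler_sum => i _; rewrite big_ord1 !mxE -[leLHS]real_normK ?num_real//.
  rewrite lerXn2r ?nnegrE ?exprn_ge0//.
  move: (floor_itv (2 ^+ j * u i ord0)); set m := Num.floor _ => /andP[h1 h2].
  rewrite -[u i ord0](mulKf (lt0r_neq0 p)) mulrC -mulrBr normrM normfV (gtr0_norm p) exprVn.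
  rewrite ler_piMr ?invr_ge0 ?(ltW p)// distrC ger0_norm ?subr_ge0//.
  by rewrite lerBlDl; move: h2; rewrite intrD => /ltW.
rewrite sumr_const card_ord -[leLHS]mulr_natl exprMn ler_wpM2r ?sqr_ge0//.
rewrite -natrX ler_nat; case: (N) => // q; by rewrite -mulnn leq_pmulr.
Qed.

(** Rounding takes countably many values, so a preimage is a countable union over them and
    measurability of each [h v] for fixed [v] suffices. *)
Lemma measurable_dyadic_round {d} {S : measurableType d} j N (u : S -> 'cV[R]_N)
    (h : 'cV[int]_N -> S -> R) : (forall i, measurable_fun setT (fun s => u s i ord0)) ->
  (forall v, measurable_fun setT (h v)) ->
  measurable_fun setT (fun s => h (dyadic_round j (u s)) s).
Proof.
move=> mu mh _ B mB; rewrite setTI.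
rewrite (_ : _ @^-1` B = \bigcup_(v in [set: 'cV[int]_N]) ((\bigcap_(i in [set: 'I_N])
    ((fun s => 2 ^+ j * u s i ord0) @^-1` `[(v i ord0)%:~R, (v i ord0 + 1)%:~R[%classic))
    `&` (h v @^-1` B))).
  apply: countable_bigcupT_measurable => [|v]; first exact: countableP.
  apply: measurableI; last by have := mh v measurableT B mB; rewrite setTI.
  apply: fin_bigcap_measurable => // i _; rewrite -[X in measurable X]setTI.
  by apply: (measurable_funM (measurable_cst _) (mu i)) => //; exact: measurable_itv.
apply/seteqP; split=> s /=.
  move=> hB; exists (dyadic_round j (u s)) => //; split => // i _ /=.
  by rewrite in_itv/= mxE; exact: floor_itv.
move=> [v _ [hv hB]]; rewrite (_ : dyadic_round j (u s) = v)//.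
apply/matrixP => i k; rewrite (ord1 k) mxE; apply/eqP; rewrite eq_le.
have := hv i I; rewrite /= in_itv/= => /andP[h1 h2].
by rewrite floor_ge_int h1 andbT -ltzD1 floor_lt_int.
Qed.

Context {dsp} {Omega : measurableType dsp}
  (P : probability Omega R) (T : R) (F : R -> set (set Omega)).
Hypothesis T0 : 0 < T.
Hypothesis hF : usual_filtration P T F.

(** Substitution is measurable after the argument is rounded to dyadic points. Continuity of [G] in
    its argument, available almost everywhere, identifies the limit there, and an upper limit
    defines the version elsewhere. *)
Lemma nemytskii N k l (G : Omega -> R -> 'cV[R]_N -> 'M[R]_(k, l)) (x : process R Omega N 1) :
  predictable T F x -> (forall u, predictable T F (fun w t => G w t u)) ->
  ae_dPdt P T (fun w t => forall u e, 0 < e -> exists2 r, 0 < r & forall u',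
    hsnorm (u' - u) <= r -> hsnorm (G w t u' - G w t u) <= e) ->
  exists H, predictable_version P T F (fun w t => G w t (x w t)) H.
Proof.
move=> /(predictableP T0 hF _) px pG cG.
pose f j (a : 'I_k) (b : 'I_l) z :=
  ext T (fun w t => G w t (dyadic_point j (dyadic_round j (ext T x z)))) z a b.
have Gf j a b : gmeas (Gpred T F) (f j a b).
  apply: (@measurable_dyadic_round _ (g_sigma_algebraType (Gpred T F)) j N (ext T x)
    (fun v z => ext T (fun w t => G w t (dyadic_point j v)) z a b)).
    by move=> i; exact: px.
  by move=> v; exact: ((predictableP T0 hF _).1 (pG _)).
pose g a b z : R := fine (limn_esup (fun j => (f j a b z)%:E)).
exists (fun w t => \matrix_(a, b) g a b (w, t)); split.
  by apply: predictable_of_gmeas => // a b; exact: gmeas_limsup.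
move: cG; rewrite !ae_dPdtE; apply: filterS => -[w t] cG /= tT; apply/matrixP => a b; rewrite mxE /g.
have h : f j a b (w, t) @[j --> \oo] --> G w t (x w t) a b.
  apply/cvgrPdist_le => e e0; have [r r0 hr] := cG tT (x w t) e e0.
  have : N%:R * 2^-1 ^+ n @[n --> \oo] --> (0 : R).
    rewrite -[X in _ --> X](mulr0 N%:R); apply: cvgMr.
    by apply: cvg_expr; rewrite ger0_norm; lra.
  move=> /cvgrPdist_le/(_ r r0); apply: filterS => j; rewrite sub0r normrN => hj.
  rewrite /f /ext/= tT -normrN opprB.
  have := hr (dyadic_point j (dyadic_round j (x w t))) _.
  rewrite (le_trans (dyadic_round_le j (x w t)) (le_trans (ler_norm _) hj)) => /(_ isT).
  apply: le_trans; apply: le_trans (entry_le _ a b); by rewrite !mxE.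
have hE : (f j a b (w, t))%:E @[j --> \oo] --> (G w t (x w t) a b)%:E.
  by apply/fine_cvgP; split; [exact: nearW|exact: h].
by have [_ ->] := cvg_limn_einf_sup hE.
Qed.

End nemytskii.

(** * Moments of Brownian increments *)

Section normal_moments.
Context {R : realType}.
Local Notation leb := (@lebesgue_measure R).

(* Its value 1 is never needed: Ito's isometry is only used up to a constant. *)
Definition normal_m2 : R := \int[leb]_x (x ^+ 2 * normal_pdf 0 1 x).

Lemma normal_pdf0E (s x : R) : s != 0 ->
  normal_pdf 0 s x = normal_peak s * expR (- x ^+ 2 / (s ^+ 2 *+ 2)).
Proof. by move=> s0; rewrite normal_pdfE// /normal_fun subr0. Qed.

(* [x^2 <= 4 s^2 exp (x^2 / (4 s^2))] bounds the integrand by a normal density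
   of variance [2 s^2]. *)
Lemma normal_sq_int1 (s : R) : 0 < s -> int1 leb (fun x => x ^+ 2 * normal_pdf 0 s x).
Proof.
move=> s0; pose r := Num.sqrt 2 * s; have r0 : 0 < r by rewrite mulr_gt0.
have p0 : 0 < normal_peak r by rewrite normal_peak_gt0// gt_eqF.
have q0 : 0 < normal_peak s by rewrite normal_peak_gt0// gt_eqF.
pose k := 4 * s ^+ 2 * normal_peak s / normal_peak r.
apply: (@int1_le _ _ _ leb _ (fun x => k * normal_pdf 0 r x)).
- by apply: measurable_funM; [exact: measurable_funX|exact: measurable_normal_pdf].
- apply: int1Z; exact: integrable_normal_pdf.
move=> x; rewrite ger0_norm; last by rewrite mulr_ge0 ?sqr_ge0 ?normal_pdf_ge0.
have kE y : k * (normal_peak r * y) = normal_peak s * (4 * s ^+ 2 * y).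
  by rewrite /k mulrA divfK ?gt_eqF//; ring.
rewrite !normal_pdf0E ?gt_eqF// kE mulrCA.
rewrite ler_wpM2l ?(ltW q0)//.
have s2 : 0 < s ^+ 2 by rewrite exprn_gt0.
have -> : - x ^+ 2 / (s ^+ 2 *+ 2) = - x ^+ 2 / (r ^+ 2 *+ 2) - x ^+ 2 / (4 * s ^+ 2).
  rewrite /r exprMn sqr_sqrtr// (_ : s ^+ 2 *+ 2 = 2 * s ^+ 2); last by rewrite mulr_natl.
  rewrite (_ : 2 * s ^+ 2 *+ 2 = 4 * s ^+ 2); last by rewrite mulr2n; ring.
  have : s ^+ 2 != 0 by rewrite gt_eqF.
  by move: (s ^+ 2) (x ^+ 2) => u v u0; field.
rewrite expRD mulrCA mulrC ler_wpM2r ?expR_ge0//.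
rewrite expRN ler_pdivrMr ?expR_gt0// -[X in X <= _](@divfK _ (4 * s ^+ 2)); last first.
  by rewrite mulf_neq0// gt_eqF.
rewrite mulrC; apply: ler_wpM2l; first by rewrite mulr_ge0// ltW.
by apply: le_trans (expR_ge1Dx _); rewrite lerDr.
Qed.

Lemma normal_id_int1 (s : R) : 0 < s -> int1 leb (fun x => x * normal_pdf 0 s x).
Proof.
move=> s0; apply: (@int1_le _ _ _ leb _ (fun x => normal_pdf 0 s x + x ^+ 2 * normal_pdf 0 s x)).
- by apply: measurable_funM => //; exact: measurable_normal_pdf.
- by apply: int1D; [exact: integrable_normal_pdf|exact: normal_sq_int1].
move=> x; have p0 := normal_pdf_ge0 0 s x.
rewrite normrM (ger0_norm p0) -[X in X + _]mul1r -mulrDl ler_wpM2r// -[x ^+ 2]real_normK ?num_real//.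
have [h|h] := leP `|x| 1; first by have := sqr_ge0 `|x|; lra.
by have : `|x| <= `|x| ^+ 2 by [rewrite expr2 ler_peMr// ltW]; lra.
Qed.

(** By symmetry the integral of [|x|] against the density is twice its part over [x >= 0], and [x]
    is [2 max(x, 0) - |x|]. *)
Lemma normal_mean (s : R) : 0 < s -> \int[leb]_x (x * normal_pdf 0 s x) = 0.
Proof.
move=> s0; have I := normal_id_int1 s0.
have mp : measurable_fun setT (normal_pdf 0 s) := measurable_normal_pdf 0 s.
have cp := continuous_normal_pdf (m := 0) (lt0r_neq0 s0).
pose a x := `|x| * normal_pdf 0 s x.
pose b x := (if 0 <= x then x else 0) * normal_pdf 0 s x.
have mb : measurable_fun setT b.
  apply: measurable_funM => //; apply: measurable_fun_ifT => //.
  by apply: measurable_fun_ler => //; exact: measurable_cst.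
have ma : measurable_fun setT a by apply: measurable_funM => //; exact: measurable_normr.
have Ia : int1 leb a.
  have := integrable_abse I; apply: eq_integrable => // x _.
  by rewrite /a/= normrM (ger0_norm (normal_pdf_ge0 _ _ _)).
have Ib : int1 leb b.
  apply: (@int1_le _ _ _ leb b a mb Ia) => x.
  rewrite /b /a normrM (ger0_norm (normal_pdf_ge0 _ _ _)) ler_wpM2r ?normal_pdf_ge0//.
  by case: ifP; rewrite ?normr0.
have e : \int[leb]_x a x = 2 * \int[leb]_x b x.
  have : (\int[leb]_x (a x)%:E = 2%:E * \int[leb]_x (b x)%:E)%E.
    rewrite (ge0_symfun_integralT (f := a)).
    - congr (_ * _)%E; rewrite integral_mkcond; apply: eq_integral => x _.
      rewrite patchE /a /b; case: (boolP (0 <= x)) => x0; first by rewrite mem_set// ger0_norm.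
      by rewrite memNset ?mul0r//; exact/negP.
    - by move=> x; rewrite mulr_ge0 ?normal_pdf_ge0.
    - by move=> x; apply: cvgM; [exact: norm_continuous|exact: cp].
    - by move=> x /=; rewrite /a normrN !normal_pdf0E ?gt_eqF// sqrrN.
  have := integrable_fin_num measurableT Ib; rewrite /Rintegral.
  by case: (\int[leb]_x (b x)%:E)%E => //= r _ ->.
have -> : \int[leb]_x (x * normal_pdf 0 s x) = \int[leb]_x (2 * b x - a x).
  apply: eq_Rintegral => x _; rewrite /a /b mulrA -mulrBl; congr (_ * _).
  case: ifPn => [x0|]; first by rewrite ger0_norm//; lra.
  by rewrite -ltNge => x0; rewrite ltr0_norm//; lra.
by rewrite RintegralB// ?RintegralZl// ?e ?subrr//; exact: int1Z.
Qed.

(** The substitution of [s x] for [x] reduces every standard deviation to 1, so the same constant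
    serves all Brownian increments. *)
Lemma normal_var (s : R) : 0 < s ->
  \int[leb]_x (x ^+ 2 * normal_pdf 0 s x) = s ^+ 2 * normal_m2.
Proof.
move=> s0; have sn : s != 0 by rewrite gt_eqF.
pose G x := x ^+ 2 * normal_pdf 0 s x; pose Fs x : R := s * x.
have F'E : (Fs^`()%classic) = cst s.
  apply/funext => x; rewrite /Fs derive1E deriveM// derive_id derive_cst.
  by rewrite scaler0 addr0 /GRing.scale/= mulr1.
have : (\int[leb]_x (G x)%:E = \int[leb]_x (((G \o Fs) * (Fs^`()%classic)) x)%:E)%E.
  apply: increasing_ge0_integration_by_substitutionT => //.
  - by move=> x y xy; rewrite /Fs ltr_pM2l.
  - by rewrite F'E => ?; exact: cvg_cst.
  - by rewrite F'E; exact: is_cvg_cst.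
  - by rewrite F'E; exact: is_cvg_cst.
  - by apply: gt0_cvgMrNy => //; exact: cvg_id.
  - by apply: gt0_cvgMry => //; exact: cvg_id.
  - by move=> x; apply: cvgM; [exact: exprn_continuous|exact: continuous_normal_pdf].
  - by move=> x; rewrite mulr_ge0 ?sqr_ge0 ?normal_pdf_ge0.
rewrite F'E /normal_m2 -RintegralZl//; last exact: normal_sq_int1.
rewrite /Rintegral => ->; congr fine; apply: eq_integral => x _.
rewrite !fctE/= /G /Fs !normal_pdf0E// ?oner_eq0//; congr (_%:E).
have -> : - (s * x) ^+ 2 / (s ^+ 2 *+ 2) = - x ^+ 2 / (1 ^+ 2 *+ 2).
  rewrite exprMn expr1n (_ : s ^+ 2 *+ 2 = 2 * s ^+ 2); last by rewrite mulr_natl.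
  have : s ^+ 2 != 0 by rewrite gt_eqF// exprn_gt0.
  by move: (s ^+ 2) (x ^+ 2) => u v u0; field.
have -> : normal_peak 1 = s * normal_peak s :> R.
  rewrite /normal_peak expr1n mul1r -mulrnAr sqrtrM ?sqr_ge0// sqrtr_sqr gtr0_norm// invfM.
  by rewrite mulVKf.
by ring.
Qed.

Lemma normal_m2_ge0 : 0 <= normal_m2.
Proof. by apply: Rintegral_ge0 => x _; rewrite mulr_ge0 ?sqr_ge0 ?normal_pdf_ge0. Qed.

(** The Radon-Nikodym derivative of the normal law and [normal_pdf] have equal integrals over all
    measurable sets, so they agree almost everywhere. *)
Lemma ge0_integral_normal (s : R) (h : R -> R) : measurable_fun setT h -> (forall x, 0 <= h x) ->
  (\int[normal_prob 0 s]_x (h x)%:E = \int[leb]_x (h x * normal_pdf 0 s x)%:E)%E.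
Proof.
move=> mh h0; have nd := normal_prob_dominates 0 s.
have mhE : measurable_fun setT (EFin \o h) by exact/measurable_EFinP.
rewrite -(@Radon_Nikodym_SigmaFinite.change_of_variables _ _ _ _ _ nd (EFin \o h) setT)//.
have If := Radon_Nikodym_SigmaFinite.f_integrable nd.
have mp : measurable_fun setT (fun x => (normal_pdf 0 s x)%:E : \bar R).
  by apply/measurable_EFinP; exact: measurable_normal_pdf.
apply: ae_eq_integral => //.
- by apply: emeasurable_funM => //; exact: measurable_int If.
- by under eq_fun do rewrite EFinM; exact: emeasurable_funM.
apply: (filterS (P := fun x => setT x -> Radon_Nikodym_SigmaFinite.f (normal_prob 0 s) leb x = (normal_pdf 0 s x)%:E)).
  by move=> x e _; rewrite e// EFinM.
apply: integral_ae_eq => // A _ mA.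
by rewrite -Radon_Nikodym_SigmaFinite.f_integral.
Qed.

End normal_moments.

Section independence.
Context {R : realType} {dsp} {Omega : measurableType dsp}.
Variable P : probability Omega R.

Lemma Rintegral_1 (A : set Omega) : measurable A -> \int[P]_w \1_A w = fine (P A).
Proof. by move=> mA; rewrite /Rintegral integral_indic// setIT. Qed.

(** Independence says that [1_A - P A] is orthogonal to the indicator of every event [D^-1 B]; by
    [int_mul_eq0], for the sigma-algebra of these events, it is orthogonal to [h], which is a
    function of [D]. *)
Lemma indep_mul (A : set Omega) (D h : Omega -> R) (g : R -> R) : measurable A ->
  measurable_fun setT D -> measurable_fun setT g -> (forall w, h w = g (D w)) -> int1 P h ->
  (forall B, measurable B -> P (A `&` D @^-1` B) = (P A * P (D @^-1` B))%E) ->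
  \int[P]_w (\1_A w * h w) = fine (P A) * \int[P]_w h w.
Proof.
move=> mA mD mg hE Ih hP.
pose G := [set D @^-1` B | B in measurable].
have mpre B : measurable B -> measurable (D @^-1` B) by move=> mB; rewrite -[X in measurable X]setTI; exact: mD.
have sG : sigma_algebra setT G.
  split; first by exists set0 => //; rewrite preimage_set0.
    by move=> _ [B mB <-]; exists (~` B); [exact: measurableC|rewrite setTD].
  move=> E hE2; have /choice[B hB] : forall n, exists B, measurable B /\ D @^-1` B = E n.
    by move=> n; have [B mB <-] := hE2 n; exists B.
  exists (\bigcup_n B n); first by apply: bigcup_measurable => n _; case: (hB n).
  by rewrite preimage_bigcup; apply: eq_bigcup => // n _; case: (hB n).
have subG : G `<=` measurable by move=> _ [B mB <-]; exact: mpre.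
have p := fine (P A); have I1 : int1 P (\1_A : Omega -> R).
  by apply: L2_int1; exact: L2_indic.
have Iz : int1 P (fun w => \1_A w - fine (P A)) by apply: int1B => //; exact: int1_cst.
have I1h : int1 P (fun w => \1_A w * h w) by exact: int1_indic.
have Ihz : int1 P (fun w => h w * (\1_A w - fine (P A))).
  rewrite (_ : (fun w => _) = fun w => \1_A w * h w - fine (P A) * h w); last by apply/funext => w; ring.
  by apply: int1B => //; exact: int1Z.
have := @int_mul_eq0 _ _ _ P G sG subG (fun w => \1_A w - fine (P A)) h Iz _ _ Ihz.
have -> : \int[P]_w (h w * (\1_A w - fine (P A))) =
    \int[P]_w (\1_A w * h w) - fine (P A) * \int[P]_w h w.
  rewrite -RintegralZl// -RintegralB//; last exact: int1Z.
  by apply: eq_Rintegral => w _; ring.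
move=> H; apply/eqP; rewrite -subr_eq0; apply/eqP; apply: H.
  move=> _ [B mB <-]; have mB' := mpre _ mB.
  have -> : \int[P]_w (\1_(D @^-1` B) w * (\1_A w - fine (P A))) =
     \int[P]_w (\1_(A `&` D @^-1` B) w) - fine (P A) * \int[P]_w \1_(D @^-1` B) w.
    rewrite -RintegralZl//; last by apply: L2_int1; exact: L2_indic.
    rewrite -RintegralB//; first last.
    - by apply: int1Z; apply: L2_int1; exact: L2_indic.
    - by apply: L2_int1; apply: L2_indic; exact: measurableI.
    by apply: eq_Rintegral => w _; rewrite indicI/=; ring.
  rewrite !Rintegral_1//; last exact: measurableI.
  by rewrite hP// fineM ?fin_num_measure// subrr.
apply/(gmeasP _ sG) => B mB; exists (g @^-1` B).
  by rewrite -[X in measurable X]setTI; exact: mg.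
by apply/seteqP; split=> w /=; rewrite hE.
Qed.

End independence.

Section brownian.
Context {R : realType} {dsp} {Omega : measurableType dsp}
  (P : probability Omega R) (T : R) (F : R -> set (set Omega)).
Hypothesis T0 : 0 < T.
Hypothesis hF : usual_filtration P T F.
Context {m : nat} (W : process R Omega m 1).
Hypothesis hW : brownian_motion P T F W.
Local Notation leb := (@lebesgue_measure R).
Local Notation c := (@normal_m2 R).

Lemma W_gmeas t b : t \in `[0, T] -> gmeas (F t) (fun w => W w t b ord0).
Proof. by case: hW => aW _ _ _ tT; apply: ((adapted_gmeas W hF).1 aW t tT). Qed.

Section increment.
Variables (s t : R).
Hypothesis (s0 : 0 <= s) (st : s < t) (tT : t <= T).

Let sI : s \in `[0, T]. Proof. by rewrite in_itv/= s0 (le_trans (ltW st)). Qed.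
Let tI : t \in `[0, T]. Proof. by rewrite in_itv/= tT (le_trans s0) ?ltW. Qed.
Let Fs_meas A : F s A -> measurable A. Proof. exact: (filt_sub hF sI). Qed.

Definition dW b w := W w t b ord0 - W w s b ord0.

Lemma measurable_dW b : measurable_fun setT (dW b).
Proof.
by apply: measurable_funB;
  [exact: (gmeas_sub (filt_sub hF tI) (W_gmeas b tI))|exact: (gmeas_sub (filt_sub hF sI) (W_gmeas b sI))].
Qed.

Let sd := Num.sqrt (t - s).
Let sd0 : 0 < sd. Proof. by rewrite sqrtr_gt0 subr_gt0. Qed.

Lemma dW_law2 A a b B B' : F s A -> a != b -> measurable B -> measurable B' ->
  P (A `&` (dW b @^-1` B' `&` dW a @^-1` B)) = (P A * (normal_prob 0 sd B' * normal_prob 0 sd B))%E.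
Proof.
move=> FA ab mB mB'; case: hW => _ _ _ h.
pose S j := if j == b then B' else if j == a then B else setT.
have mS j : measurable (S j) by rewrite /S; case: ifP => // _; case: ifP.
have := h s t A S s0 st tT FA mS; rewrite (bigD1 b)//= (bigD1 a)//= big1 => [|j /andP[jb ja]].
  rewrite /S eqxx (negbTE ab) eqxx mule1 => <-.
  congr (P (_ `&` _)); apply/seteqP; split=> w /=.
    by move=> [h1 h2] j; case: eqP => [->//|_]; case: eqP => [->//|].
  by move=> hw; have := hw b; have := hw a; rewrite !eqxx (negbTE ab).
by rewrite /S (negbTE jb) (negbTE ja) probability_setT.
Qed.

Lemma dW_law A b B : F s A -> measurable B ->
  P (A `&` dW b @^-1` B) = (P A * normal_prob 0 sd B)%E.
Proof.
move=> FA mB; case: hW => _ _ _ h.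
pose S j := if j == b then B else setT.
have mS j : measurable (S j) by rewrite /S; case: ifP.
have := h s t A S s0 st tT FA mS; rewrite (bigD1 b)//= big1 => [|j jb].
  rewrite /S eqxx mule1 => <-.
  congr (P (_ `&` _)); apply/seteqP; split=> w /=.
    by move=> h1 j; case: eqP => [->//|].
  by move=> hw; have := hw b; rewrite eqxx.
by rewrite /S (negbTE jb) probability_setT.
Qed.

Let FT : F s setT.
Proof.
have [h0 hC _] := filt_sigma hF sI.
by have := hC _ h0; rewrite setD0.
Qed.

Lemma dW_prob b B : measurable B -> P (dW b @^-1` B) = normal_prob 0 sd B.
Proof. by move=> mB; have := dW_law b FT mB; rewrite setTI probability_setT mul1e. Qed.

Lemma dW_expect b (h : R -> R) : measurable_fun setT h -> (forall x, 0 <= h x) ->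
  (\int[P]_w (h (dW b w))%:E = \int[leb]_x (h x * normal_pdf 0 sd x)%:E)%E.
Proof.
move=> mh h0; rewrite -ge0_integral_normal//.
have mD : measurable_fun setT (dW b : Omega -> measurableTypeR R) := measurable_dW b.
rewrite -[LHS](@ge0_integral_pushforward _ _ _ _ _ _ mD P setT (EFin \o h))//.
- apply: eq_measure_integral => B mB _; exact: dW_prob.
- exact/measurable_EFinP.
- by move=> x _; rewrite lee_fin.
Qed.

Lemma L2_dW b : L2 P (dW b).
Proof.
split; first exact: measurable_dW.
rewrite /nn2 (@dW_expect b (fun x => x ^+ 2))//; last by move=> x; exact: sqr_ge0.
have /integrableP[_] := normal_sq_int1 sd0; apply: le_lt_trans.
apply: ge0_le_integral => //=.
- by move=> x _; rewrite lee_fin mulr_ge0 ?sqr_ge0 ?normal_pdf_ge0.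
- by apply/measurable_EFinP; apply: measurable_funM => //; exact: measurable_normal_pdf.
- apply/measurable_EFinP; apply: measurableT_comp => //; apply: measurable_funM => //.
  exact: measurable_normal_pdf.
- by move=> x _; rewrite lee_fin ler_norm.
Qed.

Lemma dW_var b : \int[P]_w (dW b w ^+ 2) = c * (t - s).
Proof.
rewrite /Rintegral (@dW_expect b (fun x => x ^+ 2))//; last by move=> x; exact: sqr_ge0.
rewrite -[LHS]/(\int[leb]_x (x ^+ 2 * normal_pdf 0 sd x)) normal_var// /sd sqr_sqrtr; first by rewrite mulrC.
by rewrite subr_ge0 ltW.
Qed.

(** The law of the increment is available through integrals of nonnegative functions, so its
    positive and negative parts are transferred to the line separately. *)
Lemma dW_mean b : \int[P]_w dW b w = 0.
Proof.
have ID := L2_int1 (L2_dW b).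
pose pos x : R := if 0 <= x then x else 0; pose neg x : R := if 0 <= x then 0 else - x.
have mc : measurable_fun setT (fun x : R => 0 <= x) by apply: measurable_fun_ler => //; exact: measurable_cst.
have mpos : measurable_fun setT pos by apply: measurable_fun_ifT.
have mneg : measurable_fun setT neg by apply: measurable_fun_ifT => //; exact: measurable_funN.
have p0 x : 0 <= pos x by rewrite /pos; case: ifP.
have n0 x : 0 <= neg x by rewrite /neg; case: ifPn => // /negP/negP; rewrite -ltNge oppr_ge0 => /ltW.
have e (h : R -> R) : measurable_fun setT h -> (forall x, 0 <= h x) ->
    \int[P]_w h (dW b w) = \int[leb]_x (h x * normal_pdf 0 sd x).
  by move=> mh h0; rewrite /Rintegral dW_expect.
have Ipos : int1 P (fun w => pos (dW b w)).
  apply: (int1_le (g := fun w => `|dW b w|)); [exact: (measurableT_comp mpos (measurable_dW b))| |].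
    by have := integrable_abse ID; apply: eq_integrable.
  by move=> w; rewrite /pos; case: ifP; rewrite ?normr0.
have Ineg : int1 P (fun w => neg (dW b w)).
  apply: (int1_le (g := fun w => `|dW b w|)); [exact: (measurableT_comp mneg (measurable_dW b))| |].
    by have := integrable_abse ID; apply: eq_integrable.
  by move=> w; rewrite /neg; case: ifP; rewrite ?normr0 ?normrN.
have In := normal_id_int1 sd0.
have lpos : int1 leb (fun x => pos x * normal_pdf 0 sd x).
  have mf : measurable_fun setT (fun x => pos x * normal_pdf 0 sd x).
    by apply: measurable_funM => //; exact: measurable_normal_pdf.
  apply: (@int1_le _ _ _ leb _ (fun x => `|x * normal_pdf 0 sd x|) mf).
    by have := integrable_abse In; apply: eq_integrable.
  move=> x; rewrite !normrM ler_wpM2r//.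
  by rewrite /pos; case: ifP; rewrite ?normr0.
have lneg : int1 leb (fun x => neg x * normal_pdf 0 sd x).
  have mf : measurable_fun setT (fun x => neg x * normal_pdf 0 sd x).
    by apply: measurable_funM => //; exact: measurable_normal_pdf.
  apply: (@int1_le _ _ _ leb _ (fun x => `|x * normal_pdf 0 sd x|) mf).
    by have := integrable_abse In; apply: eq_integrable.
  move=> x; rewrite !normrM ler_wpM2r//.
  by rewrite /neg; case: ifP; rewrite ?normr0 ?normrN.
have d x : x = pos x - neg x by rewrite /pos /neg; case: ifP => _; rewrite ?subr0 ?sub0r ?opprK.
rewrite (_ : \int[P]_w dW b w = \int[P]_w (pos (dW b w) - neg (dW b w))); last first.
  by apply: eq_Rintegral => w _; exact: d.
rewrite RintegralB// !e// -RintegralB// -[RHS](normal_mean sd0).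
by apply: eq_Rintegral => x _; rewrite -mulrBl -d.
Qed.

Lemma dW_indep A b (h : Omega -> R) (g : R -> R) : F s A ->
  measurable_fun setT g -> (forall w, h w = g (dW b w)) -> int1 P h ->
  \int[P]_w (\1_A w * h w) = fine (P A) * \int[P]_w h w.
Proof.
move=> FA mg hE Ih; apply: (indep_mul (D := dW b) (g := g)) => //; first exact: Fs_meas.
  exact: measurable_dW.
by move=> B mB; rewrite dW_law// dW_prob.
Qed.

Lemma dW_indic_mean A b : F s A -> \int[P]_w (\1_A w * dW b w) = 0.
Proof.
move=> FA; rewrite (dW_indep (b := b) (g := id) FA)//; first by rewrite dW_mean mulr0.
by apply: L2_int1; exact: L2_dW.
Qed.

Lemma dW_indic_sq A b : F s A -> \int[P]_w (\1_A w * (dW b w ^+ 2 - c * (t - s))) = 0.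
Proof.
move=> FA; have I2 := int1_sq (L2_dW b).
have I : int1 P (fun w => dW b w ^+ 2 - c * (t - s)) by apply: int1B => //; exact: int1_cst.
rewrite (dW_indep (b := b) (g := fun x => x ^+ 2 - c * (t - s)) FA)//.
  rewrite RintegralB//; last exact: int1_cst.
  by rewrite dW_var Rint_cst subrr mulr0.
exact: measurable_funB.
Qed.

(** By the joint law, [A] intersected with an event of [dW b] is independent of [dW a], which has
    mean zero. So [1_A * dW a] is orthogonal to all events of [dW b], and then to [dW b] itself. *)
Lemma dW_indic_cross A a b : F s A -> a != b -> \int[P]_w (\1_A w * (dW a w * dW b w)) = 0.
Proof.
move=> FA ab; have mA := Fs_meas FA.
pose G := [set dW b @^-1` B | B in measurable].
have mpre B : measurable B -> measurable (dW b @^-1` B).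
  by move=> mB; rewrite -[X in measurable X]setTI; exact: measurable_dW.
have sG : sigma_algebra setT G.
  split; first by exists set0 => //; rewrite preimage_set0.
    by move=> _ [B mB <-]; exists (~` B); [exact: measurableC|rewrite setTD].
  move=> E hE2; have /choice[B hB] : forall n, exists B, measurable B /\ dW b @^-1` B = E n.
    by move=> n; have [B mB <-] := hE2 n; exists B.
  exists (\bigcup_n B n); first by apply: bigcup_measurable => n _; case: (hB n).
  by rewrite preimage_bigcup; apply: eq_bigcup => // n _; case: (hB n).
have subG : G `<=` measurable by move=> _ [B mB <-]; exact: mpre.
have LA : L2 P (fun w => \1_A w * dW a w).
  apply: (L2_le (g := dW a)); [|exact: L2_dW|].
    by apply: measurable_funM; [exact: measurable_indic|exact: measurable_dW].
  move=> w; rewrite exprMn indicE; case: (_ \in _); rewrite ?expr1n ?mul1r//.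
  by rewrite expr0n mul0r sqr_ge0.
rewrite (_ : \int[P]_w _ = \int[P]_w (dW b w * (\1_A w * dW a w))); last first.
  by apply: eq_Rintegral => w _; ring.
apply: (int_mul_eq0 sG subG); [exact: L2_int1| | |].
- move=> _ [B mB <-].
  have e : \int[P]_w (\1_(dW b @^-1` B) w * (\1_A w * dW a w)) =
      \int[P]_w (\1_(A `&` dW b @^-1` B) w * dW a w).
    by apply: eq_Rintegral => w _; rewrite indicI/=; ring.
  rewrite {}e (indep_mul (D := dW a) (g := id))//; first by rewrite dW_mean mulr0.
  - by apply: measurableI => //; exact: mpre.
  - exact: measurable_dW.
  - by apply: L2_int1; exact: L2_dW.
  move=> B' mB'; rewrite -setIA dW_law2// dW_prob// dW_law// muleA//.
- apply/(gmeasP _ sG) => B mB; by exists B.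
- by apply: L2M => //; exact: L2_dW.
Qed.

Lemma dW_orth h b : gmeas (F s) h -> L2 P h -> \int[P]_w (h w * dW b w) = 0.
Proof.
move=> Gh Lh; apply: (int_mul_eq0 (filt_sigma hF sI) (filt_sub hF sI)) => //.
- by apply: L2_int1; exact: L2_dW.
- by move=> A FA; exact: dW_indic_mean.
- by apply: L2M => //; exact: L2_dW.
Qed.

(** The isometry on a single interval. The factor [h] is bounded because it multiplies a product of
    two increments, which is handled here as an integrable variable only. *)
Lemma dW_cov h a b (K : R) : gmeas (F s) h -> (forall w, `|h w| <= K) ->
  \int[P]_w (h w * (dW a w * dW b w)) = (if a == b then c * (t - s) * \int[P]_w h w else 0).
Proof.
move=> Gh hK; have mh := gmeas_sub (filt_sub hF sI) Gh.
have Ibd z : int1 P z -> int1 P (fun w => h w * z w).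
  move=> Iz; apply: (int1_le (g := fun w => K * `|z w|)).
  - by apply: measurable_funM => //; exact: int1_measurable Iz.
  - by apply: int1Z; have := integrable_abse Iz; apply: eq_integrable.
  - by move=> w; rewrite normrM ler_wpM2r.
have Ih : int1 P h.
  by have := Ibd (cst 1) (int1_cst _ 1); under [in int1 _ _]eq_fun do rewrite mulr1.
have Iab : int1 P (fun w => dW a w * dW b w) by apply: L2M; exact: L2_dW.
case: eqP => [ab|/eqP ab]; last first.
  apply: (int_mul_eq0 (filt_sigma hF sI) (filt_sub hF sI)) => //; last exact: Ibd.
  by move=> A FA; exact: dW_indic_cross.
have I2 := int1_sq (L2_dW b).
have Iz : int1 P (fun w => dW b w ^+ 2 - c * (t - s)) by apply: int1B => //; exact: int1_cst.
have := int_mul_eq0 (filt_sigma hF sI) (filt_sub hF sI) Iz (fun A => @dW_indic_sq A b) Gh (Ibd _ Iz).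
have -> : \int[P]_w (h w * (dW b w ^+ 2 - c * (t - s))) =
    \int[P]_w (h w * (dW a w * dW b w)) - c * (t - s) * \int[P]_w h w.
  rewrite -RintegralZl// -RintegralB//; [|exact: Ibd|exact: int1Z].
  by apply: eq_Rintegral => w _; rewrite ab; ring.
by move=> /eqP; rewrite subr_eq0 => /eqP.
Qed.

End increment.

Lemma W_mart b : mart P T F (fun t w => W w t b ord0).
Proof.
have L t : t \in `[0, T] -> L2 P (fun w => W w t b ord0).
  rewrite in_itv/= => /andP[]; rewrite le_eqVlt => /predU1P[<-|t0] tT.
    case: hW => _ W0 _ _; have m0 := gmeas_sub (filt_sub hF (itv0T T0)) (W_gmeas b (itv0T T0)).
    split => //; rewrite (@ae_eq_nn2 _ _ _ P _ (cst 0))//; last first.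
      by apply: filterS W0 => w ->; rewrite mxE.
    by rewrite /nn2; under eq_integral do rewrite expr0n; rewrite integral0.
  case: hW => _ W0 _ _; have m0 := gmeas_sub (filt_sub hF (itv0T T0)) (W_gmeas b (itv0T T0)).
  have L0 : L2 P (fun w => W w 0 b ord0).
    split => //; rewrite (@ae_eq_nn2 _ _ _ P _ (cst 0))//; last first.
      by apply: filterS W0 => w ->; rewrite mxE.
    by rewrite /nn2; under eq_integral do rewrite expr0n; rewrite integral0.
  rewrite (_ : (fun w => _) = fun w => dW 0 t b w + W w 0 b ord0); last first.
    by apply/funext => w; rewrite /dW subrK.
  by apply: L2D => //; exact: L2_dW.
split=> [t tT|t tT|s t h s0 st tT Gh Lh]; [exact: W_gmeas|exact: L|].
move: st; rewrite le_eqVlt => /predU1P[<-|st].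
  by under eq_Rintegral do rewrite subrr mulr0; rewrite Rint_cst.
exact: dW_orth.
Qed.

End brownian.

Section fubini.
Context {R : realType} {dsp} {Omega : measurableType dsp}.
Variable P : probability Omega R.
Local Notation PL := (dPdt P).
Local Notation leb := (@lebesgue_measure R).

Lemma dPdt_integrable (f : Omega * R -> R) : int1 PL f ->
  (P \x leb)%E.-integrable setT (EFin \o f) /\
  (\int[PL]_z (f z)%:E = \int[P \x leb]_z (f z)%:E)%E.
Proof.
move=> /integrableP[mf hf]; have mf' : measurable_fun setT (EFin \o f) := mf.
split.
  apply/integrableP; split; first exact: mf'.
  by rewrite -integral_dPdt//; exact: measurableT_comp.
rewrite integralE [RHS]integralE; congr (_ - _)%E; apply: integral_dPdt.
- exact: measurable_funepos mf'.
- exact: funepos_ge0.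
- exact: measurable_funeneg mf'.
- exact: funeneg_ge0.
Qed.

Lemma int1_fine d (S : measurableType d) (mu : {measure set S -> \bar R}) (G : S -> \bar R) :
  mu.-integrable setT G -> int1 mu (fun x => fine (G x)) /\
  \int[mu]_x fine (G x) = fine (\int[mu]_x G x).
Proof.
move=> IG; have mG := measurable_int mu IG.
have I : int1 mu (fun x => fine (G x)).
  apply: (le_integrable measurableT _ _ IG).
    by apply/measurable_EFinP; exact: measurableT_comp.
  by move=> x _ /=; case: (G x) => //=; rewrite leey.
split => //; rewrite /Rintegral; congr fine; apply: ae_eq_integral => //.
  exact: measurable_int I.
apply: filterS (integrable_ae measurableT IG) => x h _.
by rewrite fineK//; exact: h.
Qed.

Lemma fubini_P (f : Omega * R -> R) : int1 PL f ->
  int1 P (fun w => \int[leb]_t f (w, t)) /\ \int[PL]_z f z = \int[P]_w \int[leb]_t f (w, t).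
Proof.
move=> /dPdt_integrable[I e].
have [IF eF] := int1_fine (integrable_fubini_F I).
split; first exact: IF.
by rewrite [RHS]eF /Rintegral e -(integral12_prod_meas1 I).
Qed.

Lemma fubini_leb (f : Omega * R -> R) : int1 PL f ->
  int1 leb (fun t => \int[P]_w f (w, t)) /\ \int[PL]_z f z = \int[leb]_t \int[P]_w f (w, t).
Proof.
move=> /dPdt_integrable[I e].
have IG : leb.-integrable setT (fun t => \int[P]_w (EFin \o f) (w, t))%E.
  apply/integrableP; split; first exact: (measurable_fubini_G I).
  have mf := measurable_int _ I.
  have /(integrable21ltyP _ _ mf) h := I.
  apply: le_lt_trans h; apply: ge0_le_integral => //.
  - exact: measurableT_comp (measurable_fubini_G I).
  - apply: (measurable_fun_fubini_tonelli_G (m1 := P) (fun z => `|(EFin \o f) z|)%E) => //.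
    exact: measurableT_comp.
  move=> t _; apply: le_abse_integral => //.
  exact: (measurableT_comp mf (measurable_pair2 t)).
have [IF eF] := int1_fine IG.
split; first exact: IF.
by rewrite [RHS]eF /Rintegral e -(integral21_prod_meas1 I).
Qed.

Lemma L2_dPdt_bounded (f : Omega * R -> R) (T K : R) : 0 < T -> measurable_fun setT f ->
  (forall z, `|f z| <= K) -> (forall z, z.2 \notin `[0, T] -> f z = 0) -> L2 PL f.
Proof.
move=> T0 mf hK h0; split => //; rewrite /nn2 (@tonelli_P _ _ _ P (fun z => f z ^+ 2))//; first last.
- by move=> z; exact: sqr_ge0.
- exact: measurable_funX.
apply: (@le_lt_trans _ _ (\int[P]_w (cst (K ^+ 2 * T)%:E w))%E); last first.
  by rewrite integral_cst//= probability_setT mule1 ltry.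
apply: ge0_le_integral => //.
- by move=> w _; apply: integral_ge0 => t _; rewrite lee_fin sqr_ge0.
- apply: (measurable_fun_fubini_tonelli_F (m2 := leb) (fun z => (f z ^+ 2)%:E)).
    by apply/measurable_EFinP; exact: measurable_funX.
  by move=> z; rewrite lee_fin sqr_ge0.
move=> w _; apply: (@le_trans _ _ (\int[leb]_(t in `[0%R, T]) (cst (K ^+ 2)%:E t))%E).
  rewrite [leRHS]integral_mkcond; apply: ge0_le_integral => //.
  - by move=> t _; rewrite lee_fin sqr_ge0.
  - apply/measurable_EFinP; apply: measurable_funX.
    exact: (measurableT_comp mf (measurable_pair1 w)).
  - by apply: (measurable_restrictT _ _).1 => //; exact: measurable_itv.
  move=> t _; rewrite patchE mem_setE; case: ifPn => tT; last first.
    by rewrite h0// expr0n.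
  by rewrite lee_fin -[leLHS]real_normK ?num_real// lerXn2r ?nnegrE ?(le_trans _ (hK (w, t))).
by rewrite integral_cst//= lebesgue_measure_itv/= lte_fin T0 oppr0 adde0 -EFinM.
Qed.

End fubini.

(** * The Ito isometry for simple integrands *)

Section atoms.
Context {R : realType} {dsp} {Omega : measurableType dsp}
  (P : probability Omega R) (T : R) (F : R -> set (set Omega)).
Hypothesis T0 : 0 < T.
Hypothesis hF : usual_filtration P T F.
Context {m : nat} (W : process R Omega m 1).
Hypothesis hW : brownian_motion P T F W.
Local Notation leb := (@lebesgue_measure R).
Local Notation PL := (dPdt P).
Local Notation c := (@normal_m2 R).

(* The integral up to time t of the one-dimensional integrand [z 1_(u, v]]
   against the b-th coordinate of W, and that integrand stopped at t. *)
Definition atomX (u v : R) (z : Omega -> R) (b : 'I_m) (t : R) (w : Omega) : R :=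
  z w * (W w (Num.min v t) b ord0 - W w (Num.min u t) b ord0).

Definition atomq (u v : R) (z : Omega -> R) (t : R) (x : Omega * R) : R :=
  if u < x.2 <= Num.min v t then z x.1 else 0.

Definition atom_ok (u v : R) (z : Omega -> R) :=
  [/\ 0 <= u, u <= v, v <= T, gmeas (F u) z & exists K, forall w, `|z w| <= K].

Section one_atom.
Variables (u v : R) (z : Omega -> R) (b : 'I_m).
Hypothesis ok : atom_ok u v z.

Lemma atomX0 t w : t <= u -> atomX u v z b t w = 0.
Proof.
move=> tu; case: ok => _ uv _ _ _.
by rewrite /atomX (min_idPr tu) (min_idPr (le_trans tu uv)) subrr mulr0.
Qed.

Lemma atomX_const s t w : v <= s -> v <= t -> atomX u v z b t w = atomX u v z b s w.
Proof.
move=> vs vt; case: ok => _ uv _ _ _.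
by rewrite /atomX !(min_idPl vs) !(min_idPl vt) !(min_idPl (le_trans uv _)).
Qed.

Lemma atomX_incr s t w : u <= s -> s <= t -> t <= v ->
  atomX u v z b t w = atomX u v z b s w + z w * (W w t b ord0 - W w s b ord0).
Proof.
move=> us st tv; rewrite /atomX (min_idPr tv) (min_idPr (le_trans st tv)).
by rewrite (min_idPl us) (min_idPl (le_trans us st)); ring.
Qed.

Lemma gmeas_bd s y : 0 <= s -> u <= s -> s <= T -> gmeas (F s) y -> L2 P y ->
  gmeas (F s) (fun w => z w * y w) /\ L2 P (fun w => z w * y w).
Proof.
case: ok => u0 uv vT Gz [K hK] s0 us sT Gy Ly.
have Gz' := gmeas_mono hF u0 us sT Gz.
have G : gmeas (F s) (fun w => z w * y w) by exact: (measurable_funM Gz' Gy).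
split => //; apply: (L2_le (g := fun w => K * y w)); [|exact: L2Z|].
  by apply: (gmeas_sub (filt_sub hF _) G); rewrite in_itv/= s0.
move=> w; rewrite !exprMn ler_wpM2r ?sqr_ge0//.
by rewrite -[leLHS]real_normK ?num_real// lerXn2r ?nnegrE ?(le_trans _ (hK w)).
Qed.

Lemma atom_mart : mart P T F (fun t w => atomX u v z b t w).
Proof.
case: ok => u0 uv vT Gz [K hK].
have [GW LW oW] := W_mart T0 hF hW b.
have uI : u \in `[0, T] by rewrite in_itv/= u0 (le_trans uv).
have GL t : t \in `[0, T] -> gmeas (F t) (atomX u v z b t) /\ L2 P (atomX u v z b t).
  rewrite in_itv/= => /andP[t0 tT]; have [tu|ut] := leP t u.
    rewrite (_ : atomX u v z b t = cst 0); last by apply/funext => w; exact: atomX0.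
    by split; [exact: measurable_cst|exact: L2_cst].
  have vt0 : 0 <= Num.min v t by rewrite le_min t0 (le_trans u0).
  have vtt : Num.min v t <= t by rewrite ge_min lexx orbT.
  have vtI : Num.min v t \in `[0, T] by rewrite in_itv/= vt0 (le_trans vtt).
  have tI : t \in `[0, T] by rewrite in_itv/= t0.
  rewrite /atomX (min_idPl (ltW ut)); apply: gmeas_bd => //; first exact: ltW.
    apply: measurable_funB; first by apply: (gmeas_mono hF vt0 vtt tT); exact: GW.
    by apply: (gmeas_mono hF u0 (ltW ut) tT); exact: GW.
  by apply: L2B; apply: LW.
split=> [t /GL[]//|t /GL[]//|s t h s0 st tT Gh Lh].
have [tu|ut] := leP t u.
  by under eq_Rintegral do rewrite !atomX0 ?(le_trans st)// subrr mulr0; rewrite Rint_cst.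
have [vs|sv] := leP v s.
  under eq_Rintegral do rewrite (atomX_const _ vs (le_trans vs st)) subrr mulr0.
  by rewrite Rint_cst.
(* Over [s, t] the atom moves by [z] times the increment of [W] from [q] to [p], and [z * h] is
   known at time [q]. *)
pose p := Num.min v t; pose q := Num.max u s.
have qp : q <= p by rewrite /p /q le_min !ge_max uv (ltW ut) (ltW sv) st.
have q0 : 0 <= q by rewrite le_max u0.
have pT : p <= T by rewrite ge_min vT.
have uq : u <= q by rewrite le_max lexx.
have sq : s <= q by rewrite le_max lexx orbT.
have e w : h w * (atomX u v z b t w - atomX u v z b s w) =
    (z w * h w) * (W w p b ord0 - W w q b ord0).
  have -> : atomX u v z b t w = atomX u v z b p w.
    rewrite /p; have [vt|tv] := leP v t; last by [].
    by rewrite (atomX_const _ (lexx v) vt).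
  have -> : atomX u v z b s w = atomX u v z b q w.
    rewrite /q; have [us|su] := leP u s; first by [].
    by rewrite !atomX0 ?lexx ?(ltW su).
  by rewrite (atomX_incr _ uq qp) ?ge_min ?lexx//; ring.
under eq_Rintegral do rewrite e.
have Gh' : gmeas (F q) h by apply: (gmeas_mono hF s0 sq) => //; exact: le_trans pT.
have [G L] := gmeas_bd q0 uq (le_trans qp pT) Gh' Lh.
exact: oW.
Qed.

Lemma atomq_measurable t : t \in `[0, T] -> measurable_fun setT (atomq u v z t).
Proof.
case: ok => u0 uv vT Gz _ tT; have uI : u \in `[0, T] by rewrite in_itv/= u0 (le_trans uv).
have mz := gmeas_sub (filt_sub hF uI) Gz.
apply: measurable_fun_ifT; last exact: measurable_cst.
  apply: measurable_and.
    by apply: measurable_fun_ltr; [exact: measurable_cst|exact: measurable_snd].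
  by apply: measurable_fun_ler; [exact: measurable_snd|exact: measurable_cst].
exact: (measurableT_comp mz measurable_fst).
Qed.

Lemma atomq_L2 t : t \in `[0, T] -> L2 PL (atomq u v z t).
Proof.
move=> tT; have := ok => -[u0 uv vT Gz [K hK]].
have K0 : 0 <= K by apply: le_trans (hK point); exact: normr_ge0.
apply: (L2_dPdt_bounded (K := K) P T0 (atomq_measurable tT)).
  by move=> x; rewrite /atomq; case: ifP; rewrite ?normr0.
move=> x; rewrite /atomq; case: ifP => // /andP[ux]; rewrite le_min => /andP[xv _].
by rewrite in_itv/= (le_trans xv vT) (ltW (le_lt_trans u0 ux)).
Qed.

End one_atom.

(** After [v] the first atom is frozen at a variable known at time [s], while the second is a
    martingale. *)
Lemma atomX_prod_const u v z b u' v' z' b' s t : atom_ok u v z -> atom_ok u' v' z' ->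
  0 <= s -> s <= t -> t <= T -> v <= s ->
  \int[P]_w (atomX u v z b t w * atomX u' v' z' b' t w) =
  \int[P]_w (atomX u v z b s w * atomX u' v' z' b' s w).
Proof.
move=> ok ok' s0 st tT vs.
have sI : s \in `[0, T] by rewrite in_itv/= s0 (le_trans st).
have tI : t \in `[0, T] by rewrite in_itv/= tT (le_trans s0).
have [G L _] := atom_mart b ok; have [G' L' o'] := atom_mart b' ok'.
have e w : atomX u v z b t w * atomX u' v' z' b' t w =
   atomX u v z b s w * (atomX u' v' z' b' t w - atomX u' v' z' b' s w) +
   atomX u v z b s w * atomX u' v' z' b' s w.
  by rewrite (atomX_const _ ok _ vs (le_trans vs st)); ring.
under eq_Rintegral do rewrite e.
rewrite RintegralD//; first by rewrite o' ?add0r//; [exact: G|exact: L].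
- by apply: L2M; [exact: L|apply: L2B; exact: L'].
- by apply: L2M; [exact: L|exact: L'].
Qed.

(** []p, r]] is the common part of the two intervals before [t]. Up to [p] one of the atoms vanishes
    and after [r] one of them is frozen, so the covariance is created on []p, r]]. There each atom
    is its value at [p] plus its coefficient times an increment of [W], and of the four products
    only the one with two increments can have a nonzero mean. *)
Lemma atomX_cov u v z b u' v' z' b' t : atom_ok u v z -> atom_ok u' v' z' -> t \in `[0, T] ->
  \int[P]_w (atomX u v z b t w * atomX u' v' z' b' t w) =
  if b == b' then c * \int[PL]_x (atomq u v z t x * atomq u' v' z' t x) else 0.
Proof.
move=> ok ok' tI; have := tI; rewrite in_itv/= => /andP[t0 tT].
have := ok => -[u0 uv vT Gz [K hK]]; have := ok' => -[u'0 uv' v'T Gz' [K' hK']].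
(* The outer maximum gives [r = p] when the intervals do not overlap before [t], so that [r - p] is
   the length of the overlap in every case. *)
pose p := Num.max u u'; pose q := Num.min v v'; pose r := Num.max p (Num.min q t).
have p0 : 0 <= p by rewrite le_max u0.
have pT : p <= T by rewrite ge_max (le_trans uv) ?(le_trans uv').
have pI : p \in `[0, T] by rewrite in_itv/= p0 pT.
have rT : r <= T by rewrite ge_max pT ge_min tT orbT.
have pr : p <= r by rewrite le_max lexx.
have up : u <= p by rewrite le_max lexx.
have u'p : u' <= p by rewrite le_max lexx orbT.
have Gz1 := gmeas_mono hF u0 up pT Gz; have Gz1' := gmeas_mono hF u'0 u'p pT Gz'.
have Gzz : gmeas (F p) (fun w => z w * z' w) := measurable_funM Gz1 Gz1'.
have qE : \int[PL]_x (atomq u v z t x * atomq u' v' z' t x) =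
    (r - p) * \int[P]_w (z w * z' w).
  have I : int1 PL (fun x => atomq u v z t x * atomq u' v' z' t x).
    by apply: L2M; exact: atomq_L2.
  have [_ ->] := fubini_leb I.
  have e s : \int[P]_w (atomq u v z t (w, s) * atomq u' v' z' t (w, s)) =
      \1_(`]p, r]%classic) s * \int[P]_w (z w * z' w).
    rewrite /atomq/= indicE mem_setE in_itv/=.
    have -> : (p < s <= r) = (u < s <= Num.min v t) && (u' < s <= Num.min v' t).
      rewrite /p /r /q; apply/idP/idP.
        rewrite !gt_max !le_max !le_min => /andP[/andP[us u's] /orP[|]].
          by rewrite !leNgt us u's.
        by move=> /andP[/andP[-> ->] ->]; rewrite us u's.
      rewrite !gt_max !le_max !le_min => /andP[/andP[-> /andP[-> ->]] /andP[-> /andP[-> _]]].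
      by rewrite orbT.
    move: (u < s <= _) (u' < s <= _) => [] [] /=; first by rewrite mul1r.
    - by rewrite mul0r -[RHS](Rint_cst P 0); apply: eq_Rintegral => w _; rewrite mulr0.
    - by rewrite mul0r -[RHS](Rint_cst P 0); apply: eq_Rintegral => w _; rewrite mul0r.
    by rewrite [RHS]mul0r -[RHS](Rint_cst P 0); apply: eq_Rintegral => w _; rewrite mul0r.
  under eq_Rintegral do rewrite e mulrC.
  have I1 : (\int[leb]_x (\1_(`]p, r]%classic) x)%:E = (r - p)%:E :> \bar R)%E.
    have -> : (\int[leb]_x (\1_(`]p, r]%classic) x)%:E = leb (`]p, r]%classic))%E.
      by rewrite integral_indic// setIT.
    rewrite lebesgue_measure_itv/= lte_fin; case: ltP => h; first by rewrite EFinB.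
    by congr (_%:E); apply/esym/eqP; rewrite subr_eq0 eq_le h pr.
  have I1' : \int[leb]_x (\1_(`]p, r]%classic) x) = r - p by rewrite /Rintegral I1.
  rewrite RintegralZl//; first by rewrite I1' mulrC.
  apply/integrableP; split; first by apply/measurable_EFinP; exact: measurable_indic.
  have -> : (\int[leb]_x `|(EFin \o \1_(`]p, r]%classic)) x| = \int[leb]_x (\1_(`]p, r]%classic) x)%:E)%E.
    by apply: eq_integral => x _; rewrite /= indicE ger0_norm.
  by rewrite I1 ltry.
rewrite qE.
have zero s : s <= p -> \int[P]_w (atomX u v z b s w * atomX u' v' z' b' s w) = 0.
  rewrite /p le_max => /orP[h|h].
    by under eq_Rintegral do rewrite (atomX0 _ ok _ h) mul0r; rewrite Rint_cst.
  by under eq_Rintegral do rewrite (atomX0 _ ok' _ h) mulr0; rewrite Rint_cst.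
have [tp|pt] := leP t p.
  have -> : r = p by apply/max_idPl; rewrite ge_min tp orbT.
  by rewrite zero// subrr mul0r mulr0; case: ifP.
have gr : \int[P]_w (atomX u v z b t w * atomX u' v' z' b' t w) =
    \int[P]_w (atomX u v z b r w * atomX u' v' z' b' r w).
  have [tq|qt] := leP t q.
    by rewrite /r (min_idPr tq) (max_idPr (ltW pt)).
  have rE : r = Num.max p q by rewrite /r (min_idPl (ltW qt)).
  have rt : r <= t by rewrite rE ge_max (ltW pt) (ltW qt).
  have : q <= r by rewrite rE le_max lexx orbT.
  rewrite /q ge_min => /orP[h|h].
    exact: (atomX_prod_const b b' ok ok' (le_trans p0 pr) rt tT h).
  under eq_Rintegral do rewrite mulrC; under [RHS]eq_Rintegral do rewrite mulrC.
  exact: (atomX_prod_const b' b ok' ok (le_trans p0 pr) rt tT h).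
rewrite gr; move: (pr); rewrite le_eqVlt => /predU1P[<-|ltpr].
  by rewrite zero// subrr mul0r mulr0; case: ifP.
have rq : r <= q /\ r <= t.
  move: ltpr; rewrite /r lt_max ltxx/= => h; have -> : Num.max p (Num.min q t) = Num.min q t.
    by apply/max_idPr; exact: ltW.
  by split; rewrite ge_min lexx ?orbT.
case: rq => rq rt; have rv : r <= v by apply: le_trans rq _; rewrite ge_min lexx.
have rv' : r <= v' by apply: le_trans rq _; rewrite ge_min lexx orbT.
have [G L _] := atom_mart b ok; have [G' L' _] := atom_mart b' ok'.
have [GW LW oW] := W_mart T0 hF hW b; have [GW' LW' oW'] := W_mart T0 hF hW b'.
pose A w := W w r b ord0 - W w p b ord0; pose A' w := W w r b' ord0 - W w p b' ord0.
have rI : r \in `[0, T] by rewrite in_itv/= rT (le_trans p0).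
have LA : L2 P A by apply: L2B; exact: LW.
have LA' : L2 P A' by apply: L2B; exact: LW'.
pose x w := atomX u v z b p w; pose x' w := atomX u' v' z' b' p w.
have Lx : L2 P x := L _ pI; have Lx' : L2 P x' := L' _ pI.
have [Gzx' Lzx'] := gmeas_bd ok p0 up pT (G' _ pI) (L' _ pI).
have [Gz'x Lz'x] := gmeas_bd ok' p0 u'p pT (G _ pI) (L _ pI).
have zz1 w : `|z w * z' w| <= K * K' by rewrite normrM ler_pM.
have IAA : int1 P (fun w => z w * z' w * (A w * A' w)).
  have IA : int1 P (fun w => A w * A' w) by exact: L2M.
  apply: (int1_le (g := fun w => K * K' * `|A w * A' w|)).
  - by apply: measurable_funM; [exact: (gmeas_sub (filt_sub hF pI) Gzz)|exact: int1_measurable IA].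
  - by apply: int1Z; have := integrable_abse IA; apply: eq_integrable.
  - by move=> w; rewrite normrM ler_wpM2r.
have e w : atomX u v z b r w * atomX u' v' z' b' r w =
    (x w * x' w + (z' w * x w) * A' w) + ((z w * x' w) * A w + z w * z' w * (A w * A' w)).
  by rewrite (atomX_incr _ _ _ up pr rv) (atomX_incr _ _ _ u'p pr rv') /x /x' /A /A'; ring.
under eq_Rintegral do rewrite e.
rewrite RintegralD//; first last.
- by apply: int1D => //; exact: L2M.
- by apply: int1D => //; exact: L2M.
rewrite RintegralD//; [|exact: L2M|exact: L2M].
rewrite RintegralD//; [|exact: L2M].
rewrite zero// oW// oW'// !add0r.
rewrite [LHS](dW_cov hF hW p0 ltpr rT b b' Gzz zz1).
by case: ifP => // _; rewrite mulrA.
Qed.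

(** Once the square is expanded, atoms over different coordinates of [W] have zero covariance; the
    remaining pairs, grouped by coordinate, reassemble into squares of sums. *)
Lemma atoms_isometry (I : finType) (u v : I -> R) (z : I -> Omega -> R) (b : I -> 'I_m) t :
  (forall i, atom_ok (u i) (v i) (z i)) -> t \in `[0, T] ->
  \int[P]_w ((\sum_i atomX (u i) (v i) (z i) (b i) t w) ^+ 2) =
  c * \sum_(k < m) \int[PL]_x ((\sum_(i | b i == k) atomq (u i) (v i) (z i) t x) ^+ 2).
Proof.
move=> ok tT; have LX i : L2 P (atomX (u i) (v i) (z i) (b i) t).
  by have [_ L _] := atom_mart (b i) (ok i); exact: L.
have LQ i : L2 PL (atomq (u i) (v i) (z i) t) by exact: (atomq_L2 (ok i)).
have e w : (\sum_i atomX (u i) (v i) (z i) (b i) t w) ^+ 2 = \sum_i \sum_j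
    (atomX (u i) (v i) (z i) (b i) t w * atomX (u j) (v j) (z j) (b j) t w).
  by rewrite expr2 mulr_suml; apply: eq_bigr => i _; rewrite mulr_sumr.
under eq_Rintegral do rewrite e.
rewrite Rintegral_sum; last by move=> i; apply: int1_sum => j; exact: L2M.
rewrite (eq_bigr (fun i => \sum_j \int[P]_w
    (atomX (u i) (v i) (z i) (b i) t w * atomX (u j) (v j) (z j) (b j) t w))); last first.
  by move=> i _; rewrite Rintegral_sum// => j; exact: L2M.
have e2 k x : (\sum_(i | b i == k) atomq (u i) (v i) (z i) t x) ^+ 2 = \sum_i \sum_j
    ((if (b i == k) && (b j == k) then 1 else 0) *
     (atomq (u i) (v i) (z i) t x * atomq (u j) (v j) (z j) t x)).
  rewrite expr2 mulr_suml big_mkcond/=; apply: eq_bigr => i _.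
  case: ifP => bi /=; last by under eq_bigr do rewrite mul0r; rewrite big1_eq.
  rewrite mulr_sumr big_mkcond/=; apply: eq_bigr => j _.
  by case: ifP; rewrite ?mul1r ?mul0r.
have e3 k : \int[PL]_x ((\sum_(i | b i == k) atomq (u i) (v i) (z i) t x) ^+ 2) =
    \sum_i \sum_j (if (b i == k) && (b j == k) then 1 else 0) *
      \int[PL]_x (atomq (u i) (v i) (z i) t x * atomq (u j) (v j) (z j) t x).
  under eq_Rintegral do rewrite e2.
  rewrite Rintegral_sum; last first.
    by move=> i; apply: int1_sum => j; apply: int1Z; exact: L2M.
  apply: eq_bigr => i _; rewrite Rintegral_sum; last by move=> j; apply: int1Z; exact: L2M.
  by apply: eq_bigr => j _; rewrite RintegralZl//; exact: L2M.
under [X in _ = _ * X]eq_bigr do rewrite e3.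
rewrite [X in _ = _ * X]exchange_big mulr_sumr; apply: eq_bigr => i _ /=.
rewrite [X in _ = _ * X]exchange_big mulr_sumr; apply: eq_bigr => j _ /=.
rewrite (atomX_cov _ _ (ok i) (ok j) tT) -mulr_suml (bigD1 (b i))//= eqxx/= big1 ?addr0; last first.
  by move=> k /negbTE; rewrite eq_sym => ->.
by rewrite eq_sym; case: ifP => _; rewrite ?mul1r// mul0r mulr0.
Qed.

End atoms.

Lemma ge0_integral_mono {R : realType} {d} {S : measurableType d}
    (mu : {measure set S -> \bar R}) (f g : S -> \bar R) :
  (forall x, 0 <= f x)%E -> (forall x, f x <= g x)%E -> (\int[mu]_x f x <= \int[mu]_x g x)%E.
Proof.
move=> f0 fg; have g0 x : (0 <= g x)%E by exact: le_trans (fg x).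
rewrite !ge0_integralTE//; apply: le_ereal_sup => _ [h hf <-]; exists h => // x.
exact: le_trans (hf x) (fg x).
Qed.

Section simple_integral.
Context {R : realType} {dsp} {Omega : measurableType dsp}
  (P : probability Omega R) (T : R) (F : R -> set (set Omega)).
Hypothesis T0 : 0 < T.
Hypothesis hF : usual_filtration P T F.
Context {k m : nat} (W : process R Omega m 1).
Hypothesis hW : brownian_motion P T F W.
Local Notation PL := (dPdt P).
Local Notation c := (@normal_m2 R).
Implicit Type h : @simple_process R dsp Omega k m.

(** A row of a simple integral is a sum of atoms indexed by a cell and a coordinate of [W]; these
    are the data of such an atom. *)
Definition su h (x : 'I_(sp_size h) * 'I_m) : R := sp_time h x.1.
Definition sv h (x : 'I_(sp_size h) * 'I_m) : R := sp_time h x.1.+1.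
Definition sz h a (x : 'I_(sp_size h) * 'I_m) (w : Omega) : R := sp_coef h x.1 w a x.2.

Lemma simple_atom_ok h a (x : 'I_(sp_size h) * 'I_m) : simple_integrand T F h -> atom_ok T F (su x) (sv x) (sz a x).
Proof.
move=> [h1 h2 h3 h4]; case: x => i b.
have := h1 i (ltnW (ltn_ord i)); rewrite in_itv/= => /andP[u0 uT].
have := h1 i.+1 (ltn_ord i); rewrite in_itv/= => /andP[v0 vT].
split => //; first exact: (h2 i (ltn_ord i)).
  apply: ((rv_measurableP hF _ _).1 (h3 i (ltn_ord i))).
  by rewrite in_itv/= u0.
have [K hK] := h4 i (ltn_ord i); exists K => w; exact: le_trans (entry_le _ _ _) (hK w).
Qed.

Lemma simple_integral_atoms h w t a :
  simple_integral W h w t a ord0 = \sum_(x : 'I_(sp_size h) * 'I_m) atomX W (su x) (sv x) (sz a x) x.2 t w.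
Proof.
rewrite /simple_integral summxE -(pair_bigA _ (fun i b => atomX W (su (i, b)) (sv (i, b)) (sz (h := h) a (i, b)) b t w))/=.
by apply: eq_bigr => i _; rewrite mxE; apply: eq_bigr => b _; rewrite !mxE.
Qed.

Lemma simple_value_atoms h w s t a b : s <= t ->
  simple_value h w s a b = \sum_(x : 'I_(sp_size h) * 'I_m | x.2 == b) atomq (su x) (sv x) (sz a x) t (w, s).
Proof.
move=> st; rewrite /simple_value summxE.
rewrite (eq_bigl (fun x : 'I_(sp_size h) * 'I_m => true && (x.2 == b)))//.
rewrite -(pair_big_dep xpredT (fun _ b' => b' == b) (fun i b' => atomq (su (i, b')) (sv (i, b')) (sz (h := h) a (i, b')) t (w, s)))/=.
apply: eq_bigr => i _; rewrite big_pred1_eq /atomq/= le_min st andbT /su /sv /sz/=.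
by case: ifP; rewrite ?mxE.
Qed.

Lemma simple_value_after h w s t a b : t < s -> \sum_(x : 'I_(sp_size h) * 'I_m | x.2 == b)
   atomq (su x) (sv x) (sz a x) t (w, s) = 0.
Proof.
by move=> ts; apply: big1 => x _; rewrite /atomq/= le_min (leNgt s t) ts !andbF.
Qed.

Lemma simple_mart h a : simple_integrand T F h ->
  mart P T F (fun t w => simple_integral W h w t a ord0).
Proof.
move=> hh; have M x : mart P T F (fun t w => atomX W (su x) (sv x) (sz (h := h) a x) x.2 t w).
  by apply: (atom_mart T0 hF hW); exact: simple_atom_ok.
split=> [t tT|t tT|s t g s0 st tT Gg Lg].
- under [X in gmeas _ X]funext do rewrite simple_integral_atoms.
  by apply: measurable_sum => x; case: (M x) => G _ _; exact: G.
- under [X in L2 _ X]funext do rewrite simple_integral_atoms.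
  by apply: L2_sum => x; case: (M x) => _ L _; exact: L.
have sI : s \in `[0, T] by rewrite in_itv/= s0 (le_trans st).
have tI : t \in `[0, T] by rewrite in_itv/= tT (le_trans s0).
rewrite (_ : \int[P]_w _ = \int[P]_w (\sum_x (g w * (atomX W (su x) (sv x) (sz (h := h) a x) x.2 t w -
    atomX W (su x) (sv x) (sz (h := h) a x) x.2 s w)))); last first.
  by apply: eq_Rintegral => w _; rewrite !simple_integral_atoms -sumrB mulr_sumr.
rewrite Rintegral_sum; last first.
  by move=> x; apply: L2M => //; case: (M x) => _ L _; apply: L2B; exact: L.
by apply: big1 => x _; case: (M x) => _ _; exact.
Qed.

Lemma simple_vL2 h t : simple_integrand T F h -> t \in `[0, T] -> vL2 P (simple_integral W h ^~ t).
Proof.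
move=> hh tT; apply/vL2P => a j; rewrite (ord1 j).
by have [_ L _] := simple_mart a hh; exact: L.
Qed.

Lemma simple_value_predictable h : simple_integrand T F h -> predictable T F (simple_value h).
Proof.
move=> hh; apply/(predictableP T0 hF _) => a b.
apply: (gmeas_ext (f := fun z => \sum_(x : 'I_(sp_size h) * 'I_m) (if x.2 == b then
    (if su x < z.2 <= sv x then sz a x z.1 else 0) else 0))).
  move=> [w s]; rewrite -big_mkcond/=; rewrite /ext/=; case: ifPn => sT.
    rewrite (@simple_value_atoms h w s s)//; apply: eq_bigr => x _.
    by rewrite /atomq/= le_min lexx andbT.
  rewrite mxE; apply: big1 => x _; case: ifP => // /andP[us sv'].
  have [u0 _ vT _ _] := simple_atom_ok a x hh.
  by move: sT; rewrite in_itv/= (le_trans sv' vT) (ltW (le_lt_trans u0 us)).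
apply: measurable_sum => x; case: (x.2 == b); last exact: measurable_cst.
have [u0 uv vT Gz _] := simple_atom_ok a x hh.
move: uv; rewrite le_eqVlt => /predU1P[uv|uv]; last exact: (gmeas_rect T0 hF u0 uv vT Gz).
rewrite (_ : (fun wt => _) = cst 0); first exact: measurable_cst.
apply/funext => z /=; case: ifP => // /andP[h1 h2].
by move: (lt_le_trans h1 h2); rewrite uv ltxx.
Qed.

(** The two partitions may differ, so the difference is treated as one family of atoms over the
    disjoint sum of the index sets, with opposite coefficients on the right. An inequality results
    because the atoms are stopped at [t] while the right-hand side runs over all of [0, T]. *)
Lemma simple_isometry h h' t : simple_integrand T F h -> simple_integrand T F h' -> t \in `[0, T] ->
  (vnn2 P (fun w => simple_integral W h w t - simple_integral W h' w t)%R <=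
   c%:E * vnn2 PL (ext T (fun w t => simple_value h w t - simple_value h' w t)%R))%E.
Proof.
move=> hh hh' tT.
have mD : mmeas (ext T (fun w t => simple_value h w t - simple_value h' w t)).
  apply: (predictable_mmeas T0 hF); apply: (predictableB T0 hF); exact: simple_value_predictable.
have [mI _] := vL2B (simple_vL2 hh tT) (simple_vL2 hh' tT).
have c0 := @normal_m2_ge0 R.
rewrite !vnn2E// ge0_sume_distrr//; last first.
  by move=> i _; apply: sume_ge0 => j _; exact: nn2_ge0.
apply: lee_sum => a _; rewrite big_ord1.
pose I := (('I_(sp_size h) * 'I_m) + ('I_(sp_size h') * 'I_m))%type.
pose u (x : I) : R := match x with inl x => su x | inr x => su x end.
pose v (x : I) : R := match x with inl x => sv x | inr x => sv x end.
pose z (x : I) w : R := match x with inl x => sz a x w | inr x => - sz a x w end.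
pose b (x : I) : 'I_m := match x with inl x => x.2 | inr x => x.2 end.
have ok x : atom_ok T F (u x) (v x) (z x).
  case: x => x /=; first exact: simple_atom_ok.
  have [u0 uv vT Gz [K hK]] := simple_atom_ok a x hh'.
  split => //; first exact: (measurable_funN Gz).
  by exists K => w; rewrite normrN.
have eX w : (simple_integral W h w t - simple_integral W h' w t) a ord0 =
    \sum_x atomX W (u x) (v x) (z x) (b x) t w.
  rewrite !mxE !simple_integral_atoms big_sumType/= -sumrN; congr (_ + _).
  by apply: eq_bigr => x _; rewrite /atomX mulNr.
have Lt : L2 P (fun w => (simple_integral W h w t - simple_integral W h' w t) a ord0).
  by apply: ((vL2P _ _).1 (vL2B (simple_vL2 hh tT) (simple_vL2 hh' tT))).
rewrite nn2E//; under eq_Rintegral do rewrite eX.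
rewrite (atoms_isometry T0 hF hW _ ok tT) EFinM.
apply: lee_wpmul2l; first by rewrite lee_fin.
rewrite -sumEFin; apply: lee_sum => j _.
have LQ : L2 PL (fun x => \sum_(i | b i == j) atomq (u i) (v i) (z i) t x).
  rewrite (_ : (fun x => _) = fun x => \sum_i (if b i == j then atomq (u i) (v i) (z i) t x else 0)).
    apply: L2_sum => x; case: (b x == j); first exact: (atomq_L2 T0 hF (ok x)).
    split; first exact: measurable_cst.
    by rewrite /nn2; under eq_integral do rewrite expr0n; rewrite integral0.
  by apply/funext => x; rewrite big_mkcond.
rewrite -nn2E//; apply: nn2_le; [by case: LQ|exact: mD|].
move=> [w s]; have eQ : \sum_(i | b i == j) atomq (u i) (v i) (z i) t (w, s) =
    \sum_(x : 'I_(sp_size h) * 'I_m | x.2 == j) atomq (su x) (sv x) (sz a x) t (w, s) -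
    \sum_(x : 'I_(sp_size h') * 'I_m | x.2 == j) atomq (su x) (sv x) (sz a x) t (w, s).
  rewrite big_sumType/= -sumrN; congr (_ + _).
  by apply: eq_bigr => x _; rewrite /atomq; case: ifP; rewrite ?oppr0.
rewrite eQ; have [st|ts] := leP s t; last first.
  by rewrite !simple_value_after// subrr expr0n sqr_ge0.
rewrite -!simple_value_atoms//; rewrite /ext/=; case: ifPn => sT; first by rewrite !mxE.
have z0 (g : @simple_process R dsp Omega k m) : simple_integrand T F g -> simple_value g w s a j = 0.
  move=> hg; rewrite (@simple_value_atoms g w s s)//; apply: big1 => x _.
  rewrite /atomq/= le_min lexx andbT; case: ifP => // /andP[us sv'].
  have [u0 _ vT _ _] := simple_atom_ok a x hg.
  by move: sT; rewrite in_itv/= (le_trans sv' vT) (ltW (le_lt_trans u0 us)).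
by rewrite !z0// subrr mxE.
Qed.

End simple_integral.

Section misc.
Context {R : realType}.

Lemma cvge0_le (u : nat -> \bar R) (r : R) : u q @[q --> \oo] --> 0%E -> 0 < r ->
  \forall q \near \oo, (u q <= r%:E)%E.
Proof.
move=> /fine_cvgP[fu] /cvgrPdist_le cu r0; have hr := cu r r0.
near=> q; have f : u q \is a fin_num by near: q.
have : `|0 - fine (u q)| <= r by near: q.
rewrite sub0r normrN => h; rewrite -(fineK f) lee_fin.
exact: le_trans (ler_norm _) h.
Unshelve. all: by end_near. Qed.

Lemma sqrte_le_cst (a : \bar R) (c : R) : (0 <= a)%E -> 0 <= c -> (sqrte a <= c%:E)%E ->
  (a <= (c ^+ 2)%:E)%E.
Proof.
move=> a0 c0 h; rewrite -(sqr_sqrte a0) expe2 EFin_expe expe2.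
by apply: lee_pmul => //; exact: sqrte_ge0.
Qed.

(** [f] may fail to be measurable, so it is not altered on the exceptional set; instead [g] is
    raised to infinity there, which leaves its integral unchanged. *)
Lemma ae_integral_le {d} {S : measurableType d} (mu : {measure set S -> \bar R})
    (f g : S -> \bar R) : (forall x, 0 <= f x)%E -> (forall x, 0 <= g x)%E ->
  measurable_fun setT g -> {ae mu, forall x, (f x <= g x)%E} ->
  (\int[mu]_x f x <= \int[mu]_x g x)%E.
Proof.
move=> f0 g0 mg [N [mN N0 hN]].
pose g' x : \bar R := if x \in N then +oo%E else g x.
have mg' : measurable_fun setT g'.
  apply: measurable_fun_ifT; [|exact: measurable_cst|exact: mg].
  apply: (measurable_fun_bool true); rewrite setTI (_ : _ @^-1` _ = N)//.
  by apply/seteqP; split=> x /=; [move/set_mem|move/mem_set].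
apply: (@le_trans _ _ (\int[mu]_x g' x)%E).
  apply: ge0_integral_mono => // x; rewrite /g'; case: ifPn; first by rewrite leey.
  rewrite notin_setE => xN; apply: contrapT => h; apply: xN; exact: hN.
rewrite le_eqVlt; apply/orP; left; apply/eqP; apply: ae_eq_integral => //.
exists N; split => // x h; apply: contrapT => xN; apply: h => _.
by rewrite /g' memNset.
Qed.

End misc.

(** * Isometry and martingale property of the Ito integral *)

Section ito_properties.
Context {R : realType} {dsp} {Omega : measurableType dsp}
  (P : probability Omega R) (T : R) (F : R -> set (set Omega)).
Hypothesis T0 : 0 < T.
Hypothesis hF : usual_filtration P T F.
Context {k m : nat} (W : process R Omega m 1).
Hypothesis hW : brownian_motion P T F W.
Local Notation PL := (dPdt P).
Local Notation c := (@normal_m2 R).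
Implicit Types (H : process R Omega k m) (I : process R Omega k 1).

Lemma ito_approx H I (e : R) : ito_integral P T F W H I -> 0 < e -> exists h,
  [/\ simple_integrand T F h,
      (vnn2 PL (ext T (fun w t => simple_value h w t - H w t)%R) <= e%:E)%E
    & forall t, t \in `[0, T] ->
      (vnn2 P (fun w => simple_integral W h w t - I w t)%R <= e%:E)%E].
Proof.
move=> [HH SI [h [h1 h2 h3]]] e0; have s0 : 0 < Num.sqrt e by rewrite sqrtr_gt0.
have [q [hq1 hq2]] : exists q,
    (normH2 P T (fun w t => simple_value (h q) w t - H w t)%R <= (Num.sqrt e)%:E)%E /\
    (normS2 P T (fun w t => simple_integral W (h q) w t - I w t)%R <= (Num.sqrt e)%:E)%E.
  have [N _ hN] := filterI (cvge0_le h2 s0) (cvge0_le h3 s0).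
  by exists N; exact: (hN N (leqnn N)).
exists (h q); split => //.
  have pD : predictable T F (fun w t => simple_value (h q) w t - H w t).
    apply: (predictableB T0 hF); first exact: (simple_value_predictable T0 hF).
    by case: HH.
  have ee : e = Num.sqrt e ^+ 2 by rewrite sqr_sqrtr// ltW.
  rewrite [X in (_ <= X%:E)%E]ee; apply: sqrte_le_cst; [exact: vnn2_ge0|exact: ltW|].
  by rewrite -normH2E//; exact: (predictable_mmeas T0 hF).
move=> t tT; have := normS2_le T0 (ltW s0) hq2; rewrite sqr_sqrtr; last exact: ltW.
apply: le_trans; apply: ge0_integral_mono => [w|w]; first by rewrite lee_fin sqr_ge0.
exact: esup_ub.
Qed.

Lemma ito_S2 H I : ito_integral P T F W H I -> S2 P T F I.
Proof. by case. Qed.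

Lemma ito_H2 H I : ito_integral P T F W H I -> predictable T F H /\ vL2 PL (ext T H).
Proof. by case=> /(H2P T0 hF). Qed.

Lemma S2_vL2 k' l (U : process R Omega k' l) t : S2 P T F U -> t \in `[0, T] -> vL2 P (U ^~ t).
Proof.
move=> SU tT; have rU := S2_rcproc hF SU; split; first exact: rU.1.
exact: le_lt_trans (vnn2_nS P T0 rU tT) (S2_nS T0 SU).
Qed.

(** Both integrals are replaced by simple ones within the same error [e], for which the isometry
    holds. The constant is generous; its size is harmless because in the contraction the noise
    carries a factor [T]. *)
Lemma ito_dist H I H' I' t : ito_integral P T F W H I -> ito_integral P T F W H' I' ->
  t \in `[0, T] ->
  (vnn2 P (fun w => I w t - I' w t)%R <=
   (8 * c)%:E * vnn2 PL (ext T (fun w t => H w t - H' w t)%R))%E.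
Proof.
move=> hI hI' tT; have c0 : 0 <= c := normal_m2_ge0.
have [pH LH] := ito_H2 hI; have [pH' LH'] := ito_H2 hI'.
have [mI _] := S2_vL2 (ito_S2 hI) tT; have [mI' _] := S2_vL2 (ito_S2 hI') tT.
apply/lee_addgt0Pr => r r0; pose e := r / (8 + 64 * c).
have d0 : 0 < 8 + 64 * c by lra.
have e0 : 0 < e by rewrite divr_gt0.
have [h [hh h1 h2]] := ito_approx hI e0; have [h' [hh' h1' h2']] := ito_approx hI' e0.
have [mh _] := simple_vL2 T0 hF hW hh tT; have [mh' _] := simple_vL2 T0 hF hW hh' tT.
set V := vnn2 PL _.
have V0 : (0 <= V)%E := vnn2_ge0 _ _.
have hv : (vnn2 PL (ext T (fun w t => simple_value h w t - simple_value h' w t)%R) <=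
    2%:E * V + (8 * e)%:E)%E.
  have ph := simple_value_predictable T0 hF hh; have ph' := simple_value_predictable T0 hF hh'.
  have m1 := predictable_mmeas T0 hF (predictableB T0 hF pH pH').
  have m2 := predictable_mmeas T0 hF (predictableB T0 hF ph pH).
  have m3 := predictable_mmeas T0 hF (predictableB T0 hF ph' pH').
  have -> : ext T (fun w t => simple_value h w t - simple_value h' w t) =
     fun z => ext T (fun w t => H w t - H' w t) z +
       (ext T (fun w t => simple_value h w t - H w t) z - ext T (fun w t => simple_value h' w t - H' w t) z).
    by apply/funext => z; rewrite !extB; apply/matrixP => i j; rewrite !mxE; ring.
  apply: le_trans (vnn2D PL m1 (mmeasB m2 m3)) _; apply: leeD => //.
  apply: (@le_trans _ _ (2%:E * (2%:E * e%:E + 2%:E * e%:E))%E).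
    apply: lee_wpmul2l => //; apply: le_trans (vnn2B PL m2 m3) _.
    by apply: leeD; apply: lee_wpmul2l.
  by rewrite -!(EFinM, EFinD) lee_fin; lra.
have -> : (fun w => I w t - I' w t) = fun w => (simple_integral W h w t - simple_integral W h' w t) +
    ((simple_integral W h' w t - I' w t) - (simple_integral W h w t - I w t)).
  by apply/funext => w; apply/matrixP => i j; rewrite !mxE; ring.
apply: le_trans (vnn2D P (mmeasB mh mh') (mmeasB (mmeasB mh' mI') (mmeasB mh mI))) _.
apply: (@le_trans _ _ (2%:E * (c%:E * (2%:E * V + (8 * e)%:E)) + 2%:E * (2%:E * e%:E + 2%:E * e%:E))%E).
  apply: leeD; apply: lee_wpmul2l => //.
    apply: le_trans (simple_isometry T0 hF hW hh hh' tT) _.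
    by apply: lee_wpmul2l => //; rewrite lee_fin.
  apply: le_trans (vnn2B P (mmeasB mh' mI') (mmeasB mh mI)) _.
  by apply: leeD; apply: lee_wpmul2l => //; [exact: h2'|exact: h2].
have Vf : V \is a fin_num.
  rewrite ge0_fin_numE//; case: (vL2B LH LH') => _; by rewrite -extB.
move: (V) Vf V0 => [v||]// _ v0; rewrite lee_fin in v0.
rewrite -!(EFinM, EFinD) lee_fin.
have re : r = e * (8 + 64 * c) by rewrite /e divfK// gt_eqF.
have cv : 0 <= c * v by exact: mulr_ge0.
have ce : 0 <= c * e by rewrite mulr_ge0// ltW.
rewrite re; lra.
Qed.

Lemma mart_ae (Z Z' : R -> Omega -> R) : mart P T F Z ->
  (forall t, t \in `[0, T] -> {ae P, forall w, Z t w = Z' t w}) -> mart P T F Z'.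
Proof.
move=> [G L o] h; have G' t : t \in `[0, T] -> gmeas (F t) (Z' t).
  by move=> tT; exact: (gmeas_ae hF tT (G t tT) (h t tT)).
have L' t : t \in `[0, T] -> L2 P (Z' t).
  move=> tT; have m' := gmeas_sub (filt_sub hF tT) (G' t tT); split => //.
  by have [m1] := L t tT; rewrite (ae_eq_nn2 m1 m' (h t tT)).
split => // s t g s0 st tT Gg Lg; rewrite -(o s t g s0 st tT Gg Lg).
have sI : s \in `[0, T] by rewrite in_itv/= s0 (le_trans st).
have tI : t \in `[0, T] by rewrite in_itv/= tT (le_trans s0).
have mg := gmeas_sub (filt_sub hF sI) Gg.
have [m1 _] := L s sI; have [m2 _] := L t tI; have [m1' _] := L' s sI; have [m2' _] := L' t tI.
apply: ae_eq_Rintegral.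
- by apply: measurable_funM => //; exact: measurable_funB.
- by apply: measurable_funM => //; exact: measurable_funB.
by apply: filterS2 (h s sI) (h t tI) => w -> ->.
Qed.

(** Orthogonality is exact for simple integrals. Young's inequality with weight [e] turns an
    approximation of squared error [e^2] into an error of order [e] in the pairing with [g]. *)
Lemma ito_mart H I a : ito_integral P T F W H I -> mart P T F (fun t w => I w t a ord0).
Proof.
move=> hI; have SI := ito_S2 hI; have [aI _ _] := SI.
have L t : t \in `[0, T] -> L2 P (fun w => I w t a ord0).
  by move=> tT; exact: ((vL2P _ _).1 (S2_vL2 SI tT)).
split=> [t tT|//|s t g s0 st tT Gg Lg]; first exact: ((adapted_gmeas I hF).1 aI t tT).
have sI : s \in `[0, T] by rewrite in_itv/= s0 (le_trans st).
have tI : t \in `[0, T] by rewrite in_itv/= tT (le_trans s0).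
pose y := \int[P]_w (g w ^+ 2); have y0 : 0 <= y by apply: Rintegral_ge0 => w _; exact: sqr_ge0.
set x := \int[P]_w _; suff H0 e : 0 < e -> `|x| <= e * (y + 4).
  apply/eqP; rewrite -normr_eq0 eq_le normr_ge0 andbT; apply/ler_addgt0Pr => r r0.
  have := H0 (r / (y + 4)); rewrite divfK ?add0r; last by rewrite gt_eqF//; lra.
  by apply; rewrite divr_gt0//; lra.
move=> e0; have ee0 : 0 < e ^+ 2 by rewrite exprn_gt0.
have [h [hh _ h2]] := ito_approx hI ee0.
have [_ Lh oh] := simple_mart T0 hF hW a hh.
pose Z u w := simple_integral W h w u a ord0 - I w u a ord0.
have LZ u : u \in `[0, T] -> L2 P (Z u) by move=> uT; apply: L2B; [exact: Lh|exact: L].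
have nZ u : u \in `[0, T] -> \int[P]_w (Z u w ^+ 2) <= e ^+ 2.
  move=> uT; rewrite -lee_fin -nn2E; last exact: LZ.
  apply: le_trans (h2 u uT); apply: ge0_integral_mono => w; first by rewrite lee_fin sqr_ge0.
  rewrite lee_fin; have := entry_sqr_le (simple_integral W h w u - I w u) a ord0.
  by rewrite !mxE.
have xE : x = - \int[P]_w (g w * (Z t w - Z s w)).
  have -> : \int[P]_w (g w * (Z t w - Z s w)) =
      \int[P]_w (g w * (simple_integral W h w t a ord0 - simple_integral W h w s a ord0)) - x.
    rewrite -RintegralB//; first by apply: eq_Rintegral => w _; rewrite /Z; ring.
    - by apply: L2M => //; apply: L2B; exact: Lh.
    - by apply: L2M => //; apply: L2B; exact: L.
  by rewrite oh// sub0r opprK.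
rewrite xE normrN; apply: le_trans (le_normr_Rintegral _ _) _ => //.
  by apply: L2M => //; apply: L2B; exact: LZ.
have i1 := int1_sq Lg; have i2 := int1_sq (LZ s sI); have i3 := int1_sq (LZ t tI).
apply: (@le_trans _ _ (\int[P]_w (e * g w ^+ 2 + (e^-1 * Z t w ^+ 2 + e^-1 * Z s w ^+ 2)))).
  apply: le_Rintegral => //.
  - have Ix : int1 P (fun w => g w * (Z t w - Z s w)).
      by apply: L2M => //; apply: L2B; exact: LZ.
    by have := integrable_abse Ix; apply: eq_integrable.
  - by apply: int1D; [exact: int1Z|apply: int1D; exact: int1Z].
  move=> w _; have ei : e * e^-1 = 1 by rewrite divff// gt_eqF.
  have e1 : 0 < e^-1 by rewrite invr_gt0.
  have h0 (q : R) : q * g w <= (e * g w ^+ 2) / 2 + e^-1 * q ^+ 2 / 2.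
    have : 0 <= e^-1 * (e * g w - q) ^+ 2 by rewrite mulr_ge0 ?sqr_ge0// ltW.
    have -> : e^-1 * (e * g w - q) ^+ 2 = (e * e^-1) * (e * g w ^+ 2) - 2 * (e * e^-1) * (q * g w) + e^-1 * q ^+ 2.
      by ring.
    by rewrite ei; lra.
  have h3 := h0 (Z t w); have h4 := h0 (- Z s w); have h5 := h0 (- Z t w); have h6 := h0 (Z s w).
  have p1 : 0 <= e^-1 * Z t w ^+ 2 by rewrite mulr_ge0 ?sqr_ge0// ltW.
  have p2 : 0 <= e^-1 * Z s w ^+ 2 by rewrite mulr_ge0 ?sqr_ge0// ltW.
  by rewrite sqrrN in h4 h5; rewrite ler_norml; apply/andP; split; lra.
rewrite RintegralD//; [|exact: int1Z|by apply: int1D; exact: int1Z].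
rewrite RintegralD//; [|exact: int1Z|exact: int1Z].
rewrite !RintegralZl// -/y mulrDr lerD2l.
have := nZ t tI; have := nZ s sI => hs ht.
have f (q : R) : q <= e ^+ 2 -> e^-1 * q <= e.
  by move=> hq; rewrite mulrC ler_pdivrMr// -expr2.
by have := f _ hs; have := f _ ht; lra.
Qed.

End ito_properties.

(** * Density of simple integrands and existence of the Ito integral *)

Section density.
Context {R : realType}.
Variable T : R.
Hypothesis T0 : 0 < T.
Local Notation leb := (@lebesgue_measure R).

Definition delta (j : nat) : R := T / 2 ^+ j.

Lemma delta_gt0 j : 0 < delta j.
Proof. by rewrite divr_gt0// exprn_gt0. Qed.

(** For a natural number [a], the cell that ends at grid point [a]. *)
Definition cell (j : nat) (a : R) : set R := `[delta j * (a - 1), delta j * a]%classic.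

Lemma measurable_cell j a : measurable (cell j a).
Proof. exact: measurable_itv. Qed.

Lemma leb_cell j a : leb (cell j a) = (delta j)%:E.
Proof.
have d0 := delta_gt0 j; rewrite /cell lebesgue_measure_itv/= lte_fin ltr_pM2l//.
by rewrite ltrBlDr ltrDl ltr01 -EFinB; congr (_%:E); ring.
Qed.

Lemma int1_cell j a : int1 leb (\1_(cell j a) : R -> R).
Proof.
have mc := measurable_cell j a.
apply/integrableP; split; first by apply/measurable_EFinP; exact: measurable_indic.
rewrite (_ : (\int[leb]_x `|(EFin \o \1_(cell j a)) x| = leb (cell j a))%E); first by rewrite leb_cell ltry.
transitivity (\int[leb]_x (\1_(cell j a) x)%:E)%E; last by rewrite integral_indic// setIT.
by apply: eq_integral => x _; rewrite /= indicE ger0_norm.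
Qed.

Lemma Rintegral_cell j a : \int[leb]_x (\1_(cell j a) x) = delta j.
Proof. have mc := measurable_cell j a; rewrite /Rintegral.
have -> : (\int[leb]_x (\1_(cell j a) x)%:E = leb (cell j a))%E by rewrite integral_indic// setIT.
by rewrite leb_cell. Qed.

(** The cell before the one that contains [x] misses [x] itself, but it lies in the ball of radius
    [3 delta] around it, whose measure is six times that of the cell; this is all that
    differentiation requires. *)
Lemma lagcell_nice (x : R) :
  nicely_shrinking x (fun j => cell j ((Num.ceil (x / delta j))%:~R - 1)).
Proof.
split=> [j|]; first exact: measurable_itv.
pose r j : {posnum R} := PosNum (mulr_gt0 (ltr0n R 3) (delta_gt0 j)).
have d0 := delta_gt0.
exists (6, r); split => //=.
- rewrite /delta -[X in _ --> X](mulr0 (3 * T)).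
  rewrite (_ : (fun n => _) = fun n => 3 * T * 2^-1 ^+ n); last first.
    by apply/funext => n; rewrite exprVn mulrA.
  by apply: cvgMr; apply: cvg_expr; rewrite ger0_norm; lra.
- move=> j y; rewrite /cell/= in_itv/= /ball/= => /andP[h1 h2].
  have /andP[c1 c2] := ceil_itv (x / delta j); rewrite intrD/= in c1.
  have c1' : delta j * ((Num.ceil (x / delta j))%:~R - 1) < x by rewrite mulrC -ltr_pdivlMr.
  have c2' : x <= delta j * (Num.ceil (x / delta j))%:~R by rewrite mulrC -ler_pdivrMr.
  move: h1 h2 c1' c2'; rewrite !mulrDr; have := d0 j.
  move: (delta j * _%:~R) => q D h1 h2 c1' c2'.
  by rewrite ltr_norml; apply/andP; split; lra.
- move=> j; rewrite leb_cell lebesgue_measure_ball; last by rewrite mulr_ge0// ltW.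
  rewrite -EFinM lee_fin.
  by have := d0 j; lra.
Qed.

(** The mean of [f] over the cell that ends at grid point [k], to be used on the cell that starts
    there: the lag of one cell makes the coefficient known at its time. For [k = 0] the mean is over
    times before 0, where the integrands considered vanish. *)
Definition lagcoef (j k : nat) (f : R -> R) : R :=
  (delta j)^-1 * \int[leb]_s (\1_(cell j k%:R) s * f s).

Definition lagstep (j : nat) (f : R -> R) (t : R) : R :=
  \sum_(k < 2 ^ j) (if grid T j k < t <= grid T j k.+1 then lagcoef j k f else 0).

Lemma grid_delta j k : (k <= 2 ^ j)%N -> grid T j k = delta j * k%:R.
Proof. by move=> kj; rewrite /grid (minn_idPl kj) /delta; ring. Qed.

Lemma lagstep_out j (f : R -> R) t : t \notin `]0, T] -> lagstep j f t = 0.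
Proof.
move=> tT; rewrite /lagstep big1// => k _; case: ifP => // /andP[h1 h2].
move: tT; rewrite in_itv/= (le_lt_trans (grid_ge0 T0 _ _) h1).
by rewrite (le_trans h2 (grid_leT T0 _ _)).
Qed.

Variables (f : R -> R) (K : R).
Hypothesis mf : measurable_fun setT f.
Hypothesis fK : forall s, `|f s| <= K.
Hypothesis f0 : forall s, s \notin `[0, T] -> f s = 0.

Let K0 : 0 <= K. Proof. exact: le_trans (fK 0). Qed.

Lemma int1_cellM j a : int1 leb (fun s => \1_(cell j a) s * f s).
Proof.
apply: (@int1_le _ _ _ leb _ (fun s => K * \1_(cell j a) s)).
- by apply: measurable_funM => //; apply: measurable_indic; exact: measurable_cell.
- by apply: int1Z; exact: int1_cell.
- by move=> s; rewrite normrM [X in X * _]ger0_norm ?indicE// mulrC ler_wpM2r.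
Qed.

Lemma lagcoef_bound j k : `|lagcoef j k f| <= K.
Proof.
have d0 := delta_gt0 j; have i2 := int1_cellM j k%:R.
rewrite normrM gtr0_norm ?invr_gt0// mulrC ler_pdivrMr//.
apply: le_trans (le_normr_Rintegral _ i2) _ => //.
apply: (@le_trans _ _ (\int[leb]_s (K * \1_(cell j k%:R) s))).
  apply: le_Rintegral => //.
  - by have := integrable_abse i2; apply: eq_integrable.
  - by apply: int1Z; exact: int1_cell.
  - by move=> s _; rewrite normrM [X in X * _]ger0_norm ?indicE// mulrC ler_wpM2r.
by rewrite RintegralZl//; [rewrite Rintegral_cell|exact: int1_cell].
Qed.

Lemma lagstep_bound j t : `|lagstep j f t| <= K.
Proof.
have [|tT] := boolP (t \in `]0, T]); last by rewrite lagstep_out// normr0.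
rewrite in_itv/= => /andP[t0 tT]; have [k [_ hv]] := lstep_eval T0 j t0 tT.
by rewrite /lagstep (hv (fun k => lagcoef j k f)); exact: lagcoef_bound.
Qed.

Lemma int1_supp : int1 leb f.
Proof.
apply: (@int1_le _ _ _ leb _ (fun s => K * \1_(`[0, T]%classic) s)) => //.
  apply: int1Z; apply/integrableP; split; first by apply/measurable_EFinP; exact: measurable_indic.
  rewrite (_ : (\int[leb]_x _ = leb `[0%R, T]%classic)%E).
    by rewrite lebesgue_measure_itv/= lte_fin T0 -EFinB ltry.
  transitivity (\int[leb]_x (\1_(`[0%R, T]%classic) x)%:E)%E; last by rewrite integral_indic// setIT.
  by apply: eq_integral => x _; rewrite /= indicE ger0_norm.
move=> s; rewrite indicE mem_setE; case: (boolP (s \in `[0, T])) => sT; first by rewrite mulr1.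
by rewrite f0// normr0 mulr0.
Qed.

Lemma lagstep_cvg t : lebesgue_pt f t -> 0 < t -> t <= T ->
  lagstep j f t @[j --> \oo] --> f t.
Proof.
move=> pt t0 tT.
have lf : locally_integrable setT f by exact: (open_integrable_locally openT int1_supp).
have := nice_lebesgue_differentiation lagcell_nice lf pt.
suff e j : ((leb (cell j ((Num.ceil (t / delta j))%:~R - 1)))^-1 *
   \int[leb]_(y in cell j ((Num.ceil (t / delta j))%:~R - 1)) (f y)%:E = (lagstep j f t)%:E)%E.
  by under eq_fun do rewrite e; move=> /fine_cvgP[_].
have [k [/andP[h1 h2] hv]] := lstep_eval T0 j t0 tT.
have d0 := delta_gt0 j.
have kj : (k <= 2 ^ j)%N by exact: ltnW.
have ck : (Num.ceil (t / delta j))%:~R - 1 = k%:R :> R.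
  have -> : Num.ceil (t / delta j) = (k%:Z + 1)%R.
    apply/eqP; rewrite eq_le ceil_le_int lezD1 ceil_gt_int.
    move: h1 h2; rewrite !grid_delta// => h1 h2.
    by rewrite ler_pdivrMr// ltr_pdivlMr// intrD/= ![_ * delta j]mulrC natr1 h1 h2.
  by rewrite intrD/= addrK.
rewrite ck leb_cell inver gt_eqF// /lagstep (hv (fun k => lagcoef j k f)) /lagcoef EFinM.
congr (_ * _)%E; have I := int1_cellM j k%:R.
rewrite fineK; last exact: integrable_fin_num.
rewrite [LHS]integral_mkcond; apply: eq_integral => x _.
by rewrite patchE indicE; case: ifP; rewrite ?mul1r ?mul0r.
Qed.

Lemma measurable_lagstep j : measurable_fun setT (lagstep j f).
Proof.
apply: measurable_sum => k; apply: measurable_fun_ifT; try exact: measurable_cst.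
apply: measurable_and; first by apply: measurable_fun_ltr => //; exact: measurable_cst.
by apply: measurable_fun_ler => //; exact: measurable_cst.
Qed.

Lemma lagstep_sq_le j t : (lagstep j f t - f t) ^+ 2 <= (2 * K) ^+ 2 * \1_(`[0, T]%classic) t.
Proof.
rewrite indicE mem_setE; case: (boolP (t \in `[0, T])) => tT; last first.
  rewrite f0// lagstep_out ?subrr ?expr0n ?mulr0//; apply: contra tT.
  by rewrite !in_itv/= => /andP[/ltW -> ->].
rewrite mulr1 -[leLHS]real_normK ?num_real// lerXn2r ?nnegrE ?mulr_ge0//.
by apply: le_trans (ler_normB _ _) _; have := lagstep_bound j t; have := fK t; lra.
Qed.

Lemma lagstep_L2_cvg : nn2 leb (fun t => lagstep j f t - f t) @[j --> \oo] --> 0%E.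
Proof.
have If := int1_supp.
have lf : locally_integrable setT f := open_integrable_locally openT If.
have i1 : int1 leb (fun t => (2 * K) ^+ 2 * \1_(`[0, T]%classic) t).
  apply: int1Z; apply/integrableP; split; first by apply/measurable_EFinP; exact: measurable_indic.
  rewrite (_ : (\int[leb]_x _ = leb `[0%R, T]%classic)%E).
    by rewrite lebesgue_measure_itv/= lte_fin T0 -EFinB ltry.
  transitivity (\int[leb]_x (\1_(`[0%R, T]%classic) x)%:E)%E; last by rewrite integral_indic// setIT.
  by apply: eq_integral => x _; rewrite /= indicE ger0_norm.
have := @dominated_convergence _ _ _ leb setT measurableT
  (fun j t => ((lagstep j f t - f t) ^+ 2)%:E) (cst 0%E)
  (fun t => ((2 * K) ^+ 2 * \1_(`[0, T]%classic) t)%:E).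
move=> [|||||_ _].
- move=> j; apply: measurable_sqE; apply: measurable_funB => //; exact: measurable_lagstep.
- exact: measurable_cst.
- have h0 : {ae leb, forall t : R, t != 0}.
    by exists [set 0]; split => //; [exact: lebesgue_measure_set1|move=> t /= /negP; rewrite negbK => /eqP].
  have := ae_and h0 (lebesgue_differentiation lf); apply: filterS => t [tn0 pt] _.
  apply/fine_cvgP; split; first exact: nearW.
  have [|tT] := boolP (t \in `]0, T]).
    rewrite in_itv/= => /andP[t0 tT].
    have := lagstep_cvg pt t0 tT => h.
    have hd : lagstep j f t - f t @[j --> \oo] --> f t - f t by apply: cvgB => //; exact: cvg_cst.
    rewrite subrr in hd.
    rewrite (_ : fine \o _ = (fun j => (lagstep j f t - f t) * (lagstep j f t - f t))).
      by rewrite -[X in _ --> X](mulr0 (0 : R)); exact: cvgM.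
    by apply/funext => j /=; rewrite expr2.
  rewrite (_ : (fun j => _) = cst 0); first exact: cvg_cst.
  apply/funext => j /=; rewrite lagstep_out// f0 ?subrr ?expr0n//.
  by apply: contra tT; rewrite !in_itv/= le_eqVlt eq_sym (negbTE tn0)/=.
- exact: i1.
- by apply: aeW => t j _; rewrite /= ger0_norm ?sqr_ge0// lee_fin; exact: lagstep_sq_le.
by rewrite integral0.
Qed.

End density.

Section clip.
Context {R : realType}.

Definition clip (n : nat) (x : R) : R := Num.max (- n%:R) (Num.min n%:R x).

Lemma clip_bound n x : `|clip n x| <= n%:R.
Proof.
rewrite /clip ler_norml le_max lexx/= ge_max ge_min lexx andbT.
by rewrite (le_trans _ (ler0n R n))// oppr_le0.
Qed.

Lemma clip_id n x : `|x| <= n%:R -> clip n x = x.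
Proof. by rewrite ler_norml => /andP[h1 h2]; rewrite /clip (min_idPr h2) (max_idPr h1). Qed.

Lemma clip_dist n x : (clip n x - x) ^+ 2 <= x ^+ 2.
Proof.
have n0 := ler0n R n; rewrite /clip.
case: (leP n%:R x) => h1; case: (leP (- n%:R) _) => h2; nra.
Qed.

Lemma clip0 n : clip n 0 = 0.
Proof. by apply: clip_id; rewrite normr0. Qed.

Lemma measurable_clip n : measurable_fun setT (clip n).
Proof. by apply: measurable_maxr => //; apply: measurable_minr. Qed.

End clip.

Section ito_existence.
Context {R : realType} {dsp} {Omega : measurableType dsp}
  (P : probability Omega R) (T : R) (F : R -> set (set Omega)).
Hypothesis T0 : 0 < T.
Hypothesis hP : measure_is_complete P.
Hypothesis hF : usual_filtration P T F.
Context {k m : nat} (W : process R Omega m 1).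
Hypothesis hW : brownian_motion P T F W.
Local Notation PL := (dPdt P).
Local Notation leb := (@lebesgue_measure R).
Local Notation c := (@normal_m2 R).
Implicit Types (H : process R Omega k m) (I : process R Omega k 1).

Definition clipH n H : process R Omega k m := fun w t => \matrix_(a, b) clip n (H w t a b).

Lemma ext_clipH n H z a b : ext T (clipH n H) z a b = clip n (ext T H z a b).
Proof. by rewrite /ext/clipH; case: ifP => _; rewrite !mxE ?clip0. Qed.

Lemma predictable_clipH n H : predictable T F H -> predictable T F (clipH n H).
Proof.
move=> /(predictableP T0 hF _) pH; apply/(predictableP T0 hF _) => a b.
apply: (gmeas_ext (f := clip n \o fun z => ext T H z a b)).
  by move=> z /=; rewrite ext_clipH.
exact: (measurableT_comp (@measurable_clip R n) (pH a b)).
Qed.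

Lemma clipH_cvg H : predictable T F H -> vL2 PL (ext T H) ->
  vnn2 PL (ext T (fun w t => clipH n H w t - H w t)) @[n --> \oo] --> 0%E.
Proof.
move=> pH LH; have mD n : mmeas (ext T (fun w t => clipH n H w t - H w t)).
  by apply: (predictable_mmeas T0 hF); apply: (predictableB T0 hF) => //; exact: predictable_clipH.
have := @dominated_convergence _ _ _ PL setT measurableT
  (fun n z => (hsnorm (ext T (fun w t => clipH n H w t - H w t) z) ^+ 2)%:E) (cst 0%E)
  (fun z => (hsnorm (ext T H z) ^+ 2)%:E).
move=> [|||||_ _].
- by move=> n; exact: mmeas_sqrE.
- exact: measurable_cst.
- apply: aeW => z _; apply/fine_cvgP; split; first exact: nearW.
  apply: (@cvg_trans _ (cst 0 @ \oo)); last exact: cvg_cst.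
  apply: near_eq_cvg; have [N hN] : exists N : nat, hsnorm (ext T H z) <= N%:R.
    by exists (Num.truncn (hsnorm (ext T H z))).+1; apply: ltW; exact: truncnS_gt.
  exists N => // n /= Nn; rewrite extB (_ : ext T (clipH n H) z - ext T H z = 0) ?hsnorm0 ?expr0n//.
  apply/matrixP => a b; rewrite !mxE ext_clipH clip_id ?subrr//.
  by rewrite (le_trans (entry_le _ _ _))// (le_trans hN)// ler_nat.
- exact: vL2_int1.
- apply: aeW => z n _; rewrite /= ger0_norm ?sqr_ge0// lee_fin !hsnorm_sqr.
  apply: ler_sum => a _; apply: ler_sum => b _.
  by rewrite extB !mxE ext_clipH; exact: clip_dist.
by rewrite integral0.
Qed.

Definition lagproc n j H : simple_process k m := SimpleProcess (2 ^ j) (grid T j)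
  (fun q w => \matrix_(a, b) lagcoef T j q (fun s => ext T (clipH n H) (w, s) a b)).

Section lag.
Variables (n : nat) (H : process R Omega k m).
Hypothesis pH : predictable T F H.

Let fw w a b s := ext T (clipH n H) (w, s) a b.

Let mfw w a b : measurable_fun setT (fw w a b).
Proof.
have mC := predictable_mmeas T0 hF (predictable_clipH n pH).
exact: (measurableT_comp (mC a b) (measurable_pair1 w)).
Qed.

Let fwK w a b s : `|fw w a b s| <= n%:R.
Proof. by rewrite /fw ext_clipH clip_bound. Qed.

Let fw0 w a b s : s \notin `[0, T] -> fw w a b s = 0.
Proof. by move=> /negbTE h; rewrite /fw /ext/= h mxE. Qed.

Lemma lagproc_simple j : simple_integrand T F (lagproc n j H).
Proof.
split=> /=.
- by move=> i _; exact: grid_itv.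
- by move=> i _; exact: grid_mono.
- move=> i ij; apply/(rv_measurableP hF _ (grid_itv T0 j i)) => a b.
  have tI := grid_itv T0 j i; set t := grid T j i in tI *.
  have tE : t = delta T j * i%:R by rewrite /t (grid_delta T (ltnW ij)).
  under [X in gmeas _ X]funext do rewrite mxE /lagcoef.
  apply: measurable_funM; first exact: measurable_cst.
  (* The averaging cell ends at [t], so only the part of the integrand up to [t] enters, and this
     part is jointly measurable for [F t]. *)
  have := predictable_truncated hF a b tI (predictable_clipH n pH) => mt.
  have m1 : measurable_fun [set: g_sigma_algebraType (F t) * R] (fun z => \1_(cell T j i%:R) z.2 : R).
    apply: (@measurableT_comp _ _ _ _ _ _ (\1_(cell T j i%:R) : R -> R)); last exact: measurable_snd.
    by apply: measurable_indic; exact: measurable_cell.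
  have := measurable_Rintegral_section (measurable_funM m1 mt).
  congr measurable_fun; apply/funext => w; apply: eq_Rintegral => s _ /=.
  rewrite indicE; case: (boolP (s \in cell T j i%:R)); last by rewrite !mul0r.
  rewrite mem_setE in_itv/= -tE => /andP[_ st]; congr (_ * _).
  rewrite /ext/= !in_itv/= st andbT; case: ifP => /= s0; last by rewrite mxE.
  by move: tI; rewrite in_itv/= => /andP[_ tT]; rewrite (le_trans st tT).
move=> i ij; exists (Num.sqrt (\sum_(a < k) \sum_(b < m) n%:R ^+ 2)) => w.
rewrite /hsnorm ler_sqrt; last by apply: sumr_ge0 => a _; apply: sumr_ge0 => b _; exact: sqr_ge0.
apply: ler_sum => a _; apply: ler_sum => b _; rewrite mxE -[leLHS]real_normK ?num_real//.
rewrite lerXn2r ?nnegrE//; apply: lagcoef_bound => //; [exact: mfw|exact: fwK].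
Qed.

Lemma lagproc_value j w t a b : simple_value (lagproc n j H) w t a b = lagstep T j (fw w a b) t.
Proof.
by rewrite /simple_value summxE; apply: eq_bigr => q _; case: ifP => _; rewrite mxE.
Qed.

Lemma lagproc_cvg : vnn2 PL (ext T (fun w t => simple_value (lagproc n j H) w t - clipH n H w t))
   @[j --> \oo] --> 0%E.
Proof.
have mD j : mmeas (ext T (fun w t => simple_value (lagproc n j H) w t - clipH n H w t)).
  apply: (predictable_mmeas T0 hF); apply: (predictableB T0 hF).
    by apply: (simple_value_predictable T0 hF); exact: lagproc_simple.
  exact: predictable_clipH.
have e j z a b : ext T (fun w t => simple_value (lagproc n j H) w t - clipH n H w t) z a b =
    lagstep T j (fw z.1 a b) z.2 - fw z.1 a b z.2.
  rewrite /fw -surjective_pairing extB !mxE {1}/ext; case: ifPn => [_|zT]; first by rewrite lagproc_value.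
  rewrite mxE lagstep_out//; apply: contra zT.
  by rewrite !in_itv/= => /andP[/ltW -> ->].
have step a b : (nn2 PL (fun z => ext T (fun w t => simple_value (lagproc n j H) w t - clipH n H w t)%R z a b))
    @[j --> \oo] --> 0%E.
  have e2 j : nn2 PL (fun z => ext T (fun w t => simple_value (lagproc n j H) w t - clipH n H w t) z a b) =
      (\int[P]_w nn2 leb (fun t => lagstep T j (fw w a b) t - fw w a b t)%R)%E.
    rewrite /nn2 (@tonelli_P _ _ _ P (fun z => (ext T (fun w t => simple_value (lagproc n j H) w t - clipH n H w t) z a b) ^+ 2)).
    - by apply: eq_integral => w _; apply: eq_integral => t _; rewrite e.
    - by apply: measurable_funX; exact: mD.
    - by move=> z; exact: sqr_ge0.
  under eq_fun do rewrite e2.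
  have mF j : measurable_fun setT (fun w => nn2 leb (fun t => lagstep T j (fw w a b) t - fw w a b t)).
    rewrite (_ : (fun w => _) = fun w => (\int[leb]_t ((ext T (fun w t => simple_value (lagproc n j H) w t - clipH n H w t)%R (w, t) a b) ^+ 2)%:E)%E); last first.
      by apply/funext => w; apply: eq_integral => t _; rewrite e.
    apply: (measurable_fun_fubini_tonelli_F (m2 := leb) (fun z =>
       ((ext T (fun w t => simple_value (lagproc n j H) w t - clipH n H w t) z a b) ^+ 2)%:E)).
      by apply: measurable_sqE; exact: mD.
    by move=> z; rewrite lee_fin sqr_ge0.
  have := @dominated_convergence _ _ _ P setT measurableT
    (fun j w => nn2 leb (fun t => lagstep T j (fw w a b) t - fw w a b t)) (cst 0%E)
    (cst ((2 * n%:R) ^+ 2 * T)%:E).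
  move=> [|||||_ _].
  - exact: mF.
  - exact: measurable_cst.
  - by apply: aeW => w _; apply: (lagstep_L2_cvg T0 (K := n%:R)); [exact: mfw|exact: fwK|exact: fw0].
  - exact: int1_cst.
  - apply: aeW => w j _; rewrite gee0_abs ?nn2_ge0//.
    apply: (@le_trans _ _ (\int[leb]_(t in `[0%R, T]) (cst ((2 * n%:R) ^+ 2)%:E t))%E); last first.
      by rewrite integral_cst//= lebesgue_measure_itv/= lte_fin T0 oppr0 adde0 -EFinM.
    rewrite [leRHS]integral_mkcond; apply: ge0_integral_mono => t; first by rewrite lee_fin sqr_ge0.
    have := lagstep_sq_le T0 (mfw w a b) (fwK w a b) (@fw0 w a b) j t.
    by rewrite patchE indicE; case: ifP => _; rewrite ?mulr1 ?mulr0 lee_fin.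
  by rewrite integral0.
pose u j a b := nn2 PL (fun z => ext T (fun w t => simple_value (lagproc n j H) w t - clipH n H w t)%R z a b).
rewrite (_ : (fun j => _) = fun j => (\sum_(a < k) \sum_(b < m) u j a b)%E); last first.
  by apply/funext => j; rewrite vnn2E.
rewrite -[X in _ --> X](_ : (\sum_(a < k) \sum_(b < m) 0)%E = 0%E); last first.
  by rewrite big1// => a _; rewrite big1.
apply: cvg_nnesum => [a _|a _]; first by apply: nearW => j; apply: sume_ge0 => b _; exact: nn2_ge0.
by apply: cvg_nnesum => [b _|b _]; [apply: nearW => j; exact: nn2_ge0|exact: step].
Qed.

End lag.

(** Two approximations, each within [e / 4] to leave room for the factor 2 of the triangle
    inequality: truncation of the values, then lagged averages of the truncated process. *)
Lemma simple_dense H (e : R) : predictable T F H -> vL2 PL (ext T H) -> 0 < e ->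
  exists h, simple_integrand T F h /\
    (vnn2 PL (ext T (fun w t => simple_value h w t - H w t)%R) <= e%:E)%E.
Proof.
move=> pH LH e0; have e4 : 0 < e / 4 by lra.
have [n _ /(_ n (leqnn n)) hn] := cvge0_le (clipH_cvg pH LH) e4.
have [j _ /(_ j (leqnn j)) hj] := cvge0_le (lagproc_cvg n pH) e4.
exists (lagproc n j H); split; first exact: lagproc_simple.
have -> : ext T (fun w t => simple_value (lagproc n j H) w t - H w t) = fun z =>
   ext T (fun w t => simple_value (lagproc n j H) w t - clipH n H w t) z + ext T (fun w t => clipH n H w t - H w t) z.
  by apply/funext => z; rewrite !extB addrA subrK.
apply: le_trans (vnn2D PL _ _) _.
- apply: (predictable_mmeas T0 hF); apply: (predictableB T0 hF); last exact: predictable_clipH.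
  by apply: (simple_value_predictable T0 hF); exact: lagproc_simple.
- by apply: (predictable_mmeas T0 hF); apply: (predictableB T0 hF) => //; exact: predictable_clipH.
apply: (@le_trans _ _ (2%:E * (e / 4)%:E + 2%:E * (e / 4)%:E)%E).
  by apply: leeD; apply: lee_wpmul2l.
by rewrite -!(EFinM, EFinD) lee_fin; lra.
Qed.

Lemma cvg_sqrte_geom (u : nat -> \bar R) (B : R) : 0 <= B -> (forall n, 0 <= u n)%E ->
  (forall n, (u n <= (B * 4^-1 ^+ n)%:E)%E) -> sqrte (u n) @[n --> \oo] --> 0%E.
Proof.
move=> B0 u0 hu; pose b n : R := Num.sqrt B * 2^-1 ^+ n.
have cb : b n @[n --> \oo] --> (0 : R).
  rewrite -[X in _ --> X](mulr0 (Num.sqrt B)); apply: cvgMr.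
  by apply: cvg_expr; rewrite ger0_norm; lra.
apply: (@squeeze_cvge _ _ _ _ (cst 0%E) _ (fun n => (b n)%:E)).
- apply: nearW => n /=; rewrite sqrte_ge0/=.
  have -> : (b n)%:E = sqrte (B * 4^-1 ^+ n)%:E.
    rewrite /= sqrtrM//; congr (_ * _)%:E.
    have -> : 4^-1 ^+ n = (2^-1 ^+ n) ^+ 2 :> R by rewrite -exprM mulnC exprM; congr (_ ^+ n); lra.
    by rewrite sqrtr_sqr ger0_norm.
  by rewrite lee_sqrt// lee_fin mulr_ge0.
- exact: cvg_cst.
by apply/fine_cvgP; split; [exact: nearW|exact: cb].
Qed.

Lemma tends_unif (A : set R) (u : nat -> R -> R) (v : R -> R) (B t : R) : A t -> 
  (forall n, tends A (u n) t (u n t)) ->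
  (forall n s, A s -> `|v s - u n s| <= B * 2^-1 ^+ n) -> tends A v t (v t).
Proof.
move=> At hu hv e e0.
have B0 : 0 <= B by have := hv 0 t At; rewrite expr0 mulr1; apply: le_trans.
have : B * 2^-1 ^+ n @[n --> \oo] --> (0 : R).
  rewrite -[X in _ --> X](mulr0 B); apply: cvgMr.
  by apply: cvg_expr; rewrite ger0_norm; lra.
have e3 : 0 < e / 3 by lra.
move=> /cvgrPdist_le/(_ _ e3)[n _ /(_ n (leqnn n))]; rewrite sub0r normrN => hn.
have {}hn : B * 2^-1 ^+ n <= e / 3 by exact: le_trans (ler_norm _) hn.
have [r r0 hr] := hu n _ e3; exists r => // s As st.
have h1 := hr s As st; have h2 := hv n s As; have h3 := hv n t At.
rewrite (_ : v s - v t = (v s - u n s) + (u n s - u n t) - (v t - u n t)); last by ring.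
apply: le_trans (ler_normB _ _) _; have := ler_normD (v s - u n s) (u n s - u n t).
lra.
Qed.

Lemma simple_integral_cont (h : @simple_process R dsp Omega k m) w : simple_integrand T F h ->
  {within `[0, T], continuous (W w)} -> {within `[0, T], continuous (simple_integral W h w)}.
Proof.
move=> [h1 _ _ _] /within_continuousP cW; apply/within_continuousP => a j t tT; rewrite (ord1 j).
have minW b v : v \in `[0, T] -> tends `[0, T]%classic (fun s => W w (Num.min v s) b ord0) t (W w (Num.min v t) b ord0).
  rewrite in_itv/= => /andP[v0 vT]; have := tT; rewrite in_itv/= => /andP[t0 tT'].
  have vtI : Num.min v t \in `[0, T] by rewrite in_itv/= le_min v0 t0/= ge_min vT.
  move=> e /(cW b ord0 _ vtI)[r r0 hr]; exists r => // s sT st; apply: hr.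
    by move: sT => /=; rewrite !in_itv/= => /andP[s0 sT]; rewrite le_min v0 s0/= ge_min vT.
  apply: le_lt_trans st; rewrite ler_norml -[X in _ && X]/(_ <= _).
  have := ler_norm (s - t); have := ler_norm (- (s - t)); rewrite normrN.
  by case: (leP v s) => ?; case: (leP v t) => ? ? ?; apply/andP; split; lra.
rewrite /simple_integral; under [X in tends _ X]funext do rewrite summxE.
rewrite summxE; apply: tends_sum => i; under [X in tends _ X]funext do rewrite mxE.
rewrite mxE; apply: tends_sum => b; apply: tendsM; first exact: tends_cst.
under [X in tends _ X]funext do rewrite !mxE.
rewrite !mxE; apply: tendsD; first by apply: minW; exact: h1.
by apply: tendsN; apply: minW; exact: (h1 i (ltnW (ltn_ord i))).
Qed.

(** Doob's inequality turns the isometry into S^2 bounds on the increments of the simple integrals.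
    [fast_summable], applied to suprema over time, then gives uniform convergence of almost every
    path, hence a continuous limit. *)
Lemma ito_exists H : predictable T F H -> vL2 PL (ext T H) -> exists I, ito_integral P T F W H I.
Proof.
move=> pH LH; have c0 : 0 <= c := normal_m2_ge0.
(* Doob's factor 4, the constant [c] and the two factors 2 of the triangle inequality together cost
   less than [16 c e0 16^-q], which has to stay below [16^-q]. *)
pose e0 : R := (16 * c + 1)^-1; have e0p : 0 < e0 by rewrite invr_gt0; lra.
have e0c : 16 * c * e0 <= 1 by rewrite /e0 ler_pdivrMr; lra.
have p16 n : 0 < 16^-1 ^+ n :> R by rewrite exprn_gt0.
have /choice[h hh] : forall q, exists h, simple_integrand T F h /\
    (vnn2 PL (ext T (fun w t => simple_value h w t - H w t)%R) <= (e0 * 16^-1 ^+ q)%:E)%E.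
  by move=> q; apply: simple_dense => //; rewrite mulr_gt0.
have sh q := (hh q).1; have vh q := (hh q).2.
pose good w := {within `[0, T], continuous (W w)}.
have ag : {ae P, forall w, good w} by case: hW.
(* Brownian paths are continuous only almost surely, while [S2] concerns all paths; the integrals
   are set to 0 on the exceptional ones. *)
pose J q w t : 'cV[R]_k := if `[< good w >] then simple_integral W (h q) w t else 0.
have Jae q : {ae P, forall w, forall t, J q w t = simple_integral W (h q) w t}.
  by apply: filterS ag => w gw t; rewrite /J; case: asboolP.
have mJ q a : mart P T F (fun t w => J q w t a ord0).
  apply: (mart_ae hF (simple_mart T0 hF hW a (sh q))) => t tT.
  by apply: filterS (Jae q) => w ->.
have aJ q : adapted T F (J q).
  apply/(adapted_gmeas _ hF) => t tT a j; rewrite (ord1 j).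
  by have [G _ _] := mJ q a; exact: G.
have cJ q w : {within `[0, T], continuous (J q w)}.
  rewrite /J; case: asboolP => gw; first exact: simple_integral_cont.
  apply/within_continuousP => a j t _; under [X in tends _ X]funext do rewrite mxE.
  by rewrite mxE; exact: tends_cst.
have rJ q : rcproc T (J q) := rcproc_cont hF (aJ q) (cJ q).
have TI := itvTT T0.
pose U q w t := J q.+1 w t - J q w t.
have rU q : rcproc T (U q) by exact: rcprocB.
have nU q : (nS P T (U q) <= (16^-1 ^+ q)%:E)%E.
  have mU a b : mart P T F (fun t w => U q w t a b).
    rewrite (ord1 b); under [X in mart _ _ _ X]funext do under eq_fun do rewrite !mxE.
    exact: martB.
  apply: le_trans (mart_nS T0 hF mU (rU q)) _.
  have ph := simple_value_predictable T0 hF (sh q); have ph' := simple_value_predictable T0 hF (sh q.+1).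
  have m1 := predictable_mmeas T0 hF (predictableB T0 hF ph pH).
  have m2 := predictable_mmeas T0 hF (predictableB T0 hF ph' pH).
  have e : vnn2 P (U q ^~ T) = vnn2 P (fun w => simple_integral W (h q.+1) w T - simple_integral W (h q) w T).
    apply: ae_eq_vnn2; first exact: (rU q).1.
      apply: mmeasB; [case: (simple_vL2 T0 hF hW (sh q.+1) TI)|case: (simple_vL2 T0 hF hW (sh q) TI)] => //.
    by apply: filterS2 (Jae q) (Jae q.+1) => w e1 e2; rewrite /U e1 e2.
  rewrite e; apply: (@le_trans _ _ (4%:E * (c%:E * (2%:E * (e0 * 16^-1 ^+ q.+1)%:E + 2%:E * (e0 * 16^-1 ^+ q)%:E)))%E).
    apply: lee_wpmul2l => //; apply: le_trans (simple_isometry T0 hF hW (sh q.+1) (sh q) TI) _.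
    apply: lee_wpmul2l; first by rewrite lee_fin.
    rewrite (_ : ext T _ = fun z => ext T (fun w t => simple_value (h q.+1) w t - H w t) z -
      ext T (fun w t => simple_value (h q) w t - H w t) z); last first.
      by apply/funext => z; rewrite !extB; apply/matrixP => i j; rewrite !mxE; ring.
    by apply: le_trans (vnn2B PL m2 m1) _; apply: leeD; apply: lee_wpmul2l.
  rewrite -!(EFinM, EFinD) lee_fin exprS; have := p16 q; move: (16^-1 ^+ q) => x x0.
  have cx : 0 <= c * e0 * x by rewrite !mulr_ge0// ltW.
  have : 16 * c * e0 * x <= x by rewrite ler_piMl// ltW.
  lra.
have [Q [IQ Q0 hQ]] := fast_summable (D := fun n => esup T (U n)) (fun n => measurable_esup T0 (rU n))
  (fun n w => esup_ge0 T0 (U n) w) nU.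
pose good2 w := forall n, (esup T (U n) w <= (Q w * 4^-1 ^+ n)%:E)%E.
pose I w t : 'cV[R]_k := \col_a (if `[< good2 w >] then limn (fun n => J n w t a ord0) else 0).
have lim w t a : good2 w -> t \in `[0, T] -> J n w t a ord0 @[n --> \oo] --> I w t a ord0 /\
    forall n, `|I w t a ord0 - J n w t a ord0| <= 2 * Num.sqrt (Q w) * 2^-1 ^+ n.
  move=> gw tT; have h1 n : `|J n.+1 w t a ord0 - J n w t a ord0| <= Num.sqrt (Q w) * 2^-1 ^+ n.
    have : (U n w t a ord0) ^+ 2 <= Q w * 4^-1 ^+ n.
      apply: le_trans (entry_sqr_le _ _ _) _; rewrite -lee_fin.
      exact: le_trans (esup_ub _ _ tT) (gw n).
    rewrite /U !mxE => h2; rewrite -(@ler_pXn2r _ 2)// ?nnegrE ?mulr_ge0//.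
    rewrite real_normK ?num_real// exprMn sqr_sqrtr// -exprM mulnC exprM.
    by rewrite (_ : 2^-1 ^+ 2 = 4^-1 :> R)//; lra.
  have [l [hl hl2]] := fast_cvg (sqrtr_ge0 (Q w)) h1.
  have e : I w t a ord0 = l by rewrite mxE; case: asboolP => // _; exact: cvg_lim.
  by rewrite e.
have ag2 : {ae P, forall w, good2 w} := hQ.
have aI : adapted T F I.
  apply/(adapted_gmeas _ hF) => t tT a j; rewrite (ord1 j).
  apply: (gmeas_ae hF tT (gmeas_limsup (f := fun n w => J n w t a ord0) _)).
    by move=> n; exact: ((adapted_gmeas _ hF).1 (aJ n) t tT).
  apply: filterS ag2 => w gw; have [hl _] := lim w t a gw tT.
  have hE : (J n w t a ord0)%:E @[n --> \oo] --> (I w t a ord0)%:E.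
    by apply/fine_cvgP; split; [exact: nearW|exact: hl].
  by have [_ ->] := cvg_limn_einf_sup hE.
have cI w : {within `[0, T], continuous (I w)}.
  apply/within_continuousP => a j t tT; rewrite (ord1 j).
  have [gw|ngw] := pselect (good2 w).
    apply: (@tends_unif _ (fun n s => J n w s a ord0) _ (2 * Num.sqrt (Q w)) t).
    - exact: tT.
    - by move=> n; have /within_continuousP := cJ n w; apply.
    - by move=> n s sT; exact: (lim w s a gw sT).2.
  have e s : I w s a ord0 = 0 by rewrite mxE; case: asboolP.
  by under [X in tends _ X]funext do rewrite e; rewrite e; exact: tends_cst.
have rI : rcproc T I := rcproc_cont hF aI cI.
pose B := 4 * k%:R * \int[P]_w Q w.
have B0 : 0 <= B by rewrite !mulr_ge0//; exact: Rintegral_ge0.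
have nI n (V : process R Omega k 1) : {ae P, forall w, forall t, J n w t = V w t} ->
    (nS P T (fun w t => V w t - I w t)%R <= (B * 4^-1 ^+ n)%:E)%E.
  move=> hV; have q4 : 0 <= 4^-1 ^+ n :> R by rewrite exprn_ge0.
  pose g w : \bar R := (4 * k%:R * 4^-1 ^+ n * Q w)%:E.
  have Ig : int1 P (fun w => 4 * k%:R * 4^-1 ^+ n * Q w) by exact: int1Z.
  apply: (@le_trans _ _ (\int[P]_w g w)%E).
    apply: ae_integral_le.
    - by move=> w; exact: esup_ge0.
    - by move=> w; rewrite lee_fin !mulr_ge0.
    - exact: measurable_int Ig.
    apply: filterS2 hV ag2 => w e gw; apply: esup_le => t tT; rewrite lee_fin -e hsnorm_sqr.
    apply: (@le_trans _ _ (\sum_(a < k) 4 * 4^-1 ^+ n * Q w)).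
      apply: ler_sum => a _; rewrite big_ord1; have [_ hl] := lim w t a gw tT.
      have -> : (J n w t - I w t) a ord0 = - (I w t a ord0 - J n w t a ord0).
        by rewrite mxE [X in _ + X]mxE opprB.
      rewrite sqrrN -[leLHS]real_normK ?num_real//.
      rewrite (_ : 4 * 4^-1 ^+ n * Q w = (2 * Num.sqrt (Q w) * 2^-1 ^+ n) ^+ 2).
        by rewrite lerXn2r ?nnegrE ?mulr_ge0 ?exprn_ge0.
      rewrite !exprMn sqr_sqrtr// -exprM mulnC exprM (_ : 2^-1 ^+ 2 = 4^-1 :> R); last by lra.
      by ring.
    by rewrite sumr_const card_ord -mulr_natl; rewrite le_eqVlt; apply/orP; left; apply/eqP; ring.
  have -> : (\int[P]_w g w)%E = (\int[P]_w (4 * k%:R * 4^-1 ^+ n * Q w))%:E.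
    by rewrite /Rintegral fineK//; exact: integrable_fin_num.
  rewrite lee_fin RintegralZl// /B le_eqVlt; apply/orP; left; apply/eqP; ring.
have SI : S2 P T F I.
  split => //; rewrite (nS_lty P T0).
  have -> : I = fun w t => J 0 w t - (J 0 w t - I w t).
    by apply/funext => w; apply/funext => t; rewrite subKr.
  apply: le_lt_trans (nSB P T0 (rJ 0) (rcprocB (rJ 0) rI)) _.
  apply: lte_add_pinfty; apply: lte_mul_pinfty => //.
    apply: le_lt_trans (mart_nS T0 hF _ (rJ 0)) _; first by move=> a b; rewrite (ord1 b).
    apply: lte_mul_pinfty => //.
    have e : vnn2 P (J 0 ^~ T) = vnn2 P (simple_integral W (h 0) ^~ T).
      apply: ae_eq_vnn2; first exact: (rJ 0).1.
        by case: (simple_vL2 T0 hF hW (sh 0) TI).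
      by apply: filterS (Jae 0) => w ->.
    by rewrite e; case: (simple_vL2 T0 hF hW (sh 0) TI).
  apply: le_lt_trans (nI 0 (J 0) _) _; last by rewrite ltry.
  by apply: aeW.
exists I; split => //; first exact/(H2P T0 hF).
exists h; split => //.
  have mh q : mmeas (ext T (fun w t => simple_value (h q) w t - H w t)).
    apply: (predictable_mmeas T0 hF); apply: (predictableB T0 hF) => //.
    exact: (simple_value_predictable T0 hF).
  under eq_fun do rewrite normH2E//.
  apply: (cvg_sqrte_geom (ltW e0p)) => n; first exact: vnn2_ge0.
  apply: le_trans (vh n) _; rewrite lee_fin ler_wpM2l ?(ltW e0p)//.
  by rewrite lerXn2r ?nnegrE//; lra.
under eq_fun do rewrite normS2E.
apply: (cvg_sqrte_geom B0) => n; first exact: nS_ge0.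
by apply: nI; exact: Jae.
Qed.

End ito_existence.

(** * The energy identity *)

Section square_of_integral.
Context {R : realType}.
Local Notation leb := (@lebesgue_measure R).

(** The indicator of [r <= s] as a real factor: a variable upper limit of integration becomes part
    of the integrand, and Fubini's theorem applies on the whole line. *)
Definition upto (s r : R) : R := if r <= s then 1 else 0.

Lemma measurable_upto2 : measurable_fun setT (fun z : R * R => upto z.1 z.2).
Proof.
apply: measurable_fun_ifT; try exact: measurable_cst.
by apply: measurable_fun_ler; [exact: measurable_snd|exact: measurable_fst].
Qed.

Lemma measurable_upto s : measurable_fun setT (upto s).
Proof.
apply: measurable_fun_ifT; try exact: measurable_cst.
by apply: measurable_fun_ler => //; exact: measurable_cst.
Qed.

Lemma upto_ge0 s r : 0 <= upto s r <= 1.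
Proof. by rewrite /upto; case: ifP; rewrite ?lexx ?ler01. Qed.

Lemma int1_upto d (S : measurableType d) (mu : {measure set S -> \bar R}) (f : S -> R) (a b : S -> R) :
  measurable_fun setT a -> measurable_fun setT b -> int1 mu f ->
  int1 mu (fun x => upto (a x) (b x) * f x).
Proof.
move=> ma mb If; apply: (int1_le (g := fun x => `|f x|)).
- apply: measurable_funM; last exact: int1_measurable If.
  apply: measurable_fun_ifT; try exact: measurable_cst.
  exact: measurable_fun_ler.
- by have := integrable_abse If; apply: eq_integrable.
- move=> x; rewrite normrM; have /andP[h0 h1] := upto_ge0 (a x) (b x).
  by rewrite ger0_norm// ler_piMl.
Qed.

Lemma fubini_leb2 (h : R * R -> R) (u : R -> R) : measurable_fun setT h -> int1 leb u ->
  (forall x y, `|h (x, y)| <= `|u x| * `|u y|) ->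
  \int[leb]_x \int[leb]_y h (x, y) = \int[leb]_y \int[leb]_x h (x, y).
Proof.
move=> mh Iu hu; have mu := int1_measurable Iu.
have Iu' : int1 leb (fun x => `|u x|) by have := integrable_abse Iu; apply: eq_integrable.
have I : (leb \x leb)%E.-integrable setT (EFin \o h).
  have mhE : measurable_fun setT (EFin \o h) by exact/measurable_EFinP.
  apply/integrableP; split; first exact: mhE.
  rewrite fubini_tonelli1//; last exact: measurableT_comp.
  apply: (@le_lt_trans _ _ (\int[leb]_x ((\int[leb]_y `|u y|) * `|u x|)%:E)%E).
    apply: ge0_integral_mono => x; first by apply: integral_ge0.
    apply: (@le_trans _ _ (\int[leb]_y (`|u x| * `|u y|)%:E)%E).
      by apply: ge0_integral_mono => y //=; rewrite lee_fin.
    rewrite mulrC EFinM /Rintegral fineK; last exact: integrable_fin_num.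
    under [leLHS]eq_integral do rewrite EFinM.
    by rewrite ge0_integralZl_EFin//; apply/measurable_EFinP; exact: int1_measurable Iu'.
  have /integrableP[_] := int1Z (\int[leb]_y `|u y|) Iu'.
  apply: le_lt_trans; apply: ge0_integral_mono => x.
    by rewrite lee_fin mulr_ge0//; apply: Rintegral_ge0 => y _.
  by rewrite /= lee_fin ler_norm.
have IG : leb.-integrable setT (fun y => \int[leb]_x (EFin \o h) (x, y))%E.
  apply/integrableP; split; first exact: (measurable_fubini_G I).
  have mf := measurable_int _ I.
  have /(integrable21ltyP _ _ mf) h21 := I.
  apply: le_lt_trans h21; apply: ge0_le_integral => //.
  - exact: measurableT_comp (measurable_fubini_G I).
  - apply: (measurable_fun_fubini_tonelli_G (m1 := leb) (fun z => `|(EFin \o h) z|)%E) => //.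
    exact: measurableT_comp.
  move=> t _; apply: le_abse_integral => //.
  exact: (measurableT_comp mf (measurable_pair2 t)).
have [_ e1] := int1_fine (integrable_fubini_F I); have [_ e2] := int1_fine IG.
by rewrite [LHS]e1 [RHS]e2 (Fubini I).
Qed.

(* Both sides of Fubini's theorem for [v_s v_r 1_(r <= s)] are computed; their
   sum is the square of the integral. *)
Lemma sqr_Rintegral (v : R -> R) : int1 leb v ->
  (\int[leb]_s v s) ^+ 2 = 2 * \int[leb]_s (v s * \int[leb]_r (upto s r * v r)).
Proof.
move=> Iv; have mv := int1_measurable Iv.
have mv1 : measurable_fun [set: R * R] (fun z => v z.1) := measurableT_comp mv measurable_fst.
have mv2 : measurable_fun [set: R * R] (fun z => v z.2) := measurableT_comp mv measurable_snd.
pose c s := \int[leb]_r (upto s r * v r); pose M := \int[leb]_s v s.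
have Iu s : int1 leb (fun r => upto s r * v r) by apply: int1_upto => //; exact: measurable_cst.
have Iu' r : int1 leb (fun s => upto s r * v s) by apply: int1_upto => //; exact: measurable_cst.
have Ivb (g : R -> R) (K : R) : measurable_fun setT g -> (forall s, `|g s| <= K) -> int1 leb (fun s => v s * g s).
  move=> mg gK; apply: (@int1_le _ _ _ leb _ (fun s => K * `|v s|)).
  - exact: measurable_funM.
  - by apply: int1Z; have := integrable_abse Iv; apply: eq_integrable.
  - by move=> s; rewrite normrM mulrC ler_wpM2r.
have mc : measurable_fun setT c.
  apply: (measurable_Rintegral_section (g := fun z => upto z.1 z.2 * v z.2)).
  by apply: measurable_funM => //; exact: measurable_upto2.
pose K := \int[leb]_r `|v r|.
have Iv' : int1 leb (fun x => `|v x|) by have := integrable_abse Iv; apply: eq_integrable.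
have cK s : `|c s| <= K.
  apply: le_trans (le_normr_Rintegral _ (Iu s)) _ => //; apply: le_Rintegral => //.
    by have := integrable_abse (Iu s); apply: eq_integrable.
  move=> r _; rewrite normrM; have /andP[h0 h1] := upto_ge0 s r.
  by rewrite ger0_norm// ler_piMl.
have e1 : \int[leb]_s (v s * c s) = \int[leb]_s \int[leb]_r (upto s r * (v s * v r)).
  apply: eq_Rintegral => s _; rewrite /c -RintegralZl//; last exact: Iu.
  by apply: eq_Rintegral => r _; ring.
have e2 : \int[leb]_s (v s * c s) = \int[leb]_r (v r * (M - c r)).
  rewrite e1 (fubini_leb2 (h := fun z => upto z.1 z.2 * (v z.1 * v z.2)) (u := v))//; first last.
  - move=> x y /=; rewrite !normrM; have /andP[h0 h1] := upto_ge0 x y.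
    by rewrite [X in X * _]ger0_norm// ler_piMl// mulr_ge0.
  - by apply: measurable_funM; [exact: measurable_upto2|exact: measurable_funM].
  apply: eq_Rintegral => r _ /=.
  rewrite (_ : \int[leb]_x _ = \int[leb]_x (v r * (upto x r * v x))); last first.
    by apply: eq_Rintegral => s _; ring.
  rewrite RintegralZl//; last exact: Iu'.
  congr (_ * _); rewrite /M /c -RintegralB//; last exact: Iu.
  apply: ae_eq_Rintegral.
  - exact: int1_measurable (Iu' r).
  - by apply: measurable_funB => //; exact: int1_measurable (Iu r).
  exists [set r]; split => //; first exact: lebesgue_measure_set1.
  move=> s /= h; apply: contrapT => /eqP sr; apply: h; rewrite /upto.
  have [rs|sr'] := leP r s; last by rewrite (ltW sr') mul0r mul1r subrr.
  by rewrite leNgt lt_neqAle rs eq_sym sr/= mul1r mul0r subr0.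
have e3 : \int[leb]_r (v r * (M - c r)) = M ^+ 2 - \int[leb]_s (v s * c s).
  rewrite (_ : \int[leb]_r _ = \int[leb]_r (M * v r - v r * c r)); last first.
    by apply: eq_Rintegral => s _; ring.
  rewrite RintegralB//; [|exact: int1Z|exact: (Ivb c K)].
  by rewrite RintegralZl// -/M expr2.
by rewrite -/M; move: e2; rewrite e3 => e; lra.
Qed.

End square_of_integral.

Section energy.
Context {R : realType} {dsp} {Omega : measurableType dsp}
  (P : probability Omega R) (T : R) (F : R -> set (set Omega)).
Hypothesis T0 : 0 < T.
Hypothesis hF : usual_filtration P T F.
Local Notation PL := (dPdt P).
Local Notation leb := (@lebesgue_measure R).

Lemma ae_L2_section_leb (f : Omega * R -> R) : L2 PL f ->
  {ae leb, forall s, L2 P (fun w => f (w, s))}.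
Proof.
move=> [mf hf]; have ms s : measurable_fun setT (fun w => f (w, s)).
  exact: (measurableT_comp mf (measurable_pair2 s)).
have mf2 : measurable_fun setT (fun z => f z ^+ 2) by exact: measurable_funX.
have e : nn2 PL f = (\int[leb]_s nn2 P (fun w => f (w, s)))%E.
  by rewrite /nn2 (@tonelli_leb _ _ _ P (fun z => f z ^+ 2))// => z; exact: sqr_ge0.
have I : leb.-integrable setT (fun s => nn2 P (fun w => f (w, s))).
  apply/integrableP; split.
    apply: (measurable_fun_fubini_tonelli_G (m1 := P) (fun z => (f z ^+ 2)%:E)).
      exact/measurable_EFinP.
    by move=> z; rewrite lee_fin sqr_ge0.
  by under eq_integral do rewrite gee0_abs ?nn2_ge0//; rewrite -e.
have := integrable_ae measurableT I; apply: filterS => s /(_ Logic.I) h.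
by split; [exact: ms|rewrite -ge0_fin_numE// nn2_ge0].
Qed.

Section scalar.
Variables (f g : Omega * R -> R) (N : R -> Omega -> R).
Hypothesis Lf : L2 PL f.
Hypothesis f0 : forall z, z.2 \notin `[0, T] -> f z = 0.
Hypothesis Gf : forall s, s \in `[0, T] -> gmeas (F s) (fun w => f (w, s)).
Hypothesis mN : mart P T F N.
Hypothesis Lg : L2 PL g.
Hypothesis gN : forall w s, s \in `[0, T] -> g (w, s) = N s w.

Let b (z : Omega * R) := \int[leb]_r (upto z.2 r * f (z.1, r)).

Lemma measurable_drift : measurable_fun setT b.
Proof.
apply: (measurable_Rintegral_section (g := fun x : (Omega * R) * R => upto x.1.2 x.2 * f (x.1.1, x.2))).
case: Lf => mf _; apply: measurable_funM.
  apply: measurable_fun_ifT; try exact: measurable_cst.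
  apply: measurable_fun_ler; first exact: measurable_snd.
  exact: (measurableT_comp measurable_snd measurable_fst).
apply: (measurableT_comp mf); apply: measurable_fun_pair; last exact: measurable_snd.
exact: (measurableT_comp measurable_fst measurable_fst).
Qed.

Let b_itv w t : t \in `[0, T] -> b (w, t) = \int[leb]_(s in `[0, t]) f (w, s).
Proof.
move=> tT; rewrite /b/= [RHS]Rintegral_mkcond; apply: eq_Rintegral => s _.
rewrite patchE mem_setE in_itv/= /upto; case: (leP s t) => st; last by rewrite mul0r andbF.
rewrite mul1r andbT; case: ifPn => // s0; rewrite f0// in_itv/= (negbTE s0)//.
Qed.

Let ae_sec : {ae P, forall w, L2 leb (fun s => f (w, s))}.
Proof. exact: ae_L2_section. Qed.

Lemma ae_drift_sq : {ae P, forall w, forall t, t \in `[0, T] ->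
  b (w, t) ^+ 2 <= T * \int[leb]_s (f (w, s) ^+ 2)}.
Proof.
by apply: filterS ae_sec => w Lw t tT; rewrite b_itv//; exact: sqr_Rintegral_le.
Qed.

Lemma L2_drift t : t \in `[0, T] -> L2 P (fun w => b (w, t)).
Proof.
move=> tT; split; first exact: (measurableT_comp measurable_drift (measurable_pair2 t)).
have If2 := int1_sq Lf; have [IF _] := fubini_P If2.
apply: (@le_lt_trans _ _ (\int[P]_w (T * \int[leb]_s (f (w, s) ^+ 2))%:E)%E).
  apply: ae_integral_le.
  - by move=> w; rewrite lee_fin sqr_ge0.
  - by move=> w; rewrite lee_fin mulr_ge0 ?(ltW T0)//; apply: Rintegral_ge0 => s _; exact: sqr_ge0.
  - exact: measurable_int (int1Z T IF).
  - by apply: filterS ae_drift_sq => w h; rewrite lee_fin; exact: h.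
have := integrable_fin_num measurableT (int1Z T IF).
by rewrite ge0_fin_numE//; apply: integral_ge0 => w _; rewrite lee_fin mulr_ge0 ?(ltW T0)//;
  apply: Rintegral_ge0 => s _; exact: sqr_ge0.
Qed.

Let inT (z : Omega * R) : R := if z.2 \in `[0, T] then 1 else 0.

Let minT : measurable_fun setT inT.
Proof.
apply: measurable_fun_ifT; try exact: measurable_cst.
apply: (measurable_fun_bool true); rewrite setTI.
rewrite (_ : _ @^-1` _ = setT `*` `[0, T]%classic); first by apply: measurableX => //; exact: measurable_itv.
by apply/seteqP; split=> z /=; [move=> h; split|case].
Qed.

Lemma L2_time_marginal (h : Omega * R -> R) (H : Omega -> R) : measurable_fun setT h -> int1 P H ->
  {ae P, forall w, forall t, t \in `[0, T] -> h (w, t) ^+ 2 <= H w} -> (forall w, 0 <= H w) ->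
  L2 PL (fun z => inT z * h z).
Proof.
move=> mh IH hH H0; have mi : measurable_fun setT (fun z => inT z * h z) by exact: measurable_funM.
split => //; rewrite /nn2 (@tonelli_P _ _ _ P (fun z => (inT z * h z) ^+ 2))//; first last.
- by move=> z; exact: sqr_ge0.
- exact: measurable_funX.
apply: (@le_lt_trans _ _ (\int[P]_w (T * H w)%:E)%E).
  apply: ae_integral_le.
  - by move=> w; apply: integral_ge0 => t _; rewrite lee_fin sqr_ge0.
  - by move=> w; rewrite lee_fin mulr_ge0// ltW.
  - exact: measurable_int (int1Z T IH).
  apply: filterS hH => w hw.
  apply: (@le_trans _ _ (\int[leb]_(t in `[0%R, T]) (cst (H w)%:E t))%E); last first.
    by rewrite integral_cst//= lebesgue_measure_itv/= lte_fin T0 oppr0 adde0 -EFinM mulrC.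
  rewrite [leRHS]integral_mkcond; apply: ge0_integral_mono => t; first by rewrite lee_fin sqr_ge0.
  rewrite patchE mem_setE /inT/=; case: ifP => tT; last by rewrite mul0r expr0n.
  by rewrite mul1r lee_fin; exact: hw.
have := integrable_fin_num measurableT (int1Z T IH).
by rewrite ge0_fin_numE//; apply: integral_ge0 => w _; rewrite lee_fin mulr_ge0 ?(ltW T0).
Qed.

Lemma L2_drift_PL : L2 PL (fun z => inT z * b z).
Proof.
have [IF _] := fubini_P (int1_sq Lf).
apply: (L2_time_marginal measurable_drift (int1Z T IF) ae_drift_sq) => w.
by rewrite mulr_ge0 ?(ltW T0)//; apply: Rintegral_ge0 => s _; exact: sqr_ge0.
Qed.

Let fE z : f z = inT z * f z.
Proof. by rewrite /inT; case: ifPn => zT; rewrite ?mul1r// f0// mulr0. Qed.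

Let mup t : measurable_fun setT (fun z : Omega * R => upto t z.2).
Proof. exact: (measurableT_comp (measurable_upto t) measurable_snd). Qed.

Let int_up t (h : Omega * R -> R) : int1 PL h -> int1 PL (fun z => upto t z.2 * h z).
Proof. by move=> Ih; apply: int1_upto. Qed.

(** [sqr_Rintegral] on almost every path, for the integrand cut off at [t]; below [t] the inner
    integral is again [b]. *)
Lemma energy_drift t : t \in `[0, T] ->
  \int[P]_w (b (w, t) ^+ 2) = 2 * \int[PL]_z (upto t z.2 * (b z * f z)).
Proof.
move=> tT; have Ibf : int1 PL (fun z => b z * f z).
  rewrite (_ : (fun z => _) = fun z => (inT z * b z) * f z); last first.
    by apply/funext => z; rewrite {1}fE; ring.
  exact: L2M L2_drift_PL Lf.
have [IF ->] := fubini_P (int_up t Ibf); rewrite -RintegralZl//.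
apply: ae_eq_Rintegral.
- by apply: measurable_funX; case: (L2_drift tT).
- exact: int1_measurable (int1Z 2 IF).
apply: filterS ae_sec => w Lw; pose v r := upto t r * f (w, r).
have Iv : int1 leb v.
  have : int1 leb (fun s => \1_(`[0, T]%classic) s * f (w, s)) by exact: L2M (L2_itv T) Lw.
  rewrite (_ : (fun s => _) = fun s => f (w, s)).
    by move=> If; apply: int1_upto => //; exact: measurable_cst.
  by apply/funext => s; rewrite indicE mem_setE; case: (boolP (s \in `[0, T])) => sT;
    rewrite ?mul1r// f0// mulr0.
rewrite {1}/b/= (sqr_Rintegral Iv); congr (_ * _); apply: eq_Rintegral => s _.
rewrite /v /b/= /upto; case: (leP s t) => st; last by rewrite !mul0r.
rewrite !mul1r mulrC; congr (_ * _); apply: eq_Rintegral => r _.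
by case: (leP r s) => rs; rewrite ?mul0r// (le_trans rs st) !mul1r.
Qed.

(** For fixed [s <= t] the variable [f (w, s)] is known at time [s], so the martingale property
    allows [N t] to be replaced by [N s], which is [g]. Fubini's theorem is used on both sides of
    this replacement. *)
Lemma energy_cross t : t \in `[0, T] ->
  \int[P]_w (b (w, t) * N t w) = \int[PL]_z (upto t z.2 * (g z * f z)).
Proof.
move=> tT; have [GN LN oN] := mN.
have mNt := gmeas_sub (filt_sub hF tT) (GN t tT).
have LNt : L2 PL (fun z => inT z * N t z.1).
  have m1 : measurable_fun setT (fun z : Omega * R => N t z.1) := measurableT_comp mNt measurable_fst.
  apply: (L2_time_marginal m1 (int1_sq (LN t tT))); first by apply: aeW.
  by move=> w; exact: sqr_ge0.
have Iz : int1 PL (fun z => N t z.1 * f z).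
  rewrite (_ : (fun z => _) = fun z => (inT z * N t z.1) * f z); last first.
    by apply/funext => z; rewrite {1}fE; ring.
  exact: L2M LNt Lf.
have Igf : int1 PL (fun z => g z * f z) by exact: L2M.
have -> : \int[P]_w (b (w, t) * N t w) = \int[PL]_z (upto t z.2 * (N t z.1 * f z)).
  have [IF ->] := fubini_P (int_up t Iz); apply: ae_eq_Rintegral.
  - by apply: measurable_funM => //; case: (L2_drift tT).
  - exact: int1_measurable IF.
  apply: filterS ae_sec => w Lw; rewrite /b/= mulrC -RintegralZl//.
    by apply: eq_Rintegral => s _; ring.
  have : int1 leb (fun s => \1_(`[0, T]%classic) s * f (w, s)) by exact: L2M (L2_itv T) Lw.
  rewrite (_ : (fun s => _) = fun s => f (w, s)).
    by move=> If; apply: int1_upto => //; exact: measurable_cst.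
  by apply/funext => s; rewrite indicE mem_setE; case: (boolP (s \in `[0, T])) => sT;
    rewrite ?mul1r// f0// mulr0.
have [I1 ->] := fubini_leb (int_up t Iz); have [I2 ->] := fubini_leb (int_up t Igf).
apply: ae_eq_Rintegral; [exact: int1_measurable I1|exact: int1_measurable I2|].
have := ae_and (ae_L2_section_leb Lf) (ae_L2_section_leb Lf); apply: filterS => s [Ls _].
have := tT; rewrite in_itv/= => /andP[t0 tT'].
rewrite /= /upto; case: (leP s t) => st; last first.
  by apply: eq_Rintegral => w _; rewrite !mul0r.
have [s0|s0] := leP 0 s; last first.
  by apply: eq_Rintegral => w _; rewrite f0 ?mulr0// in_itv/= leNgt s0.
have sT : s \in `[0, T] by rewrite in_itv/= s0 (le_trans st).
have Ns := LN s sT; have Nt := LN t tT.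
have := oN s t (fun w => f (w, s)) s0 st tT' (Gf sT) Ls.
rewrite (_ : \int[P]_w _ = \int[P]_w (N t w * f (w, s)) - \int[P]_w (N s w * f (w, s))); last first.
  rewrite -RintegralB//; [|exact: L2M|exact: L2M].
  by apply: eq_Rintegral => w _; ring.
move=> /eqP; rewrite subr_eq0 => /eqP e.
transitivity (\int[P]_w (N t w * f (w, s))); first by apply: eq_Rintegral => w _; rewrite mul1r.
by rewrite e; apply: eq_Rintegral => w _; rewrite mul1r gN.
Qed.

Lemma energy_scalar t : t \in `[0, T] -> \int[P]_w ((b (w, t) + N t w) ^+ 2) =
  2 * \int[PL]_z (upto t z.2 * ((b z + g z) * f z)) + \int[P]_w (N t w ^+ 2).
Proof.
move=> tT; have [_ LN _] := mN; have Lb := L2_drift tT; have Lt := LN t tT.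
have Igf : int1 PL (fun z => g z * f z) by exact: L2M.
have Ibf : int1 PL (fun z => b z * f z).
  rewrite (_ : (fun z => _) = fun z => (inT z * b z) * f z); last first.
    by apply/funext => z; rewrite {1}fE; ring.
  exact: L2M L2_drift_PL Lf.
rewrite (_ : \int[P]_w _ = \int[P]_w (b (w, t) ^+ 2 + (2 * (b (w, t) * N t w) + N t w ^+ 2))); last first.
  by apply: eq_Rintegral => w _; ring.
rewrite RintegralD//; [|exact: int1_sq|by apply: int1D; [apply: int1Z; exact: L2M|exact: int1_sq]].
rewrite RintegralD//; [|by apply: int1Z; exact: L2M|exact: int1_sq].
rewrite RintegralZl//; last exact: L2M.
rewrite energy_drift// energy_cross// addrA -mulrDr -RintegralD//; [|exact: int_up|exact: int_up].
by congr (2 * _ + _); apply: eq_Rintegral => z _; ring.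
Qed.

End scalar.

Lemma indist_ext k l (U V : process R Omega k l) :
  {ae P, forall w, forall t, t \in `[0, T] -> U w t = V w t} ->
  {ae PL, forall z, ext T U z = ext T V z}.
Proof.
move=> [A [mA A0 hA]]; exists (A `*` setT); split; first exact: measurableX.
  rewrite -[LHS]/((P \x leb)%E (A `*` setT)) product_measure1E//.
  transitivity (0 * leb setT)%E; last exact: mul0e.
  by congr (_ * _)%E; exact: A0.
move=> [w t] /= h; split => //; apply: hA => /= hw; apply: h.
by rewrite /ext/=; case: ifP => // tT; exact: hw.
Qed.

(** Stands in for Ito's formula for [|D|^2], one coordinate at a time: the square of the finite
    variation part contributes [B . beta], the cross term contributes [N . beta], and together they
    give [D . beta]. *)
Lemma energy k (beta B N D : process R Omega k 1) t :
  predictable T F beta -> vL2 PL (ext T beta) -> time_integral P T beta B ->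
  (forall a, mart P T F (fun t w => N w t a ord0)) -> vL2 PL (ext T N) ->
  {ae P, forall w, forall t, t \in `[0, T] -> D w t = B w t + N w t} ->
  vL2 PL (ext T D) -> mmeas (D ^~ t) -> t \in `[0, T] ->
  \int[P]_w (hsnorm (D w t) ^+ 2) =
   2 * \int[PL]_z (upto t z.2 * mdot (ext T D z) (ext T beta z)) + \int[P]_w (hsnorm (N w t) ^+ 2).
Proof.
move=> pb Lb tB mN LN hD LD mDt tT.
have Lba a := (vL2P _ _).1 Lb a ord0; have LNa a := (vL2P _ _).1 LN a ord0.
have LDa a := (vL2P _ _).1 LD a ord0.
have b0 a z : z.2 \notin `[0, T] -> ext T beta z a ord0 = 0.
  by move=> /negbTE zT; rewrite /ext zT mxE.
have aB : adapted T F beta by exact: (predictable_adapted hF pb).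
have Gb a s : s \in `[0, T] -> gmeas (F s) (fun w => ext T beta (w, s) a ord0).
  by move=> sT; rewrite /ext/= sT; exact: ((adapted_gmeas _ hF).1 aB s sT).
have eN a w s : s \in `[0, T] -> ext T N (w, s) a ord0 = N w s a ord0 by move=> sT; rewrite /ext/= sT.
pose bb a (z : Omega * R) := \int[leb]_r (upto z.2 r * ext T beta (z.1, r) a ord0).
have ES a := energy_scalar (Lba a) (b0 a) (Gb a) (mN a) (LNa a) (@eN a) tT.
have bB : {ae P, forall w, forall s, s \in `[0, T] -> forall a, D w s a ord0 = bb a (w, s) + N w s a ord0}.
  apply: filterS2 hD tB => w h1 [_ h2] s sT a; rewrite h1// mxE h2//; congr (_ + _).
  rewrite (Rintegral_ext _ _ _ sT) /bb/= Rintegral_mkcond; apply: eq_Rintegral => r _.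
  rewrite patchE mem_setE in_itv/= /upto; case: (leP r s) => rs; last by rewrite mul0r andbF.
  rewrite mul1r andbT; case: ifPn => // r0; rewrite b0// in_itv/= (negbTE r0)//.
have LNt a : L2 P (fun w => N w t a ord0) by have [_ L _] := mN a; exact: L.
have Lbt a : L2 P (fun w => bb a (w, t)) := L2_drift (Lba a) (b0 a) tT.
have bBt a : {ae P, forall w, D w t a ord0 = bb a (w, t) + N w t a ord0}.
  by apply: filterS bB => w h; exact: h.
have mbN a : measurable_fun setT (fun w => bb a (w, t) + N w t a ord0) by case: (L2D (Lbt a) (LNt a)).
have LDt a : L2 P (fun w => D w t a ord0).
  split; first exact: mDt.
  by rewrite (ae_eq_nn2 (mDt a ord0) (mbN a) (bBt a)); case: (L2D (Lbt a) (LNt a)).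
have sumsq (X : Omega -> 'cV[R]_k) : (forall a, L2 P (fun w => X w a ord0)) ->
    \int[P]_w (hsnorm (X w) ^+ 2) = \sum_a \int[P]_w (X w a ord0 ^+ 2).
  move=> LX; rewrite -Rintegral_sum; last by move=> a; exact: int1_sq.
  by apply: eq_Rintegral => w _; rewrite hsnorm_sqr; apply: eq_bigr => a _; rewrite big_ord1.
have Iup (h : Omega * R -> R) : int1 PL h -> int1 PL (fun z => upto t z.2 * h z).
  by move=> Ih; apply: int1_upto.
have IDb a : int1 PL (fun z => ext T D z a ord0 * ext T beta z a ord0) by exact: L2M.
rewrite (sumsq (D ^~ t))// (sumsq (N ^~ t))//.
have -> : \int[PL]_z (upto t z.2 * mdot (ext T D z) (ext T beta z)) =
    \sum_a \int[PL]_z (upto t z.2 * (ext T D z a ord0 * ext T beta z a ord0)).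
  rewrite -Rintegral_sum; last by move=> a; exact: Iup.
  apply: eq_Rintegral => z _; rewrite /mdot mulr_sumr.
  by apply: eq_bigr => a _; rewrite big_ord1.
rewrite mulr_sumr -big_split/=; apply: eq_bigr => a _.
have -> : \int[P]_w (D w t a ord0 ^+ 2) = \int[P]_w ((bb a (w, t) + N w t a ord0) ^+ 2).
  apply: ae_eq_Rintegral; [exact: measurable_funX|exact: measurable_funX|].
  by apply: filterS (bBt a) => w ->.
rewrite ES; congr (2 * _ + _); apply: ae_eq_Rintegral.
- have [m1 _] := L2_drift_PL (Lba a) (b0 a).
  have mup : measurable_fun setT (fun z : Omega * R => upto t z.2).
    exact: (measurableT_comp (measurable_upto t) measurable_snd).
  have [mb _] := Lba a; have [mn _] := LNa a.
  apply: measurable_funM => //; apply: measurable_funM => //; apply: measurable_funD => //.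
  exact: measurable_drift (Lba a).
- exact: int1_measurable (Iup _ (IDb a)).
have h1 : {ae P, forall w, forall s, s \in `[0, T] ->
    D w s = (fun w s => \col_a (bb a (w, s) + N w s a ord0)) w s}.
  apply: filterS bB => w h s sT; apply/matrixP => i j; rewrite (ord1 j) mxE; exact: h.
apply: filterS (indist_ext h1) => -[w s] e.
have [sT|sT] := boolP (s \in `[0, T]); last by rewrite b0// !mulr0.
have -> : ext T D (w, s) a ord0 = bb a (w, s) + ext T N (w, s) a ord0.
  by rewrite e {1}/ext/= sT mxE eN.
by [].
Qed.

End energy.

(* Replaces Gronwall's lemma: on a short interval every bound [c] of [u]
   improves to [a + c / 2]. *)
Lemma absorb {R : realType} (S : Type) (D : set S) (u : S -> R) (a c0 : R) :
  (forall t, D t -> u t <= c0) ->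
  (forall c, (forall t, D t -> u t <= c) -> forall t, D t -> u t <= a + c / 2) ->
  forall t, D t -> u t <= 2 * a.
Proof.
move=> h0 h t Dt.
have hn n : forall t, D t -> u t <= 2 * a + (c0 - 2 * a) * 2^-1 ^+ n.
  elim: n => [s Ds|n IH s Ds]; first by rewrite expr0 mulr1 addrC subrK; exact: h0.
  by have := h _ IH s Ds; rewrite exprS; lra.
apply/ler_addgt0Pr => r r0.
have : (c0 - 2 * a) * 2^-1 ^+ n @[n --> \oo] --> (0 : R).
  rewrite -[X in _ --> X](mulr0 (c0 - 2 * a)); apply: cvgMr.
  by apply: cvg_expr; rewrite ger0_norm; lra.
move=> /cvgrPdist_le/(_ r r0)[n _ /(_ n (leqnn n))]; rewrite sub0r normrN => h1.
by have := hn n t Dt; have := ler_norm ((c0 - 2 * a) * 2^-1 ^+ n); lra.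
Qed.

Lemma quad_le {R : realFieldType} (p q i r : R) : 0 <= p - q + i -> p <= r -> q = 2 * r -> r <= i.
Proof. by move=> ? ? ?; lra. Qed.

Section paths.
Context {R : realType}.
Local Notation leb := (@lebesgue_measure R).

(** Cauchy-Schwarz, from the nonnegative integral of [(l 1_A - u)^2] with [l = m / d], where [m] is
    the integral over [A]. *)
Lemma sqr_Rintegral_set (u : R -> R) (A : set R) (d : R) : measurable A -> L2 leb u ->
  0 < d -> (leb A <= d%:E)%E -> (\int[leb]_(s in A) u s) ^+ 2 <= d * \int[leb]_s (u s ^+ 2).
Proof.
move=> mA Lu d0 Ad.
have e0 : (\int[leb]_x (\1_A x)%:E = leb A)%E by rewrite integral_indic// setIT.
have sq : (fun s => (\1_A s : R) ^+ 2) = \1_A.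
  by apply/funext => x; rewrite indicE; case: (_ \in _); rewrite ?expr1n ?expr0n.
have L1 : L2 leb (\1_A : R -> R).
  split; first exact: measurable_indic.
  rewrite /nn2 (_ : (fun x => _) = (fun x => (\1_A x)%:E)); last first.
    by apply/funext => x; rewrite -[in RHS]sq.
  by rewrite e0 (le_lt_trans Ad) ?ltry.
have e1 : \int[leb]_s ((\1_A s : R) ^+ 2) <= d.
  rewrite sq /Rintegral e0; rewrite -lee_fin fineK//.
  by rewrite ge0_fin_numE// (le_lt_trans Ad) ?ltry.
rewrite Rintegral_indic//; set m := \int[leb]_s (\1__ s * u s).
pose l := m / d; have L := L2B (L2Z l L1) Lu.
have : 0 <= \int[leb]_s ((l * \1_A s - u s) ^+ 2).
  by apply: Rintegral_ge0 => s _; exact: sqr_ge0.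
have -> : \int[leb]_s ((l * \1_A s - u s) ^+ 2) =
    l ^+ 2 * \int[leb]_s ((\1_A s : R) ^+ 2) - 2 * l * m + \int[leb]_s (u s ^+ 2).
  rewrite /m -!RintegralZl//; [|exact: L2M|exact: int1_sq].
  rewrite -RintegralB//; [|by apply: int1Z; exact: int1_sq|by apply: int1Z; exact: L2M].
  rewrite -RintegralD//; first by apply: eq_Rintegral => s _; ring.
  - by apply: int1B; apply: int1Z; [exact: int1_sq|exact: L2M].
  - exact: int1_sq.
have : l ^+ 2 * \int[leb]_s ((\1_A s : R) ^+ 2) <= l ^+ 2 * d by rewrite ler_wpM2l ?sqr_ge0.
set I := \int[leb]_s (u s ^+ 2) => h2 h.
have hl : m = l * d by rewrite /l divfK// gt_eqF.
rewrite hl in h *; rewrite (_ : (l * d) ^+ 2 = d * (l ^+ 2 * d)); last by ring.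
apply: ler_wpM2l; first exact: ltW.
by apply: quad_le h h2 _; ring.
Qed.

End paths.

Section lstep_matrix.
Context {R : realType} {dsp} {Omega : measurableType dsp}
  (P : probability Omega R) (T : R) (F : R -> set (set Omega)).
Hypothesis T0 : 0 < T.
Hypothesis hF : usual_filtration P T F.
Local Notation PL := (dPdt P).
Local Notation leb := (@lebesgue_measure R).
Context {k : nat}.
Implicit Type U : process R Omega k 1.

Definition lstepm j U : process R Omega k 1 :=
  fun w t => \col_a lstep T j (fun s => U w s a ord0) t.

(** One grid point serves all processes and paths. The third clause says that it is the last grid
    point strictly before [t], or that [t = 0]; the induction over cells for the Euler scheme rests
    on it. *)
Lemma lstepm_eval j t : t \in `[0, T] -> exists q : nat,
  [/\ grid T j q <= t, t - grid T j q <= T / 2 ^+ j, forall i, (i < q)%N -> grid T j i.+1 < t \/ t = 0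
    & forall U w, lstepm j U w t = U w (grid T j q)].
Proof.
rewrite in_itv/= => /andP[]; rewrite le_eqVlt => /predU1P[<-|t0] tT.
  exists 0%N; rewrite grid0 subrr; split => //; first by rewrite divr_ge0 ?exprn_ge0 ?ltW.
  by move=> U w; apply/matrixP => a b; rewrite (ord1 b) mxE lstep0.
have [q [/andP[h1 h2] hv]] := lstep_eval T0 j t0 tT; exists q; split.
- exact: ltW.
- by have := grid_step T0 j q; lra.
- move=> i iq; left; apply: le_lt_trans h1; exact: grid_mono.
move=> U w; apply/matrixP => a b; rewrite (ord1 b) mxE /lstep (gt_eqF t0) add0r.
exact: (hv (fun m => U w (grid T j m) a ord0)).
Qed.

Lemma lstepm_predictable j U : adapted T F U -> predictable T F (lstepm j U).
Proof.
move=> aU; apply/(predictableP T0 hF _) => a b; rewrite (ord1 b).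
apply: (gmeas_ext (f := fun z => lstep T j (fun s => U z.1 s a ord0) z.2)).
  move=> [w t]; rewrite /ext/=; case: ifPn => tT; first by rewrite mxE.
  by rewrite mxE lstep_out.
apply: (@gmeas_lstep _ _ _ P T F T0 hF _ (fun w t => U w t a ord0)) => t tT.
exact: ((adapted_gmeas U hF).1 aU t tT).
Qed.

Lemma lstepm_vnn2 j U (c : R) : adapted T F U -> 0 <= c ->
  (forall t, t \in `[0, T] -> (vnn2 P (U ^~ t) <= c%:E)%E) ->
  (vnn2 PL (ext T (lstepm j U)) <= (T * c)%:E)%E.
Proof.
move=> aU c0 h; apply: vnn2_time_le => //.
  by apply: (predictable_mmeas T0 hF); exact: lstepm_predictable.
move=> t tT; have [q [_ _ _ e]] := lstepm_eval j tT.
rewrite (_ : (fun w => lstepm j U w t) = U ^~ (grid T j q)); first by apply: h; exact: grid_itv.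
by apply/funext => w; exact: e.
Qed.

Lemma lstepm_mart_dist j (N : process R Omega k 1) :
  (forall a, mart P T F (fun t w => N w t a ord0)) -> mmeas (ext T N) -> vL2 P (N ^~ T) ->
  (vnn2 PL (ext T (fun w t => N w t - lstepm j N w t)%R) <=
    (T / 2 ^+ j * \int[P]_w (hsnorm (N w T) ^+ 2))%:E)%E.
Proof.
move=> mN mE LT; have aN : adapted T F N.
  by apply/(adapted_gmeas _ hF) => t tT a b; rewrite (ord1 b); case: (mN a) => G _ _; exact: G.
have pl := lstepm_predictable j aN.
have mD : mmeas (ext T (fun w t => N w t - lstepm j N w t)).
  by rewrite extB; apply: mmeasB => //; exact: (predictable_mmeas T0 hF).
rewrite vnn2E//.
have e : \int[P]_w (hsnorm (N w T) ^+ 2) = \sum_a \int[P]_w (N w T a ord0 ^+ 2).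
  rewrite -Rintegral_sum; last by move=> a; apply: int1_sq; exact: ((vL2P _ _).1 LT).
  by apply: eq_Rintegral => w _; rewrite hsnorm_sqr; apply: eq_bigr => a _; rewrite big_ord1.
rewrite e mulr_sumr -sumEFin; apply: lee_sum => a _; rewrite big_ord1.
have mEa : measurable_fun setT (fun z : Omega * R => if z.2 \in `[0, T] then N z.1 z.2 a ord0 else 0).
  rewrite (_ : (fun z => _) = fun z => ext T N z a ord0); first exact: mE.
  by apply/funext => z; rewrite /ext; case: ifP; rewrite ?mxE.
apply: le_trans (lstep_mart_dist T0 hF j (mN a) mEa).
apply: ge0_integral_mono => -[w t]; first by rewrite lee_fin sqr_ge0.
rewrite lee_fin /ext/=; case: ifPn => tT; first by rewrite !mxE.
by rewrite mxE lstep_out// subrr.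
Qed.

(* On each cell the increment of the integral is controlled by Cauchy-Schwarz. *)
Lemma lstepm_integral_dist j (b A : process R Omega k 1) :
  vL2 PL (ext T b) -> S2 P T F A -> time_integral P T b A ->
  (vnn2 PL (ext T (fun w t => A w t - lstepm j A w t)%R) <=
    (T * (T / 2 ^+ j))%:E * vnn2 PL (ext T b))%E.
Proof.
move=> Lb SA tA; have [aA _ _] := SA; have rA := S2_rcproc hF SA.
have pl := lstepm_predictable j aA.
have mD : mmeas (ext T (fun w t => A w t - lstepm j A w t)).
  by rewrite extB; apply: mmeasB; [exact: rcproc_mmeas|exact: (predictable_mmeas T0 hF)].
have d0 : 0 < T / 2 ^+ j by rewrite divr_gt0 ?exprn_gt0.
rewrite (vnn2_fine Lb) -EFinM -mulrA; apply: vnn2_time_le => //.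
  apply: mulr_ge0; first exact: ltW.
  by apply: Rintegral_ge0 => z _; exact: sqr_ge0.
move=> t tT; have [q [h1 h2 _ e]] := lstepm_eval j tT.
have := tT; rewrite in_itv/= => /andP[t0 tT'].
have gT := grid_itv T0 j q; have := gT; rewrite in_itv/= => /andP[g0 _].
have mS := mmeas_sqr Lb.1.
have [IF eF] := fubini_P (vL2_int1 Lb).
apply: (@le_trans _ _ (\int[P]_w (T / 2 ^+ j * \int[leb]_s (hsnorm (ext T b (w, s)) ^+ 2))%:E)%E).
  apply: ae_integral_le.
  - by move=> w; rewrite lee_fin sqr_ge0.
  - move=> w; rewrite lee_fin; apply: mulr_ge0; first exact: ltW.
    by apply: Rintegral_ge0 => z _; exact: sqr_ge0.
  - exact: measurable_int (int1Z (T / 2 ^+ j) IF).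
  apply: filterS2 tA (ae_time_integrable Lb) => w [_ Aw] Lw; rewrite lee_fin e hsnorm_sqr.
  rewrite (_ : \int[leb]_s _ = \sum_(i < k) \int[leb]_s (ext T b (w, s) i ord0 ^+ 2)); last first.
    rewrite -Rintegral_sum; last by move=> i; apply: int1_sq; exact: Lw.
    by apply: eq_Rintegral => s _; rewrite hsnorm_sqr; apply: eq_bigr => i _; rewrite big_ord1.
  rewrite mulr_sumr; apply: ler_sum => i _; rewrite big_ord1 !mxE Aw// Aw//.
  rewrite !(Rintegral_ext _ _ _ tT) !(Rintegral_ext _ _ _ gT).
  have a' (A' : set R) (u : R -> R) : measurable A' -> \int[leb]_(s in A') u s = \int[leb]_s (\1_A' s * u s).
    by move=> mA'; exact: Rintegral_indic.
  have mo : measurable (`]grid T j q, t]%classic : set R) by exact: measurable_itv.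
  have -> : \int[leb]_(s in `[0, t]) ext T b (w, s) i ord0 - \int[leb]_(s in `[0, grid T j q]) ext T b (w, s) i ord0 =
     \int[leb]_(s in `]grid T j q, t]) ext T b (w, s) i ord0.
    rewrite (a' `[0, t]%classic)// (a' `[0, grid T j q]%classic)// (a' `]grid T j q, t]%classic)//.
    rewrite -RintegralB//; [|exact: (L2M (L2_itv t) (Lw i))|exact: (L2M (L2_itv _) (Lw i))].
    apply: eq_Rintegral => s _; rewrite -mulrBl; congr (_ * _); rewrite !indicE !mem_setE !in_itv/=.
    case: (leP 0 s) => s0 /=; last by rewrite subrr ltNge (le_trans (ltW s0) g0).
    case: (leP s (grid T j q)) => sg /=; first by rewrite (le_trans sg h1) subrr.
    by rewrite subr0.
  apply: sqr_Rintegral_set => //.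
  rewrite lebesgue_measure_itv/= lte_fin; case: ifP => _; first by rewrite -EFinB lee_fin.
  by rewrite lee_fin ltW.
have -> : (\int[P]_w (T / 2 ^+ j * \int[leb]_s (hsnorm (ext T b (w, s)) ^+ 2))%:E)%E =
  (\int[P]_w (T / 2 ^+ j * \int[leb]_s (hsnorm (ext T b (w, s)) ^+ 2)))%:E.
  have := int1Z (T / 2 ^+ j) IF; set G := (fun w => _ * _) => hG.
  by rewrite [RHS]fineK//; exact: (integrable_fin_num measurableT hG).
by rewrite lee_fin RintegralZl// -eF.
Qed.

End lstep_matrix.

Section mean_square.
Context {R : realType} {d : measure_display} {S : measurableType d} {k l : nat}.
Variable mu : {measure set S -> \bar R}.
Implicit Types X Y Z : S -> 'M[R]_(k, l).

(** The real counterpart of [vnn2], equal to it under [vL2], so that chains of estimates can be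
    closed by arithmetic in the field. *)
Definition q2 X : R := \int[mu]_s (hsnorm (X s) ^+ 2).

Lemma q2E X : vL2 mu X -> vnn2 mu X = (q2 X)%:E.
Proof. exact: vnn2_fine. Qed.

Lemma q2_ge0 X : 0 <= q2 X.
Proof. by apply: Rintegral_ge0 => s _; exact: sqr_ge0. Qed.

Lemma Rintegral_ae_le (f g : S -> R) : int1 mu f -> int1 mu g ->
  {ae mu, forall s, f s <= g s} -> \int[mu]_s f s <= \int[mu]_s g s.
Proof.
move=> If Ig h; rewrite -subr_ge0 -RintegralB//.
have iB := int1B Ig If.
have iA : int1 mu (fun s => `|g s - f s|).
  by have := integrable_abse iB; apply: eq_integrable.
rewrite (@ae_eq_Rintegral _ _ _ mu _ (fun s => `|g s - f s|)).
- exact: Rintegral_ge0.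
- exact/measurable_EFinP/(measurable_int _ iB).
- exact/measurable_EFinP/(measurable_int _ iA).
by apply: filterS h => s hs; rewrite ger0_norm// subr_ge0.
Qed.

Lemma q2_ae_le X (G : S -> R) : mmeas X -> int1 mu G ->
  {ae mu, forall s, hsnorm (X s) ^+ 2 <= G s} -> vL2 mu X /\ q2 X <= \int[mu]_s G s.
Proof.
move=> mX iG h.
have e0 : (vnn2 mu X <= \int[mu]_s (`|G s|)%:E)%E.
  apply: ae_integral_le.
  - by move=> s; rewrite lee_fin sqr_ge0.
  - by move=> s; rewrite lee_fin.
  - by apply/measurable_EFinP; apply: measurableT_comp => //; exact/measurable_EFinP/(measurable_int _ iG).
  by apply: filterS h => s hs; rewrite lee_fin (le_trans hs)// ler_norm.
have LX : vL2 mu X.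
  split => //; apply: le_lt_trans e0 _; have /integrableP[_] := iG.
  by under eq_integral do rewrite /=.
by split => //; apply: Rintegral_ae_le => //; exact: vL2_int1.
Qed.

Lemma q2_lin (a b c : R) X k1 l1 (Y : S -> 'M[R]_(k1, l1)) k2 l2 (Z : S -> 'M[R]_(k2, l2))
    k3 l3 (U : S -> 'M[R]_(k3, l3)) :
  mmeas X -> vL2 mu Y -> vL2 mu Z -> vL2 mu U ->
  {ae mu, forall s, hsnorm (X s) ^+ 2 <=
     a * hsnorm (Y s) ^+ 2 + b * hsnorm (Z s) ^+ 2 + c * hsnorm (U s) ^+ 2} ->
  vL2 mu X /\ q2 X <= a * \int[mu]_s (hsnorm (Y s) ^+ 2) + b * \int[mu]_s (hsnorm (Z s) ^+ 2)
      + c * \int[mu]_s (hsnorm (U s) ^+ 2).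
Proof.
move=> mX LY LZ LU h.
have iY := int1Z a (vL2_int1 LY); have iZ := int1Z b (vL2_int1 LZ); have iU := int1Z c (vL2_int1 LU).
have [L1 L2] := q2_ae_le mX (int1D (int1D iY iZ) iU) h; split => //.
apply: le_trans L2 _; rewrite RintegralD//; last exact: (int1D iY iZ).
by rewrite RintegralD// !RintegralZl//; exact: vL2_int1.
Qed.

Lemma q2_eq0 X : vL2 mu X -> q2 X <= 0 -> {ae mu, forall s, X s = 0}.
Proof.
move=> LX h; apply: (vnn2_eq0 LX.1); rewrite q2E//.
by congr EFin; apply/eqP; rewrite eq_le h q2_ge0.
Qed.

Lemma q2B X Y : vL2 mu X -> vL2 mu Y ->
  q2 (fun s => X s - Y s) <= 2 * q2 X + 2 * q2 Y.
Proof.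
move=> LX LY; have := vnn2B mu LX.1 LY.1.
by rewrite (q2E LX) (q2E LY) (q2E (vL2B LX LY)) -!EFinM -EFinD lee_fin.
Qed.

Lemma q2D X Y : vL2 mu X -> vL2 mu Y ->
  q2 (fun s => X s + Y s) <= 2 * q2 X + 2 * q2 Y.
Proof.
move=> LX LY; have := vnn2D mu LX.1 LY.1.
by rewrite (q2E LX) (q2E LY) (q2E (vL2D LX LY)) -!EFinM -EFinD lee_fin.
Qed.

Lemma q2_ae_eq X Y : mmeas X -> mmeas Y -> {ae mu, forall s, X s = Y s} -> q2 X = q2 Y.
Proof.
move=> mX mY h; apply: ae_eq_Rintegral; [exact: mmeas_sqr..|].
by apply: filterS h => s ->.
Qed.

Lemma vL2_ae_eq X Y : mmeas X -> vL2 mu Y -> {ae mu, forall s, X s = Y s} -> vL2 mu X.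
Proof. by move=> mX LY h; split => //; rewrite (ae_eq_vnn2 mX LY.1 h); case: LY. Qed.

End mean_square.

Section S2_processes.
Context {R : realType} {dsp} {Omega : measurableType dsp}
  (P : probability Omega R) (T : R) (F : R -> set (set Omega)).
Hypothesis T0 : 0 < T.
Hypothesis hF : usual_filtration P T F.
Local Notation PL := (dPdt P).

Definition nR {k l} (U : process R Omega k l) : R := fine (nS P T U).

Lemma nRE k l (U : process R Omega k l) : (nS P T U < +oo)%E -> nS P T U = (nR U)%:E.
Proof. by move=> h; rewrite /nR fineK// ge0_fin_numE// nS_ge0. Qed.

Lemma nR_ge0 k l (U : process R Omega k l) : 0 <= nR U.
Proof. by rewrite fine_ge0// nS_ge0. Qed.

Lemma adaptedD k l (U V : process R Omega k l) : adapted T F U -> adapted T F V ->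
  adapted T F (fun w t => U w t + V w t).
Proof.
move=> /(adapted_gmeas _ hF) aU /(adapted_gmeas _ hF) aV.
apply/(adapted_gmeas _ hF) => t tT i j.
apply: (gmeas_ext (f := fun w => U w t i j + V w t i j)); first by move=> w; rewrite mxE.
by apply: measurable_funD; [exact: aU|exact: aV].
Qed.

Lemma adaptedN k l (U : process R Omega k l) : adapted T F U ->
  adapted T F (fun w t => - U w t).
Proof.
move=> /(adapted_gmeas _ hF) aU.
apply/(adapted_gmeas _ hF) => t tT i j.
apply: (gmeas_ext (f := fun w => - U w t i j)); first by move=> w; rewrite mxE.
by apply: measurable_funN; exact: aU.
Qed.

Lemma S2D k l (U V : process R Omega k l) : S2 P T F U -> S2 P T F V ->
  S2 P T F (fun w t => U w t + V w t).
Proof.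
move=> SU SV; have [aU cU _] := SU; have [aV cV _] := SV; split; first exact: adaptedD.
  move=> w; apply/within_continuousP => i j t tT; rewrite mxE.
  under [X in tends _ X]funext do rewrite mxE.
  by apply: tendsD; [apply: (within_continuousP _ _).1|apply: (within_continuousP _ _).1].
rewrite (nS_lty P T0); apply: le_lt_trans (nSD P T0 (S2_rcproc hF SU) (S2_rcproc hF SV)) _.
by rewrite (nRE (S2_nS T0 SU)) (nRE (S2_nS T0 SV)) -!EFinM -EFinD ltry.
Qed.

Lemma S2N k l (U : process R Omega k l) : S2 P T F U -> S2 P T F (fun w t => - U w t).
Proof.
move=> SU; have [aU cU fU] := SU; split; first exact: adaptedN.
  move=> w; apply/within_continuousP => i j t tT; rewrite mxE.
  under [X in tends _ X]funext do rewrite mxE.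
  by apply: tendsN; apply: (within_continuousP _ _).1.
by rewrite (nS_lty P T0) nSN -(nS_lty P T0).
Qed.

Lemma S2B k l (U V : process R Omega k l) : S2 P T F U -> S2 P T F V ->
  S2 P T F (fun w t => U w t - V w t).
Proof. by move=> SU /S2N SV; exact: S2D SU SV. Qed.

Lemma S2_cst k l (x : 'M[R]_(k, l)) : S2 P T F (fun _ _ => x).
Proof.
have a : adapted T F (fun (_ : Omega) (_ : R) => x).
  apply/(adapted_gmeas _ hF) => t tT i j; exact: measurable_cst.
have c (w : Omega) : {within `[0, T], continuous (fun _ : R => x)}.
  by apply: continuous_subspaceT => y; exact: cvg_cst.
split => //; rewrite (nS_lty P T0).
apply: (@le_lt_trans _ _ (\int[P]_w (hsnorm x ^+ 2)%:E)%E).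
  apply: ge0_integral_mono => w; first exact: esup_ge0.
  by apply: esup_le; rewrite ?sqr_ge0.
by rewrite integral_cst//= probability_setT mule1 ltry.
Qed.

Lemma q2_nR k l (U : process R Omega k l) t : S2 P T F U -> t \in `[0, T] -> q2 P (U ^~ t) <= nR U.
Proof.
move=> SU tT; have := vnn2_nS P T0 (S2_rcproc hF SU) tT.
by rewrite (nRE (S2_nS T0 SU)) (q2E (S2_vL2 T0 hF SU tT)) lee_fin.
Qed.

Lemma q2_ext_nR k l (U : process R Omega k l) : S2 P T F U -> q2 PL (ext T U) <= T * nR U.
Proof.
move=> SU; have := vnn2_le_nS T0 (S2_rcproc hF SU) (S2_nS T0 SU).
by rewrite (nRE (S2_nS T0 SU)) (q2E (S2_H2 T0 hF SU).2) -EFinM lee_fin.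
Qed.

Lemma q2_time_le k l (U : process R Omega k l) (c : R) : S2 P T F U -> 0 <= c ->
  (forall t, t \in `[0, T] -> q2 P (U ^~ t) <= c) -> q2 PL (ext T U) <= T * c.
Proof.
move=> SU c0 h; have [_ LU] := S2_H2 T0 hF SU.
have := @vnn2_time_le _ _ _ P T T0 _ _ U c c0 LU.1; rewrite (q2E LU) lee_fin; apply.
by move=> t tT; rewrite (q2E (S2_vL2 T0 hF SU tT)) lee_fin h.
Qed.

Lemma time_integral_nR k (g g' J J' : process R Omega k 1) :
  vL2 PL (ext T g) -> vL2 PL (ext T g') -> S2 P T F J -> S2 P T F J' ->
  time_integral P T g J -> time_integral P T g' J' ->
  nR (fun w t => J w t - J' w t) <= T * q2 PL (ext T (fun w t => g w t - g' w t)).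
Proof.
move=> Lg Lg' SJ SJ' tJ tJ'.
have := time_integral_nS T0 Lg Lg' (S2_rcproc hF SJ) (S2_rcproc hF SJ') tJ tJ'.
rewrite (nRE (S2_nS T0 (S2B SJ SJ'))) q2E; last by rewrite extB; exact: vL2B.
by rewrite -EFinM lee_fin.
Qed.

Lemma time_integral_nR0 k (g J : process R Omega k 1) :
  vL2 PL (ext T g) -> S2 P T F J -> time_integral P T g J -> nR J <= T * q2 PL (ext T g).
Proof.
move=> Lg SJ tJ; have := time_integral_le T0 Lg (S2_rcproc hF SJ) tJ.
by rewrite (nRE (S2_nS T0 SJ)) q2E// -EFinM lee_fin.
Qed.

Lemma S2_indist k l (U V : process R Omega k l) : S2 P T F U -> S2 P T F V ->
  nR (fun w t => U w t - V w t) <= 0 -> indistinguishable P T U V.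
Proof.
move=> SU SV h; have SD := S2B SU SV.
have : nS P T (fun w t => U w t - V w t) = 0%E.
  by rewrite (nRE (S2_nS T0 SD)); congr EFin; apply/eqP; rewrite eq_le h nR_ge0.
move=> /(nS_eq0 T0 (S2_rcproc hF SD)); apply: filterS => w e t tT.
by apply/eqP; rewrite -subr_eq0 e.
Qed.



Lemma time_integralB k (g g' J J' : process R Omega k 1) :
  time_integral P T g J -> time_integral P T g' J' ->
  time_integral P T (fun w t => g w t - g' w t) (fun w t => J w t - J' w t).
Proof.
move=> h h'; apply: filterS2 h h' => w [i1 h1] [i2 h2].
have e s i : ((g w s - g' w s) i ord0)%:E = ((g w s i ord0)%:E - (g' w s i ord0)%:E)%E.
  by rewrite !mxE EFinB.
split=> [i|t tT i].
  rewrite (_ : (fun s => _) = (fun s => (g w s i ord0)%:E - (g' w s i ord0)%:E)%E).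
    by apply: integrableB => //; exact: measurable_itv.
  by apply/funext => s; exact: e.
rewrite !mxE h1// h2// -RintegralB//; first by apply: eq_Rintegral => s _; rewrite !mxE.
- have := tT; rewrite in_itv/= => /andP[_ tT']; apply: integrableS (i1 i) => //.
  by move=> s; rewrite /= !in_itv/= => /andP[-> st]; exact: le_trans st _.
- have := tT; rewrite in_itv/= => /andP[_ tT']; apply: integrableS (i2 i) => //.
  by move=> s; rewrite /= !in_itv/= => /andP[-> st]; exact: le_trans st _.
Qed.

Lemma energy_le k (beta B N D : process R Omega k 1) (G : Omega * R -> R) t :
  predictable T F beta -> vL2 PL (ext T beta) -> time_integral P T beta B ->
  (forall a, mart P T F (fun t w => N w t a ord0)) -> vL2 PL (ext T N) ->
  {ae P, forall w, forall t, t \in `[0, T] -> D w t = B w t + N w t} ->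
  vL2 PL (ext T D) -> mmeas (D ^~ t) -> t \in `[0, T] ->
  int1 PL G -> (forall z, 0 <= G z) ->
  {ae PL, forall z, 2 * mdot (ext T D z) (ext T beta z) <= G z} ->
  q2 P (D ^~ t) <= \int[PL]_z G z + q2 P (N ^~ t).
Proof.
move=> pb Lb tB mN LN eD LD mD tT iG G0 h; rewrite /q2 (energy T0 hF pb Lb tB mN LN eD LD mD tT).
rewrite lerD2r.
have im : int1 PL (fun z => mdot (ext T D z) (ext T beta z)).
  rewrite /mdot; apply: int1_sum => i; apply: int1_sum => j.
  by apply: L2M; [exact: (vL2P _ _).1|exact: (vL2P _ _).1].
have iu : int1 PL (fun z => upto t z.2 * mdot (ext T D z) (ext T beta z)).
  by apply: int1_upto => //; exact: measurable_cst.
rewrite -RintegralZl//; apply: Rintegral_ae_le => //; first exact: int1Z.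
by apply: filterS h => z; rewrite /upto; case: ifP => _; rewrite ?mul1r// mul0r mulr0.
Qed.

End S2_processes.

Ltac nonneg := repeat first [assumption | exact: ler01 | exact: ler0n | apply: sqr_ge0 |
  apply: addr_ge0 | apply: mulr_ge0 | apply: exprn_ge0 | by []].

(** * Additive noise and monotone drift *)

Lemma double_sum_le {R : realFieldType} (p q r s : R) : p <= r * s -> q <= r * s ->
  2 * p + 2 * q <= 4 * (r * s).
Proof. by move=> ? ?; lra. Qed.

Lemma half_of_eighth {R : realFieldType} (p q r : R) : 8 * p * q * r <= r -> 4 * p * (q * r) <= r / 2.
Proof. by move=> ?; lra. Qed.

Lemma half_pow_le1 {R : realFieldType} (m : nat) : 2^-1 ^+ m <= 1 :> R.
Proof. by apply: exprn_ile1; rewrite ?invr_ge0 ?invf_le1 ?ler1n. Qed.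

Lemma le_cvg0 {R : realType} (a : R) (s : nat -> R) : (forall q, a <= s q) ->
  s q @[q --> \oo] --> 0 -> a <= 0.
Proof.
move=> h /cvgrPdist_le hs; apply/ler_addgt0Pr => e e0.
have [q _ /(_ q (leqnn q))] := hs e e0; rewrite sub0r normrN add0r => h1.
by apply: le_trans (h q) _; apply: le_trans h1; exact: ler_norm.
Qed.

Lemma cvg_geom {R : realType} (B x : R) : 0 <= x -> x < 1 -> B * x ^+ q @[q --> \oo] --> 0.
Proof.
move=> x0 x1; rewrite -[X in _ --> X](mulr0 B); apply: cvgMr.
by apply: cvg_expr; rewrite ger0_norm.
Qed.

Lemma cvg_bigsum {R : realType} (I : Type) (r : seq I) (u : I -> nat -> R) (l : I -> R) :
  (forall i, u i q @[q --> \oo] --> l i) -> \sum_(i <- r) u i q @[q --> \oo] --> \sum_(i <- r) l i.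
Proof.
move=> h; elim: r => [|i r IH].
  by rewrite big_nil (_ : (fun q => _) = cst 0); [exact: cvg_cst|apply/funext => q; rewrite big_nil].
rewrite big_cons (_ : (fun q => _) = (fun q => u i q + \sum_(j <- r) u j q)); first exact: cvgD.
by apply/funext => q; rewrite big_cons.
Qed.

Lemma hsnorm_cvg0 {R : realType} k l (A : nat -> 'M[R]_(k, l)) (L : 'M[R]_(k, l)) :
  (forall i j, A q i j @[q --> \oo] --> L i j) -> hsnorm (A q - L) @[q --> \oo] --> 0.
Proof.
move=> h; have h1 : \sum_i \sum_j (A q - L) i j ^+ 2 @[q --> \oo] --> \sum_(i < k) \sum_(j < l) (0 : R).
  apply: cvg_bigsum => i; apply: cvg_bigsum => j.
  rewrite (_ : (fun q => _) = (fun q => (A q i j - L i j) * (A q i j - L i j))); last first.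
    by apply/funext => q; rewrite !mxE expr2.
  rewrite -[X in _ --> X](mulr0 0).
  have h0 : A q i j - L i j @[q --> \oo] --> 0.
    by rewrite -[X in _ --> X](subrr (L i j)); apply: cvgB => //; exact: cvg_cst.
  by apply: cvgM.
rewrite big1 in h1; last by move=> i _; rewrite big1.
rewrite -[X in _ --> X](@sqrtr0 R).
exact: (@cvg_comp _ _ _ (fun q => \sum_i \sum_j (A q - L) i j ^+ 2) Num.sqrt _ _ _ h1 (@sqrt_continuous R 0)).
Qed.

Lemma growth_le {R : realFieldType} (C a b1 b2 x y l h : R) : a <= b1 + b2 ->
  b1 <= C * x + h -> b2 <= C * y + h -> C * x <= C * (y + l) -> a - C * l <= 2 * C * y + 2 * h.
Proof. by move=> ? ? ? ?; lra. Qed.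

Lemma three_terms {R : realFieldType} (u v s a b c p : R) : u <= a -> v <= b -> s <= c ->
  p <= 2 * v + 2 * s -> 2 * p + 2 * u <= 2 * a + 4 * b + 4 * c.
Proof. by move=> ? ? ? ?; lra. Qed.

Lemma sqr_le_split {R : realFieldType} (C d r l : R) : 0 <= d -> d <= r + C * l ->
  d ^+ 2 <= 2 * r ^+ 2 + 2 * C ^+ 2 * l ^+ 2.
Proof.
move=> d0 h; apply: (@le_trans _ _ ((r + C * l) ^+ 2)).
  by rewrite ler_sqr// nnegrE// (le_trans d0).
by have := sqr_ge0 (r - C * l); lra.
Qed.

Section fast_matrix.
Context {R : realType} {d : measure_display} {S : measurableType d} {k l : nat}.
Variables (mu : {measure set S -> \bar R}) (G : set (set S)).
Hypothesis subG : G `<=` measurable.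

Lemma fast_mx (f : nat -> S -> 'M[R]_(k, l)) :
  (forall n i j, gmeas G (fun z => f n z i j)) -> vL2 mu (f 0%N) ->
  (forall n, vnn2 mu (fun z => f n.+1 z - f n z)%R <= (16^-1 ^+ n)%:E)%E ->
  exists (g : S -> 'M[R]_(k, l)) (B : R), [/\ forall i j, gmeas G (fun z => g z i j), vL2 mu g,
    0 <= B, forall n, (vnn2 mu (fun z => g z - f n z)%R <= (B * 4^-1 ^+ n)%:E)%E
    & {ae mu, forall z, forall i j, f n z i j @[n --> \oo] --> g z i j}].
Proof.
move=> Gf L0 hf.
have mf n : mmeas (f n) by move=> i j; exact: (gmeas_sub subG (Gf n i j)).
have /choice[gQ hgQ] : forall p : 'I_k * 'I_l, exists gQ : (S -> R) * (S -> R),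
    [/\ gmeas G gQ.1, int1 mu gQ.2, forall x, 0 <= gQ.2 x &
   {ae mu, forall x, f n x p.1 p.2 @[n --> \oo] --> gQ.1 x /\
      forall n, `|gQ.1 x - f n x p.1 p.2| <= 2 * Num.sqrt (gQ.2 x) * 2^-1 ^+ n}].
  move=> [i j].
  have [|g [Q [h1 h2 h3 h4]]] := fast_L2 subG (fun n => Gf n i j) (mu := mu); last by exists (g, Q).
  move=> n; apply: le_trans (hf n); apply: ge0_integral_mono => x; first by rewrite lee_fin sqr_ge0.
  by rewrite lee_fin; have := entry_sqr_le (f n.+1 x - f n x) i j; rewrite !mxE.
pose g z : 'M[R]_(k, l) := \matrix_(i, j) (gQ (i, j)).1 z.
pose B : R := \sum_i \sum_j 4 * \int[mu]_x (gQ (i, j)).2 x.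
have Gg i j : gmeas G (fun z => g z i j).
  apply: (gmeas_ext (f := (gQ (i, j)).1)); first by move=> z; rewrite mxE.
  by case: (hgQ (i, j)).
have mg : mmeas g by move=> i j; exact: (gmeas_sub subG (Gg i j)).
have hB n : (vnn2 mu (fun z => g z - f n z)%R <= (B * 4^-1 ^+ n)%:E)%E.
  rewrite vnn2E; last exact: mmeasB.
  rewrite /B mulr_suml -sumEFin; apply: lee_sum => i _; rewrite mulr_suml -sumEFin.
  apply: lee_sum => j _; have [h1 h2 h3 h4] := hgQ (i, j).
  have := @fast_L2_cvg _ _ _ mu G subG (fun n z => f n z i j) _ _ (fun n => Gf n i j) h1 h2 h3.
  move=> /(_ (filterS _ h4)) h; rewrite mulrAC; apply: le_trans (h _ n).
    by apply: ge0_integral_mono => x; [rewrite lee_fin sqr_ge0|rewrite !mxE].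
  by move=> x [].
exists g, B; split => //.
- split => //.
  have Ld : vL2 mu (fun z => g z - f 0%N z).
    by split; [exact: mmeasB|exact: le_lt_trans (hB 0%N) (ltry _)].
  by have [_] := vL2D Ld L0; under eq_fun do rewrite subrK.
- apply: sumr_ge0 => i _; apply: sumr_ge0 => j _; apply: mulr_ge0 => //.
  by apply: Rintegral_ge0 => x _; case: (hgQ (i, j)).
apply: filter_forall => i; apply: filter_forall => j; have [_ _ _] := hgQ (i, j).
by apply: filterS => z [h _]; rewrite mxE.
Qed.

End fast_matrix.

(** Completeness of H^2 along fast sequences. Off [0, T] the limit is almost everywhere a limit of
    zeros, so it is again the extension of a predictable process. *)
Lemma fast_process {R : realType} {dsp} {Omega : measurableType dsp}
    (P : probability Omega R) (T : R) (F : R -> set (set Omega)) k l (U : nat -> process R Omega k l) :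
  0 < T -> usual_filtration P T F -> (forall q, predictable T F (U q)) -> vL2 (dPdt P) (ext T (U 0%N)) ->
  (forall q, (vnn2 (dPdt P) (ext T (fun w t => U q.+1 w t - U q w t)%R) <= (16^-1 ^+ q)%:E)%E) ->
  exists (V : process R Omega k l) (B : R), [/\ predictable T F V, vL2 (dPdt P) (ext T V), 0 <= B,
    forall q, q2 (dPdt P) (ext T (fun w t => V w t - U q w t)) <= B * 4^-1 ^+ q
    & {ae dPdt P, forall z, forall i j, ext T (U q) z i j @[q --> \oo] --> ext T V z i j}].
Proof.
move=> T0 hF pU L0 hU.
have Gf q a c : gmeas (Gpred T F) (fun z => ext T (U q) z a c) by exact: (predictableP T0 hF _).1.
have hf q : (vnn2 (dPdt P) (fun z => ext T (U q.+1) z - ext T (U q) z)%R <= (16^-1 ^+ q)%:E)%E.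
  by have := hU q; rewrite extB.
have [g [B [Gg Lg B0 hB hae]]] := fast_mx (Gpred_sub (T:=T) (F:=F)) Gf L0 hf.
pose V w t : 'M[R]_(k, l) := \matrix_(a, c) g (w, t) a c.
have pV : predictable T F V := predictable_of_gmeas Gg.
have mV := predictable_mmeas T0 hF pV.
have eV : {ae dPdt P, forall z, ext T V z = g z}.
  apply: filterS hae => -[w t] h; rewrite /ext/=; case: ifPn => tT; first by apply/matrixP => a c; rewrite !mxE.
  apply/matrixP => a c; rewrite !mxE; have := h a c.
  rewrite (_ : (fun q => _) = cst 0); last by apply/funext => q; rewrite /ext/= (negbTE tT) mxE.
  by move=> /(cvg_lim (@Rhausdorff R)) <-; rewrite lim_cst.
have LV : vL2 (dPdt P) (ext T V) := vL2_ae_eq mV Lg eV.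
exists V, B; split => //.
  move=> q; rewrite extB.
  have LU : vL2 (dPdt P) (fun z => g z - ext T (U q) z).
    split; last exact: le_lt_trans (hB q) (ltry _).
    by apply: mmeasB; [exact: Lg.1|exact: (predictable_mmeas T0 hF)].
  rewrite (@q2_ae_eq _ _ _ _ _ _ _ (fun z => g z - ext T (U q) z)).
  - by have := hB q; rewrite (q2E LU) lee_fin.
  - by apply: mmeasB => //; exact: (predictable_mmeas T0 hF).
  - exact: LU.1.
  by apply: filterS eV => z ->.
by apply: filterS2 hae eV => z h ->.
Qed.

Section additive_sde.
Context {R : realType} {dsp} {Omega : measurableType dsp}
  (P : probability Omega R) (T : R) (F : R -> set (set Omega)).
Hypothesis T0 : 0 < T.
Hypothesis hF : usual_filtration P T F.
Local Notation PL := (dPdt P).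
Local Notation leb := (@lebesgue_measure R).
Context {n : nat}.
Variables (beta : Omega -> R -> 'cV[R]_n -> 'cV[R]_n) (C : R) (hb : Omega * R -> R).
Variables (N : process R Omega n 1) (x0 : 'cV[R]_n).
Hypothesis C0 : 0 < C.
Hypothesis Lh : L2 PL hb.
Hypothesis beta_version : forall U, predictable T F U ->
  exists b, predictable_version P T F (fun w t => beta w t (U w t)) b.
Hypothesis beta_monotone : ae_dPdt P T (fun w t => forall x x',
  dotp (x - x') (beta w t x - beta w t x') <= C * hsnorm (x - x') ^+ 2).
Hypothesis beta_growth : ae_dPdt P T (fun w t => forall x,
  hsnorm (beta w t x) <= C * hsnorm x + hb (w, t)).
Hypothesis beta_continuous : ae_dPdt P T (fun w t => forall u e, 0 < e -> exists2 r, 0 < r &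
  forall u', hsnorm (u' - u) <= r -> hsnorm (beta w t u' - beta w t u) <= e).
Hypothesis SN : S2 P T F N.
Hypothesis mN : forall a, mart P T F (fun t w => N w t a ord0).
Implicit Types U A b X : process R Omega n 1.

Definition hb2 : R := \int[PL]_z (hb z ^+ 2).

Lemma version_bound U b : vL2 PL (ext T U) ->
  predictable_version P T F (fun w t => beta w t (U w t)) b ->
  vL2 PL (ext T b) /\ q2 PL (ext T b) <= 2 * C ^+ 2 * q2 PL (ext T U) + 2 * hb2.
Proof.
move=> LU [pb eb]; have mb := predictable_mmeas T0 hF pb.
have iU := int1Z (2 * C ^+ 2) (vL2_int1 LU); have ih := int1Z 2 (int1_sq Lh).
have h : {ae PL, forall z, hsnorm (ext T b z) ^+ 2 <=
    2 * C ^+ 2 * hsnorm (ext T U z) ^+ 2 + 2 * hb z ^+ 2}.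
  move: eb beta_growth; rewrite !ae_dPdtE => eb bg.
  apply: filterS2 eb bg => -[w t]/= eb bg; rewrite /ext/=; case: ifPn => tT; last first.
    by rewrite hsnorm0 expr0n/= mulr0 add0r mulr_ge0// sqr_ge0.
  rewrite (eb tT); have := bg tT (U w t).
  have := hsnorm_ge0 (beta w t (U w t)); have := sqr_ge0 (C * hsnorm (U w t) - hb (w, t)).
  move: (hsnorm _) (hsnorm _) (hb _) => p q r; nra.
have [L1 h1] := q2_ae_le mb (int1D iU ih) h; split => //; apply: le_trans h1 _.
by rewrite RintegralD// !RintegralZl//; [exact: int1_sq|exact: vL2_int1].
Qed.

(* One explicit step of the fixed-point equation of the Euler scheme. Since
   [lstepm] only looks at the last grid point, iterates agree on one more cell
   at each step, and [2 ^ j] of them reach the scheme [euler j X X b A]. *)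
Definition euler j U U' b A := [/\ S2 P T F U',
  predictable_version P T F (fun w t => beta w t (lstepm T j U w t)) b,
  S2 P T F A /\ (forall w, A w 0 = 0), time_integral P T b A
  & forall w t, U' w t = x0 + A w t + N w t].

Lemma lstepm_vL2 j U : S2 P T F U -> vL2 PL (ext T (lstepm T j U)).
Proof.
move=> SU; have [aU _ _] := SU; have pl := lstepm_predictable T0 hF j aU.
split; first exact: (predictable_mmeas T0 hF).
apply: le_lt_trans (lstepm_vnn2 T0 hF j aU (nR_ge0 P T0 U) _) (ltry _) => t tT.
by have := q2_nR T0 hF SU tT; rewrite -lee_fin -q2E//; exact: (S2_vL2 T0 hF SU tT).
Qed.

Lemma euler_step j U : S2 P T F U -> exists U' b A, euler j U U' b A.
Proof.
move=> SU; have [aU _ _] := SU; have pl := lstepm_predictable T0 hF j aU.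
have [b vb] := beta_version pl; have [Lb _] := version_bound (lstepm_vL2 j SU) vb.
have [A [SA A0 tA]] := time_integral_exists T0 hF vb.1 Lb.
exists (fun w t => x0 + A w t + N w t), b, A.
split; [|exact: vb|by split|exact: tA|by []].
exact: (S2D T0 hF (S2D T0 hF (S2_cst T0 hF x0) SA) SN).
Qed.

Lemma euler_prefix j i U U' U'' b b' A A' : euler j U U' b A -> euler j U' U'' b' A' ->
  {ae P, forall w, forall t, t \in `[0, T] -> t <= grid T j i -> U w t = U' w t} ->
  {ae P, forall w, forall t, t \in `[0, T] -> t <= grid T j i.+1 -> U' w t = U'' w t}.
Proof.
move=> [_ [_ vb] _ tA eU] [_ [_ vb'] _ tA' eU'] h.
have h1 := ae_and (ae_section vb) (ae_section vb').
apply: filterS2 (ae_and tA tA') (ae_and h h1) => w [[iA wA] [iA' wA']] [hw [h2 h3]] t tT tg.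
rewrite eU eU'; congr (_ + _ + _); apply/matrixP => a c; rewrite (ord1 c) wA// wA'//.
have tT' : t <= T by move: tT; rewrite in_itv/= => /andP[].
have st : (`[0, t] `<=` `[0, T])%classic by move=> s; rewrite /= !in_itv/= => /andP[-> st]; exact: le_trans st _.
have ms (v : R -> R) : leb.-integrable `[0, T] (fun s => (v s)%:E) -> measurable_fun `[0, t]%classic (fun s => (v s)%:E).
  by move=> /measurable_int; apply: measurable_funS => //; exact: measurable_itv.
rewrite /Rintegral; congr fine; apply: ae_eq_integral; [exact: measurable_itv|exact: ms|exact: ms|].
apply: filterS (ae_and h2 h3) => s [e1 e2] st'; have sT : s \in `[0, T] by exact: st.
rewrite e1// e2//; congr (beta _ _ _ _ _)%:E.
(* Up to grid point [i + 1] the lagged process is evaluated at a grid point of index at most [i], or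
   at time 0, and there the iterates already agree. *)
have [q [h4 _ hq e]] := @lstepm_eval _ _ Omega _ T0 n j _ sT; rewrite !e hw//; first exact: grid_itv.
have := st'; rewrite /= in_itv/= => /andP[s0 s1].
case: (leqP q i) => qi; first exact: grid_mono.
have [h5|s00] := hq i qi; first by have := lt_le_trans h5 (le_trans s1 tg); rewrite ltxx.
by apply: le_trans h4 _; rewrite s00; exact: grid_ge0.
Qed.

Lemma euler_iterate j i : exists U U' b A, [/\ S2 P T F U, euler j U U' b A &
  {ae P, forall w, forall t, t \in `[0, T] -> t <= grid T j i -> U w t = U' w t}].
Proof.
elim: i => [|i [U [U' [b [A [SU e h]]]]]].
  have S0 := S2_cst T0 hF (0 : 'cV[R]_n).
  have [U [b [A e]]] := euler_step j S0; have [SU _ _ _ _] := e.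
  have [U' [b' [A' e']]] := euler_step j SU.
  exists U, U', b', A'; split => //; apply: aeW => w t.
  rewrite in_itv/= grid0 => /andP[t0 _] t1; have -> : t = 0 by apply/eqP; rewrite eq_le t1.
  by case: e => _ _ [_ a0] _ ->; case: e' => _ _ [_ a0'] _ ->; rewrite a0 a0'.
have [SU' _ _ _ _] := e; have [U'' [b' [A' e']]] := euler_step j SU'.
by exists U', U'', b', A'; split => //; exact: (euler_prefix e e' h).
Qed.

Lemma euler_exists j : exists X b A, euler j X X b A.
Proof.
have [U [X [b [A [SU [SX [pb vb] SA tA eX] h]]]]] := euler_iterate j (2 ^ j).
have h' : {ae P, forall w, forall t, t \in `[0, T] -> lstepm T j U w t = lstepm T j X w t}.
  apply: filterS h => w h t tT; have [q [_ _ _ e]] := @lstepm_eval _ _ Omega _ T0 n j _ tT.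
  rewrite !e; have gT := grid_itv T0 j q; apply: h => //.
  by rewrite (gridT T (leqnn _)); move: gT; rewrite in_itv/= => /andP[].
exists X, b, A; split; [exact: SX| |exact: SA|exact: tA|exact: eX].
split; first exact: pb.
have /ext_ae h2 := indist_ext h'.
move: vb h2; rewrite !ae_dPdtE => vb h2; apply: filterS2 vb h2 => z e1 e2 zT.
by rewrite e1// e2.
Qed.


Lemma lstepm_q2 j U (c : R) : S2 P T F U -> 0 <= c ->
  (forall t, t \in `[0, T] -> q2 P (U ^~ t) <= c) -> q2 PL (ext T (lstepm T j U)) <= T * c.
Proof.
move=> SU c0 h; have [aU _ _] := SU; rewrite -lee_fin -q2E; last exact: lstepm_vL2.
apply: (lstepm_vnn2 T0 hF) => // t tT.
by rewrite (q2E (S2_vL2 T0 hF SU tT)) lee_fin h.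
Qed.

Lemma hsnorm_sqrD3 (x y z : 'cV[R]_n) :
  hsnorm (x + y + z) ^+ 2 <= 3 * hsnorm x ^+ 2 + 3 * hsnorm y ^+ 2 + 3 * hsnorm z ^+ 2.
Proof.
have := hsnormD (x + y) z; have := hsnormD x y.
have := hsnorm_ge0 (x + y + z); have := hsnorm_ge0 x; have := hsnorm_ge0 y; have := hsnorm_ge0 z.
move: (hsnorm (x + y + z)) (hsnorm (x + y)) (hsnorm x) (hsnorm y) (hsnorm z) => s v p q r.
move=> r0 q0 p0 s0 h1 h2; apply: (@le_trans _ _ ((p + q + r) ^+ 2)).
  by rewrite ler_sqr ?nnegrE; lra.
by have := sqr_ge0 (p - q); have := sqr_ge0 (q - r); have := sqr_ge0 (p - r); nra.
Qed.

Lemma q2_cst k l (x : 'M[R]_(k, l)) : q2 P (fun=> x) = hsnorm x ^+ 2.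
Proof. exact: Rint_cst. Qed.

Hypothesis small_energy : 12 * C ^+ 2 * T ^+ 2 <= 1.
Hypothesis small_monotone : 8 * C * T <= 1.

Lemma hb2_ge0 : 0 <= hb2.
Proof. by apply: Rintegral_ge0 => z _; exact: sqr_ge0. Qed.

Definition moment_bound : R := 2 * (3 * (hsnorm x0 ^+ 2 + nR P T N + 2 * T * hb2)).

Lemma moment_bound_ge0 : 0 <= moment_bound.
Proof.
rewrite /moment_bound; do 2 (apply: mulr_ge0 => //); have h := hb2_ge0.
by rewrite addr_ge0 ?addr_ge0 ?sqr_ge0 ?nR_ge0// !mulr_ge0// ltW.
Qed.

(** The time integral of the drift contributes [T * (2 C^2 T c)] and the three summands a factor 3,
    so the bound [c] reappears with the coefficient [6 C^2 T^2]; [small_energy] makes it at most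
    [1 / 2], ready for [absorb]. *)
Lemma euler_sq j X b A : euler j X X b A -> forall t, t \in `[0, T] -> q2 P (X ^~ t) <= moment_bound.
Proof.
move=> [SX vb [SA _] tA eX].
apply: (@absorb _ _ [set t | t \in `[0, T]] (fun t => q2 P (X ^~ t)) _ (nR P T X)).
  by move=> t tT; exact: (q2_nR T0 hF).
move=> c hc t tT.
have c0 : 0 <= c by apply: le_trans (hc t tT); exact: q2_ge0.
have Lx0 := S2_vL2 T0 hF (S2_cst T0 hF x0) tT; have LA := S2_vL2 T0 hF SA tT.
have LN := S2_vL2 T0 hF SN tT; have LX := S2_vL2 T0 hF SX tT.
have h : {ae P, forall w, hsnorm (X w t) ^+ 2 <=
   3 * hsnorm x0 ^+ 2 + 3 * hsnorm (A w t) ^+ 2 + 3 * hsnorm (N w t) ^+ 2}.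
  by apply: aeW => w; rewrite eX; exact: hsnorm_sqrD3.
have [_] := q2_lin LX.1 Lx0 LA LN h; rewrite [\int[P]_s (hsnorm x0 ^+ 2)]q2_cst => h1.
have h2 : q2 P (A ^~ t) <= nR P T A by exact: (q2_nR T0 hF).
have h3 : q2 P (N ^~ t) <= nR P T N by exact: (q2_nR T0 hF).
have [Lb hb1] := version_bound (lstepm_vL2 j SX) vb.
have h4 := time_integral_nR0 T0 hF Lb SA tA.
have h5 : q2 PL (ext T (lstepm T j X)) <= T * c by exact: lstepm_q2.
have h6 : T * q2 PL (ext T b) <= T * (2 * C ^+ 2 * (T * c) + 2 * hb2).
  apply: ler_wpM2l; first exact: ltW.
  apply: le_trans hb1 _; rewrite lerD2r; apply: ler_wpM2l => //.
  by rewrite mulr_ge0// sqr_ge0.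
have h7 : 12 * C ^+ 2 * T ^+ 2 * c <= c by rewrite ler_piMl.
apply: le_trans h1 _; rewrite /q2 in h2 h3.
lra.
Qed.

Definition drift_bound : R := 2 * C ^+ 2 * (T * moment_bound) + 2 * hb2.

Lemma euler_b j X b A : euler j X X b A -> vL2 PL (ext T b) /\ q2 PL (ext T b) <= drift_bound.
Proof.
move=> e; have [SX vb _ _ _] := e; have [Lb hb1] := version_bound (lstepm_vL2 j SX) vb.
split => //; apply: le_trans hb1 _; rewrite lerD2r; apply: ler_wpM2l.
  by rewrite mulr_ge0// sqr_ge0.
by apply: lstepm_q2 => //; [exact: moment_bound_ge0|exact: (euler_sq e)].
Qed.

Definition lag_bound : R := 2 * (T * T * drift_bound + T * nR P T N).

Lemma S2_lstepm_vL2 j X : S2 P T F X -> vL2 PL (ext T (fun w t => X w t - lstepm T j X w t)).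
Proof. by move=> SX; rewrite extB; apply: vL2B; [exact: (S2_H2 T0 hF SX).2|exact: lstepm_vL2]. Qed.

(** The rate [2^-j] comes from both parts of [X]: Cauchy-Schwarz over one cell for the drift
    integral, telescoping second moments for the noise. *)
Lemma euler_lag j X b A : euler j X X b A ->
  q2 PL (ext T (fun w t => X w t - lstepm T j X w t)) <= lag_bound / 2 ^+ j.
Proof.
move=> e; have [SX vb [SA _] tA eX] := e; have [Lb hb1] := euler_b e.
have TT : T \in `[0, T] by rewrite in_itv/= lexx ltW.
have LA := S2_lstepm_vL2 j SA; have LN := S2_lstepm_vL2 j SN; have LX := S2_lstepm_vL2 j SX.
have -> : ext T (fun w t => X w t - lstepm T j X w t) = fun z =>
    ext T (fun w t => A w t - lstepm T j A w t) z + ext T (fun w t => N w t - lstepm T j N w t) z.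
  apply/funext => -[w t]; rewrite /ext/=; case: ifPn => [tT|]; last by rewrite addr0.
  have [q [_ _ _ e']] := @lstepm_eval _ _ Omega _ T0 n j _ tT; rewrite !e' !eX.
  by rewrite !opprD !addrA; apply/matrixP => a c; rewrite !mxE; ring.
apply: le_trans (q2D LA LN) _.
have h1 := lstepm_integral_dist T0 hF j Lb SA tA.
rewrite (q2E LA) (q2E Lb) -EFinM lee_fin in h1.
have h2 := lstepm_mart_dist T0 hF j mN (S2_H2 T0 hF SN).2.1 (S2_vL2 T0 hF SN TT).
rewrite (q2E LN) lee_fin in h2.
have h3 := q2_nR T0 hF SN TT; rewrite /q2 in h3.
have d0 : 0 <= T / 2 ^+ j by rewrite divr_ge0 ?exprn_ge0 ?ltW.
have h4 : T / 2 ^+ j * \int[P]_w hsnorm (N w T) ^+ 2 <= T / 2 ^+ j * nR P T N by rewrite ler_wpM2l.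
have h5 : T * (T / 2 ^+ j) * q2 PL (ext T b) <= T * (T / 2 ^+ j) * drift_bound.
  by rewrite ler_wpM2l// mulr_ge0// ltW.
rewrite (_ : lag_bound / 2 ^+ j = 2 * (T * (T / 2 ^+ j) * drift_bound) + 2 * (T / 2 ^+ j * nR P T N)).
  by apply: lerD; rewrite ler_wpM2l//; [exact: le_trans h5|exact: le_trans h4].
by rewrite /lag_bound; ring.
Qed.

Lemma drift_bound_ge0 : 0 <= drift_bound.
Proof.
have T0' := ltW T0; have C0' := ltW C0.
by rewrite /drift_bound; have := hb2_ge0; have := moment_bound_ge0 => h1 h2; nonneg.
Qed.

Lemma lag_bound_ge0 : 0 <= lag_bound.
Proof.
have T0' := ltW T0; have h1 := drift_bound_ge0; have h2 := nR_ge0 P T0 N.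
by rewrite /lag_bound; nonneg.
Qed.

(** Monotonicity is available for [x - y], the difference of the lagged states at which the drifts
    are evaluated, whereas the energy identity produces [x]. The remaining product of [y] and [z] is
    split with a small weight on [z], which is only bounded, and a large one on the small lag
    [y]. *)
Lemma drift_young (e : R) (x y z : 'cV[R]_n) : 0 < e ->
  mdot (x - y) z <= C * hsnorm (x - y) ^+ 2 ->
  2 * mdot x z <= 4 * C * hsnorm x ^+ 2 + (4 * C + e^-1) * hsnorm y ^+ 2 + e * hsnorm z ^+ 2.
Proof.
move=> e0 h.
have hx : mdot x z = mdot (x - y) z + mdot y z by rewrite -mdotDl subrK.
have h1 := mdot_young (e := e^-1) y z; rewrite invr_gt0 invrK in h1; have {}h1 := h1 e0.
have h2 : hsnorm (x - y) ^+ 2 <= 2 * hsnorm x ^+ 2 + 2 * hsnorm y ^+ 2.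
  by have := hsnorm_sqrD x (- y); rewrite hsnormN.
have h3 : C * hsnorm (x - y) ^+ 2 <= C * (2 * hsnorm x ^+ 2 + 2 * hsnorm y ^+ 2).
  by apply: ler_wpM2l => //; exact: ltW.
by rewrite hx; lra.
Qed.

Lemma half_pow (j m : nat) (E : R) : 0 <= E -> (m.*2 <= j)%N ->
  E / 2 ^+ j <= E * (2^-1 ^+ m * 2^-1 ^+ m).
Proof.
move=> E0 mj; apply: ler_wpM2l => //; rewrite -exprD addnn -exprVn.
by apply: ler_wiXn2l => //; rewrite ?invr_ge0 ?invf_le1 ?ler1n.
Qed.

Definition scheme_rate : R := 2 * ((4 * C + 1) * (4 * lag_bound) + 4 * drift_bound).

Section two_schemes.
Variables (m j j' : nat) (X b A X' b' A' : process R Omega n 1).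
Hypotheses (mj : (m.*2 <= j)%N) (mj' : (m.*2 <= j')%N).
Hypotheses (e : euler j X X b A) (e' : euler j' X' X' b' A').
Let D w t := X w t - X' w t.
Let lag w t := (X w t - lstepm T j X w t) - (X' w t - lstepm T j' X' w t).

Lemma lag_q2 : vL2 PL (ext T lag) /\ q2 PL (ext T lag) <= 4 * lag_bound * (2^-1 ^+ m * 2^-1 ^+ m).
Proof.
have [SX _ _ _ _] := e; have [SX' _ _ _ _] := e'.
have LX := S2_lstepm_vL2 j SX; have LX' := S2_lstepm_vL2 j' SX'.
have -> : ext T lag = fun z => ext T (fun w t => X w t - lstepm T j X w t) z -
    ext T (fun w t => X' w t - lstepm T j' X' w t) z by rewrite -extB.
split; first exact: (vL2B LX LX').
apply: le_trans (q2B LX LX') _.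
have h1 := le_trans (euler_lag e) (half_pow lag_bound_ge0 mj).
have h2 := le_trans (euler_lag e') (half_pow lag_bound_ge0 mj').
by move: h1 h2; rewrite -mulrA; exact: double_sum_le.
Qed.

(** The noise is common to both schemes and cancels. The squared lag is of order [4^-m], so the
    weight [2^-m] in [drift_young] balances [2^m 4^-m] against [2^-m] times the bounded difference
    of drifts. The term in [D] is absorbed thanks to [small_monotone]. *)
Lemma euler_dist t : t \in `[0, T] -> q2 P (D ^~ t) <= scheme_rate * 2^-1 ^+ m.
Proof.
move=> tT; rewrite /scheme_rate -mulrA.
have [SX vb [SA _] tA eX] := e; have [SX' vb' [SA' _] tA' eX'] := e'.
have SD : S2 P T F D by exact: S2B.
have [Lb qb] := euler_b e; have [Lb' qb'] := euler_b e'; have [Lg qg] := lag_q2.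
have [pb eb] := vb; have [pb' eb'] := vb'.
pose bb w t := b w t - b' w t.
have Lbb : vL2 PL (ext T bb) by rewrite extB; exact: vL2B.
have qbb : q2 PL (ext T bb) <= 4 * drift_bound by rewrite extB; apply: le_trans (q2B Lb Lb') _; lra.
have pbb : predictable T F bb by exact: (predictableB T0 hF).
have tbb := time_integralB tA tA'.
have e0 : 0 < 2^-1 ^+ m :> R by rewrite exprn_gt0.
have hp : {ae PL, forall z, 2 * mdot (ext T D z) (ext T bb z) <=
   4 * C * hsnorm (ext T D z) ^+ 2 + (4 * C + (2^-1 ^+ m)^-1) * hsnorm (ext T lag z) ^+ 2 +
   2^-1 ^+ m * hsnorm (ext T bb z) ^+ 2}.
  move: eb eb' beta_monotone; rewrite !ae_dPdtE => eb eb' bm.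
  apply: filterS2 (ae_and eb eb') bm => -[w s] /= [h1 h2] h3.
  apply: drift_young => //; rewrite /ext/=; case: ifPn => sT; last first.
    by rewrite subrr hsnorm0 mdot0l expr0n mulr0.
  rewrite /bb h1// h2// -dotp_mdot.
  rewrite (_ : D w s - lag w s = lstepm T j X w s - lstepm T j' X' w s); first exact: h3.
  by rewrite /D /lag; apply/matrixP => a c; rewrite !mxE; ring.
have [_ LD] := S2_H2 T0 hF SD.
have i1 := vL2_int1 LD; have i2 := vL2_int1 Lg; have i3 := vL2_int1 Lbb.
pose G z := 4 * C * hsnorm (ext T D z) ^+ 2 + (4 * C + (2^-1 ^+ m)^-1) * hsnorm (ext T lag z) ^+ 2 +
   2^-1 ^+ m * hsnorm (ext T bb z) ^+ 2.
have iG : int1 PL G by apply: int1D; [apply: int1D|]; exact: int1Z.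
have eG : \int[PL]_z G z = 4 * C * q2 PL (ext T D) + (4 * C + (2^-1 ^+ m)^-1) * q2 PL (ext T lag) +
   2^-1 ^+ m * q2 PL (ext T bb).
  rewrite RintegralD//; [|by apply: int1D; exact: int1Z|exact: int1Z].
  by rewrite RintegralD//; [|exact: int1Z..]; rewrite !RintegralZl.
have e0' := ltW e0.
have d0 : 0 <= 4 * C + (2^-1 ^+ m)^-1 by rewrite addr_ge0 ?mulr_ge0 ?invr_ge0// ltW.
have C4 : 0 <= 4 * C by rewrite mulr_ge0// ltW.
have G0 z : 0 <= G z.
  by rewrite /G !addr_ge0// mulr_ge0 ?sqr_ge0// ltW.
have S0 := S2_cst T0 hF (0 : 'cV[R]_n).
apply: (@absorb _ _ [set t | t \in `[0, T]] (fun t => q2 P (D ^~ t)) _ (nR P T D)) => //.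
  by move=> s sT; exact: (q2_nR T0 hF).
move=> c hc s sT.
have c0 : 0 <= c by apply: le_trans (hc s sT); exact: q2_ge0.
have qD : q2 PL (ext T D) <= T * c by exact: (q2_time_le T0 hF).
have LD' := S2_vL2 T0 hF SD sT.
have := @energy_le _ _ _ P T F T0 hF _ bb (fun w t => A w t - A' w t) (fun _ _ => 0) D G s.
move=> /(_ pbb Lbb tbb _ (S2_H2 T0 hF S0).2 _ LD LD'.1 sT iG G0 hp).
have m0 (a : 'I_n) : mart P T F (fun (t : R) (w : Omega) => (0 : 'cV[R]_n) a ord0).
  rewrite (_ : (fun t w => _) = (fun t w => N w t a ord0 - N w t a ord0)); first exact: martB.
  by apply/funext => r; apply/funext => w; rewrite mxE subrr.
move=> /(_ m0); rewrite eG (q2_cst (0 : 'cV[R]_n)) hsnorm0 expr0n addr0.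
move=> h; apply: le_trans (h _) _.
  by apply: aeW => w r rT; rewrite /D eX eX' addr0; apply/matrixP => a k; rewrite !mxE; ring.
have k1 : 4 * C * q2 PL (ext T D) <= c / 2.
  apply: le_trans (ler_wpM2l C4 qD) _.
  by apply: half_of_eighth; rewrite ler_piMl.
have k2 : (4 * C + (2^-1 ^+ m)^-1) * q2 PL (ext T lag) <= (4 * C + 1) * (4 * lag_bound) * 2^-1 ^+ m.
  apply: le_trans (ler_wpM2l d0 qg) _.
  have u : (2^-1 ^+ m)^-1 * 2^-1 ^+ m = 1 :> R by rewrite mulVf// gt_eqF.
  rewrite (_ : _ * (4 * lag_bound * _) = 4 * C * 2^-1 ^+ m * (4 * lag_bound * 2^-1 ^+ m) +
     ((2^-1 ^+ m)^-1 * 2^-1 ^+ m) * (4 * lag_bound * 2^-1 ^+ m)); last by ring.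
  rewrite u mul1r (_ : (4 * C + 1) * _ * _ = 4 * C * 1 * (4 * lag_bound * 2^-1 ^+ m) + 4 * lag_bound * 2^-1 ^+ m); last by ring.
  have E0 := lag_bound_ge0; rewrite lerD2r; apply: ler_wpM2r; first by nonneg.
  by apply: ler_wpM2l => //; exact: half_pow_le1.
have k3 : 2^-1 ^+ m * q2 PL (ext T bb) <= 4 * drift_bound * 2^-1 ^+ m by rewrite mulrC; apply: ler_wpM2r => //; exact: ltW.
apply: (le_trans (lerD (lerD k1 k2) k3)).
by rewrite le_eqVlt; apply/orP; left; apply/eqP; ring.
Qed.

Definition lagged_rate : R := 2 * (T * scheme_rate) + 8 * lag_bound.

Lemma euler_lstep_dist : q2 PL (ext T (fun w t => lstepm T j' X' w t - lstepm T j X w t)) <= lagged_rate * 2^-1 ^+ m.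
Proof.
have [SX _ _ _ _] := e; have [SX' _ _ _ _] := e'; have [Lg qg] := lag_q2.
have SD : S2 P T F D by exact: S2B.
have [_ LD] := S2_H2 T0 hF SD.
have -> : ext T (fun w t => lstepm T j' X' w t - lstepm T j X w t) = fun z => ext T lag z - ext T D z.
  rewrite -extB; congr (ext T); apply/funext => w; apply/funext => t.
  by rewrite /D /lag; apply/matrixP => a c; rewrite !mxE; ring.
apply: le_trans (q2B Lg LD) _.
have T0' := ltW T0; have C0' := ltW C0; have E10 := lag_bound_ge0.
have h0 := drift_bound_ge0; have G10 : 0 <= scheme_rate by rewrite /scheme_rate; nonneg.
have e0 : 0 <= 2^-1 ^+ m :> R by rewrite exprn_ge0.
have qD : q2 PL (ext T D) <= T * (scheme_rate * 2^-1 ^+ m).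
  by apply: (q2_time_le T0 hF) => //; [rewrite mulr_ge0|exact: euler_dist].
have e1 : 2^-1 ^+ m <= 1 :> R by exact: half_pow_le1.
have h : 4 * lag_bound * (2^-1 ^+ m * 2^-1 ^+ m) <= 4 * lag_bound * (1 * 2^-1 ^+ m).
  by apply: ler_wpM2l; [nonneg|exact: ler_wpM2r].
by apply: (le_trans (lerD (ler_wpM2l _ (le_trans qg h)) (ler_wpM2l _ qD))) => //; rewrite /lagged_rate le_eqVlt; apply/orP; left; apply/eqP; ring.
Qed.

End two_schemes.

Lemma sde_limit : exists (xh : process R Omega n 1) (j : nat -> nat) (X b A : nat -> process R Omega n 1) (B : R),
  [/\ forall q, euler (j q) (X q) (X q) (b q) (A q), predictable T F xh, vL2 PL (ext T xh),
    forall q, q2 PL (ext T (fun w t => xh w t - lstepm T (j q) (X q) w t)) <= B * 4^-1 ^+ q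
    & (forall q, (q <= j q)%N) /\
      {ae PL, forall z, forall i, ext T (lstepm T (j q) (X q)) z i ord0 @[q --> \oo] --> ext T xh z i ord0}].
Proof.
(* [2^-(4 q + r)] is [16^-q 2^-r], and [2^r] exceeds [lagged_rate], so the increments are fast.
   Level [j q] is twice [m q] because the rate of the schemes is only the square root of that of the
   squared lag. *)
pose r := (Num.truncn lagged_rate).+1; pose m q := (4 * q + r)%N; pose j q := (m q).*2.
have /choice[XbA hX] : forall q, exists XbA : process R Omega n 1 * process R Omega n 1 * process R Omega n 1,
    euler (j q) XbA.1.1 XbA.1.1 XbA.1.2 XbA.2.
  by move=> q; have [X [b [A e]]] := euler_exists (j q); exists (X, b, A).
pose f q := ext T (lstepm T (j q) (XbA q).1.1).
have Sq q : S2 P T F (XbA q).1.1 by case: (hX q).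
have pf q : predictable T F (lstepm T (j q) (XbA q).1.1).
  by apply: (lstepm_predictable T0 hF); case: (Sq q).
have hf q : (vnn2 PL (fun z => f q.+1 z - f q z)%R <= (16^-1 ^+ q)%:E)%E.
  have LB : vL2 PL (fun z => f q.+1 z - f q z) by exact: (vL2B (lstepm_vL2 (j q.+1) (Sq q.+1)) (lstepm_vL2 (j q) (Sq q))).
  rewrite (q2E LB) lee_fin.
  have mj : ((m q).*2 <= j q)%N by [].
  have mj' : ((m q).*2 <= j q.+1)%N by rewrite leq_double /m leq_add2r leq_mul2l leqnSn orbT.
  have := euler_lstep_dist mj mj' (hX q) (hX q.+1); rewrite extB => h; apply: le_trans h _.
  rewrite /m exprD exprM (_ : 2^-1 ^+ 4 = 16^-1 :> R); last by rewrite exprVn; congr (_^-1); ring.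
  rewrite mulrCA ler_piMr ?exprn_ge0 ?invr_ge0//.
  rewrite exprVn ler_pdivrMr ?exprn_gt0// mul1r.
  have h1 : lagged_rate <= r%:R by apply: ltW; exact: truncnS_gt.
  by apply: le_trans h1 _; rewrite -natrX ler_nat ltnW// ltn_expl.
have hf' q : (vnn2 PL (ext T (fun w t => lstepm T (j q.+1) (XbA q.+1).1.1 w t - lstepm T (j q) (XbA q).1.1 w t)%R)
   <= (16^-1 ^+ q)%:E)%E by rewrite extB; exact: hf.
have [xh [B [px Lx B0 hB hae]]] := fast_process T0 hF pf (lstepm_vL2 _ (Sq 0%N)) hf'.
exists xh, j, (fun q => (XbA q).1.1), (fun q => (XbA q).1.2), (fun q => (XbA q).2), B.
split; [exact: hX|exact: px|exact: Lx|exact: hB|split].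
  move=> q; rewrite /j /m -addnn; apply: leq_trans (leq_addr _ _); apply: leq_trans (leq_addr _ _).
  by rewrite leq_pmull.
by apply: filterS hae => z h i; exact: h.
Qed.

(* The drifts converge in mean square although they are not dominated: by the
   growth condition |b_q - b| - C |x_q - x| is, and x_q - x tends to 0 in mean
   square. *)
Lemma drift_cvg (xh bh : process R Omega n 1) (x b : nat -> process R Omega n 1) (B : R) :
  vL2 PL (ext T xh) -> predictable_version P T F (fun w t => beta w t (xh w t)) bh ->
  (forall q, vL2 PL (ext T (x q))) ->
  (forall q, predictable_version P T F (fun w t => beta w t (x q w t)) (b q)) ->
  (forall q, q2 PL (ext T (fun w t => xh w t - x q w t)) <= B * 4^-1 ^+ q) ->
  {ae PL, forall z, forall i, ext T (x q) z i ord0 @[q --> \oo] --> ext T xh z i ord0} ->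
  q2 PL (ext T (fun w t => b q w t - bh w t)) @[q --> \oo] --> 0.
Proof.
move=> Lxh vbh Lx vb hB hx.
have [Lbh _] := version_bound Lxh vbh; have Lb q := (version_bound (Lx q) (vb q)).1.
have Ld q : vL2 PL (ext T (fun w t => b q w t - bh w t)) by rewrite extB; exact: vL2B.
have Ll q : vL2 PL (ext T (fun w t => xh w t - x q w t)) by rewrite extB; exact: vL2B.
pose dl q z : R := hsnorm (ext T (fun w t => b q w t - bh w t) z).
pose la q z : R := hsnorm (ext T (fun w t => xh w t - x q w t) z).
pose g z : R := 2 * C * hsnorm (ext T xh z) + 2 * hb z.
pose rho q z : R := Num.min `|g z| (Num.max 0 (dl q z - C * la q z)).
have mdl q : measurable_fun setT (dl q) by apply: mmeas_hsnorm; exact: (Ld q).1.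
have mla q : measurable_fun setT (la q) by apply: mmeas_hsnorm; exact: (Ll q).1.
have Lg : L2 PL g.
  apply: L2D; apply: L2Z => //.
  by split; [apply: mmeas_hsnorm; exact: Lxh.1|exact: Lxh.2].
have mrho q : measurable_fun setT (rho q).
  apply: measurable_minr; first by apply: measurableT_comp => //; exact: Lg.1.
  apply: measurable_maxr; first exact: measurable_cst.
  by apply: measurable_funB => //; exact: measurable_funM.
have rho0 q z : 0 <= rho q z by rewrite /rho le_min normr_ge0 le_max lexx.
have rhog q z : rho q z <= `|g z| by rewrite /rho ge_min lexx.
have rhod q z : rho q z <= dl q z.
  by rewrite /rho ge_min ge_max hsnorm_ge0 gerBl mulr_ge0 ?hsnorm_ge0 ?orbT// ltW.
have hdl : {ae PL, forall z, dl q z @[q --> \oo] --> 0}.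
  have hv : {ae PL, forall z, forall q, z.2 \in `[0, T] -> b q z.1 z.2 = beta z.1 z.2 (x q z.1 z.2)}.
    by apply/ae_foralln => q; have [_] := vb q; rewrite ae_dPdtE.
  have [_] := vbh; rewrite ae_dPdtE => hvh; have := beta_continuous; rewrite ae_dPdtE => hc.
  apply: filterS2 (ae_and hx hv) (ae_and hvh hc) => -[w t]/= [hx' hb'] [hbh' hc'].
  have [tT|tT] := boolP (t \in `[0, T]); last first.
    rewrite (_ : (fun q => _) = cst 0); first exact: cvg_cst.
    by apply/funext => q; rewrite /dl /ext/= (negbTE tT) hsnorm0.
  have e q : dl q (w, t) = hsnorm (beta w t (x q w t) - beta w t (xh w t)).
    by rewrite /dl /ext/= tT hb'// hbh'.
  have hxs : hsnorm (x q w t - xh w t) @[q --> \oo] --> 0.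
    by apply: hsnorm_cvg0 => i c; rewrite (ord1 c); have := hx' i; rewrite /ext/= tT.
  apply/cvgrPdist_le => r r0; have [s s0 hs] := hc' tT (xh w t) r r0.
  move/cvgrPdist_le: hxs => /(_ s s0); apply: filterS => q; rewrite !sub0r !normrN e.
  by rewrite !ger0_norm ?hsnorm_ge0//; exact: hs.
have hrho : {ae PL, forall z, rho q z ^+ 2 @[q --> \oo] --> 0}.
  apply: filterS hdl => z hz.
  have h0 : rho q z @[q --> \oo] --> 0.
    apply: (squeeze_cvgr _ (cvg_cst 0) hz); apply: nearW => q; by rewrite rho0 rhod.
  rewrite -[X in _ --> X](mulr0 0) (_ : (fun q => _) = (fun q => rho q z * rho q z)); first exact: cvgM.
  by apply/funext => q; rewrite expr2.
have hI : (\int[PL]_z (rho q z ^+ 2)%:E)%E @[q --> \oo] --> 0%E.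
  have := @dominated_convergence _ _ _ PL setT measurableT (fun q z => (rho q z ^+ 2)%:E) (cst 0%E) (fun z => (g z ^+ 2)%:E).
  move=> [|||||_ _].
  - by move=> q; apply/measurable_EFinP; exact: measurable_funX.
  - exact: measurable_cst.
  - by apply: filterS hrho => z hz _; apply: cvg_EFin => //; exact: nearW.
  - exact: (int1_sq Lg).
  - apply: aeW => z q _; rewrite gee0_abs ?lee_fin ?sqr_ge0//.
    by rewrite -[g z ^+ 2]real_normK ?num_real// ler_sqr ?nnegrE.
  by rewrite integral0.
have Lrho q : L2 PL (rho q).
  apply: (L2_le (mrho q) Lg) => z.
  by rewrite -[g z ^+ 2]real_normK ?num_real// ler_sqr ?nnegrE.
have hd q : q2 PL (ext T (fun w t => b q w t - bh w t)) <=
    2 * fine (\int[PL]_z (rho q z ^+ 2)%:E)%E + 2 * C ^+ 2 * B * 4^-1 ^+ q.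
  have i1 := int1Z 2 (int1_sq (Lrho q)); have i2 := int1Z (2 * C ^+ 2) (vL2_int1 (Ll q)).
  have h : {ae PL, forall z, hsnorm (ext T (fun w t => b q w t - bh w t) z) ^+ 2 <=
      2 * rho q z ^+ 2 + 2 * C ^+ 2 * hsnorm (ext T (fun w t => xh w t - x q w t) z) ^+ 2}.
    have [_] := vb q; have [_] := vbh; rewrite !ae_dPdtE => hvh hv.
    have := beta_growth; rewrite ae_dPdtE => hg.
    apply: filterS2 (ae_and hvh hv) hg => -[w t]/= [e1 e2] hg'.
    rewrite -/(dl q (w, t)) -/(la q (w, t)).
    have h1 : dl q (w, t) - C * la q (w, t) <= `|g (w, t)|.
      rewrite /dl /la /g /ext/=; case: ifPn => tT; last first.
        by rewrite hsnorm0 mulr0 subr0.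
      apply: le_trans (ler_norm _); rewrite e1// e2//.
      have h1 := hsnormB (beta w t (x q w t)) (beta w t (xh w t)).
      have h2 := hsnormB (xh w t) (xh w t - x q w t); rewrite opprB addrC subrK in h2.
      have h3 := hg' tT (x q w t); have h4 := hg' tT (xh w t).
      have h5 : C * hsnorm (x q w t) <= C * (hsnorm (xh w t) + hsnorm (xh w t - x q w t)).
        by apply: ler_wpM2l => //; exact: ltW.
      exact: growth_le h1 h3 h4 h5.
    have h2 : dl q (w, t) <= rho q (w, t) + C * la q (w, t).
      rewrite -lerBlDr /rho le_min h1 le_max lexx orbT//.
    apply: sqr_le_split => //; exact: hsnorm_ge0.
  have [_ h1] := q2_ae_le (Ld q).1 (int1D i1 i2) h; apply: le_trans h1 _.
  rewrite RintegralD// !RintegralZl//; [|exact: vL2_int1|exact: int1_sq].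
  apply: lerD; first exact: lexx.
  rewrite -(mulrA _ B); apply: ler_wpM2l; last exact: hB.
  by apply: mulr_ge0 => //; exact: sqr_ge0.
have hI' : fine (\int[PL]_z (rho q z ^+ 2)%:E)%E @[q --> \oo] --> 0.
  exact: (fine_cvg hI).
have hs : 2 * fine (\int[PL]_z (rho q z ^+ 2)%:E)%E + 2 * C ^+ 2 * B * 4^-1 ^+ q @[q --> \oo] --> 0.
  rewrite -[X in _ --> X]addr0; apply: cvgD.
    by rewrite -[X in _ --> X](mulr0 2); apply: cvgMr.
  by apply: cvg_geom; rewrite ?invr_ge0// invf_lt1// ltr1n.
by apply: (squeeze_cvgr _ (cvg_cst 0) hs); apply: nearW => q; rewrite q2_ge0 hd.
Qed.

(** The solution is rebuilt from the limit drift, which gives continuous paths. It agrees with [xh]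
    almost everywhere, because the Euler schemes approach it through their drift integrals and
    approach [xh] through their lagged values; the limit drift is then a version of the drift along
    the solution. *)
Lemma sde_exists : exists X b A, [/\ S2 P T F X,
  predictable_version P T F (fun w t => beta w t (X w t)) b, S2 P T F A, time_integral P T b A
  & vL2 PL (ext T b) /\ forall w t, X w t = x0 + A w t + N w t].
Proof.
have [xh [j [Xq [b [A [B [hX px Lx hB [jq hx]]]]]]]] := sde_limit.
have [bh vbh] := beta_version px; have [Lbh _] := version_bound Lx vbh.
have [Ah [SAh A0 tAh]] := time_integral_exists T0 hF vbh.1 Lbh.
pose X w t := x0 + Ah w t + N w t.
have SX : S2 P T F X := S2D T0 hF (S2D T0 hF (S2_cst T0 hF x0) SAh) SN.
have Sq q : S2 P T F (Xq q) by case: (hX q).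
have vb q : predictable_version P T F (fun w t => beta w t (lstepm T (j q) (Xq q) w t)) (b q) by case: (hX q).
have hbb := drift_cvg Lx vbh (fun q => lstepm_vL2 (j q) (Sq q)) vb hB hx.
have hXx q : q2 PL (ext T (fun w t => X w t - xh w t)) <=
    2 * (T * (T * q2 PL (ext T (fun w t => b q w t - bh w t)))) + 4 * lag_bound * 2^-1 ^+ q + 4 * B * 4^-1 ^+ q.
  have [_ _ [SA _] tA eX] := hX q; have [Lb _] := euler_b (hX q).
  have SD : S2 P T F (fun w t => Xq q w t - X w t) := S2B T0 hF (Sq q) SX.
  have k1 : q2 PL (ext T (fun w t => Xq q w t - X w t)) <= T * (T * q2 PL (ext T (fun w t => b q w t - bh w t))).
    apply: le_trans (q2_ext_nR T0 hF SD) _; apply: ler_wpM2l; first exact: ltW.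
    have -> : (fun w t => Xq q w t - X w t) = (fun w t => A q w t - Ah w t).
      apply/funext => w; apply/funext => t; rewrite eX /X.
      by apply/matrixP => a c; rewrite !mxE; ring.
    exact: (time_integral_nR T0 hF Lb Lbh SA SAh tA tAh).
  have k2 := euler_lag (hX q); have k3 := hB q.
  have L1 := S2_lstepm_vL2 (j q) (Sq q).
  have L2 : vL2 PL (ext T (fun w t => xh w t - lstepm T (j q) (Xq q) w t)).
    by rewrite extB; exact: (vL2B Lx (lstepm_vL2 (j q) (Sq q))).
  have L3 := (S2_H2 T0 hF SD).2.
  have -> : ext T (fun w t => X w t - xh w t) = fun z => (ext T (fun w t => Xq q w t - lstepm T (j q) (Xq q) w t) z
      - ext T (fun w t => xh w t - lstepm T (j q) (Xq q) w t) z) - ext T (fun w t => Xq q w t - X w t) z.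
    apply/funext => -[w t]; rewrite /ext/=; case: ifP => _; last by rewrite !subr0.
    by apply/matrixP => a c; rewrite !mxE; ring.
  have L4 := vL2B L1 L2.
  apply: le_trans (q2B L4 L3) _; have := q2B L1 L2.
  have k2' : lag_bound / 2 ^+ j q <= lag_bound * 2^-1 ^+ q.
    apply: ler_wpM2l; first exact: lag_bound_ge0.
    by rewrite -exprVn; apply: ler_wiXn2l; rewrite ?invr_ge0 ?invf_le1 ?ler1n.
  have k4 := le_trans k2 k2'.
  move=> k5; have k6 := three_terms k1 k4 k3 k5; by apply: (le_trans k6); rewrite -!mulrA lexx.
have hs : 2 * (T * (T * q2 PL (ext T (fun w t => b q w t - bh w t)))) + 4 * lag_bound * 2^-1 ^+ q + 4 * B * 4^-1 ^+ q
    @[q --> \oo] --> 0.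
  rewrite -[X in _ --> X]addr0; apply: cvgD; last first.
    by apply: cvg_geom; rewrite ?invr_ge0// invf_lt1// ltr1n.
  rewrite -[X in _ --> X]addr0; apply: cvgD; last first.
    by apply: cvg_geom; rewrite ?invr_ge0// invf_lt1// ltr1n.
  rewrite -[X in _ --> X](mulr0 2); apply: cvgMr.
  rewrite -[X in _ --> X](mulr0 T); apply: cvgMr.
  by rewrite -[X in _ --> X](mulr0 T); apply: cvgMr.
have LXx : vL2 PL (ext T (fun w t => X w t - xh w t)) by rewrite extB; exact: (vL2B (S2_H2 T0 hF SX).2 Lx).
have := q2_eq0 LXx (le_cvg0 hXx hs); rewrite extB => eXx.
exists X, bh, Ah; split => //; split; first exact: vbh.1.
have := vbh.2; rewrite !ae_dPdtE => h2; apply: filterS2 eXx h2 => -[w t]/= h1 h2 tT.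
rewrite h2//; congr beta; apply/eqP; rewrite eq_sym -subr_eq0; apply/eqP.
by move: h1; rewrite /ext/= tT.
Qed.

End additive_sde.

(** * The contraction *)

Section matrices.
Context {R : realType}.

Lemma hsnorm_le_entries k l (A : 'M[R]_(k, l)) (e : R) : 0 <= e ->
  (forall i j, `|A i j| <= e / (k * l).+1%:R) -> hsnorm A <= e.
Proof.
move=> e0 h; rewrite -ler_sqr ?nnegrE ?hsnorm_ge0// hsnorm_sqr.
apply: (@le_trans _ _ (\sum_(i < k) \sum_(j < l) (e / (k * l).+1%:R) ^+ 2)).
  apply: ler_sum => i _; apply: ler_sum => j _.
  rewrite -[A i j ^+ 2]real_normK ?num_real// ler_sqr ?nnegrE ?divr_ge0 ?ler0n//; exact: h.
rewrite (eq_bigr (fun=> (e / (k * l).+1%:R) ^+ 2 *+ l)); last by move=> i _; rewrite sumr_const card_ord.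
rewrite sumr_const card_ord -mulrnA -[leLHS]mulr_natr.
rewrite (_ : _ * _ = e ^+ 2 * ((k * l)%:R / (k * l).+1%:R ^+ 2)); last first.
  by rewrite expr_div_n mulrAC -mulrA (mulnC l k).
apply: ler_piMr; first exact: sqr_ge0.
rewrite ler_pdivrMr ?exprn_gt0// mul1r -natrX ler_nat.
by rewrite (leq_trans (leqnSn _))// -[X in (X <= _)%N]muln1 expnS leq_mul// expn1.
Qed.

(** The topology of matrices is entrywise. The tolerance is divided by [k l + 1] to pass to the
    Hilbert-Schmidt norm, the added 1 keeping the divisor positive for empty matrices. *)
Lemma hsnorm_continuous n k l (G : 'cV[R]_n -> 'M[R]_(k, l)) : continuous G ->
  forall u e, 0 < e -> exists2 r, 0 < r & forall u', hsnorm (u' - u) <= r -> hsnorm (G u' - G u) <= e.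
Proof.
move=> cG u e e0; have d0 : 0 < e / (k * l).+1%:R by rewrite divr_gt0.
have /cvg_ballP/(_ _ d0)/nbhs_ballP[r /= r0 hr] := cG u.
exists (r / 2); first by rewrite divr_gt0.
move=> u' hu; have [_ hG] : ball (G u) (e / (k * l).+1%:R) (G u').
  apply: hr; split => // i j; rewrite /ball/= distrC.
  have := entry_le (u' - u) i j; rewrite !mxE => h.
  by apply: le_lt_trans (le_trans h hu) _; rewrite ltr_pdivrMr// ltr_pMr// ltr1n.
apply: hsnorm_le_entries; first exact: ltW.
by move=> i j; have := hG i j; rewrite /ball/= distrC !mxE => /ltW.
Qed.

Lemma hsnorm_col_mx m n (u : 'cV[R]_(m + n)) :
  hsnorm u ^+ 2 = hsnorm (usubmx u) ^+ 2 + hsnorm (dsubmx u) ^+ 2.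
Proof.
rewrite !hsnorm_sqr big_split_ord/=; congr (_ + _).
  by apply: eq_bigr => i _; apply: eq_bigr => j _; rewrite mxE.
by apply: eq_bigr => i _; apply: eq_bigr => j _; rewrite mxE.
Qed.

Lemma hsnorm_usubmx m n (u u' : 'cV[R]_(m + n)) :
  hsnorm (usubmx u' - usubmx u) <= hsnorm (u' - u).
Proof.
rewrite -ler_sqr ?nnegrE ?hsnorm_ge0// [leRHS]hsnorm_col_mx.
have -> : usubmx (u' - u) = usubmx u' - usubmx u by apply/matrixP => i j; rewrite !mxE.
by rewrite lerDl sqr_ge0.
Qed.

Lemma hsnorm_dsubmx m n (u u' : 'cV[R]_(m + n)) :
  hsnorm (dsubmx u' - dsubmx u) <= hsnorm (u' - u).
Proof.
rewrite -ler_sqr ?nnegrE ?hsnorm_ge0// [leRHS]hsnorm_col_mx.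
have -> : dsubmx (u' - u) = dsubmx u' - dsubmx u by apply/matrixP => i j; rewrite !mxE.
by rewrite lerDr sqr_ge0.
Qed.

End matrices.

Section versions.
Context {R : realType} {dsp} {Omega : measurableType dsp}
  (P : probability Omega R) (T : R) (F : R -> set (set Omega)).
Hypothesis T0 : 0 < T.
Hypothesis hF : usual_filtration P T F.

Lemma predictable_col_mx m n (U : process R Omega m 1) (V : process R Omega n 1) :
  predictable T F U -> predictable T F V -> predictable T F (fun w t => col_mx (U w t) (V w t)).
Proof.
move=> pU pV i j B mB; case: (split_ordP i) => i' ->.
  have := pU i' j B mB; congr predictable_sets.
  by congr (_ `&` _); apply/seteqP; split => z /=; rewrite col_mxEu.
have := pV i' j B mB; congr predictable_sets.
by congr (_ `&` _); apply/seteqP; split => z /=; rewrite col_mxEd.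
Qed.

(** The three arguments are stacked into one column, to which [nemytskii] applies; the norm of each
    block is at most that of the column. *)
Lemma version3 n d p k l (G : Omega -> R -> 'cV[R]_n -> 'cV[R]_d -> 'cV[R]_p -> 'M[R]_(k, l)) X Y Z :
  predictable T F X -> predictable T F Y -> predictable T F Z ->
  (forall x y z, predictable T F (fun w t => G w t x y z)) ->
  ae_dPdt P T (fun w t => forall x y z e, 0 < e -> exists2 r, 0 < r & forall x' y' z',
    hsnorm (x' - x) <= r -> hsnorm (y' - y) <= r -> hsnorm (z' - z) <= r ->
    hsnorm (G w t x' y' z' - G w t x y z) <= e) ->
  exists H, predictable_version P T F (fun w t => G w t (X w t) (Y w t) (Z w t)) H.
Proof.
move=> pX pY pZ pG cG.
pose G' w t (u : 'cV[R]_(n + (d + p))) := G w t (usubmx u) (usubmx (dsubmx u)) (dsubmx (dsubmx u)).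
have [|||H [pH hH]] := @nemytskii _ _ _ P T F T0 hF _ _ _ G' (fun w t => col_mx (X w t) (col_mx (Y w t) (Z w t))).
- by apply: predictable_col_mx => //; exact: predictable_col_mx.
- by move=> u; exact: pG.
- move: cG; rewrite !ae_dPdtE; apply: filterS => z h zT u e e0.
  have [r r0 hr] := h zT (usubmx u) (usubmx (dsubmx u)) (dsubmx (dsubmx u)) e e0.
  exists r => // u' hu; apply: hr.
  + exact: le_trans (hsnorm_usubmx _ _) hu.
  + exact: le_trans (hsnorm_usubmx _ _) (le_trans (hsnorm_dsubmx _ _) hu).
  + exact: le_trans (hsnorm_dsubmx _ _) (le_trans (hsnorm_dsubmx _ _) hu).
exists H; split => //; move: hH; rewrite !ae_dPdtE; apply: filterS => z h zT.
by rewrite (h zT) /G' !(col_mxKu, col_mxKd).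
Qed.

(** Rounding again, now at a fixed time, for the terminal function: the Lipschitz bound makes the
    error of rounding explicit, and the limit is identified off a null set contained in [F t]. *)
Lemma gmeas_nemytskii n k l (G : Omega -> 'cV[R]_n -> 'M[R]_(k, l)) (Z : Omega -> 'cV[R]_n) (C : R) t :
  0 <= C -> t \in `[0, T] -> (forall i, gmeas (F t) (fun w => Z w i ord0)) ->
  (forall u, rv_measurable (F t) (fun w => G w u)) ->
  {ae P, forall w, forall u u', hsnorm (G w u - G w u') <= C * hsnorm (u - u')} ->
  forall i j, gmeas (F t) (fun w => G w (Z w) i j).
Proof.
move=> C0 tT mZ mG hG i j.
pose f q w := G w (dyadic_point q (dyadic_round q (Z w))) i j.
have Gf q : gmeas (F t) (f q).
  apply: (@measurable_dyadic_round _ _ (g_sigma_algebraType (F t)) q n Z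
    (fun v w => G w (dyadic_point q v) i j)) => // v.
  by apply/(gmeasP _ (filt_sigma hF tT)) => B mB; exact: mG.
apply: (gmeas_ae hF tT (gmeas_limsup Gf)); apply: filterS hG => w hw.
have h : f q w @[q --> \oo] --> G w (Z w) i j.
  apply/cvgrPdist_le => e e0.
  have : C * n%:R * 2^-1 ^+ q @[q --> \oo] --> (0 : R).
    by apply: cvg_geom; rewrite ?invr_ge0// invf_lt1// ltr1n.
  move=> /cvgrPdist_le/(_ e e0); apply: filterS => q; rewrite sub0r normrN => hq.
  apply: le_trans hq; apply: le_trans (ler_norm _).
  have := entry_le (G w (Z w) - G w (dyadic_point q (dyadic_round q (Z w)))) i j.
  rewrite !mxE => h; apply: le_trans h _; apply: le_trans (hw _ _) _; rewrite -mulrA.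
  apply: ler_wpM2l => //; rewrite -hsnormN opprB; exact: dyadic_round_le.
have hE : (f q w)%:E @[q --> \oo] --> (G w (Z w) i j)%:E.
  by apply/fine_cvgP; split; [exact: nearW|exact: h].
by have [_ ->] := cvg_limn_einf_sup hE.
Qed.

(** Equality at each time is first collected over all grid points off one null set, then extended to
    all times by the dyadic description of the supremum. It is meant for [X], which the energy
    identity compares time by time and not in supremum. *)
Lemma S2_indist_times k l (U V : process R Omega k l) : S2 P T F U -> S2 P T F V ->
  (forall t, t \in `[0, T] -> q2 P (fun w => U w t - V w t) <= 0) -> indistinguishable P T U V.
Proof.
move=> SU SV h; have SD := S2B T0 hF SU SV.
apply: (S2_indist T0 hF SU SV).
have hg : {ae P, forall w, forall j i, U w (grid T j i) - V w (grid T j i) = 0}.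
  apply/ae_foralln => j; apply/ae_foralln => i; have gT := grid_itv T0 j i.
  exact: q2_eq0 (S2_vL2 T0 hF SD gT) (h _ gT).
rewrite /nR (_ : nS P T _ = 0%E)//.
rewrite /nS -[RHS](integral0 P setT); apply: ae_eq_integral => //.
  by apply: (measurable_esup T0); exact: (S2_rcproc hF).
apply: filterS hg => w hw _; rewrite (esup_limn T0); last exact: (S2_rcproc hF).
rewrite (_ : (fun j => _) = cst 0%E); first by rewrite lim_cst.
apply/funext => j; congr EFin; rewrite /gsup.
by elim: (2 ^ j)%N => [|i IH] /=; rewrite ?IH hw hsnorm0 expr0n normr0 ?maxxx.
Qed.

End versions.

Lemma three_le {R : realFieldType} (a b c r : R) : a <= r -> b <= r -> c <= r -> c + b + a <= 3 * r.
Proof. by move=> ? ? ?; lra. Qed.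

(** The condition on [sigma] bounds squares; [C <= (C + 1)^2] converts it into a linear bound of the
    same form as the one for [f]. *)
Lemma lipschitz_sqr {R : realFieldType} (C a b c : R) : 0 <= C -> 0 <= a -> 0 <= b -> 0 <= c ->
  C * (a ^+ 2 + b ^+ 2 + c ^+ 2) <= ((C + 1) * (a + b + c)) ^+ 2.
Proof.
move=> C0 a0 b0 c0; rewrite exprMn; apply: ler_pM => //.
- by rewrite !addr_ge0 ?sqr_ge0.
- by have := sqr_ge0 C; rewrite sqrrD expr1n mulr1; lra.
have := mulr_ge0 a0 b0; have := mulr_ge0 a0 c0; have := mulr_ge0 b0 c0; lra.
Qed.

Lemma lipschitz_sqr3 {R : realFieldType} (C u a b c : R) : 0 <= u -> 0 <= a -> 0 <= b -> 0 <= c ->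
  u <= C * (a + b + c) -> u ^+ 2 <= 3 * C ^+ 2 * a ^+ 2 + 3 * C ^+ 2 * b ^+ 2 + 3 * C ^+ 2 * c ^+ 2.
Proof.
move=> u0 a0 b0 c0 h; apply: (@le_trans _ _ ((C * (a + b + c)) ^+ 2)).
  by rewrite ler_sqr// nnegrE// (le_trans u0).
have h1 : 0 <= C ^+ 2 * ((a - b) ^+ 2 + (b - c) ^+ 2 + (a - c) ^+ 2).
  by rewrite mulr_ge0 ?sqr_ge0// !addr_ge0// sqr_ge0.
by rewrite exprMn; lra.
Qed.

Lemma half_of_double {R : realFieldType} (p q r : R) : 2 * p * q * r <= r -> p * (q * r) <= r / 2.
Proof. by move=> ?; lra. Qed.

Lemma three_sixteenths {R : realFieldType} (a b c r : R) : a <= r / 16 -> b <= r / 16 ->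
  c <= r / 16 -> r = a + b + c -> r <= 0.
Proof. by move=> ? ? ? ?; lra. Qed.

Lemma limit_unique {R : realType} {dS : measure_display} {S : measurableType dS}
    (nu : {measure set S -> \bar R}) k l (A B : S -> 'M[R]_(k, l)) (f : nat -> S -> 'M[R]_(k, l)) (a b : R) :
  vL2 nu A -> vL2 nu B -> (forall q, vL2 nu (f q)) ->
  (forall q, q2 nu (fun s => A s - f q s) <= a * 4^-1 ^+ q) ->
  (forall q, q2 nu (fun s => B s - f q s) <= b * 4^-1 ^+ q) -> {ae nu, forall s, A s = B s}.
Proof.
move=> LA LB Lf hA hB; have LAB := vL2B LA LB.
have h q : q2 nu (fun s => A s - B s) <= (2 * a + 2 * b) * 4^-1 ^+ q.
  have -> : (fun s => A s - B s) = (fun s => (A s - f q s) - (B s - f q s)).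
    by apply/funext => s; apply/matrixP => i j; rewrite !mxE; ring.
  apply: le_trans (q2B (vL2B LA (Lf q)) (vL2B LB (Lf q))) _.
  rewrite (_ : _ * 4^-1 ^+ q = 2 * (a * 4^-1 ^+ q) + 2 * (b * 4^-1 ^+ q)); last by ring.
  by apply: lerD; exact: ler_wpM2l.
have hs : (2 * a + 2 * b) * 4^-1 ^+ q @[q --> \oo] --> 0.
  by apply: cvg_geom; rewrite ?invr_ge0// invf_lt1// ltr1n.
by have := q2_eq0 LAB (le_cvg0 h hs); apply: filterS => s /eqP; rewrite subr_eq0 => /eqP ->.
Qed.

Lemma small_terms {R : realFieldType} (t a b c d e f : R) : 0 <= t -> 0 <= a -> 0 <= b -> 0 <= c ->
  0 <= d -> 0 <= e -> 0 <= f -> (a + b + c + d + e + f) * t < 1 ->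
  [/\ a * t <= 1, b * t <= 1, c * t <= 1 & [/\ d * t <= 1, e * t <= 1 & f * t <= 1]].
Proof.
move=> t0 a0 b0 c0 d0 e0 f0; rewrite !mulrDl.
have := mulr_ge0 a0 t0; have := mulr_ge0 b0 t0; have := mulr_ge0 c0 t0.
have := mulr_ge0 d0 t0; have := mulr_ge0 e0 t0; have := mulr_ge0 f0 t0.
move: (a * t) (b * t) (c * t) (d * t) (e * t) (f * t) => *.
by split; last split; lra.
Qed.

Lemma budget1 {R : realFieldType} (s p : R) : 0 <= p -> 2 * s + 4 * p <= 32^-1 -> 2 * s <= 16^-1.
Proof. by move=> ? ?; lra. Qed.

Lemma budget2 {R : realFieldType} (s p r : R) : 0 <= s -> 2 * s + 4 * p <= 32^-1 -> r <= 64^-1 ->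
  4 * p + 2 * r <= 16^-1.
Proof. by move=> ? ? ?; lra. Qed.

Section fds.
Context {R : realType} {dsp} {Omega : measurableType dsp}
  (P : probability Omega R) (T : R) (F : R -> set (set Omega)).
Hypothesis T0 : 0 < T.
Hypothesis hF : usual_filtration P T F.
Local Notation PL := (dPdt P).
Context {n d m p1 p2 p3 : nat}.
Variable W : process R Omega m 1.
Hypothesis hW : brownian_motion P T F W.
Variables (x0 : 'cV[R]_n) (C K : R).
Hypothesis C0 : 0 < C.
Hypothesis K0 : 0 < K.
Variables (mu : Omega -> R -> 'cV[R]_n -> 'cV[R]_d -> 'cV[R]_p1 -> 'cV[R]_n)
  (sigma : Omega -> R -> 'cV[R]_n -> 'cV[R]_d -> 'cV[R]_p2 -> 'M[R]_(n, m))
  (f : Omega -> R -> 'cV[R]_n -> 'cV[R]_d -> 'cV[R]_p3 -> 'cV[R]_d)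
  (phi : Omega -> 'cV[R]_n -> 'cV[R]_d).
Hypothesis hcoef : coefficients_condition P T F C mu sigma f phi.
Variables (La : process R Omega d 1 -> process R Omega p1 1)
  (Lb : process R Omega d 1 -> process R Omega p2 1)
  (Lc : process R Omega d 1 -> process R Omega p3 1) (oa oc : O2_kind).
Hypothesis hLa : operator_condition P T F K oa La.
Hypothesis hLb : operator_condition P T F K O2_is_S2 Lb.
Hypothesis hLc : operator_condition P T F K oc Lc.

Lemma mu_jointly_continuous : ae_dPdt P T (fun w t => forall x y z e, 0 < e -> exists2 r, 0 < r &
  forall x' y' z', hsnorm (x' - x) <= r -> hsnorm (y' - y) <= r -> hsnorm (z' - z) <= r ->
  hsnorm (mu w t x' y' z' - mu w t x y z) <= e).
Proof.
have := mu_lipschitz hcoef; have := mu_continuous hcoef; rewrite !ae_dPdtE => hc hl.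
apply: filterS2 hc hl => -[w t]/= hc hl tT x y z e e0; have C0' := ltW C0.
have [r r0 hr] := hsnorm_continuous (hc tT y z) x (divr_gt0 e0 (ltr0Sn _ 1)).
have s0 : 0 < e / (4 * C) by rewrite divr_gt0// mulr_gt0.
exists (Num.min r (e / (4 * C))); first by rewrite lt_min r0.
move=> x' y' z'; rewrite !le_min => /andP[h1 _] /andP[_ h2] /andP[_ h3].
have -> : mu w t x' y' z' - mu w t x y z =
    (mu w t x' y' z' - mu w t x' y z) + (mu w t x' y z - mu w t x y z) by rewrite addrA subrK.
have h4 := hr x' h1; have h5 := hl tT x' y' y z' z.
apply: le_trans (hsnormD _ _) _; apply: le_trans (lerD h5 h4) _.
have : C * (hsnorm (y' - y) + hsnorm (z' - z)) <= C * (e / (4 * C) + e / (4 * C)).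
  by apply: ler_wpM2l => //; exact: lerD.
have -> : C * (e / (4 * C) + e / (4 * C)) = e / 2 by field; rewrite gt_eqF.
by lra.
Qed.

Lemma f_jointly_continuous : ae_dPdt P T (fun w t => forall x y z e, 0 < e -> exists2 r, 0 < r &
  forall x' y' z', hsnorm (x' - x) <= r -> hsnorm (y' - y) <= r -> hsnorm (z' - z) <= r ->
  hsnorm (f w t x' y' z' - f w t x y z) <= e).
Proof.
have := f_lipschitz hcoef; rewrite !ae_dPdtE; apply: filterS => -[w t]/= hl tT x y z e e0.
have s0 : 0 < e / (3 * C) by rewrite divr_gt0// mulr_gt0.
exists (e / (3 * C)) => // x' y' z' h1 h2 h3; apply: le_trans (hl tT _ _ _ _ _ _) _.
have -> : e = C * (e / (3 * C) + e / (3 * C) + e / (3 * C)) by field; rewrite gt_eqF.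
by apply: ler_wpM2l; [exact: ltW|rewrite !lerD].
Qed.

Lemma sigma_jointly_continuous : ae_dPdt P T (fun w t => forall x y z e, 0 < e -> exists2 r, 0 < r &
  forall x' y' z', hsnorm (x' - x) <= r -> hsnorm (y' - y) <= r -> hsnorm (z' - z) <= r ->
  hsnorm (sigma w t x' y' z' - sigma w t x y z) <= e).
Proof.
have := sigma_lipschitz hcoef; rewrite !ae_dPdtE; apply: filterS => -[w t]/= hl tT x y z e e0.
have C3 : 0 < 3 * C + 1 by rewrite addr_gt0// mulr_gt0.
have s0 : 0 < e / (3 * C + 1) by rewrite divr_gt0.
exists (e / (3 * C + 1)) => // x' y' z' h1 h2 h3.
rewrite -ler_sqr ?nnegrE ?hsnorm_ge0 ?(ltW e0)//; apply: le_trans (hl tT _ _ _ _ _ _) _.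
have sq (u : R) : 0 <= u -> u <= e / (3 * C + 1) -> u ^+ 2 <= (e / (3 * C + 1)) ^+ 2.
  by move=> u0 ue; rewrite ler_sqr// nnegrE// ltW.
apply: (@le_trans _ _ (3 * C * (e / (3 * C + 1)) ^+ 2)).
  rewrite (_ : 3 * C * _ = C * (3 * (e / (3 * C + 1)) ^+ 2)); last by ring.
  apply: ler_wpM2l; first exact: ltW.
  have := sq _ (hsnorm_ge0 _) h1; have := sq _ (hsnorm_ge0 _) h2; have := sq _ (hsnorm_ge0 _) h3.
  exact: three_le.
rewrite expr_div_n mulrA ler_pdivrMr ?exprn_gt0// mulrC; apply: ler_wpM2l; first exact: sqr_ge0.
by have := sqr_ge0 (3 * C); have := ltW C0; rewrite sqrrD expr1n mulr1; lra.
Qed.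

Definition version_of {k l} (G H : process R Omega k l) := predictable_version P T F G H.

(** The constant 1 of the growth condition is written as the extension of a constant process, so
    that the bound vanishes off [0, T] and is square integrable over dP dt. *)
Definition mu_bound (y : process R Omega d 1) (z : process R Omega p1 1) (u : Omega * R) : R :=
  C * hsnorm (ext T (fun _ _ => 1 : 'M[R]_1) u) + C * hsnorm (ext T y u) + C * hsnorm (ext T z u).

Lemma L2_hsnorm k l (U : Omega * R -> 'M[R]_(k, l)) : vL2 PL U -> L2 PL (fun u => hsnorm (U u)).
Proof. by move=> [mU hU]; split => //; exact: mmeas_hsnorm. Qed.

Lemma mu_bound_L2 y z : vL2 PL (ext T y) -> vL2 PL (ext T z) -> L2 PL (mu_bound y z).
Proof.
move=> Ly Lz; have [_ L1] := S2_H2 T0 hF (S2_cst T0 hF (1 : 'M[R]_1)).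
by apply: L2D; [apply: L2D|]; apply: L2Z; exact: L2_hsnorm.
Qed.

Lemma hsnorm1 : hsnorm (1 : 'M[R]_1) = 1.
Proof. by rewrite /hsnorm !big_ord1 mxE eqxx expr1n sqrtr1. Qed.

Lemma mu_bound_growth y z : ae_dPdt P T (fun w t => forall x,
  hsnorm (mu w t x (y w t) (z w t)) <= C * hsnorm x + mu_bound y z (w, t)).
Proof.
have := mu_growth hcoef; have := mu_lipschitz hcoef; rewrite !ae_dPdtE => hl hg.
apply: filterS2 hl hg => -[w t]/= hl hg tT x; rewrite /mu_bound /ext/= tT hsnorm1.
have h1 := hg tT x; have := hl tT x (y w t) 0 (z w t) 0; rewrite !subr0 => h2.
have h3 := hsnormD (mu w t x (y w t) (z w t) - mu w t x 0 0) (mu w t x 0 0); rewrite subrK in h3.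
by apply: le_trans h3 _; apply: le_trans (lerD h2 h1) _; lra.
Qed.

Lemma mu_vL2 x y z b : vL2 PL (ext T x) -> vL2 PL (ext T y) -> vL2 PL (ext T z) ->
  version_of (fun w t => mu w t (x w t) (y w t) (z w t)) b -> vL2 PL (ext T b).
Proof.
move=> Lx Ly Lz vb.
exact: (version_bound T0 hF (beta := fun w t x => mu w t x (y w t) (z w t)) (mu_bound_L2 Ly Lz) (mu_bound_growth y z) Lx vb).1.
Qed.

Lemma vL2_ae_le k l (X : Omega * R -> 'M[R]_(k, l)) (c : Omega * R -> R) : mmeas X -> L2 PL c ->
  {ae PL, forall u, hsnorm (X u) <= c u} -> vL2 PL X.
Proof.
move=> mX Lc' h; apply: (q2_ae_le mX (int1_sq Lc') _).1; apply: filterS h => u h.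
by rewrite ler_sqr ?nnegrE ?hsnorm_ge0// (le_trans (hsnorm_ge0 _) h).
Qed.

Lemma f_vL2 x y z g : vL2 PL (ext T x) -> vL2 PL (ext T y) -> vL2 PL (ext T z) ->
  version_of (fun w t => f w t (x w t) (y w t) (z w t)) g -> vL2 PL (ext T g).
Proof.
move=> Lx Ly Lz [pg eg]; have [p0 L0] := (H2P T0 hF _).1 (f_H2 hcoef).
pose c u := hsnorm (ext T (fun w t => f w t 0 0 0) u) +
  C * (hsnorm (ext T x u) + hsnorm (ext T y u) + hsnorm (ext T z u)).
have Lc' : L2 PL c.
  apply: L2D; first exact: L2_hsnorm; apply: L2Z; apply: L2D; last exact: L2_hsnorm.
  by apply: L2D; exact: L2_hsnorm.
apply: (vL2_ae_le (predictable_mmeas T0 hF pg) Lc').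
move: eg (f_lipschitz hcoef); rewrite !ae_dPdtE => eg hl; apply: filterS2 eg hl => -[w t]/= eg hl.
rewrite /c /ext/=; case: ifPn => tT; last by rewrite !hsnorm0 !addr0 mulr0 addr0.
rewrite eg//; have := hl tT (x w t) 0 (y w t) 0 (z w t) 0; rewrite !subr0 => h.
have h3 := hsnormD (f w t (x w t) (y w t) (z w t) - f w t 0 0 0) (f w t 0 0 0); rewrite subrK in h3.
by apply: le_trans h3 _; rewrite addrC lerD2l.
Qed.

Lemma sigma_vL2 x y z g : vL2 PL (ext T x) -> vL2 PL (ext T y) -> vL2 PL (ext T z) ->
  version_of (fun w t => sigma w t (x w t) (y w t) (z w t)) g -> vL2 PL (ext T g).
Proof.
move=> Lx Ly Lz [pg eg]; have [p0 L0] := (H2P T0 hF _).1 (sigma_H2 hcoef).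
pose c u := hsnorm (ext T (fun w t => sigma w t 0 0 0) u) +
  (C + 1) * (hsnorm (ext T x u) + hsnorm (ext T y u) + hsnorm (ext T z u)).
have Lc' : L2 PL c.
  apply: L2D; first exact: L2_hsnorm; apply: L2Z; apply: L2D; last exact: L2_hsnorm.
  by apply: L2D; exact: L2_hsnorm.
apply: (vL2_ae_le (predictable_mmeas T0 hF pg) Lc').
move: eg (sigma_lipschitz hcoef); rewrite !ae_dPdtE => eg hl; apply: filterS2 eg hl => -[w t]/= eg hl.
rewrite /c /ext/=; case: ifPn => tT; last by rewrite !hsnorm0 !addr0 mulr0 addr0.
rewrite eg//; have := hl tT (x w t) 0 (y w t) 0 (z w t) 0; rewrite !subr0 => h.
have h3 := hsnormD (sigma w t (x w t) (y w t) (z w t) - sigma w t 0 0 0) (sigma w t 0 0 0); rewrite subrK in h3.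
apply: le_trans h3 _; rewrite addrC lerD2l; have C0' := ltW C0.
have s0 : 0 <= hsnorm (x w t) + hsnorm (y w t) + hsnorm (z w t) by rewrite !addr_ge0// hsnorm_ge0.
have s1 : 0 <= (C + 1) * (hsnorm (x w t) + hsnorm (y w t) + hsnorm (z w t)) by nonneg.
rewrite -ler_sqr ?nnegrE ?hsnorm_ge0//; apply: le_trans h _.
by apply: lipschitz_sqr => //; exact: hsnorm_ge0.
Qed.

Lemma M2_vL2_ext (M : process R Omega d 1) : M2 P T F M -> vL2 PL (ext T M).
Proof.
move=> M2M; have rM := M2_rcproc hF M2M; split; first exact: (rcproc_mmeas T0).
apply: le_lt_trans (vnn2_le_nS T0 rM (M2_nS T0 hF M2M)) _.
by rewrite (nRE T0 (M2_nS T0 hF M2M)) -EFinM ltry.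
Qed.


(* The state [(xi, x, v)] enters the martingale [M], [y], [sigma] and [f]; the
   drift is implicit in [X], because [mu] is only monotone in its first variable.
   Solutions are the fixed points with [xi = phi (X_T) + V_T]. *)
Definition step (xi : Omega -> 'cV[R]_d) (x : process R Omega n 1) (v : process R Omega d 1)
    (X : process R Omega n 1) (V : process R Omega d 1) :=
  [/\ S2 P T F X, S2 P T F V & exists M y b s g A I,
    [/\ condexp_process P T F xi M, version_of (fun w t => M w t - v w t) y,
       version_of (fun w t => mu w t (X w t) (y w t) (La M w t)) b,
       version_of (fun w t => sigma w t (x w t) (y w t) (Lb M w t)) s
     & version_of (fun w t => f w t (x w t) (y w t) (Lc M w t)) g] /\
    [/\ time_integral P T b A, ito_integral P T F W s I, time_integral P T g V
     & indistinguishable P T X (fun w t => x0 + A w t + I w t)]].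

Hypothesis small_energy : 12 * C ^+ 2 * T ^+ 2 <= 1.
Hypothesis small_monotone : 8 * C * T <= 1.

Lemma step_exists xi x v : vL2 P xi -> predictable T F x -> vL2 PL (ext T x) ->
  predictable T F v -> vL2 PL (ext T v) ->
  exists X V, step xi x v X V /\ forall w, V w 0 = 0.
Proof.
have [pmu psi pf _ _ _ _ _ _ _ _ _ _ _] := hcoef.
move=> Lxi px Lx pv Lv; have [M hM] := condexp_process_exists T0 hF Lxi.
have M2M : M2 P T F M by case: hM.
(* [M] is only cadlag, so [y] is formed from a predictable representative; the operators are still
   applied to [M] itself. *)
have [Mp [pMp eMp]] := M2_predictable_version T0 hF M2M.
pose y w t := Mp w t - v w t.
have py : predictable T F y := predictableB T0 hF pMp pv.
have ey : version_of (fun w t => M w t - v w t) y.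
  split => //; move: eMp; rewrite !ae_dPdtE; apply: filterS => z h zT.
  by rewrite /y h.
have LM : vL2 PL (ext T Mp).
  apply: (vL2_ae_eq (predictable_mmeas T0 hF pMp) (Y := ext T M)); last by apply/ext_ae.
  exact: M2_vL2_ext.
have Ly : vL2 PL (ext T y) by rewrite extB; exact: (vL2B LM Lv).
have [pa LLa] := operator_H2 T0 hF hLa M2M.
have [pb LLb] := operator_H2 T0 hF hLb M2M.
have [pc LLc] := operator_H2 T0 hF hLc M2M.
have [s vs] := version3 (G := sigma) T0 hF px py pb psi sigma_jointly_continuous.
have [I hI] := ito_exists T0 hF hW vs.1 (sigma_vL2 Lx Ly LLb vs).
have [g vg] := version3 (G := f) T0 hF px py pc pf f_jointly_continuous.
have [V [SV V0 tV]] := time_integral_exists T0 hF vg.1 (f_vL2 Lx Ly LLc vg).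
have bm : ae_dPdt P T (fun w t => forall x x', dotp (x - x') (mu w t x (y w t) (La M w t) -
    mu w t x' (y w t) (La M w t)) <= C * hsnorm (x - x') ^+ 2).
  by have := mu_monotone hcoef; rewrite !ae_dPdtE; apply: filterS => z h zT x1 x2; exact: h.
have bc : ae_dPdt P T (fun w t => forall u e, 0 < e -> exists2 r, 0 < r & forall u',
    hsnorm (u' - u) <= r -> hsnorm (mu w t u' (y w t) (La M w t) - mu w t u (y w t) (La M w t)) <= e).
  have := mu_continuous hcoef; rewrite !ae_dPdtE; apply: filterS => z h zT.
  exact: hsnorm_continuous (h zT _ _).
have [X [b [A [SX vb SA tA [_ eX]]]]] :=
  @sde_exists _ _ _ P T F T0 hF n (fun w t x => mu w t x (y w t) (La M w t)) C _ I x0 C0 (mu_bound_L2 Ly LLa)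
   (fun U pU => version3 (G := mu) T0 hF pU py pa pmu mu_jointly_continuous) bm
   (mu_bound_growth y (La M)) bc (ito_S2 hI) (fun a => ito_mart T0 hF hW a hI) small_energy small_monotone.
exists X, V; split => //; split => //; exists M, y, b, s, g, A, I; split; first by split.
by split => //; apply: aeW => w t _; exact: eX.
Qed.

(** [a], [b], [c] stand for [mu (x, y, z)], [mu (x', y, z)] and [mu (x', y', z')]: monotonicity
    treats the first change, the Lipschitz condition and Young's inequality with weight [l] the
    second. *)
Lemma coefficient_young (l : R) (x x' : 'cV[R]_n) (a b c : 'cV[R]_n) (dy dz : R) : 0 < l ->
  0 <= dy -> 0 <= dz -> mdot (x - x') (a - b) <= C * hsnorm (x - x') ^+ 2 ->
  hsnorm (b - c) <= C * (dy + dz) ->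
  2 * mdot (x - x') (a - c) <= (2 * C + l) * hsnorm (x - x') ^+ 2 +
    2 * l^-1 * C ^+ 2 * dy ^+ 2 + 2 * l^-1 * C ^+ 2 * dz ^+ 2.
Proof.
move=> l0 y0 z0 h1 h2; have li : 0 < l^-1 by rewrite invr_gt0.
have -> : mdot (x - x') (a - c) = mdot (x - x') (a - b) + mdot (x - x') (b - c).
  by rewrite ![mdot (x - x') _]mdotC -mdotDl addrA subrK.
have h3 := mdot_young (x - x') (b - c) l0.
have h4 : l^-1 * hsnorm (b - c) ^+ 2 <= l^-1 * (C ^+ 2 * (2 * dy ^+ 2 + 2 * dz ^+ 2)).
  apply: ler_wpM2l; first exact: ltW.
  apply: (@le_trans _ _ ((C * (dy + dz)) ^+ 2)).
    by rewrite ler_sqr ?nnegrE ?hsnorm_ge0// mulr_ge0 ?addr_ge0// ltW.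
  rewrite exprMn; apply: ler_wpM2l; first exact: sqr_ge0.
  by have := sqr_ge0 (dy - dz); lra.
by lra.
Qed.

Section two_steps.
Variables (xi xi' : Omega -> 'cV[R]_d) (x x' : process R Omega n 1) (v v' : process R Omega d 1).
Variables (X X' : process R Omega n 1) (V V' : process R Omega d 1) (rho tau : R).
Hypotheses (hs : step xi x v X V) (hs' : step xi' x' v' X' V').
Hypotheses (Lxi : vL2 P xi) (Lxi' : vL2 P xi') (Lx : vL2 PL (ext T x)) (Lx' : vL2 PL (ext T x'))
  (Lv : vL2 PL (ext T v)) (Lv' : vL2 PL (ext T v')).
Hypotheses (rho0 : 0 <= rho) (dxi : q2 P (fun w => xi w - xi' w) <= rho)
  (dx : q2 PL (ext T (fun w t => x w t - x' w t)) <= T * rho)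
  (dv : q2 PL (ext T (fun w t => v w t - v' w t)) <= T * rho).
Hypotheses (T1 : T <= 1) (tau0 : 0 < tau) (htau : 2 * (2 * C + tau^-1) * T <= 1).

Local Notation c := (@normal_m2 R).
(** The outer 2 comes from [absorb]. The squared distance of [y] is [10 T rho], twice Doob's 4 for
    [M] plus twice 1 for [v]; the operator in the drift adds [8 K^2 rho]. In the noise, [8 c] is the
    constant of [ito_dist], 11 collects [x] and [y], and [4 K^2] is the S^2-valued operator; there
    every term carries [T]. The backward factor counts likewise, with 3 from the square of three
    terms. *)
Definition forward_factor := 2 * (2 * tau * C ^+ 2 * (10 + 8 * K ^+ 2) + 8 * c * C * (11 + 4 * K ^+ 2) * T).
Definition backward_factor := 3 * C ^+ 2 * (11 + 8 * K ^+ 2) * T.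

(** [X] is compared at each time, which is what the energy identity yields and what later steps use,
    namely its H^2 distance and its value at [T]. [V], a time integral, is compared in S^2 and gains
    [T] by Cauchy-Schwarz. *)
Lemma step_contract : (forall t, t \in `[0, T] -> q2 P (fun w => X w t - X' w t) <= forward_factor * rho) /\
  nR P T (fun w t => V w t - V' w t) <= backward_factor * rho.
Proof.
have [SX SV [M [y [b [s [g [A [I [[hM vy vb vs vg] [tA hI tV eX]]]]]]]]]] := hs.
have [SX' SV' [M' [y' [b' [s' [g' [A' [I' [[hM' vy' vb' vs' vg'] [tA' hI' tV' eX']]]]]]]]]] := hs'.
have M2M : M2 P T F M by case: hM. have M2M' : M2 P T F M' by case: hM'.
have T0' := ltW T0; have C0' := ltW C0; have K0' := ltW K0; have c0 := @normal_m2_ge0 R.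
pose dM w t := M w t - M' w t.
have dMS : (nS P T dM <= (4 * rho)%:E)%E.
  apply: le_trans (condexp_process_dist T0 hF Lxi Lxi' hM hM') _.
  by rewrite (q2E (vL2B Lxi Lxi')) -EFinM lee_fin ler_wpM2l.
have LdM : vL2 PL (ext T dM) by rewrite extB; exact: (vL2B (M2_vL2_ext M2M) (M2_vL2_ext M2M')).
have qM : q2 PL (ext T dM) <= T * (4 * rho).
  rewrite -lee_fin -q2E//.
  have rD : rcproc T dM := rcprocB (M2_rcproc hF M2M) (M2_rcproc hF M2M').
  apply: le_trans (vnn2_le_nS T0 rD (le_lt_trans dMS (ltry _))) _.
  by rewrite EFinM; apply: lee_wpmul2l; rewrite ?lee_fin.
have Ldv : vL2 PL (ext T (fun w t => v w t - v' w t)) by rewrite extB; exact: (vL2B Lv Lv').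
have Ldx : vL2 PL (ext T (fun w t => x w t - x' w t)) by rewrite extB; exact: (vL2B Lx Lx').
have mdy : mmeas (ext T (fun w t => y w t - y' w t)).
  by apply: (predictable_mmeas T0 hF); exact: (predictableB T0 hF vy.1 vy'.1).
have [Ldy qy] : vL2 PL (ext T (fun w t => y w t - y' w t)) /\
    q2 PL (ext T (fun w t => y w t - y' w t)) <= 10 * T * rho.
  have h : {ae PL, forall u, hsnorm (ext T (fun w t => y w t - y' w t) u) ^+ 2 <=
      2 * hsnorm (ext T dM u) ^+ 2 + 2 * hsnorm (ext T (fun w t => v w t - v' w t) u) ^+ 2 + 0 * hsnorm (ext T dM u) ^+ 2}.
    move: vy.2 vy'.2; rewrite !ae_dPdtE => h h'; apply: filterS2 h h' => -[w t]/= h h'.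
    rewrite /ext/= mul0r addr0; case: ifPn => tT; last by rewrite !hsnorm0 expr0n/= mulr0 addr0.
    rewrite h// h'// (_ : _ - _ = dM w t + (- (v w t - v' w t))); last first.
      by apply/matrixP => i j; rewrite !mxE; ring.
    by apply: le_trans (hsnorm_sqrD _ _) _; rewrite hsnormN.
  have [h1 h2] := q2_lin mdy LdM Ldv LdM h; split => //; apply: le_trans h2 _.
  by rewrite mul0r addr0; apply: le_trans (lerD (ler_wpM2l _ qM) (ler_wpM2l _ dv)) _ => //; rewrite le_eqVlt; apply/orP; left; apply/eqP; ring.
have ymv (M0 y0 v0 : process R Omega d 1) : M2 P T F M0 -> vL2 PL (ext T v0) ->
    version_of (fun w t => M0 w t - v0 w t) y0 -> vL2 PL (ext T y0).
  move=> hM0 Lv0 vy0; apply: (vL2_ae_eq (predictable_mmeas T0 hF vy0.1) (Y := ext T (fun w t => M0 w t - v0 w t))).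
    by rewrite extB; exact: (vL2B (M2_vL2_ext hM0) Lv0).
  exact/ext_ae/vy0.2.
have Ly := ymv _ _ _ M2M Lv vy; have Ly' := ymv _ _ _ M2M' Lv' vy'.
have op p (L : process R Omega d 1 -> process R Omega p 1) o : operator_condition P T F K o L ->
    vL2 PL (ext T (fun w t => L M w t - L M' w t)) /\ q2 PL (ext T (fun w t => L M w t - L M' w t)) <= 8 * K ^+ 2 * rho.
  move=> hL; have LL : vL2 PL (ext T (fun w t => L M w t - L M' w t)).
    by rewrite extB; exact: (vL2B (operator_H2 T0 hF hL M2M).2 (operator_H2 T0 hF hL M2M').2).
  split => //; rewrite -lee_fin -q2E//; apply: le_trans (operator_dist T0 hF K0' hL M2M M2M') _.
  have k0 : 0 <= K ^+ 2 * (1 + T) by apply: mulr_ge0; [exact: sqr_ge0|exact: addr_ge0].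
  (* Doob's bound [4 rho] on the martingales enters here, and [T <= 1] then replaces [1 + T] by
     2. *)
  apply: (@le_trans _ _ ((K ^+ 2 * (1 + T))%:E * (4 * rho)%:E)%E); first by apply: lee_wpmul2l; rewrite ?lee_fin.
  rewrite -EFinM lee_fin (_ : 8 * K ^+ 2 * rho = K ^+ 2 * (1 + 1) * (4 * rho)); last by ring.
  apply: ler_wpM2r; first exact: mulr_ge0.
  by apply: ler_wpM2l; [exact: sqr_ge0|exact: lerD].
have [LdLa qLa] := op _ _ _ hLa; have [LdLc qLc] := op _ _ _ hLc.
have [LdLb _] := op _ _ _ hLb.
have qLb : q2 PL (ext T (fun w t => Lb M w t - Lb M' w t)) <= T * K ^+ 2 * (4 * rho).
  rewrite -lee_fin -q2E//; apply: le_trans (operator_S2_dist T0 hF K0' hLb M2M M2M') _.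
  by rewrite [X in (_ <= X)%E]EFinM; apply: lee_wpmul2l => //; rewrite lee_fin mulr_ge0// sqr_ge0.
have mds : mmeas (ext T (fun w t => s w t - s' w t)).
  by apply: (predictable_mmeas T0 hF); exact: (predictableB T0 hF vs.1 vs'.1).
have [Lds qs] : vL2 PL (ext T (fun w t => s w t - s' w t)) /\
    q2 PL (ext T (fun w t => s w t - s' w t)) <= C * (11 + 4 * K ^+ 2) * T * rho.
  have h : {ae PL, forall u, hsnorm (ext T (fun w t => s w t - s' w t) u) ^+ 2 <=
      C * hsnorm (ext T (fun w t => x w t - x' w t) u) ^+ 2 + C * hsnorm (ext T (fun w t => y w t - y' w t) u) ^+ 2
      + C * hsnorm (ext T (fun w t => Lb M w t - Lb M' w t) u) ^+ 2}.
    move: vs.2 vs'.2 vy.2 vy'.2 (sigma_lipschitz hcoef); rewrite !ae_dPdtE => h h' hy hy' hl.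
    apply: filterS2 (ae_and h h') hl => -[w t]/= [{}h {}h'] {}hl.
    rewrite /ext/=; case: ifPn => tT; last by rewrite !hsnorm0 expr0n/= mulr0 !addr0.
    by rewrite h// h'// -!mulrDr; exact: hl.
  have [h1 h2] := q2_lin mds Ldx Ldy LdLb h; split => //; apply: le_trans h2 _.
  by apply: le_trans (lerD (lerD (ler_wpM2l _ dx) (ler_wpM2l _ qy)) (ler_wpM2l _ qLb)) _ => //; rewrite le_eqVlt; apply/orP; left; apply/eqP; ring.
have mdg : mmeas (ext T (fun w t => g w t - g' w t)).
  by apply: (predictable_mmeas T0 hF); exact: (predictableB T0 hF vg.1 vg'.1).
have [Ldg qg] : vL2 PL (ext T (fun w t => g w t - g' w t)) /\
    q2 PL (ext T (fun w t => g w t - g' w t)) <= 3 * C ^+ 2 * (11 + 8 * K ^+ 2) * rho.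
  have h : {ae PL, forall u, hsnorm (ext T (fun w t => g w t - g' w t) u) ^+ 2 <=
      3 * C ^+ 2 * hsnorm (ext T (fun w t => x w t - x' w t) u) ^+ 2 + 3 * C ^+ 2 * hsnorm (ext T (fun w t => y w t - y' w t) u) ^+ 2
      + 3 * C ^+ 2 * hsnorm (ext T (fun w t => Lc M w t - Lc M' w t) u) ^+ 2}.
    move: vg.2 vg'.2 (f_lipschitz hcoef); rewrite !ae_dPdtE => h h' hl.
    apply: filterS2 (ae_and h h') hl => -[w t]/= [{}h {}h'] {}hl.
    rewrite /ext/=; case: ifPn => tT; last by rewrite !hsnorm0 expr0n/= mulr0 !addr0.
    by rewrite h// h'//; apply: lipschitz_sqr3 (hl tT _ _ _ _ _ _); exact: hsnorm_ge0.
  have [h1 h2] := q2_lin mdg Ldx Ldy LdLc h; split => //; apply: le_trans h2 _.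
  have C3 : 0 <= 3 * C ^+ 2 by rewrite mulr_ge0// sqr_ge0.
  apply: le_trans (lerD (lerD (ler_wpM2l C3 dx) (ler_wpM2l C3 qy)) (ler_wpM2l C3 qLc)) _.
  rewrite (_ : _ + _ = 3 * C ^+ 2 * (11 * T * rho + 8 * K ^+ 2 * rho)); last by ring.
  rewrite (_ : 3 * C ^+ 2 * _ * rho = 3 * C ^+ 2 * (11 * 1 * rho + 8 * K ^+ 2 * rho)); last by ring.
  by apply: ler_wpM2l => //; rewrite lerD2r; apply: ler_wpM2r => //; exact: ler_wpM2l.
split; last first.
  have -> : backward_factor * rho = T * (3 * C ^+ 2 * (11 + 8 * K ^+ 2) * rho) by rewrite /backward_factor; ring.
  have Lg := f_vL2 Lx Ly (operator_H2 T0 hF hLc M2M).2 vg.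
  have Lg' := f_vL2 Lx' Ly' (operator_H2 T0 hF hLc M2M').2 vg'.
  apply: le_trans (time_integral_nR T0 hF Lg Lg' SV SV' tV tV') _.
  exact: ler_wpM2l.
move=> t tT; pose D w t := X w t - X' w t.
have SD : S2 P T F D := S2B T0 hF SX SX'.
have [_ LX] := S2_H2 T0 hF SX; have [_ LX'] := S2_H2 T0 hF SX'; have [_ LD] := S2_H2 T0 hF SD.
have Lb' := mu_vL2 LX Ly (operator_H2 T0 hF hLa M2M).2 vb.
have Lb'' := mu_vL2 LX' Ly' (operator_H2 T0 hF hLa M2M').2 vb'.
pose bb w t := b w t - b' w t.
have Lbb : vL2 PL (ext T bb) by rewrite extB; exact: vL2B.
have pbb : predictable T F bb := predictableB T0 hF vb.1 vb'.1.
have tbb := time_integralB tA tA'.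
have ti : 0 < tau^-1 by rewrite invr_gt0.
pose e1 := 2 * C + tau^-1; pose e2 := 2 * tau * C ^+ 2.
have e1p : 0 <= e1 by rewrite /e1 addr_ge0 ?mulr_ge0// ltW.
have e2p : 0 <= e2 by rewrite /e2 !mulr_ge0 ?sqr_ge0// ltW.
pose G u := e1 * hsnorm (ext T D u) ^+ 2 + e2 * hsnorm (ext T (fun w t => y w t - y' w t) u) ^+ 2
  + e2 * hsnorm (ext T (fun w t => La M w t - La M' w t) u) ^+ 2.
(* [coefficient_young] with [l = tau^-1]: the small weight [tau] falls on [y] and the operator, the
   large one on [|D|^2], where the smallness of [T] pays for it. *)
have hp : {ae PL, forall u, 2 * mdot (ext T D u) (ext T bb u) <= G u}.
  move: vb.2 vb'.2 (mu_lipschitz hcoef) (mu_monotone hcoef); rewrite !ae_dPdtE => h h' hl hm.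
  apply: filterS2 (ae_and h h') (ae_and hl hm) => -[w r]/= [{}h {}h'] [{}hl {}hm].
  rewrite /G /e1 /e2 /ext/=; case: ifPn => rT; last by rewrite mdot0l !hsnorm0 expr0n/= !mulr0 !addr0.
  rewrite /bb h// h'//.
  have := @coefficient_young tau^-1 (X w r) (X' w r) (mu w r (X w r) (y w r) (La M w r))
    (mu w r (X' w r) (y w r) (La M w r)) (mu w r (X' w r) (y' w r) (La M' w r)) _ _ ti (hsnorm_ge0 _) (hsnorm_ge0 _) _ (hl rT _ _ _ _ _).
  by rewrite invrK; apply; rewrite -dotp_mdot; exact: hm.
have i1 := vL2_int1 LD; have i2 := vL2_int1 Ldy; have i3 := vL2_int1 LdLa.
have iG : int1 PL G by apply: int1D; [apply: int1D|]; exact: int1Z.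
have eG : \int[PL]_u G u = e1 * q2 PL (ext T D) + e2 * q2 PL (ext T (fun w t => y w t - y' w t)) +
   e2 * q2 PL (ext T (fun w t => La M w t - La M' w t)).
  rewrite RintegralD//; [|by apply: int1D; exact: int1Z|exact: int1Z].
  by rewrite RintegralD//; [|exact: int1Z..]; rewrite !RintegralZl.
have G0 u : 0 <= G u by rewrite /G; nonneg.
have SI := ito_S2 hI; have SI' := ito_S2 hI'.
have SdI : S2 P T F (fun w t => I w t - I' w t) := S2B T0 hF SI SI'.
have mI a : mart P T F (fun t w => (I w t - I' w t) a ord0).
  rewrite (_ : (fun t w => _) = (fun t w => I w t a ord0 - I' w t a ord0)).
    exact: (martB (ito_mart T0 hF hW a hI) (ito_mart T0 hF hW a hI')).
  by apply/funext => r; apply/funext => w; rewrite !mxE.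
rewrite /forward_factor -mulrA; apply: (@absorb _ _ [set t | t \in `[0, T]] (fun t => q2 P (D ^~ t)) _ (nR P T D)) => //.
  by move=> r rT; exact: (q2_nR T0 hF).
move=> k hk r rT.
have k0 : 0 <= k by apply: le_trans (hk r rT); exact: q2_ge0.
have qD : q2 PL (ext T D) <= T * k by exact: (q2_time_le T0 hF).
have LDr := S2_vL2 T0 hF SD rT.
have hI1 : q2 P (fun w => I w r - I' w r) <= 8 * c * (C * (11 + 4 * K ^+ 2) * T * rho).
  rewrite -lee_fin -q2E; last exact: (S2_vL2 T0 hF SdI rT).
  apply: le_trans (ito_dist T0 hF hW hI hI' rT) _; rewrite (q2E Lds) -EFinM lee_fin.
  by apply: ler_wpM2l => //; exact: mulr_ge0.
have hD : {ae P, forall w, forall t, t \in `[0, T] -> D w t = (A w t - A' w t) + (I w t - I' w t)}.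
  apply: filterS2 eX eX' => w h h' q qT; rewrite /D h// h'//.
  by apply/matrixP => i j; rewrite !mxE; ring.
have := energy_le T0 hF pbb Lbb tbb mI (S2_H2 T0 hF SdI).2 hD LD LDr.1 rT iG G0 hp.
rewrite eG => h; apply: le_trans h _.
have k1 : e1 * q2 PL (ext T D) <= k / 2.
  apply: le_trans (ler_wpM2l e1p qD) _.
  have : 2 * e1 * T * k <= k by rewrite ler_piMl.
  exact: half_of_double.
have k2 := ler_wpM2l e2p qy; have k3 := ler_wpM2l e2p qLa.
apply: le_trans (lerD (lerD (lerD k1 k2) k3) hI1) _.
have k4 : e2 * (10 * T * rho) <= e2 * (10 * 1 * rho).
  by apply: ler_wpM2l => //; apply: ler_wpM2r => //; exact: ler_wpM2l.
apply: (@le_trans _ _ (k / 2 + e2 * (10 * 1 * rho) + e2 * (8 * K ^+ 2 * rho) + 8 * c * (C * (11 + 4 * K ^+ 2) * T * rho))).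
  by rewrite lerD2r lerD2r lerD2l.
by rewrite le_eqVlt; apply/orP; left; apply/eqP; rewrite /e2; ring.
Qed.
End two_steps.

Definition terminal (X : process R Omega n 1) (V : process R Omega d 1) (w : Omega) : 'cV[R]_d :=
  phi w (X w T) + V w T.

Let TT : T \in `[0, T]. Proof. by rewrite in_itv/= lexx ltW. Qed.

Lemma terminal_gmeas X V i j : S2 P T F X -> S2 P T F V -> gmeas (F T) (fun w => terminal X V w i j).
Proof.
move=> [/(adapted_gmeas _ hF) aX _ _] [/(adapted_gmeas _ hF) aV _ _].
have [_ _ _ mphi _ _ _ _ _ _ _ _ _ lphi] := hcoef.
apply: (gmeas_ext (f := fun w => phi w (X w T) i j + V w T i j)); first by move=> w; rewrite mxE.
apply: measurable_funD; last exact: aV.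
by apply: (gmeas_nemytskii hF (ltW C0) TT _ mphi lphi) => a; exact: aX.
Qed.

Lemma terminal_vL2 X V : S2 P T F X -> S2 P T F V -> vL2 P (terminal X V).
Proof.
move=> SX SV; have [_ _ _ mphi _ _ _ _ _ _ iphi _ _ lphi] := hcoef.
have mt : mmeas (terminal X V) by move=> i j; exact: (gmeas_sub (filt_sub hF TT) (terminal_gmeas i j SX SV)).
have LX := S2_vL2 T0 hF SX TT; have LV := S2_vL2 T0 hF SV TT.
have Lp : vL2 P (fun w => phi w 0).
  split; last exact: iphi.
  move=> i j; apply: (gmeas_sub (filt_sub hF TT)).
  by apply/(gmeasP _ (filt_sigma hF TT)) => B mB; exact: mphi.
have h : {ae P, forall w, hsnorm (terminal X V w) ^+ 2 <= 3 * hsnorm (phi w 0) ^+ 2 +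
    3 * C ^+ 2 * hsnorm (X w T) ^+ 2 + 3 * hsnorm (V w T) ^+ 2}.
  apply: filterS lphi => w h; have := h (X w T) 0; rewrite subr0 => h1.
  have -> : terminal X V w = phi w 0 + (phi w (X w T) - phi w 0) + V w T.
    by rewrite /terminal; congr (_ + _); rewrite addrC subrK.
  apply: le_trans (hsnorm_sqrD3 _ _ _) _; rewrite lerD2r lerD2l -mulrA; apply: ler_wpM2l => //.
  rewrite -exprMn ler_sqr ?nnegrE ?hsnorm_ge0//.
  by apply: mulr_ge0; [exact: ltW|exact: hsnorm_ge0].
exact: (q2_lin mt Lp LX LV h).1.
Qed.

Lemma terminal_dist X V X' V' : S2 P T F X -> S2 P T F V -> S2 P T F X' -> S2 P T F V' ->
  q2 P (fun w => terminal X V w - terminal X' V' w) <=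
    2 * C ^+ 2 * q2 P (fun w => X w T - X' w T) + 2 * q2 P (fun w => V w T - V' w T).
Proof.
move=> SX SV SX' SV'; have [_ _ _ _ _ _ _ _ _ _ _ _ _ lphi] := hcoef.
have Lt := vL2B (terminal_vL2 SX SV) (terminal_vL2 SX' SV').
have LX := S2_vL2 T0 hF (S2B T0 hF SX SX') TT; have LV := S2_vL2 T0 hF (S2B T0 hF SV SV') TT.
have h : {ae P, forall w, hsnorm (terminal X V w - terminal X' V' w) ^+ 2 <=
    2 * C ^+ 2 * hsnorm (X w T - X' w T) ^+ 2 + 2 * hsnorm (V w T - V' w T) ^+ 2 + 0 * hsnorm (V w T - V' w T) ^+ 2}.
  apply: filterS lphi => w h; have h1 := h (X w T) (X' w T).
  have -> : terminal X V w - terminal X' V' w = (phi w (X w T) - phi w (X' w T)) + (V w T - V' w T).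
    by rewrite /terminal; apply/matrixP => i j; rewrite !mxE; ring.
  rewrite mul0r addr0; apply: le_trans (hsnorm_sqrD _ _) _; rewrite lerD2r -mulrA; apply: ler_wpM2l => //.
  rewrite -exprMn ler_sqr ?nnegrE ?hsnorm_ge0//.
  by apply: mulr_ge0; [exact: ltW|exact: hsnorm_ge0].
by have [_] := q2_lin Lt.1 LX LV LV h; rewrite mul0r addr0.
Qed.

Variable tau : R.
Hypotheses (T1 : T <= 1) (tau0 : 0 < tau) (htau : 2 * (2 * C + tau^-1) * T <= 1).
Hypotheses (hforward : forward_factor tau <= 16^-1) (hbackward : backward_factor <= 16^-1) (hterminal : 2 * C ^+ 2 * forward_factor tau + 2 * backward_factor <= 16^-1).

(** The H^2 distances are measured with a factor [T], so that bounds valid at each time reproduce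
    them by integration over [0, T] and all three components shrink by the same factor. *)
Lemma step_next xi xi' x x' v v' X X' V V' rho : step xi x v X V -> step xi' x' v' X' V' ->
  vL2 P xi -> vL2 P xi' -> vL2 PL (ext T x) -> vL2 PL (ext T x') -> vL2 PL (ext T v) -> vL2 PL (ext T v') ->
  0 <= rho -> q2 P (fun w => xi w - xi' w) <= rho ->
  q2 PL (ext T (fun w t => x w t - x' w t)) <= T * rho -> q2 PL (ext T (fun w t => v w t - v' w t)) <= T * rho ->
  [/\ q2 P (fun w => terminal X V w - terminal X' V' w) <= rho / 16,
    q2 PL (ext T (fun w t => X w t - X' w t)) <= T * (rho / 16)
   & q2 PL (ext T (fun w t => V w t - V' w t)) <= T * (rho / 16)].
Proof.
move=> hs hs' Lxi Lxi' Lx Lx' Lv Lv' r0 dxi dx dv.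
have [hX hV] := step_contract hs hs' Lxi Lxi' Lx Lx' Lv Lv' r0 dxi dx dv T1 tau0 htau.
have [SX SV _] := hs; have [SX' SV' _] := hs'.
have r16 : 0 <= rho / 16 by rewrite divr_ge0.
have kr (k : R) : k <= 16^-1 -> k * rho <= rho / 16 by move=> h; rewrite mulrC ler_wpM2l.
have T0' := ltW T0; split.
- apply: le_trans (terminal_dist SX SV SX' SV') _.
  have h1 := q2_nR T0 hF (S2B T0 hF SV SV') TT.
  have C2 : 0 <= 2 * C ^+ 2 by rewrite mulr_ge0// sqr_ge0.
  have := lerD (ler_wpM2l C2 (hX T TT)) (ler_wpM2l (ler0n R 2) (le_trans h1 hV)).
  move=> h; apply: le_trans h _.
  by rewrite (_ : _ + _ = (2 * C ^+ 2 * forward_factor tau + 2 * backward_factor) * rho); [exact: kr|ring].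
- exact: (q2_time_le T0 hF (S2B T0 hF SX SX') r16 (fun t tT => le_trans (hX t tT) (kr _ hforward))).
- apply: le_trans (q2_ext_nR T0 hF (S2B T0 hF SV SV')) _; apply: ler_wpM2l => //.
  by apply: le_trans hV _; exact: kr.
Qed.

Local Notation solution := (fds_solution P T F W x0 mu sigma f phi La Lb Lc).

(** A solution uses the cadlag process [M - V]; a predictable representative changes the
    coefficients only on a dP dt-null set. Likewise [V] inherits the integral formula from [J]. *)
Lemma solution_step X V : solution X V -> step (terminal X V) X V X V.
Proof.
move=> [SX [SV V0] [M [hM [b [s [g [A [I [J [[vb vs vg] [tA hI tJ eX eV]]]]]]]]]]].
have [G [pG eG]] := M2_predictable_version T0 hF hM.1; have [pV _] := S2_H2 T0 hF SV.
pose y w t := G w t - V w t.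
have vy : version_of (fun w t => M w t - V w t) y.
  split; first exact: (predictableB T0 hF pG pV).
  by move: eG; rewrite !ae_dPdtE; apply: filterS => z h zT; rewrite /y h.
split => //; exists M, y, b, s, g, A, I; split; split => //.
- split; first exact: vb.1.
  by move: vb.2 vy.2; rewrite !ae_dPdtE => h1 h2; apply: filterS2 h1 h2 => z h1 h2 zT; rewrite h1// h2.
- split; first exact: vs.1.
  by move: vs.2 vy.2; rewrite !ae_dPdtE => h1 h2; apply: filterS2 h1 h2 => z h1 h2 zT; rewrite h1// h2.
- split; first exact: vg.1.
  by move: vg.2 vy.2; rewrite !ae_dPdtE => h1 h2; apply: filterS2 h1 h2 => z h1 h2 zT; rewrite h1// h2.
by apply: filterS2 tJ eV => w [h1 h2] h3; split => // t tT i; rewrite h3// h2.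
Qed.

(** With [rho] the sum of the three distances, the two in H^2 divided by [T], one step gives
    [rho <= 3 rho / 16], so [rho = 0]. A second use of the step estimate, now with [rho = 0],
    upgrades equality almost everywhere to indistinguishability. *)
Lemma solution_unique X V X' V' : solution X V -> solution X' V' ->
  indistinguishable P T X X' /\ indistinguishable P T V V'.
Proof.
move=> hX hX'; have hs := solution_step hX; have hs' := solution_step hX'.
have [SX SV _] := hs; have [SX' SV' _] := hs'.
have Lt := terminal_vL2 SX SV; have Lt' := terminal_vL2 SX' SV'.
have [_ LX] := S2_H2 T0 hF SX; have [_ LX'] := S2_H2 T0 hF SX'.
have [_ LV] := S2_H2 T0 hF SV; have [_ LV'] := S2_H2 T0 hF SV'.
set a := q2 P (fun w => terminal X V w - terminal X' V' w).
set u := q2 PL (ext T (fun w t => X w t - X' w t)); set v := q2 PL (ext T (fun w t => V w t - V' w t)).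
have a0 : 0 <= a := q2_ge0 _ _; have u0 : 0 <= u / T by rewrite divr_ge0 ?q2_ge0// ltW.
have v0 : 0 <= v / T by rewrite divr_ge0 ?q2_ge0// ltW.
pose rho := a + u / T + v / T.
have r0 : 0 <= rho by rewrite !addr_ge0.
have ha : a <= rho by rewrite /rho -addrA lerDl addr_ge0.
have hu : u <= T * rho by rewrite mulrC -ler_pdivrMr// /rho; lra.
have hv : v <= T * rho by rewrite mulrC -ler_pdivrMr// /rho; lra.
have [h1 h2 h3] := step_next hs hs' Lt Lt' LX LX' LV LV' r0 ha hu hv.
have h2' : u / T <= rho / 16 by rewrite ler_pdivrMr// mulrC.
have h3' : v / T <= rho / 16 by rewrite ler_pdivrMr// mulrC.
have r1 : rho <= 0.
  by apply: (three_sixteenths h1 h2' h3').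
have re : rho = 0 by apply/eqP; rewrite eq_le r1.
have [k1 k2] := step_contract hs hs' Lt Lt' LX LX' LV LV' r0 ha hu hv T1 tau0 htau.
split.
  apply: (S2_indist_times T0 hF) => // t tT; apply: le_trans (k1 t tT) _.
  by rewrite re mulr0.
by apply: (S2_indist T0 hF) => //; apply: le_trans k2 _; rewrite re mulr0.
Qed.

(** Variables that agree almost surely have the same conditional expectations, so the martingale of
    [xi] serves for the terminal value; the remaining equalities alter the coefficients only on null
    sets of dP dt. *)
Lemma step_solution xi xh vh X V : vL2 P xi -> step xi xh vh X V -> (forall w, V w 0 = 0) ->
  {ae P, forall w, xi w = terminal X V w} -> {ae PL, forall z, ext T xh z = ext T X z} ->
  {ae PL, forall z, ext T vh z = ext T V z} -> solution X V.
Proof.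
move=> Lxi [SX SV [M [y [b [s [g [A [I [[hM vy vb vs vg] [tA hI tV eX]]]]]]]]]] V0 exi ex ev.
have Lt := terminal_vL2 SX SV.
move/ext_ae: ex => ex; move/ext_ae: ev => ev.
split => //; exists M; split.
  have [M2M hM2] := hM; split => // t tT; have [h1 h2] := hM2 t tT; split => // i j.
  have [i1 i2 h3] := h2 i j; split => //.
    exact: (L2_int1 ((vL2P _ _).1 Lt i j)).
  move=> D FD; rewrite -h3//; apply: ae_eq_integral.
  - exact: (filt_sub hF tT).
  - apply: (@measurable_funS _ _ _ _ setT) => //.
    by apply/measurable_EFinP; exact: Lt.1.
  - apply: (@measurable_funS _ _ _ _ setT) => //.
    by apply/measurable_EFinP; exact: Lxi.1.
  by apply: filterS exi => w -> _.
exists b, s, g, A, I, V; split; split => //.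
- split; first exact: vb.1.
  move: vb.2 vy.2 ev; rewrite !ae_dPdtE => h1 h2 h3; apply: filterS2 (ae_and h1 h2) h3 => z [e1 e2] e3 zT.
  by rewrite e1// e2// e3.
- split; first exact: vs.1.
  move: vs.2 vy.2 ev ex; rewrite !ae_dPdtE => h1 h2 h3 h4.
  apply: filterS2 (ae_and h1 h2) (ae_and h3 h4) => z [e1 e2] [e3 e4] zT.
  by rewrite e1// e2// e3// e4.
- split; first exact: vg.1.
  move: vg.2 vy.2 ev ex; rewrite !ae_dPdtE => h1 h2 h3 h4.
  apply: filterS2 (ae_and h1 h2) (ae_and h3 h4) => z [e1 e2] [e3 e4] zT.
  by rewrite e1// e2// e3// e4.
by apply: aeW.
Qed.

Definition distances (p p' : process R Omega n 1 * process R Omega d 1) (rho : R) :=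
  [/\ q2 P (fun w => terminal p.1 p.2 w - terminal p'.1 p'.2 w) <= rho,
    q2 PL (ext T (fun w t => p.1 w t - p'.1 w t)) <= T * rho
  & q2 PL (ext T (fun w t => p.2 w t - p'.2 w t)) <= T * rho].

Lemma picard : exists s : nat -> process R Omega n 1 * process R Omega d 1,
  [/\ forall q, S2 P T F (s q).1 /\ S2 P T F (s q).2,
    forall q, step (terminal (s q).1 (s q).2) (s q).1 (s q).2 (s q.+1).1 (s q.+1).2
  & forall q, distances (s q.+1) (s q) (16^-1 ^+ q)].
Proof.
have /choice[Phi hPhi] : forall p : process R Omega n 1 * process R Omega d 1, exists p',
    S2 P T F p.1 /\ S2 P T F p.2 -> step (terminal p.1 p.2) p.1 p.2 p'.1 p'.2.
  (* The choice of a successor must be total; for a pair outside [S2] the implication is void and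
     the pair itself is a filler. *)
  move=> p; have [[S1 S2]|h] := pselect (S2 P T F p.1 /\ S2 P T F p.2); last by exists p => /h.
  have [q1 L1] := S2_H2 T0 hF S1; have [q2' L2] := S2_H2 T0 hF S2.
  have [X [V [hs _]]] := step_exists (terminal_vL2 S1 S2) q1 L1 q2' L2.
  by exists (X, V).
pose u q := iter q Phi ((fun _ _ => 0), (fun _ _ => 0)).
have hS q : S2 P T F (u q).1 /\ S2 P T F (u q).2.
  elim: q => [|q IH]; first by split; exact: S2_cst.
  by case: (hPhi _ IH) => h1 h2 _; split; [exact: h1|exact: h2].
have hst q : step (terminal (u q).1 (u q).2) (u q).1 (u q).2 (u q.+1).1 (u q.+1).2 := hPhi _ (hS q).
pose rho := q2 P (fun w => terminal (u 1%N).1 (u 1%N).2 w - terminal (u 0%N).1 (u 0%N).2 w) +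
  q2 PL (ext T (fun w t => (u 1%N).1 w t - (u 0%N).1 w t)) / T +
  q2 PL (ext T (fun w t => (u 1%N).2 w t - (u 0%N).2 w t)) / T.
have r0 : 0 <= rho by rewrite !addr_ge0 ?divr_ge0 ?q2_ge0// ltW.
have hd q : distances (u q.+1) (u q) (rho * 16^-1 ^+ q).
  elim: q => [|q [h1 h2 h3]].
    rewrite expr0 mulr1; split.
    - by rewrite /rho -addrA lerDl addr_ge0 ?divr_ge0 ?q2_ge0// ltW.
    - by rewrite mulrC -ler_pdivrMr// /rho addrAC lerDr addr_ge0 ?divr_ge0 ?q2_ge0// ltW.
    - by rewrite mulrC -ler_pdivrMr// /rho lerDr addr_ge0 ?divr_ge0 ?q2_ge0// ltW.
  have [S1 S2] := hS q; have [S1' S2'] := hS q.+1.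
  have e0 : 0 <= rho * 16^-1 ^+ q by rewrite mulr_ge0// exprn_ge0.
  have -> : rho * 16^-1 ^+ q.+1 = rho * 16^-1 ^+ q / 16 by rewrite exprSr mulrA.
  exact: (step_next (hst q.+1) (hst q) (terminal_vL2 S1' S2') (terminal_vL2 S1 S2) (S2_H2 T0 hF S1').2
    (S2_H2 T0 hF S1).2 (S2_H2 T0 hF S2').2 (S2_H2 T0 hF S2).2 e0 h1 h2 h3).
(* Starting [r] steps later absorbs the initial distance, since [rho <= 16^r]. *)
pose r := (Num.truncn rho).+1; exists (fun q => u (q + r)%N); split => //.
move=> q; have [h1 h2 h3] := hd (q + r)%N.
have hr : rho * 16^-1 ^+ (q + r) <= 16^-1 ^+ q.
  rewrite exprD mulrCA ler_piMr ?exprn_ge0 ?invr_ge0//.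
  rewrite exprVn ler_pdivrMr ?exprn_gt0// mul1r.
  have h : rho <= r%:R by apply: ltW; exact: truncnS_gt.
  by apply: le_trans h _; rewrite -natrX ler_nat ltnW// ltn_expl.
have T0' := ltW T0.
by split; [exact: le_trans h1 hr|apply: le_trans h2 _; exact: ler_wpM2l|apply: le_trans h3 _; exact: ler_wpM2l].
Qed.

(** The iterates converge to [xi], [xh] and [vh] in L^2 and H^2 only. A step from this limit yields
    continuous [X] and [V]; compared with the step from the [q]-th iterate, it shows that the
    terminal value, [X] and [V] are limits of the same sequences, so the limit is a fixed point. *)
Lemma solution_exists : exists X V, solution X V.
Proof.
have [s [hS hst hd]] := picard; have T0' := ltW T0.
have p16 q : 0 <= 16^-1 ^+ q :> R by rewrite exprn_ge0 ?invr_ge0.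
have T16 q : T * 16^-1 ^+ q <= 16^-1 ^+ q by rewrite ler_piMl.
have Lt q : vL2 P (terminal (s q).1 (s q).2) by case: (hS q) => S1 S2; exact: terminal_vL2.
have [px Lx] : (forall q, predictable T F (s q).1) /\ (forall q, vL2 PL (ext T (s q).1)).
  by split=> q; case: (hS q) => /(S2_H2 T0 hF)[].
have [pv Lv] : (forall q, predictable T F (s q).2) /\ (forall q, vL2 PL (ext T (s q).2)).
  by split=> q; case: (hS q) => _ /(S2_H2 T0 hF)[].
have Gt q i j : gmeas (F T) (fun w => terminal (s q).1 (s q).2 w i j).
  by case: (hS q) => S1 S2; exact: terminal_gmeas.
have hq q : (vnn2 P (fun w => terminal (s q.+1).1 (s q.+1).2 w - terminal (s q).1 (s q).2 w)%R <= (16^-1 ^+ q)%:E)%E.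
  by rewrite (q2E (vL2B (Lt q.+1) (Lt q))) lee_fin; case: (hd q).
have [xi [B1 [_ Lxi B10 hB1 _]]] := fast_mx (filt_sub hF TT) Gt (Lt 0%N) hq.
have hx q : (vnn2 PL (ext T (fun w t => (s q.+1).1 w t - (s q).1 w t)%R) <= (16^-1 ^+ q)%:E)%E.
  rewrite q2E; last by rewrite extB; exact: (vL2B (Lx q.+1) (Lx q)).
  by rewrite lee_fin; case: (hd q) => _ h _; exact: le_trans h (T16 q).
have [xh [B2 [pxh Lxh B20 hB2 _]]] := fast_process T0 hF px (Lx 0%N) hx.
have hv q : (vnn2 PL (ext T (fun w t => (s q.+1).2 w t - (s q).2 w t)%R) <= (16^-1 ^+ q)%:E)%E.
  rewrite q2E; last by rewrite extB; exact: (vL2B (Lv q.+1) (Lv q)).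
  by rewrite lee_fin; case: (hd q) => _ _ h; exact: le_trans h (T16 q).
have [vh [B3 [pvh Lvh B30 hB3 _]]] := fast_process T0 hF pv (Lv 0%N) hv.
have [X [V [hs V0]]] := step_exists Lxi pxh Lxh pvh Lvh; have [SX SV _] := hs.
(* One constant for the three rates, the H^2 ones divided by [T] to match the normalization of
   [step_next]. *)
pose B := B1 + B2 / T + B3 / T.
have B0 : 0 <= B by rewrite !addr_ge0 ?divr_ge0.
have TB2 : B2 <= T * B.
  by rewrite mulrC -ler_pdivrMr// /B addrAC lerDr addr_ge0 ?divr_ge0.
have TB3 : B3 <= T * B.
  by rewrite mulrC -ler_pdivrMr// /B lerDr addr_ge0 ?divr_ge0.
have p4 q : 0 <= 4^-1 ^+ q :> R by rewrite exprn_ge0 ?invr_ge0.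
have hn q : [/\ q2 P (fun w => terminal X V w - terminal (s q.+1).1 (s q.+1).2 w) <= B * 4^-1 ^+ q,
    q2 PL (ext T (fun w t => X w t - (s q.+1).1 w t)) <= T * B * 4^-1 ^+ q
   & q2 PL (ext T (fun w t => V w t - (s q.+1).2 w t)) <= T * B * 4^-1 ^+ q].
  have r0 : 0 <= B * 4^-1 ^+ q by exact: mulr_ge0.
  have h1 : q2 P (fun w => xi w - terminal (s q).1 (s q).2 w) <= B * 4^-1 ^+ q.
    rewrite -lee_fin -(q2E (vL2B Lxi (Lt q))); apply: le_trans (hB1 q) _; rewrite lee_fin; apply: ler_wpM2r => //.
    by rewrite /B -addrA lerDl addr_ge0 ?divr_ge0.
  have h2 : q2 PL (ext T (fun w t => xh w t - (s q).1 w t)) <= T * (B * 4^-1 ^+ q).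
    by apply: le_trans (hB2 q) _; rewrite mulrA; exact: ler_wpM2r.
  have h3 : q2 PL (ext T (fun w t => vh w t - (s q).2 w t)) <= T * (B * 4^-1 ^+ q).
    by apply: le_trans (hB3 q) _; rewrite mulrA; exact: ler_wpM2r.
  have [k1 k2 k3] := step_next hs (hst q) Lxi (Lt q) Lxh (Lx q) Lvh (Lv q) r0 h1 h2 h3.
  have d16 : B * 4^-1 ^+ q / 16 <= B * 4^-1 ^+ q by rewrite ler_piMr// invf_le1// ler1n.
  rewrite -!(mulrA T); split; first exact: le_trans k1 d16.
    by apply: le_trans k2 _; exact: ler_wpM2l.
  by apply: le_trans k3 _; exact: ler_wpM2l.
have s4 (b : R) q : 0 <= b -> b * 4^-1 ^+ q.+1 <= b * 4^-1 ^+ q.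
  by move=> b0; apply: ler_wpM2l => //; apply: ler_wiXn2l; rewrite ?invr_ge0 ?invf_le1 ?ler1n.
exists X, V; apply: (step_solution Lxi hs V0).
- apply: (limit_unique (f := fun q => terminal (s q.+1).1 (s q.+1).2) Lxi (terminal_vL2 SX SV) (fun q => Lt q.+1) (a := B1) (b := B)).
    move=> q; rewrite -lee_fin -(q2E (vL2B Lxi (Lt q.+1))); apply: le_trans (hB1 q.+1) _.
    by rewrite lee_fin; exact: s4.
  by move=> q; case: (hn q).
- apply: (limit_unique (f := fun q => ext T (s q.+1).1) Lxh (S2_H2 T0 hF SX).2 (fun q => Lx q.+1) (a := B2) (b := T * B)).
    by move=> q; have := hB2 q.+1; rewrite extB => h; apply: le_trans h (s4 _ _ B20).
  by move=> q; case: (hn q) => _; rewrite extB.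
- apply: (limit_unique (f := fun q => ext T (s q.+1).2) Lvh (S2_H2 T0 hF SV).2 (fun q => Lv q.+1) (a := B3) (b := T * B)).
    by move=> q; have := hB3 q.+1; rewrite extB => h; apply: le_trans h (s4 _ _ B30).
  by move=> q; case: (hn q) => _ _; rewrite extB.
Qed.

End fds.

Theorem theorem4p5 (R : realType) (C K : R) (hC : 0 < C) (hK : 0 < K) :
  exists ell : R, 0 < ell /\
  forall (T : R) (hT : 0 < T) (hTell : T < ell)
    (dsp : measure_display) (Omega : measurableType dsp)
    (P : probability Omega R) (hP : measure_is_complete P)
    (F : R -> set (set Omega)) (hF : usual_filtration P T F)
    (n d m p1 p2 p3 : nat)
    (W : process R Omega m 1) (hW : brownian_motion P T F W)
    (x : 'cV[R]_n)
    (mu : Omega -> R -> 'cV[R]_n -> 'cV[R]_d -> 'cV[R]_p1 -> 'cV[R]_n)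
    (sigma : Omega -> R -> 'cV[R]_n -> 'cV[R]_d -> 'cV[R]_p2 -> 'M[R]_(n, m))
    (f : Omega -> R -> 'cV[R]_n -> 'cV[R]_d -> 'cV[R]_p3 -> 'cV[R]_d)
    (phi : Omega -> 'cV[R]_n -> 'cV[R]_d)
    (hcoef : coefficients_condition P T F C mu sigma f phi)
    (L1 : process R Omega d 1 -> process R Omega p1 1)
    (L2 : process R Omega d 1 -> process R Omega p2 1)
    (L3 : process R Omega d 1 -> process R Omega p3 1)
    (o1 o3 : O2_kind)
    (hL1 : operator_condition P T F K o1 L1)
    (hL2 : operator_condition P T F K O2_is_S2 L2)
    (hL3 : operator_condition P T F K o3 L3),
  exists (X : process R Omega n 1) (V : process R Omega d 1),
    fds_solution P T F W x mu sigma f phi L1 L2 L3 X V /\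
    forall (X' : process R Omega n 1) (V' : process R Omega d 1),
      fds_solution P T F W x mu sigma f phi L1 L2 L3 X' V' ->
      indistinguishable P T X X' /\ indistinguishable P T V V'.
Proof.
have c0 := @normal_m2_ge0 R; have C0 := ltW hC.
(* With [s = tau * a + b * T] the forward factor is [2 s], and its share of the terminal condition
   is [4 C^2 s]; the single bound [u * s <= 1 / 32], half from [tau] and half from [T], controls
   both. *)
pose u := (2 + 4 * C ^+ 2).
have u0 : 0 < u by rewrite /u ltr_pwDl// mulr_ge0// sqr_ge0.
pose a := 2 * C ^+ 2 * (10 + 8 * K ^+ 2).
have a0 : 0 < a by rewrite /a !mulr_gt0 ?exprn_gt0// ltr_pwDl// mulr_ge0// sqr_ge0.
(* [tau] is the weight in Young's inequality for the drift; it is fixed first,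
   because the factor [8 K ^ 2] of the operator [L1] does not vanish with [T]. *)
pose tau := (64 * u * a)^-1.
have ua0 : 0 < 64 * u * a by apply: mulr_gt0 => //; exact: mulr_gt0.
have tau0 : 0 < tau by rewrite invr_gt0.
pose b := 8 * normal_m2 * C * (11 + 4 * K ^+ 2).
have b0 : 0 <= b by rewrite /b !mulr_ge0// addr_ge0// mulr_ge0// sqr_ge0.
pose e := 3 * C ^+ 2 * (11 + 8 * K ^+ 2).
have e0 : 0 <= e by rewrite /e !mulr_ge0 ?sqr_ge0// addr_ge0// mulr_ge0// sqr_ge0.
have t0 := ltW tau0; have ti : 0 <= tau^-1 by rewrite invr_ge0.
pose q := 2 * (2 * C + tau^-1).
have q0 : 0 <= q by rewrite /q mulr_ge0// addr_ge0// mulr_ge0.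
(* One summand per smallness condition on [T]: [T <= 1], absorption in the comparison of two steps,
   the noise, the integral of [f], and the two conditions of the equation with additive noise. Only
   [C] and [K] occur, apart from the normal moment, so the horizon is free of the dimensions. *)
pose Lam := 1 + q + 64 * u * b + 64 * e + 12 * C ^+ 2 + 8 * C.
have ub0 : 0 <= 64 * u * b by do 2 (apply: mulr_ge0 => //); exact: ltW.
have C20 : 0 <= 12 * C ^+ 2 by rewrite mulr_ge0// sqr_ge0.
have e64 : 0 <= 64 * e by exact: mulr_ge0.
have C8 : 0 <= 8 * C by exact: mulr_ge0.
have L0 : 0 < Lam by rewrite /Lam -!addrA ltr_pwDl// !addr_ge0.
exists Lam^-1; split; first by rewrite invr_gt0.
move=> T hT hTell dsp Omega P hP F hF n d m p1 p2 p3 W hW x mu sigma f phi hcoef L1 L2 L3 o1 o3 hL1 hL2 hL3.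
have TL : Lam * T < 1 by rewrite mulrC -ltr_pdivlMr// div1r.
have T0 := ltW hT.
have [k1 k2 k3 [k4 k5 k6]] := small_terms T0 ler01 q0 ub0 (mulr_ge0 (ler0n R 64) e0) C20 (mulr_ge0 (ler0n R 8) C0) TL.
have T1 : T <= 1 by rewrite mul1r in k1.
have small1 : 12 * C ^+ 2 * T ^+ 2 <= 1.
  rewrite (expr2 T) mulrA; apply: (le_trans _ k5); apply: ler_piMr => //; exact: mulr_ge0.
have tau1 : u * (tau * a) = 64^-1.
  by rewrite /tau; field; rewrite !gt_eqF.
have b1 : u * (b * T) <= 64^-1.
  by rewrite -[X in _ <= X]mul1r ler_pdivlMr// (_ : _ * 64 = 64 * u * b * T)//; ring.
have e1 : e * T <= 64^-1.
  by rewrite -[X in _ <= X]mul1r ler_pdivlMr// (_ : _ * 64 = 64 * e * T)//; ring.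
have eforward : @forward_factor R T C K tau = 2 * (tau * a + b * T) by rewrite /forward_factor /a /b; ring.
have ebackward : @backward_factor R T C K = e * T by rewrite /backward_factor /e.
have a0' := ltW a0; have ta0 : 0 <= tau * a + b * T := addr_ge0 (mulr_ge0 t0 a0') (mulr_ge0 b0 T0).
have C2ta : 0 <= C ^+ 2 * (tau * a + b * T) := mulr_ge0 (sqr_ge0 C) ta0.
have us : u * (tau * a + b * T) <= 32^-1.
  by rewrite mulrDr tau1; apply: le_trans (lerD (lexx _) b1) _; lra.
have us' : 2 * (tau * a + b * T) + 4 * (C ^+ 2 * (tau * a + b * T)) <= 32^-1.
  by apply: (le_trans _ us); rewrite le_eqVlt; apply/orP; left; apply/eqP; rewrite /u; ring.
have hforward : @forward_factor R T C K tau <= 16^-1 by rewrite eforward; exact: budget1 C2ta us'.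
have hbackward : @backward_factor R T C K <= 16^-1 by rewrite ebackward; apply: le_trans e1 _; lra.
have hterminal : 2 * C ^+ 2 * @forward_factor R T C K tau + 2 * @backward_factor R T C K <= 16^-1.
  rewrite eforward ebackward (_ : 2 * C ^+ 2 * _ = 4 * (C ^+ 2 * (tau * a + b * T))); last by ring.
  exact: budget2 ta0 us' e1.
have [X [V hXV]] := solution_exists hT hF hW x hC hK hcoef hL1 hL2 hL3 small1 k6 T1 tau0 k2 hforward hbackward hterminal.
exists X, V; split => // X' V' hXV'.
exact: (solution_unique hT hF hW hC hK hcoef hL1 hL2 hL3 T1 tau0 k2 hforward hbackward hterminal hXV hXV').
Qed.
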